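(* Let $\rho:\Gamma\to GL_5(\mathbb{C})$ be a $T$-unitarizable, $T$-determined representation and $\upsilon$ a multiplier system with cusp parameter $m$. Let $\widetilde{\lambda_1},\dots,\widetilde{\lambda_5}$ and $\lambda_0$ be as in the context, and assume $\frac{12\lambda_0}{5}-m\in\mathbb{Z}$. Put $k_0=\frac{12}{5}\lambda_0-4$, and let $F_0\in\mathcal{H}(k_0,\rho,\upsilon)$ be a nonzero vector whose components form a fundamental system of solutions of a fifth order MLDE in weight $k_0$. Then: (i) $\mathcal{H}(\rho,\upsilon)$ is a free $\mathcal{M}$-module of rank 5 with basis $\{F_0,DF_0,D^2F_0,D^3F_0,D^4F_0\}$; (ii) for all integers $k\ge0$, $\dim\mathcal{H}(k_0+2k,\rho,\upsilon)=\left[\frac{5k}{6}\right]$ if $k\equiv5\pmod 6$ and $=\left[\frac{5k}{6}\right]+1$ if $k\not\equiv5\pmod6$; (iii) $\mathcal{H}(\rho,\upsilon)=\mathcal{R}F_0$ is a cyclic $\mathcal{R}$-module.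
   Context: $\Gamma=SL(2,\mathbb{Z})$ acts on the upper half-plane $\mathbb{H}$ by Möbius transformations; $T=\begin{pmatrix}1&1\\0&1\end{pmatrix}$; $q=e^{2\pi iz}$, $\mathbf{e}(r)=e^{2\pi ir}$; $[x]$ is the greatest integer $\le x$. Complex powers use the principal branch of $\log$. For $k\in\mathbb{R}$, a multiplier system of weight $k$ is a map $\upsilon:\Gamma\to\{|w|=1\}$ such that $\nu(\gamma,z)=\upsilon(\gamma)(cz+d)^k$ satisfies $\nu(\gamma\sigma,z)=\nu(\gamma,\sigma z)\nu(\sigma,z)$; it is also one of weight $k+n$, $n\in\mathbb{Z}$. Cusp parameter: the $m\in[0,12)$ with $\upsilon(T)=\mathbf{e}(m/12)$. Slash: $(f|_k^\upsilon\gamma)(z)=\upsilon(\gamma)^{-1}(cz+d)^{-k}f(\gamma z)$. Moderate growth: $|f(x+iy)|\le y^N$ for $y>c$. $\mathcal{H}(k,\rho,\upsilon)$: column vectors $F$ of holomorphic moderate-growth functions on $\mathbb{H}$ with $F|_k^\upsilon\gamma=\rho(\gamma)F$ for all $\gamma$; $\mathcal{H}(\rho,\upsilon)=\bigoplus_{n\in\mathbb{Z}}\mathcal{H}(k+n,\rho,\upsilon)$. $\mathcal{M}=\mathbb{C}[E_4,E_6]$ is the graded ring of holomorphic integral-weight modular forms for $\Gamma$ with trivial multiplier, acting by multiplication. $T$-unitarizable: $\rho(T)$ conjugate to a unitary matrix. An irreducible $\rho$ of dimension $d$ is $T$-determined if every indecomposable $\rho':\Gamma\to GL_d(\mathbb{C})$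 with $\rho'(T)$ having the same eigenvalues as $\rho(T)$ is irreducible. $\eta=q^{1/24}\prod_{n\ge1}(1-q^n)$, $P=\frac{i}{\pi}\frac{\eta'}{\eta}$, $D_kf=\frac{1}{2\pi i}\frac{df}{dz}+kPf$; $D$ acts on $\mathcal{H}(k,\rho,\upsilon)$ componentwise as $D_k$, $D^n=D_{k+2(n-1)}\circ\cdots\circ D_k$. An MLDE of order $n$ in weight $k$ is $D_k^nf+M_4D_k^{n-2}f+\cdots+M_{2n}f=0$, $M_{2j}\in\mathcal{M}_{2j}$; a fundamental system is a basis of its solution space. $\mathcal{R}=\mathcal{M}[d]$ with $dM=Md+DM$ acts by $d\cdot F=DF$; $\mathcal{R}F_0$ = all finite sums $\sum M_jD^jF_0$. Setting: write the eigenvalues of $\rho(T)$ as $\mathbf{e}(r_1),\dots,\mathbf{e}(r_5)$, $0\le r_1<\dots<r_5<1$; $\widetilde{\lambda_j}\in[0,1)$ with $\widetilde{\lambda_j}\equiv r_j+\frac{m}{12}\pmod{\mathbb{Z}}$; $\lambda_0=\sum_j\widetilde{\lambda_j}$. *)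

(* Defs.v *)
From Stdlib Require Import Reals Lra Lia ZArith ClassicalEpsilon.
From Coquelicot Require Import Coquelicot.

Open Scope R_scope.

Definition Cexp (z : C) : C :=
  Cmult (RtoC (exp (Re z))) (cos (Im z), sin (Im z)).

Definition ee (r : C) : C := Cexp (Cmult (RtoC (2 * PI)) (Cmult Ci r)).

(* principal argument, in (-pi, pi] *)
Definition Carg (w : C) : R :=
  if Rle_dec 0 (Im w) then acos (Re w / Cmod w) else - acos (Re w / Cmod w).

Definition Clog (w : C) : C := (ln (Cmod w), Carg w).

Definition Cpow (w : C) (k : R) : C := Cexp (Cmult (RtoC k) (Clog w)).

Definition UH (z : C) : Prop := 0 < Im z.

Definition holo (f : C -> C) : Prop :=
  forall z, UH z -> @ex_derive C_AbsRing C_NormedModule f z.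

Definition Cderiv (f : C -> C) (z : C) : C :=
  epsilon (inhabits (RtoC 0))
    (fun l => @is_derive C_AbsRing C_NormedModule f z l).

Definition Clim (u : nat -> C) : C :=
  epsilon (inhabits (RtoC 0)) (fun l => filterlim u eventually (locally l)).

Definition mod_growth (f : C -> C) : Prop :=
  exists (c : R) (N : nat), forall x y : R, 0 < y -> c < y -> Cmod (f (x, y)) <= y ^ N.

Fixpoint csum (n : nat) (f : nat -> C) : C :=
  match n with O => RtoC 0 | S n => Cplus (csum n f) (f n) end.
Fixpoint cprod (n : nat) (f : nat -> C) : C :=
  match n with O => RtoC 1 | S n => Cmult (cprod n f) (f n) end.

Record SL2Z := mkSL2Z {
  sa : Z; sb : Z; sc : Z; sd : Z;
  sdet : (sa * sd - sb * sc = 1)%Z }.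

Lemma smul_det (g h : SL2Z) :
  ((sa g * sa h + sb g * sc h) * (sc g * sb h + sd g * sd h)
   - (sa g * sb h + sb g * sd h) * (sc g * sa h + sd g * sc h) = 1)%Z.
Proof.
  destruct g as [a b c d Hg], h as [a' b' c' d' Hh]; simpl.
  replace ((a * a' + b * c') * (c * b' + d * d') - (a * b' + b * d') * (c * a' + d * c'))%Z
    with ((a * d - b * c) * (a' * d' - b' * c'))%Z by ring.
  rewrite Hg, Hh; reflexivity.
Qed.

Definition smul (g h : SL2Z) : SL2Z :=
  mkSL2Z (sa g * sa h + sb g * sc h) (sa g * sb h + sb g * sd h)
         (sc g * sa h + sd g * sc h) (sc g * sb h + sd g * sd h) (smul_det g h).

Definition sT : SL2Z := mkSL2Z 1 1 0 1 eq_refl.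

Definition jfac (g : SL2Z) (z : C) : C :=
  Cplus (Cmult (RtoC (IZR (sc g))) z) (RtoC (IZR (sd g))).
Definition mob (g : SL2Z) (z : C) : C :=
  Cdiv (Cplus (Cmult (RtoC (IZR (sa g))) z) (RtoC (IZR (sb g)))) (jfac g z).

Definition multiplier_system (k : R) (ups : SL2Z -> C) : Prop :=
  (forall g, Cmod (ups g) = 1) /\
  forall g s z, UH z ->
    Cmult (ups (smul g s)) (Cpow (jfac (smul g s) z) k)
    = Cmult (Cmult (ups g) (Cpow (jfac g (mob s z)) k))
            (Cmult (ups s) (Cpow (jfac s z) k)).

Definition cusp_parameter (ups : SL2Z -> C) (m : R) : Prop :=
  0 <= m < 12 /\ ups sT = ee (RtoC (m / 12)).

Definition vec := nat -> C.
Definition mat := nat -> nat -> C.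

Definition veq (n : nat) (u v : vec) : Prop := forall i, (i < n)%nat -> u i = v i.
Definition vzero : vec := fun _ => RtoC 0.
Definition meq (n : nat) (A B : mat) : Prop :=
  forall i j, (i < n)%nat -> (j < n)%nat -> A i j = B i j.
Definition mid : mat := fun i j => if Nat.eqb i j then RtoC 1 else RtoC 0.
Definition mmul (n : nat) (A B : mat) : mat :=
  fun i j => csum n (fun l => Cmult (A i l) (B l j)).
Definition mapp (n : nat) (A : mat) (v : vec) : vec :=
  fun i => csum n (fun l => Cmult (A i l) (v l)).
Definition madj (A : mat) : mat := fun i j => Cconj (A j i).

Definition invertible (n : nat) (A : mat) : Prop :=
  exists B, meq n (mmul n A B) mid /\ meq n (mmul n B A) mid.

Definition unitary (n : nat) (A : mat) : Prop := meq n (mmul n A (madj A)) mid.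

Definition is_rep (n : nat) (rho : SL2Z -> mat) : Prop :=
  (forall g h, meq n (rho (smul g h)) (mmul n (rho g) (rho h))) /\
  (forall g, invertible n (rho g)).

Definition subspace (n : nat) (U : vec -> Prop) : Prop :=
  (forall u v, veq n u v -> U u -> U v) /\
  U vzero /\
  (forall u v, U u -> U v -> U (fun i => Cplus (u i) (v i))) /\
  (forall (a : C) u, U u -> U (fun i => Cmult a (u i))).

Definition invariant (n : nat) (rho : SL2Z -> mat) (U : vec -> Prop) : Prop :=
  forall g v, U v -> U (mapp n (rho g) v).

Definition nonzero_sub (n : nat) (U : vec -> Prop) : Prop :=
  exists v, U v /\ ~ veq n v vzero.

Definition irreducible (n : nat) (rho : SL2Z -> mat) : Prop :=
  is_rep n rho /\ (0 < n)%nat /\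
  forall U, subspace n U -> invariant n rho U ->
    (forall v, U v -> veq n v vzero) \/ (forall v, U v).

Definition indecomposable (n : nat) (rho : SL2Z -> mat) : Prop :=
  is_rep n rho /\ (0 < n)%nat /\
  ~ exists U W, subspace n U /\ subspace n W /\
      invariant n rho U /\ invariant n rho W /\
      nonzero_sub n U /\ nonzero_sub n W /\
      (forall v, U v -> W v -> veq n v vzero) /\
      (forall v, exists u w, U u /\ W w /\ veq n v (fun i => Cplus (u i) (w i))).

Definition eigenvalue (n : nat) (A : mat) (lam : C) : Prop :=
  exists v, ~ veq n v vzero /\ veq n (mapp n A v) (fun i => Cmult lam (v i)).

Definition T_unitarizable (n : nat) (rho : SL2Z -> mat) : Prop :=
  exists P Q, meq n (mmul n P Q) mid /\ meq n (mmul n Q P) mid /\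
    unitary n (mmul n (mmul n P (rho sT)) Q).

Definition T_determined (n : nat) (rho : SL2Z -> mat) : Prop :=
  irreducible n rho /\
  forall rho', is_rep n rho' ->
    (forall lam, eigenvalue n (rho' sT) lam <-> eigenvalue n (rho sT) lam) ->
    indecomposable n rho' -> irreducible n rho'.

Definition T_exponents (rho : SL2Z -> mat) (r : nat -> R) : Prop :=
  0 <= r 0%nat /\ (forall j, (j < 4)%nat -> r j < r (S j)) /\ r 4%nat < 1 /\
  forall lam, eigenvalue 5 (rho sT) lam <->
              exists j, (j < 5)%nat /\ lam = ee (RtoC (r j)).

Definition lamt (r : nat -> R) (m : R) (j : nat) : R :=
  r j + m / 12 - IZR (Int_part (r j + m / 12)).

Definition lambda0 (r : nat -> R) (m : R) : R :=
  lamt r m 0 + lamt r m 1 + lamt r m 2 + lamt r m 3 + lamt r m 4.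

Definition qpow (z : C) : C := ee z.

Definition eta (z : C) : C :=
  Clim (fun N => Cmult (ee (Cdiv z (RtoC 24)))
                       (cprod N (fun n => Cminus (RtoC 1) (ee (Cmult (RtoC (INR (S n))) z))))).

Definition Pfun (z : C) : C := Cmult (Cdiv Ci (RtoC PI)) (Cdiv (Cderiv eta z) (eta z)).

Definition Dop (k : R) (f : C -> C) : C -> C :=
  fun z => Cplus (Cmult (Cinv (Cmult (RtoC (2 * PI)) Ci)) (Cderiv f z))
                 (Cmult (Cmult (RtoC k) (Pfun z)) (f z)).

Fixpoint Dpow (j : nat) (k : R) (f : C -> C) : C -> C :=
  match j with O => f | S j' => Dop (k + 2 * INR j') (Dpow j' k f) end.

Definition DpowV (j : nat) (k : R) (F : C -> vec) : C -> vec :=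
  fun z i => Dpow j k (fun w => F w i) z.

Definition Hsp (n : nat) (rho : SL2Z -> mat) (ups : SL2Z -> C) (k : R) (F : C -> vec) : Prop :=
  (forall i, (i < n)%nat -> holo (fun z => F z i) /\ mod_growth (fun z => F z i)) /\
  forall g z, UH z ->
    veq n (fun i => Cmult (Cmult (Cinv (ups g)) (Cpow (jfac g z) (- k))) (F (mob g z) i))
          (mapp n (rho g) (F z)).

Definition ModForm (k : Z) (f : C -> C) : Prop :=
  holo f /\ mod_growth f /\
  forall g z, UH z -> Cmult (Cpow (jfac g z) (- IZR k)) (f (mob g z)) = f z.

(* elements of the graded ring M = (+)_k M_k, as finitely supported families *)
Definition Mgr (f : Z -> C -> C) : Prop :=
  (forall a, ModForm a (f a)) /\
  exists N, forall a, (N < Z.abs a)%Z -> forall z, UH z -> f a z = RtoC 0.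

(* elements of H(rho,ups) = (+)_{n in Z} H(k0+n, rho, ups), as finitely supported families *)
Definition Hgr (rho : SL2Z -> mat) (ups : SL2Z -> C) (k0 : R) (G : Z -> C -> vec) : Prop :=
  (forall n, Hsp 5 rho ups (k0 + IZR n) (G n)) /\
  exists N, forall n, (N < Z.abs n)%Z -> forall z, UH z -> veq 5 (G n z) vzero.

Definition geq (G G' : Z -> C -> vec) : Prop :=
  forall n z, UH z -> veq 5 (G n z) (G' n z).

(* sum_{j<J} M_j D^j F0, computed in the grading: the weight-(k0+n) component
   is sum_j M_j[weight n-2j] * D^j F0 *)
Definition comb (J : nat) (M : nat -> Z -> C -> C) (k0 : R) (F0 : C -> vec) : Z -> C -> vec :=
  fun n z i => csum J (fun j => Cmult (M j (n - 2 * Z.of_nat j)%Z z) (DpowV j k0 F0 z i)).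

Definition has_dim (P : (C -> vec) -> Prop) (d : nat) : Prop :=
  exists b : nat -> C -> vec,
    (forall i, (i < d)%nat -> P (b i)) /\
    (forall c : nat -> C,
        (forall z, UH z -> veq 5 (fun l => csum d (fun i => Cmult (c i) (b i z l))) vzero) ->
        forall i, (i < d)%nat -> c i = RtoC 0) /\
    (forall F, P F -> exists c : nat -> C, forall z, UH z ->
        veq 5 (F z) (fun l => csum d (fun i => Cmult (c i) (b i z l)))).

Definition mlde5 (k : R) (M4 M6 M8 M10 : C -> C) (f : C -> C) : Prop :=
  forall z, UH z ->
    Cplus (Cplus (Cplus (Cplus (Dpow 5 k f z) (Cmult (M4 z) (Dpow 3 k f z)))
                        (Cmult (M6 z) (Dpow 2 k f z)))
                 (Cmult (M8 z) (Dpow 1 k f z)))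
          (Cmult (M10 z) (f z)) = RtoC 0.

Definition fundamental_system (k : R) (F : C -> vec) : Prop :=
  exists M4 M6 M8 M10,
    ModForm 4 M4 /\ ModForm 6 M6 /\ ModForm 8 M8 /\ ModForm 10 M10 /\
    (forall i, (i < 5)%nat -> holo (fun z => F z i) /\ mlde5 k M4 M6 M8 M10 (fun z => F z i)) /\
    (forall c : nat -> C,
        (forall z, UH z -> csum 5 (fun i => Cmult (c i) (F z i)) = RtoC 0) ->
        forall i, (i < 5)%nat -> c i = RtoC 0) /\
    (forall f, holo f -> mlde5 k M4 M6 M8 M10 f ->
        exists c : nat -> C, forall z, UH z -> f z = csum 5 (fun i => Cmult (c i) (F z i))).

(* Main.v *)
(** Diagonalize [rho(T)]. Each component of a vector in [H(k, rho, ups)] becomes [e(l_i z) g_i(z)] with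
    [l_i] in [0, 1) and [g_i] a power series in [q]; this comes from Cauchy's formula on a period strip.
    Let [W] be the determinant of the matrix with columns [D^j F0], [j < 5]. The MLDE and uniqueness for linear
    ODEs show that [W] has no zero, and Liouville's formula gives [W' = - 12 lambda0 (2 pi i) P W], so that
    [W = c e(lambda0 z) (1 + O(q))] because [P = -1/12 + O(q)]. After removal of
    the factors [e(l_i z)] the determinant is a [q]-series that is invertible at the cusp as well, and
    Cramer's rule writes every [F] in [H(rho, ups)] as [sum_j M_j D^j F0] with [M_j] holomorphic, also at the
    cusp. By uniqueness of the coefficients the [M_j] are modular forms.

    That [D^j F0] is modular needs the quasi-modularity of [P], which the MLDE itself provides: for each
    [gamma] in [Gamma], the pull-back of the equation has the same solutions, hence the same coefficient of
    [D^4], and the difference of these coefficients is [12 lambda0] times the defect of [P].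

    The dimension formula is the sum over [j < 5] of the dimensions of [M_(2k - 2j)]. These follow by dividing
    by [Delta = eta^24], from the form [P^2 + P'/(2 pi i)] of weight 4 and its derivative, and from the
    vanishing of forms of weight 2 and of negative weight. *)

Require Import Defs.
From Stdlib Require Import Reals ZArith Lra Lia Classical ClassicalEpsilon FunctionalExtensionality.
From Coquelicot Require Import Coquelicot.
From HB Require Import structures.
From mathcomp Require all_boot all_algebra perm boolp.
Import Defs.
Local Open Scope C_scope.

(** * Complex derivatives and the exponential *)

(** The weight [k0] is the one for which the weights met by D, D^2, ..., D^5 add up correctly: k0 +
    (k0+2) + ... + (k0+8) = 5 k0 + 20 = 12 lambda0. This sum is the trace that governs the
    Wronskian, so W solves the same first order equation as a power Delta^lambda0, and its order at
    the cusp is exactly what the five factors e(l_i z) remove. The same sum multiplies the defect of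
    P; it is positive because the eigenvalues of rho(T) are distinct, so at most one l_i vanishes.

    Both ends of the interval [0, 1) matter: l_i < 1 turns moderate growth into o(1/|q|) after
    division by e(l_i z), so that the singularity at q = 0 is removable, and l_i >= 0 keeps the
    recombined functions bounded at the cusp.

    Since quasi-modularity of P is extracted from F0, all facts about Delta and the forms of weight
    4 and 6 come after it. Zeros are controlled throughout by uniqueness for linear differential
    equations: this serves for W, for the inversion formula of Delta and for forms of weight 2. *)

Definition cderive (f : C -> C) (z l : C) : Prop := @is_derive C_AbsRing C_NormedModule f z l.

Lemma cderive_eps (f : C -> C) z l :
  cderive f z l <->
  forall eps : R, (0 < eps)%R -> exists del : R, (0 < del)%R /\
    forall w, (Cmod (w - z) < del)%R ->
      (Cmod (f w - f z - l * (w - z)) <= eps * Cmod (w - z))%R.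
Proof.
  split.
  - intros [_ H] eps He.
    specialize (H z (fun P p => p) (mkposreal eps He)).
    destruct H as [d Hd]. exists d. split; [apply cond_pos|].
    intros w Hw. specialize (Hd w Hw).
    change (Cmod (f w - f z - (w - z) * l) <= eps * Cmod (w - z))%R in Hd.
    rewrite (Cmult_comm l). exact Hd.
  - intros H. split; [apply is_linear_scal_l|].
    intros x Hx eps.
    assert (x = z) as -> by (symmetry; apply (is_filter_lim_locally_unique (K:=C_AbsRing) (V:=AbsRing_NormedModule C_AbsRing)); exact Hx).
    destruct (H eps (cond_pos eps)) as [d [Hd H']].
    exists (mkposreal _ Hd). intros w Hw.
    change (Cmod (f w - f z - (w - z) * l) <= eps * Cmod (w - z))%R.
    rewrite <- (Cmult_comm l). apply H', Hw.
Qed.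

Lemma cderive_eq (f : C -> C) z l l' : cderive f z l -> l = l' -> cderive f z l'.
Proof. intros H <-; exact H. Qed.

Lemma cderive_ext_loc (f g : C -> C) z l :
  (exists d : R, (0 < d)%R /\ forall w, (Cmod (w - z) < d)%R -> f w = g w) ->
  cderive f z l -> cderive g z l.
Proof.
  intros [d [Hd He]] H. apply cderive_eps. intros eps Heps.
  destruct (proj1 (cderive_eps _ _ _) H eps Heps) as [d' [Hd' H']].
  exists (Rmin d d'). split; [now apply Rmin_glb_lt|].
  intros w Hw. rewrite <- !He.
  - apply H'. eapply Rlt_le_trans; [exact Hw|apply Rmin_r].
  - replace (z - z) with (RtoC 0) by ring. now rewrite Cmod_0.
  - eapply Rlt_le_trans; [exact Hw|apply Rmin_l].
Qed.

Lemma Im_le_Cmod z : (Rabs (Im z) <= Cmod z)%R.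
Proof. eapply Rle_trans; [apply Rmax_r|apply (Rmax_Cmod z)]. Qed.

Lemma Cmod_tri3 (x y : C) : (Cmod x <= Cmod y + Cmod (x - y))%R.
Proof. replace x with (y + (x - y)) at 1 by ring. apply Cmod_triangle. Qed.

Lemma Cmod_minus_sym (x y : C) : Cmod (x - y) = Cmod (y - x).
Proof. rewrite <- Cmod_opp. f_equal. ring. Qed.

Lemma near_Im_gt (a : R) z w : (a < Im z)%R -> (Cmod (w - z) < Im z - a)%R -> (a < Im w)%R.
Proof.
  intros Hz Hw. pose proof (Im_le_Cmod (w - z)) as H.
  replace (Im (w - z)) with (Im w - Im z)%R in H by (unfold Im; simpl; ring).
  apply Rabs_le_between in H. lra.
Qed.

Lemma cderive_ext_UH (f g : C -> C) z l : UH z -> (forall w, UH w -> f w = g w) ->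
  cderive f z l -> cderive g z l.
Proof.
  intros Hz He. apply cderive_ext_loc. exists (Im z). split; [exact Hz|].
  intros w Hw. apply He, (near_Im_gt 0 z w); [exact Hz|lra].
Qed.

Lemma cderive_ext (f g : C -> C) z l : (forall w, f w = g w) -> cderive f z l -> cderive g z l.
Proof. intros He. apply cderive_ext_loc. exists 1%R. split; [lra|auto]. Qed.

Lemma cderive_plus f g z a b : cderive f z a -> cderive g z b -> cderive (fun w => f w + g w) z (a + b).
Proof. intros; now apply (is_derive_plus f g z a b). Qed.

Lemma cderive_minus f g z a b : cderive f z a -> cderive g z b -> cderive (fun w => f w - g w) z (a - b).
Proof. intros; now apply (is_derive_minus f g z a b). Qed.

Lemma cderive_const (c z : C) : cderive (fun _ => c) z 0.
Proof. apply (is_derive_const (K := C_AbsRing) (V := C_NormedModule) c z). Qed.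

Lemma cderive_bound (f : C -> C) z l : cderive f z l -> exists d, (0 < d)%R /\ forall w, (Cmod (w - z) < d)%R -> (Cmod (f w - f z) <= (Cmod l + 1) * Cmod (w - z))%R.
Proof.
  intros H. destruct (proj1 (cderive_eps _ _ _) H 1 Rlt_0_1) as [d [Hd H']].
  exists d. split; [exact Hd|]. intros w Hw.
  pose proof (Cmod_tri3 (f w - f z) (l * (w - z))) as T.
  specialize (H' w Hw). rewrite Cmod_mult in T. lra.
Qed.

Lemma cderive_cont (f : C -> C) z l : cderive f z l -> forall eps : R, (0 < eps)%R ->
  exists d, (0 < d)%R /\ forall w, (Cmod (w - z) < d)%R -> (Cmod (f w - f z) < eps)%R.
Proof.
  intros H eps He. destruct (cderive_bound _ _ _ H) as [d [Hd H']].
  pose proof (Cmod_ge_0 l).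
  assert (Hp : (0 < eps / (Cmod l + 1))%R) by (apply Rdiv_lt_0_compat; lra).
  exists (Rmin d (eps / (Cmod l + 1))). split; [now apply Rmin_glb_lt|].
  intros w Hw. eapply Rle_lt_trans; [apply H'; eapply Rlt_le_trans; [exact Hw|apply Rmin_l]|].
  apply Rlt_le_trans with ((Cmod l + 1) * (eps / (Cmod l + 1)))%R.
  - apply Rmult_lt_compat_l; [lra|]. eapply Rlt_le_trans; [exact Hw|apply Rmin_r].
  - right. field. lra.
Qed.

Lemma cderive_id (z : C) : cderive (fun w => w) z 1.
Proof.
  apply cderive_eps. intros eps He. exists 1%R. split; [lra|]. intros w _.
  replace (w - z - 1 * (w - z)) with (RtoC 0) by ring. rewrite Cmod_0.
  apply Rmult_le_pos; [lra|apply Cmod_ge_0].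
Qed.

Lemma cderive_mult f g z a b : cderive f z a -> cderive g z b -> cderive (fun w => f w * g w) z (a * g z + f z * b).
Proof.
  intros Hf Hg. apply cderive_eps. intros eps He.
  pose proof (Cmod_ge_0 (f z)) as Pf. pose proof (Cmod_ge_0 (g z)) as Pg.
  pose proof (Cmod_ge_0 a) as Pa. pose proof (Cmod_ge_0 b) as Pb.
  set (M := (1 + Cmod (f z) + Cmod (g z) + Cmod a)%R).
  assert (HM : (1 <= M)%R) by (unfold M; lra).
  assert (He' : (0 < eps / (3 * M))%R) by (apply Rdiv_lt_0_compat; lra).
  set (e' := (eps / (3 * M))%R) in *.
  destruct (proj1 (cderive_eps _ _ _) Hf e' He') as [d1 [Hd1 H1]].
  destruct (proj1 (cderive_eps _ _ _) Hg e' He') as [d2 [Hd2 H2]].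
  destruct (cderive_cont _ _ _ Hg (Rmin 1 e') (Rmin_glb_lt _ _ _ Rlt_0_1 He')) as [d3 [Hd3 H3]].
  exists (Rmin d1 (Rmin d2 d3)). split; [now repeat apply Rmin_glb_lt|].
  intros w Hw.
  assert (W1 : (Cmod (w - z) < d1)%R) by (eapply Rlt_le_trans; [exact Hw|apply Rmin_l]).
  assert (W2 : (Cmod (w - z) < d2)%R)
    by (eapply Rlt_le_trans; [exact Hw|eapply Rle_trans; [apply Rmin_r|apply Rmin_l]]).
  assert (W3 : (Cmod (w - z) < d3)%R)
    by (eapply Rlt_le_trans; [exact Hw|eapply Rle_trans; [apply Rmin_r|apply Rmin_r]]).
  specialize (H1 w W1). specialize (H2 w W2). specialize (H3 w W3).
  replace (f w * g w - f z * g z - (a * g z + f z * b) * (w - z))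
    with ((f w - f z - a * (w - z)) * g w + (a * (w - z) * (g w - g z)
          + f z * (g w - g z - b * (w - z)))) by ring.
  eapply Rle_trans; [apply Cmod_triangle|].
  eapply Rle_trans; [apply Rplus_le_compat_l, Cmod_triangle|].
  rewrite !Cmod_mult.
  pose proof (Cmod_tri3 (g w) (g z)) as T.
  pose proof (Rmin_l 1 e') as M1. pose proof (Rmin_r 1 e') as M2.
  pose proof (Cmod_ge_0 (w - z)) as P.
  assert (E : eps = (3 * (M * e'))%R) by (unfold e'; field; lra). rewrite E.
  set (h := Cmod (w - z)) in *.
  assert (A1 : (Cmod (f w - f z - a * (w - z)) * Cmod (g w) <= e' * h * M)%R).
  { apply Rmult_le_compat; try apply Cmod_ge_0; [exact H1|unfold M; lra]. }
  assert (A2 : (Cmod a * h * Cmod (g w - g z) <= M * h * e')%R).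
  { apply Rmult_le_compat; try apply Cmod_ge_0; [apply Rmult_le_pos; lra| |lra].
    apply Rmult_le_compat_r; [lra|unfold M; lra]. }
  assert (A3 : (Cmod (f z) * Cmod (g w - g z - b * (w - z)) <= M * (e' * h))%R).
  { apply Rmult_le_compat; try apply Cmod_ge_0; [unfold M; lra|exact H2]. }
  lra.
Qed.

Lemma cderive_scal c f z a : cderive f z a -> cderive (fun w => c * f w) z (c * a).
Proof.
  intros H. eapply cderive_eq; [apply cderive_mult; [apply cderive_const|exact H]|cbv beta; ring].
Qed.

Lemma cderive_comp f g z a b : cderive f (g z) a -> cderive g z b -> cderive (fun w => f (g w)) z (b * a).
Proof.
  intros Hf Hg. apply cderive_eps. intros eps He.
  pose proof (Cmod_ge_0 a) as Pa. pose proof (Cmod_ge_0 b) as Pb.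
  assert (He1 : (0 < eps / (2 * (Cmod b + 1)))%R) by (apply Rdiv_lt_0_compat; lra).
  assert (He2 : (0 < eps / (2 * (Cmod a + 1)))%R) by (apply Rdiv_lt_0_compat; lra).
  destruct (proj1 (cderive_eps _ _ _) Hf _ He1) as [d1 [Hd1 H1]].
  destruct (proj1 (cderive_eps _ _ _) Hg _ He2) as [d2 [Hd2 H2]].
  destruct (cderive_cont _ _ _ Hg _ Hd1) as [d3 [Hd3 H3]].
  destruct (cderive_bound _ _ _ Hg) as [d4 [Hd4 H4]].
  exists (Rmin d2 (Rmin d3 d4)). split; [now repeat apply Rmin_glb_lt|].
  intros w Hw.
  assert (W2 : (Cmod (w - z) < d2)%R) by (eapply Rlt_le_trans; [exact Hw|apply Rmin_l]).
  assert (W3 : (Cmod (w - z) < d3)%R)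
    by (eapply Rlt_le_trans; [exact Hw|eapply Rle_trans; [apply Rmin_r|apply Rmin_l]]).
  assert (W4 : (Cmod (w - z) < d4)%R)
    by (eapply Rlt_le_trans; [exact Hw|eapply Rle_trans; [apply Rmin_r|apply Rmin_r]]).
  specialize (H1 _ (H3 w W3)). specialize (H2 w W2). specialize (H4 w W4).
  replace (f (g w) - f (g z) - b * a * (w - z))
    with ((f (g w) - f (g z) - a * (g w - g z)) + a * (g w - g z - b * (w - z))) by ring.
  eapply Rle_trans; [apply Cmod_triangle|]. rewrite Cmod_mult.
  pose proof (Cmod_ge_0 (w - z)) as P. set (h := Cmod (w - z)) in *.
  apply Rle_trans with (eps / (2 * (Cmod b + 1)) * ((Cmod b + 1) * h)
     + (Cmod a + 1) * (eps / (2 * (Cmod a + 1)) * h))%R.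
  - apply Rplus_le_compat.
    + eapply Rle_trans; [exact H1|]. apply Rmult_le_compat_l; [lra|exact H4].
    + apply Rmult_le_compat; try apply Cmod_ge_0; try assumption; lra.
  - right. field. lra.
Qed.

Lemma cderive_Cinv (z : C) : z <> 0 -> cderive Cinv z (- / (z * z)).
Proof.
  intros Hz. apply cderive_eps. intros eps He.
  pose proof (proj1 (Cmod_gt_0 z) Hz) as P.
  set (m := Cmod z) in *.
  set (d := Rmin (m / 2) (eps * (m * m * m) / 2)).
  assert (Hd : (0 < d)%R).
  { apply Rmin_glb_lt; [lra|]. apply Rdiv_lt_0_compat; [|lra].
    repeat apply Rmult_lt_0_compat; lra. }
  exists d. split; [exact Hd|]. intros w Hw.
  assert (Hw1 : (m / 2 < Cmod w)%R).
  { pose proof (Cmod_tri3 z w) as T. rewrite Cmod_minus_sym in T. fold m in T.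
    pose proof (Rmin_l (m/2) (eps * (m * m * m) / 2)). unfold d in Hw. lra. }
  assert (Hwz : w <> 0) by (apply Cmod_gt_0; lra).
  replace (/ w - / z - - / (z * z) * (w - z)) with ((w - z) * ((w - z) * / (z * z * w)))
    by (field; auto).
  rewrite !Cmod_mult, Cmod_inv by (repeat apply Cmult_neq_0; auto).
  rewrite !Cmod_mult. fold m. rewrite Rmult_comm.
  apply Rmult_le_compat_r; [apply Cmod_ge_0|].
  assert (Hq : (0 < m * m * Cmod w)%R) by (repeat apply Rmult_lt_0_compat; lra).
  apply Rmult_le_reg_r with (m * m * Cmod w)%R; [exact Hq|].
  replace (Cmod (w - z) * / (m * m * Cmod w) * (m * m * Cmod w))%R with (Cmod (w - z))
    by (field; split; lra).
  apply Rle_trans with (eps * (m * m * m) / 2)%R.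
  - left. eapply Rlt_le_trans; [exact Hw|apply Rmin_r].
  - replace (eps * (m * m * m) / 2)%R with (eps * (m * m * (m / 2)))%R by field.
    apply Rmult_le_compat_l; [lra|]. apply Rmult_le_compat_l; [|lra].
    apply Rmult_le_pos; lra.
Qed.

Lemma cderive_inv f z a : cderive f z a -> f z <> 0 -> cderive (fun w => / f w) z (- a / (f z * f z)).
Proof.
  intros H Hz. eapply cderive_eq; [apply (cderive_comp Cinv f); [now apply cderive_Cinv|exact H]|].
  cbv beta. field. exact Hz.
Qed.

Lemma cderive_unique (f : C -> C) z a b : cderive f z a -> cderive f z b -> a = b.
Proof.
  intros Ha Hb. rewrite <- (is_C_derive_unique f z a Ha). apply is_C_derive_unique, Hb.
Qed.

Lemma Cderiv_unique f z a : cderive f z a -> Cderiv f z = a.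
Proof.
  intros H. apply (cderive_unique f z); [|exact H].
  unfold Cderiv. apply epsilon_spec. now exists a.
Qed.

Lemma Cderiv_cderive f z : holo f -> UH z -> cderive f z (Cderiv f z).
Proof.
  intros H Hz. destruct (H z Hz) as [l Hl]. rewrite (Cderiv_unique _ _ _ Hl). exact Hl.
Qed.

Lemma holo_cderive f : (forall z, UH z -> exists l, cderive f z l) -> holo f.
Proof. intros H z Hz. exact (H z Hz). Qed.

Lemma Cmod_le_Rabs (z : C) : (Cmod z <= Rabs (Re z) + Rabs (Im z))%R.
Proof.
  destruct z as [x y]. replace (x, y) with (RtoC x + Ci * RtoC y).
  - eapply Rle_trans; [apply Cmod_triangle|]. rewrite Cmod_mult, Cmod_Ci, !Cmod_R.
    unfold Re, Im; simpl. right. f_equal; [f_equal; ring|]. rewrite Rmult_1_l. f_equal. ring.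
  - unfold Cplus, Cmult, Ci, RtoC; simpl. f_equal; ring.
Qed.

Lemma Re_le_Cmod z : (Rabs (Re z) <= Cmod z)%R.
Proof. eapply Rle_trans; [apply Rmax_l|apply (Rmax_Cmod z)]. Qed.

Lemma Cexp_add a b : Cexp (a + b) = Cexp a * Cexp b.
Proof.
  unfold Cexp. rewrite re_plus, im_plus, exp_plus, cos_plus, sin_plus.
  unfold Cmult, RtoC; simpl. f_equal; ring.
Qed.

Lemma Cexp_0 : Cexp 0 = 1.
Proof.
  unfold Cexp. rewrite re_RtoC, im_RtoC, exp_0, cos_0, sin_0.
  unfold Cmult, RtoC; simpl. f_equal; ring.
Qed.

Lemma Cmod_Cexp z : Cmod (Cexp z) = exp (Re z).
Proof.
  unfold Cexp. rewrite Cmod_mult, Cmod_R, Rabs_pos_eq by (left; apply exp_pos).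
  unfold Cmod; simpl.
  replace (cos (Im z) * (cos (Im z) * 1) + sin (Im z) * (sin (Im z) * 1))%R with 1%R.
  - rewrite sqrt_1. ring.
  - pose proof (sin2_cos2 (Im z)) as H. unfold Rsqr in H. lra.
Qed.

Lemma Cexp_neq0 z : Cexp z <> 0.
Proof. apply Cmod_gt_0. rewrite Cmod_Cexp. apply exp_pos. Qed.

Lemma derive0_eps (f : R -> R) l : derivable_pt_lim f 0 l -> forall eps, (0 < eps)%R ->
  exists d, (0 < d)%R /\ forall h, (Rabs h < d)%R -> (Rabs (f h - f 0 - l * h) <= eps * Rabs h)%R.
Proof.
  intros H eps He. destruct (H eps He) as [d Hd]. exists d. split; [apply cond_pos|].
  intros h Hh. destruct (Req_dec h 0) as [->|Hn].
  - rewrite Rabs_R0. replace (f 0 - f 0 - l * 0)%R with 0%R by ring. rewrite Rabs_R0. lra.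
  - specialize (Hd h Hn Hh). rewrite Rplus_0_l in Hd.
    replace (f h - f 0 - l * h)%R with (((f h - f 0) / h - l) * h)%R by (field; exact Hn).
    rewrite Rabs_mult. apply Rmult_le_compat_r; [apply Rabs_pos|lra].
Qed.

(** At 0 the real and imaginary parts of e^w - 1 - w are small by the first order expansions of the
    real exp, sin and cos; the addition formula carries the result to any point. *)
Lemma cderive_Cexp z : cderive Cexp z (Cexp z).
Proof.
  assert (H0 : cderive Cexp 0 1).
  { apply cderive_eps. intros eps He.
    set (e := Rmin 1 (eps / 8)).
    assert (E : (0 < e)%R) by (apply Rmin_glb_lt; lra).
    assert (E1 : (e <= 1)%R) by apply Rmin_l.
    assert (E2 : (e <= eps / 8)%R) by apply Rmin_r.
    pose proof (derivable_pt_lim_exp 0) as De. rewrite exp_0 in De.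
    pose proof (derivable_pt_lim_sin 0) as Ds. rewrite cos_0 in Ds.
    pose proof (derivable_pt_lim_cos 0) as Dc. rewrite sin_0, Ropp_0 in Dc.
    destruct (derive0_eps _ _ De e E) as [d1 [Hd1 H1]].
    destruct (derive0_eps _ _ Ds e E) as [d2 [Hd2 H2]].
    destruct (derive0_eps _ _ Dc e E) as [d3 [Hd3 H3]].
    exists (Rmin e (Rmin (1/2) (Rmin d1 (Rmin d2 d3)))). split.
    { repeat apply Rmin_glb_lt; lra. }
    intros w Hw. replace (w - 0) with w in * by ring.
    pose proof (Re_le_Cmod w) as Bd1. pose proof (Im_le_Cmod w) as B2.
    repeat match goal with H : (Cmod w < Rmin ?a ?b)%R |- _ =>
      let H1 := fresh in let H2 := fresh in
      assert (H1 : (Cmod w < a)%R) by (eapply Rlt_le_trans; [exact H|apply Rmin_l]);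
      assert (H2 : (Cmod w < b)%R) by (eapply Rlt_le_trans; [exact H|apply Rmin_r]); clear H end.
    specialize (H1 (Re w)). specialize (H2 (Im w)). specialize (H3 (Im w)).
    rewrite exp_0 in H1. rewrite sin_0 in H2. rewrite cos_0 in H3.
    assert (P1 := H1 ltac:(lra)). assert (P2 := H2 ltac:(lra)). assert (P3 := H3 ltac:(lra)).
    clear H1 H2 H3.
    rewrite Cexp_0. set (x := Re w) in *. set (y := Im w) in *. set (h := Cmod w) in *.
    assert (R1 : (Rabs (exp x - 1 - x) <= e * h)%R).
    { replace (exp x - 1 - x)%R with (exp x - 1 - 1 * x)%R by ring.
      eapply Rle_trans; [exact P1|]. apply Rmult_le_compat_l; lra. }
    assert (R2 : (Rabs (sin y - y) <= e * h)%R).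
    { replace (sin y - y)%R with (sin y - 0 - 1 * y)%R by ring.
      eapply Rle_trans; [exact P2|]. apply Rmult_le_compat_l; lra. }
    assert (R3 : (Rabs (cos y - 1) <= e * h)%R).
    { replace (cos y - 1)%R with (cos y - 1 - 0 * y)%R by ring.
      eapply Rle_trans; [exact P3|]. apply Rmult_le_compat_l; lra. }
    assert (Hh : (0 <= h)%R) by apply Cmod_ge_0.
    assert (Heh : (e * h <= 1 * h)%R) by (apply Rmult_le_compat_r; lra).
    assert (R4 : (Rabs (exp x - 1) <= 2 * h)%R).
    { replace (exp x - 1)%R with ((exp x - 1 - x) + x)%R by ring.
      eapply Rle_trans; [apply Rabs_triang|]. lra. }
    assert (R5 : (Rabs (exp x) <= 2)%R).
    { replace (exp x)%R with ((exp x - 1) + 1)%R by ring.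
      eapply Rle_trans; [apply Rabs_triang|]. rewrite (Rabs_pos_eq 1) by lra. lra. }
    eapply Rle_trans; [apply Cmod_le_Rabs|].
    replace (Re (Cexp w - 1 - 1 * w)) with ((exp x - 1 - x) + exp x * (cos y - 1))%R
      by (unfold x, y, Cexp, Re, Im; simpl; ring).
    replace (Im (Cexp w - 1 - 1 * w)) with ((exp x - 1) * y + exp x * (sin y - y))%R
      by (unfold x, y, Cexp, Re, Im; simpl; ring).
    assert (Q1 : (Rabs (exp x - 1 - x + exp x * (cos y - 1)) <= e * h + 2 * (e * h))%R).
    { eapply Rle_trans; [apply Rabs_triang|]. rewrite Rabs_mult. apply Rplus_le_compat; [easy|].
      apply Rmult_le_compat; auto using Rabs_pos. }
    assert (Q2 : (Rabs ((exp x - 1) * y + exp x * (sin y - y)) <= 2 * h * e + 2 * (e * h))%R).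
    { eapply Rle_trans; [apply Rabs_triang|]. rewrite !Rabs_mult. apply Rplus_le_compat.
      - apply Rmult_le_compat; auto using Rabs_pos. lra.
      - apply Rmult_le_compat; auto using Rabs_pos. }
    assert (e * h <= eps / 8 * h)%R by (apply Rmult_le_compat_r; lra).
    assert (0 <= eps * h)%R by (apply Rmult_le_pos; lra). lra. }
  assert (H1 : cderive (fun w => Cexp z * Cexp (w - z)) z (Cexp z * (1 * 1))).
  { apply cderive_scal. apply cderive_comp.
    - replace (z - z) with (RtoC 0) by ring. exact H0.
    - eapply cderive_eq; [apply cderive_minus; [apply cderive_id|apply cderive_const]|ring]. }
  eapply cderive_eq; [|apply (eq_trans (y := Cexp z * (1 * 1))); [reflexivity|ring]].
  eapply cderive_ext; [|exact H1]. intros w. simpl. rewrite <- Cexp_add. f_equal. ring.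
Qed.

(** The constant 2 pi i, not a modular variable; points of the upper half-plane are always called
    [z]. *)
Definition tau : C := RtoC (2 * PI) * Ci.

Lemma tau_neq0 : tau <> 0.
Proof.
  apply Cmult_neq_0; [|apply Ci_nz]. intros H. apply RtoC_inj in H. pose proof PI_RGT_0. lra.
Qed.

Lemma ee_Cexp z : ee z = Cexp (tau * z).
Proof. unfold ee, tau. f_equal. ring. Qed.

Lemma ee_add a b : ee (a + b) = ee a * ee b.
Proof. rewrite !ee_Cexp, <- Cexp_add. f_equal. ring. Qed.

Lemma ee_0 : ee 0 = 1.
Proof. rewrite ee_Cexp, Cmult_0_r. apply Cexp_0. Qed.

Lemma ee_neq0 z : ee z <> 0.
Proof. apply Cexp_neq0. Qed.

Lemma Cmod_ee z : Cmod (ee z) = exp (- (2 * PI) * Im z).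
Proof. unfold ee. rewrite Cmod_Cexp. f_equal. unfold Re, Im; simpl. ring. Qed.

Lemma ee_opp z : ee (- z) = / ee z.
Proof.
  assert (H : ee z * ee (- z) = 1) by (rewrite <- ee_add, Cplus_opp_r; apply ee_0).
  pose proof (ee_neq0 z). replace (ee (- z)) with (/ ee z * (ee z * ee (- z))) by (field; auto).
  rewrite H. ring.
Qed.

Lemma ee_nat (n : nat) z : ee (RtoC (INR n) * z) = (ee z ^ n).
Proof.
  induction n as [|n IH].
  - simpl. rewrite Cmult_0_l. apply ee_0.
  - rewrite S_INR, RtoC_plus, Cmult_plus_distr_r, ee_add, IH, Cmult_1_l. simpl. ring.
Qed.

Lemma ee_1 : ee 1 = 1.
Proof.
  unfold ee, Cexp.
  replace (Re _) with 0%R by (unfold Re; simpl; ring).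
  replace (Im _) with (2 * PI)%R by (unfold Im; simpl; ring).
  rewrite exp_0, cos_2PI, sin_2PI. unfold Cmult, RtoC; simpl. f_equal; ring.
Qed.

Lemma ee_INR n : ee (RtoC (INR n)) = 1.
Proof. rewrite <- (Cmult_1_r (RtoC (INR n))), ee_nat, ee_1. apply Cpow_1_l. Qed.

Lemma ee_IZR n : ee (RtoC (IZR n)) = 1.
Proof.
  destruct (Z_le_gt_dec 0 n) as [H|H].
  - rewrite <- (Z2Nat.id n H), <- INR_IZR_INZ. apply ee_INR.
  - replace n with (- Z.of_nat (Z.to_nat (- n)))%Z by lia.
    rewrite opp_IZR, <- INR_IZR_INZ, RtoC_opp, ee_opp, ee_INR. field.
Qed.

Lemma cderive_ee z : cderive ee z (tau * ee z).
Proof.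
  eapply cderive_ext; [intros w; symmetry; apply ee_Cexp|].
  eapply cderive_eq; [apply cderive_comp; [apply cderive_Cexp|apply cderive_scal, cderive_id]|].
  rewrite <- ee_Cexp. ring.
Qed.

Lemma cderive_ee_scal l z : cderive (fun w => ee (l * w)) z (tau * l * ee (l * z)).
Proof.
  eapply cderive_eq; [apply cderive_comp; [apply cderive_ee|apply cderive_scal, cderive_id]|]. ring.
Qed.

Lemma ee_eq1 u : ee u = 1 -> Im u = 0%R /\ exists n : Z, Re u = IZR n.
Proof.
  intros H. pose proof PI_RGT_0 as HP.
  assert (Hi : Im u = 0%R).
  { pose proof (Cmod_ee u) as Hm. rewrite H, Cmod_1, <- exp_0 in Hm. apply exp_inv in Hm. nra. }
  split; [exact Hi|].
  unfold ee, Cexp in H.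
  replace (Re (RtoC (2 * PI) * (Ci * u))) with 0%R in H
    by (unfold Re, Im in *; simpl in *; rewrite Hi; ring).
  replace (Im (RtoC (2 * PI) * (Ci * u))) with (2 * PI * Re u)%R in H by (unfold Re, Im; simpl; ring).
  rewrite exp_0 in H. unfold Cmult, RtoC in H; simpl in H. injection H as Hc Hs.
  (* Passing to half the angle turns cos(2 pi x) = 1 into sin(pi x) = 0, whose solutions are
     known. *)
  assert (Hc' : cos (2 * (PI * Re u)) = 1%R) by (rewrite <- Rmult_assoc; lra).
  rewrite cos_2a_sin in Hc'.
  assert (Hs' : sin (PI * Re u) = 0%R) by nra.
  destruct (sin_eq_0_0 _ Hs') as [k Hk]. exists k. nra.
Qed.

(** * Integrals along segments and Goursat's theorem *)

Definition CR := C_R_CompleteNormedModule.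
Definition rcontinuous (f : R -> C) (t : R) : Prop := continuous (U := C_UniformSpace) f t.
Definition is_CInt (f : R -> C) (a b : R) (l : C) : Prop := is_RInt (V := C_R_NormedModule) f a b l.
Definition CInt (f : R -> C) (a b : R) : C := RInt (V := C_R_CompleteNormedModule) f a b.
Definition rderive (f : R -> C) (t : R) (l : C) : Prop :=
  is_derive (K := R_AbsRing) (V := C_R_NormedModule) f t l.

Lemma rcontinuous_eps (f : R -> C) t :
  (forall eps : R, (0 < eps)%R -> exists d, (0 < d)%R /\
     forall s, (Rabs (s - t) < d)%R -> (Cmod (f s - f t) < eps)%R) -> rcontinuous f t.
Proof.
  intros H. unfold rcontinuous, continuous. apply filterlim_locally. intros eps.
  destruct (H eps (cond_pos eps)) as [d [Hd Hf]].
  exists (mkposreal d Hd). intros s Hs. apply C_NormedModule_mixin_compat1. now apply Hf.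
Qed.

Lemma rcontinuous_eps_inv (f : R -> C) t : rcontinuous f t -> forall eps : R, (0 < eps)%R ->
  exists d, (0 < d)%R /\ forall s, (Rabs (s - t) < d)%R -> (Cmod (f s - f t) < eps)%R.
Proof.
  intros H eps He. unfold rcontinuous, continuous in H.
  (* Balls of the product uniform structure are squares; the square of half-side e lies in the disc
     of radius sqrt 2 times e. *)
  assert (He2 : (0 < eps / sqrt 2)%R) by (apply Rdiv_lt_0_compat; [easy|apply sqrt_lt_R0; lra]).
  destruct (proj1 (filterlim_locally f (f t)) H (mkposreal _ He2)) as [d Hd].
  exists d. split; [apply cond_pos|]. intros s Hs.
  pose proof (C_NormedModule_mixin_compat2 _ _ _ (Hd s Hs)) as Q. simpl in Q.
  replace eps with (sqrt 2 * (eps / sqrt 2))%R; [exact Q|].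
  field. apply Rgt_not_eq, sqrt_lt_R0; lra.
Qed.

Lemma rderive_eps (f : R -> C) t l :
  (forall eps : R, (0 < eps)%R -> exists d, (0 < d)%R /\
     forall s, (Rabs (s - t) < d)%R ->
       (Cmod (f s - f t - RtoC (s - t) * l) <= eps * Rabs (s - t))%R) -> rderive f t l.
Proof.
  intros H. split; [apply is_linear_scal_l|].
  intros x Hx eps.
  assert (x = t) as -> by (symmetry; apply (is_filter_lim_locally_unique (K:=R_AbsRing) (V:=R_NormedModule)); exact Hx).
  destruct (H eps (cond_pos eps)) as [d [Hd H']].
  exists (mkposreal _ Hd). intros w Hw.
  specialize (H' w Hw). rewrite <- scal_R_Cmult, Cmod_norm in H'. exact H'.
Qed.

Lemma rderive_eps_inv (f : R -> C) t l : rderive f t l ->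
  (forall eps : R, (0 < eps)%R -> exists d, (0 < d)%R /\
     forall s, (Rabs (s - t) < d)%R ->
       (Cmod (f s - f t - RtoC (s - t) * l) <= eps * Rabs (s - t))%R).
Proof.
  intros [_ H] eps He.
  destruct (H t (fun P p => p) (mkposreal eps He)) as [d Hd].
  exists d. split; [apply cond_pos|]. intros s Hs. specialize (Hd s Hs).
  rewrite <- scal_R_Cmult, Cmod_norm. exact Hd.
Qed.

Lemma rderive_line (f : C -> C) z0 v t l : cderive f (z0 + RtoC t * v) l ->
  rderive (fun s => f (z0 + RtoC s * v)) t (v * l).
Proof.
  intros H. apply rderive_eps. intros eps He.
  pose proof (Cmod_ge_0 v) as Pv.
  assert (He' : (0 < eps / (Cmod v + 1))%R) by (apply Rdiv_lt_0_compat; lra).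
  destruct (proj1 (cderive_eps _ _ _) H _ He') as [d [Hd H']].
  exists (d / (Cmod v + 1))%R. split; [apply Rdiv_lt_0_compat; lra|].
  intros s Hs.
  assert (E : z0 + RtoC s * v - (z0 + RtoC t * v) = RtoC (s - t) * v)
    by (rewrite RtoC_minus; ring).
  specialize (H' (z0 + RtoC s * v)). rewrite E, Cmod_mult, Cmod_R in H'.
  replace (RtoC (s - t) * (v * l)) with (l * (RtoC (s - t) * v)) by ring.
  pose proof (Rabs_pos (s - t)) as Ps.
  eapply Rle_trans; [apply H'|].
  - apply Rle_lt_trans with (Rabs (s - t) * (Cmod v + 1))%R; [apply Rmult_le_compat_l; lra|].
    replace d with (d / (Cmod v + 1) * (Cmod v + 1))%R at 1 by (field; lra).
    apply Rmult_lt_compat_r; lra.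
  - apply Rle_trans with (eps / (Cmod v + 1) * (Rabs (s - t) * (Cmod v + 1)))%R.
    + apply Rmult_le_compat_l; [lra|]. apply Rmult_le_compat_l; lra.
    + right. field. lra.
Qed.

Lemma rcontinuous_rderive (f : R -> C) t l : rderive f t l -> rcontinuous f t.
Proof.
  intros H. apply (ex_derive_continuous (K := R_AbsRing) (V := C_R_NormedModule)).
  exists l. exact H.
Qed.

Lemma line_h (x y : R) : (x, y) = (0, y)%R + RtoC x * 1.
Proof. unfold Cplus, Cmult, RtoC; simpl. f_equal; ring. Qed.

Lemma line_v (x y : R) : (x, y) = RtoC x + RtoC y * Ci.
Proof. unfold Cplus, Cmult, RtoC, Ci; simpl. f_equal; ring. Qed.

Lemma rderive_h (f : C -> C) x y l : cderive f (x, y) l -> rderive (fun t => f (t, y)) x l.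
Proof.
  intros H. rewrite line_h in H. apply rderive_line in H.
  unfold rderive. rewrite <- (Cmult_1_l l).
  eapply is_derive_ext; [|exact H]. intros t. simpl. now rewrite <- line_h.
Qed.

Lemma rderive_v (f : C -> C) x y l : cderive f (x, y) l -> rderive (fun t => f (x, t)) y (Ci * l).
Proof.
  intros H. rewrite line_v in H. apply rderive_line in H.
  eapply is_derive_ext; [|exact H]. intros t. simpl. now rewrite <- line_v.
Qed.

Lemma is_CInt_unique f a b l : is_CInt f a b l -> CInt f a b = l.
Proof. apply (is_RInt_unique (V := CR)). Qed.

Lemma is_CInt_cont f a b : (a <= b)%R -> (forall t, (a <= t <= b)%R -> rcontinuous f t) -> is_CInt f a b (CInt f a b).
Proof.
  intros Hab H. apply (RInt_correct (V := CR)), (ex_RInt_continuous (V := CR)).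
  intros t. rewrite Rmin_left, Rmax_right by easy. apply H.
Qed.

Lemma is_CInt_plus f g a b k l : is_CInt f a b k -> is_CInt g a b l -> is_CInt (fun t => f t + g t) a b (k + l).
Proof. apply (is_RInt_plus (V := C_R_NormedModule)). Qed.

Lemma is_CInt_minus f g a b k l : is_CInt f a b k -> is_CInt g a b l -> is_CInt (fun t => f t - g t) a b (k - l).
Proof. apply (is_RInt_minus (V := C_R_NormedModule)). Qed.

(** The integral takes values in a real normed module, so linearity covers real scalars only. A
    complex scalar mixes the two components, which are therefore integrated one by one. *)
Lemma is_CInt_scal c f a b l : is_CInt f a b l -> is_CInt (fun t => c * f t) a b (c * l).
Proof.
  intros H.
  pose proof (is_RInt_fct_extend_fst (U := R_NormedModule) (V := R_NormedModule) f a b l H) as H1.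
  pose proof (is_RInt_fct_extend_snd (U := R_NormedModule) (V := R_NormedModule) f a b l H) as H2.
  apply (is_RInt_fct_extend_pair (U := R_NormedModule) (V := R_NormedModule)).
  - apply (is_RInt_minus (V := R_NormedModule)); apply (is_RInt_scal (V := R_NormedModule)); assumption.
  - apply (is_RInt_plus (V := R_NormedModule)); apply (is_RInt_scal (V := R_NormedModule)); assumption.
Qed.

Lemma is_CInt_const (c : C) a b : is_CInt (fun _ => c) a b (RtoC (b - a) * c).
Proof.
  rewrite <- scal_R_Cmult. apply (is_RInt_const (V := C_R_NormedModule)).
Qed.

Lemma is_CInt_Chasles f a b c k l : is_CInt f a b k -> is_CInt f b c l -> is_CInt f a c (k + l).
Proof. apply (is_RInt_Chasles (V := C_R_NormedModule)). Qed.

Lemma is_CInt_ext f g a b l : (a <= b)%R -> (forall t, (a <= t <= b)%R -> f t = g t) -> is_CInt f a b l -> is_CInt g a b l.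
Proof.
  intros Hab H. apply is_RInt_ext. intros t. rewrite Rmin_left, Rmax_right by easy.
  intros Ht. apply H. lra.
Qed.

Lemma is_CInt_bound f a b l M : (a <= b)%R -> is_CInt f a b l -> (forall t, (a <= t <= b)%R -> (Cmod (f t) <= M)%R) ->
  (Cmod l <= (b - a) * M)%R.
Proof.
  intros Hab H HM. rewrite Cmod_norm. apply (norm_RInt_le_const (V := C_R_NormedModule) f a b l M Hab); [|exact H].
  intros t Ht. specialize (HM t Ht). now rewrite Cmod_norm in HM.
Qed.

Lemma is_CInt_FTC (F f : R -> C) a b : (a <= b)%R ->
  (forall t, (a <= t <= b)%R -> rderive F t (f t)) -> (forall t, (a <= t <= b)%R -> rcontinuous f t) ->
  is_CInt f a b (F b - F a).
Proof.
  intros Hab H1 H2. apply (is_RInt_derive (V := CR)); intros t;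
    rewrite Rmin_left, Rmax_right by easy; [apply H1|apply H2].
Qed.

(** The contour integral over the boundary of [a, b] x [c, d], counterclockwise; on the vertical
    sides dz = i dt. *)
Definition rect_int (f : C -> C) (a b c d : R) : C :=
  CInt (fun t => f (t, c)) a b - CInt (fun t => f (t, d)) a b
  + Ci * (CInt (fun t => f (b, t)) c d - CInt (fun t => f (a, t)) c d).

Definition ccontinuous (f : C -> C) (z : C) : Prop := forall eps : R, (0 < eps)%R ->
  exists d, (0 < d)%R /\ forall w, (Cmod (w - z) < d)%R -> (Cmod (f w - f z) < eps)%R.

Lemma ccontinuous_cderive f z l : cderive f z l -> ccontinuous f z.
Proof. intros H. exact (cderive_cont f z l H). Qed.

Lemma pt_minus (x x' y y' : R) : ((x, y) - (x', y') : C) = (x - x', y - y')%R.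
Proof. reflexivity. Qed.

Lemma Cmod_h (x : R) : Cmod (x, 0%R) = Rabs x.
Proof. apply (Cmod_R x). Qed.

Lemma Cmod_v (x : R) : Cmod (0%R, x) = Rabs x.
Proof.
  replace (0%R, x) with (Ci * RtoC x) by (unfold Cmult, Ci, RtoC; simpl; f_equal; ring).
  rewrite Cmod_mult, Cmod_Ci, Cmod_R. ring.
Qed.

Lemma rcontinuous_h f x y : ccontinuous f (x, y) -> rcontinuous (fun t => f (t, y)) x.
Proof.
  intros H. apply rcontinuous_eps. intros eps He. destruct (H eps He) as [d [Hd H']].
  exists d. split; [exact Hd|]. intros s Hs. apply H'.
  rewrite pt_minus, Rminus_diag, Cmod_h. exact Hs.
Qed.

Lemma rcontinuous_v f x y : ccontinuous f (x, y) -> rcontinuous (fun t => f (x, t)) y.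
Proof.
  intros H. apply rcontinuous_eps. intros eps He. destruct (H eps He) as [d [Hd H']].
  exists d. split; [exact Hd|]. intros s Hs. apply H'.
  rewrite pt_minus, Rminus_diag, Cmod_v. exact Hs.
Qed.

Definition rect_continuous f a b c d : Prop :=
  forall x y, (a <= x <= b)%R -> (c <= y <= d)%R -> ccontinuous f (x, y).

Lemma is_CInt_h f a b c d x x' y : rect_continuous f a b c d -> (a <= x <= b)%R -> (a <= x' <= b)%R -> (x <= x')%R ->
  (c <= y <= d)%R -> is_CInt (fun t => f (t, y)) x x' (CInt (fun t => f (t, y)) x x').
Proof. intros H H1 H2 H3 Hy. apply is_CInt_cont; [lra|]. intros t Ht. apply rcontinuous_h, H; lra. Qed.

Lemma is_CInt_v f a b c d y y' x : rect_continuous f a b c d -> (c <= y <= d)%R -> (c <= y' <= d)%R -> (y <= y')%R ->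
  (a <= x <= b)%R -> is_CInt (fun t => f (x, t)) y y' (CInt (fun t => f (x, t)) y y').
Proof. intros H H1 H2 H3 Hy. apply is_CInt_cont; [lra|]. intros t Ht. apply rcontinuous_v, H; lra. Qed.

Lemma rect_int_quarter f a b c d m n : rect_continuous f a b c d -> (a <= m <= b)%R -> (c <= n <= d)%R ->
  rect_int f a b c d = rect_int f a m c n + rect_int f m b c n + (rect_int f a m n d + rect_int f m b n d).
Proof.
  intros H Hm Hn. unfold rect_int.
  assert (Hh : forall y, (c <= y <= d)%R -> CInt (fun t => f (t, y)) a b
     = CInt (fun t => f (t, y)) a m + CInt (fun t => f (t, y)) m b).
  { intros y Hy. apply is_CInt_unique.
    apply is_CInt_Chasles with m; apply (is_CInt_h f a b c d); try assumption; lra. }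
  assert (Hv : forall x, (a <= x <= b)%R -> CInt (fun t => f (x, t)) c d
     = CInt (fun t => f (x, t)) c n + CInt (fun t => f (x, t)) n d).
  { intros y Hy. apply is_CInt_unique.
    apply is_CInt_Chasles with n; apply (is_CInt_v f a b c d); try assumption; lra. }
  rewrite (Hh c), (Hh d), (Hv a), (Hv b) by lra. ring.
Qed.

Lemma rect_int_bound f a b c d M : (a <= b)%R -> (c <= d)%R -> rect_continuous f a b c d ->
  (forall x y, (a <= x <= b)%R -> (c <= y <= d)%R -> (Cmod (f (x, y)) <= M)%R) ->
  (Cmod (rect_int f a b c d) <= 2 * ((b - a) + (d - c)) * M)%R.
Proof.
  intros Hab Hcd H HM. unfold rect_int.
  assert (Hh : forall y, (c <= y <= d)%R -> (Cmod (CInt (fun t => f (t, y)) a b) <= (b - a) * M)%R).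
  { intros y Hy. eapply is_CInt_bound; [exact Hab|apply (is_CInt_h f a b c d); try assumption; lra|].
    intros; apply HM; lra. }
  assert (Hv : forall x, (a <= x <= b)%R -> (Cmod (CInt (fun t => f (x, t)) c d) <= (d - c) * M)%R).
  { intros y Hy. eapply is_CInt_bound; [exact Hcd|apply (is_CInt_v f a b c d); try assumption; lra|].
    intros; apply HM; lra. }
  pose proof (Hh c ltac:(lra)). pose proof (Hh d ltac:(lra)).
  pose proof (Hv a ltac:(lra)). pose proof (Hv b ltac:(lra)).
  eapply Rle_trans; [apply Cmod_triangle|]. rewrite Cmod_mult, Cmod_Ci. unfold Cminus.
  pose proof (Cmod_triangle (CInt (fun t => f (t, c)) a b) (- CInt (fun t => f (t, d)) a b)).
  pose proof (Cmod_triangle (CInt (fun t => f (b, t)) c d) (- CInt (fun t => f (a, t)) c d)).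
  rewrite Cmod_opp in *. lra.
Qed.

Lemma rect_int_minus f g a b c d : (a <= b)%R -> (c <= d)%R -> rect_continuous f a b c d -> rect_continuous g a b c d ->
  rect_int (fun z => f z - g z) a b c d = rect_int f a b c d - rect_int g a b c d.
Proof.
  intros Hab Hcd Hf Hg. unfold rect_int.
  assert (Hh : forall y, (c <= y <= d)%R -> CInt (fun t => f (t, y) - g (t, y)) a b
     = CInt (fun t => f (t, y)) a b - CInt (fun t => g (t, y)) a b).
  { intros y Hy. apply is_CInt_unique, is_CInt_minus; [apply (is_CInt_h f a b c d)|apply (is_CInt_h g a b c d)];
    try assumption; lra. }
  assert (Hv : forall x, (a <= x <= b)%R -> CInt (fun t => f (x, t) - g (x, t)) c d
     = CInt (fun t => f (x, t)) c d - CInt (fun t => g (x, t)) c d).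
  { intros y Hy. apply is_CInt_unique, is_CInt_minus; [apply (is_CInt_v f a b c d)|apply (is_CInt_v g a b c d)];
    try assumption; lra. }
  rewrite (Hh c), (Hh d), (Hv a), (Hv b) by lra. ring.
Qed.

Lemma rect_int_primitive F f a b c d : (a <= b)%R -> (c <= d)%R -> rect_continuous f a b c d ->
  (forall x y, (a <= x <= b)%R -> (c <= y <= d)%R -> cderive F (x, y) (f (x, y))) ->
  rect_int f a b c d = 0.
Proof.
  intros Hab Hcd Hf HF. unfold rect_int.
  assert (Hh : forall y, (c <= y <= d)%R -> CInt (fun t => f (t, y)) a b = F (b, y) - F (a, y)).
  { intros y Hy. apply is_CInt_unique. apply (is_CInt_FTC (fun t => F (t, y))); [exact Hab| |].
    - intros t Ht. now apply rderive_h, HF.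
    - intros t Ht. now apply rcontinuous_h, Hf. }
  assert (Hv : forall x, (a <= x <= b)%R -> Ci * CInt (fun t => f (x, t)) c d = F (x, d) - F (x, c)).
  { intros x Hx.
    assert (E : is_CInt (fun t => Ci * f (x, t)) c d (F (x, d) - F (x, c))).
    { apply (is_CInt_FTC (fun t => F (x, t))); [exact Hcd| |].
      - intros t Ht. now apply rderive_v, HF.
      - intros t Ht. apply (rcontinuous_v (fun z => Ci * f z)). intros eps He.
        destruct (Hf x t Hx Ht eps He) as [e [He' H']]. exists e. split; [exact He'|].
        intros w Hw. replace (Ci * f w - Ci * f (x, t)) with (Ci * (f w - f (x, t))) by ring.
        rewrite Cmod_mult, Cmod_Ci, Rmult_1_l. now apply H'. }
    rewrite <- (is_CInt_unique _ _ _ _ E). symmetry. apply is_CInt_unique, is_CInt_scal.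
    apply (is_CInt_v f a b c d); try assumption; lra. }
  rewrite !Hh by lra.
  replace (Ci * (CInt (fun t => f (b, t)) c d - CInt (fun t => f (a, t)) c d))
    with (Ci * CInt (fun t => f (b, t)) c d - Ci * CInt (fun t => f (a, t)) c d) by ring.
  rewrite !Hv by lra. ring.
Qed.

Section Goursat.
Variables (f : C -> C) (a c w h : R).
Hypothesis Hw : (0 <= w)%R.
Hypothesis Hh : (0 <= h)%R.
Hypothesis Hf : forall x y, (a <= x <= a + w)%R -> (c <= y <= c + h)%R -> exists l, cderive f (x, y) l.

Let wn (n : nat) := (w / 2 ^ n)%R.
Let hn (n : nat) := (h / 2 ^ n)%R.
Let Jn n (p : R * R) := rect_int f (fst p) (fst p + wn n) (snd p) (snd p + hn n).
Let inn n (p : R * R) := (a <= fst p)%R /\ (fst p + wn n <= a + w)%R /\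
   (c <= snd p)%R /\ (snd p + hn n <= c + h)%R.
(** The first clauses say that the new rectangle lies in the old one, the last that it keeps at
    least a quarter of the integral. Some quarter always does, by the triangle inequality. *)
Let step n (p p' : R * R) := (fst p <= fst p')%R /\ (fst p' + wn (S n) <= fst p + wn n)%R /\
   (snd p <= snd p')%R /\ (snd p' + hn (S n) <= snd p + hn n)%R /\
   (Cmod (Jn n p) <= 4 * Cmod (Jn (S n) p'))%R.

Local Lemma wnS n : wn n = (wn (S n) + wn (S n))%R /\ (0 <= wn (S n))%R.
Proof.
  unfold wn. simpl. pose proof (pow_lt 2 n ltac:(lra)). split; [field; lra|].
  apply Rdiv_le_0_compat; lra.
Qed.
Local Lemma hnS n : hn n = (hn (S n) + hn (S n))%R /\ (0 <= hn (S n))%R.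
Proof.
  unfold hn. simpl. pose proof (pow_lt 2 n ltac:(lra)). split; [field; lra|].
  apply Rdiv_le_0_compat; lra.
Qed.

Local Lemma rect_continuous_f : rect_continuous f a (a + w) c (c + h).
Proof. intros x y Hx Hy. destruct (Hf x y Hx Hy) as [l Hl]. apply (ccontinuous_cderive f _ l Hl). Qed.

Local Lemma step_ex n p : inn n p -> exists p', step n p p'.
Proof.
  intros [I1 [I2 [I3 I4]]]. destruct (wnS n) as [W W0]. destruct (hnS n) as [H H0].
  assert (Q : Jn n p = Jn (S n) p + Jn (S n) (fst p + wn (S n), snd p)%R
    + (Jn (S n) (fst p, snd p + hn (S n))%R + Jn (S n) (fst p + wn (S n), snd p + hn (S n))%R)).
  { unfold Jn. rewrite (rect_int_quarter f _ _ _ _ (fst p + wn (S n)) (snd p + hn (S n))); try lra.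
    - simpl. rewrite W, H, !Rplus_assoc. reflexivity.
    - intros x y Hx Hy. apply rect_continuous_f; lra. }
  assert (T : (Cmod (Jn n p) <= Cmod (Jn (S n) p) + Cmod (Jn (S n) (fst p + wn (S n), snd p)%R)
    + (Cmod (Jn (S n) (fst p, snd p + hn (S n))%R) + Cmod (Jn (S n) (fst p + wn (S n), snd p + hn (S n))%R)))%R).
  { rewrite Q. eapply Rle_trans; [apply Cmod_triangle|]. apply Rplus_le_compat; apply Cmod_triangle. }
  unfold step.
  destruct (Rle_dec (Cmod (Jn n p)) (4 * Cmod (Jn (S n) p))) as [L|L].
  { exists p. repeat split; lra. }
  destruct (Rle_dec (Cmod (Jn n p)) (4 * Cmod (Jn (S n) (fst p + wn (S n), snd p)%R))) as [L1|L1].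
  { eexists. repeat split; [..|exact L1]; simpl; lra. }
  destruct (Rle_dec (Cmod (Jn n p)) (4 * Cmod (Jn (S n) (fst p, snd p + hn (S n))%R))) as [L2|L2].
  { eexists. repeat split; [..|exact L2]; simpl; lra. }
  destruct (Rle_dec (Cmod (Jn n p)) (4 * Cmod (Jn (S n) (fst p + wn (S n), snd p + hn (S n))%R))) as [L3|L3].
  { eexists. repeat split; [..|exact L3]; simpl; lra. }
  lra.
Qed.

Let corner := fix corner (n : nat) : R * R := match n with
  | O => (a, c)
  | S n => epsilon (inhabits (0, 0)%R) (fun p' => step n (corner n) p')
  end.

Local Lemma corner_inn n : inn n (corner n).
Proof.
  induction n as [|n IH].
  - unfold inn, wn, hn; simpl. unfold Rdiv. rewrite Rinv_1. lra.
  - destruct (step_ex n _ IH) as [p' Hp'].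
    pose proof (epsilon_spec (inhabits (0, 0)%R) (fun p' => step n (corner n) p') (ex_intro _ p' Hp')) as [S1 [S2 [S3 [S4 _]]]].
    destruct IH as [I1 [I2 [I3 I4]]].
    change (corner (S n)) with (epsilon (inhabits (0, 0)%R) (fun p' => step n (corner n) p')).
    unfold inn. lra.
Qed.

Local Lemma corner_step n : step n (corner n) (corner (S n)).
Proof.
  apply (epsilon_spec (inhabits (0, 0)%R) (fun p' => step n (corner n) p')).
  apply step_ex, corner_inn.
Qed.

Local Lemma corner_mono n m : (n <= m)%nat -> (fst (corner n) <= fst (corner m))%R /\
  (fst (corner m) + wn m <= fst (corner n) + wn n)%R /\
  (snd (corner n) <= snd (corner m))%R /\ (snd (corner m) + hn m <= snd (corner n) + hn n)%R.
Proof.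
  intros H. induction H as [|m _ IH]; [lra|].
  destruct (corner_step m) as [S1 [S2 [S3 [S4 _]]]]. lra.
Qed.

Local Lemma J_pow n : (Cmod (Jn 0 (a, c)) <= 4 ^ n * Cmod (Jn n (corner n)))%R.
Proof.
  induction n as [|n IH].
  - simpl. lra.
  - destruct (corner_step n) as [_ [_ [_ [_ S5]]]].
    eapply Rle_trans; [exact IH|]. rewrite <- tech_pow_Rmult, (Rmult_comm 4), Rmult_assoc.
    apply Rmult_le_compat_l; [apply pow_le; lra|exact S5].
Qed.

Local Lemma limit_pt : exists x y, forall n, (fst (corner n) <= x <= fst (corner n) + wn n)%R /\
   (snd (corner n) <= y <= snd (corner n) + hn n)%R.
Proof.
  assert (W : forall n, (0 <= wn n)%R) by (intros n; destruct (wnS n); lra).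
  assert (H : forall n, (0 <= hn n)%R) by (intros n; destruct (hnS n); lra).
  assert (M : forall n m, (fst (corner n) <= fst (corner m) + wn m)%R /\ (snd (corner n) <= snd (corner m) + hn m)%R).
  { intros n m. pose proof (W n). pose proof (W m). pose proof (H n). pose proof (H m).
    destruct (Nat.le_ge_cases n m) as [L|L]; destruct (corner_mono _ _ L) as [? [? [? ?]]]; lra. }
  assert (X : exists x, forall n, (fst (corner n) <= x <= fst (corner n) + wn n)%R).
  { destruct (completeness (fun x => exists n, x = fst (corner n))) as [x [U L]].
    - exists (fst (corner 0) + wn 0)%R. intros x [n ->]. apply M.
    - exists (fst (corner 0)). now exists 0%nat.
    - exists x. intros n. split; [apply U; now exists n|]. apply L. intros y [m ->]. apply M. }
  assert (Y : exists x, forall n, (snd (corner n) <= x <= snd (corner n) + hn n)%R).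
  { destruct (completeness (fun x => exists n, x = snd (corner n))) as [x [U L]].
    - exists (snd (corner 0) + hn 0)%R. intros x [n ->]. apply M.
    - exists (snd (corner 0)). now exists 0%nat.
    - exists x. intros n. split; [apply U; now exists n|]. apply L. intros y [m ->]. apply M. }
  destruct X as [x X]. destruct Y as [y Y]. exists x, y. auto.
Qed.

(** The nested quarters shrink to a point (x, y). The first order Taylor polynomial there has a
    primitive, hence integral 0; what remains is at most a small constant times the diameter.
    Perimeter and diameter each contribute 2^(-n), which cancels the factor 4^n of [J_pow]. *)
Lemma Goursat : rect_int f a (a + w) c (c + h) = 0.
Proof.
  destruct limit_pt as [x [y Hxy]].
  assert (W : forall n, (0 <= wn n)%R) by (intros n; destruct (wnS n); lra).
  assert (H : forall n, (0 <= hn n)%R) by (intros n; destruct (hnS n); lra).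
  assert (E0 : Jn 0 (a, c) = rect_int f a (a + w) c (c + h)).
  { unfold Jn, wn, hn; simpl. f_equal; field. }
  destruct (Hf x y) as [l Hl].
  { destruct (Hxy 0%nat) as [X _]. simpl in X. unfold wn in X. simpl in X. lra. }
  { destruct (Hxy 0%nat) as [_ X]. simpl in X. unfold hn in X. simpl in X. lra. }
  apply Cmod_eq_0, Rle_antisym; [|apply Cmod_ge_0].
  apply le_epsilon. intros eps He. rewrite Rplus_0_l, <- E0.
  set (s := (w + h)%R).
  assert (Hs : (0 <= s)%R) by (unfold s; lra).
  (* The final bound is 2 s^2 times this constant; the summand 1 keeps the denominator positive for
     a degenerate rectangle. *)
  assert (He' : (0 < eps / (2 * (s * s) + 1))%R) by (apply Rdiv_lt_0_compat; nra).
  destruct (proj1 (cderive_eps _ _ _) Hl _ He') as [d [Hd H']].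
  destruct (pow_lt_1_zero (/2) ltac:(rewrite Rabs_pos_eq; lra) (d / (s + 1))%R) as [n Hn].
  { apply Rdiv_lt_0_compat; lra. }
  specialize (Hn n (le_n n)). rewrite Rabs_pos_eq in Hn by (apply pow_le; lra).
  rewrite pow_inv in Hn.
  assert (P2 : (0 < 2 ^ n)%R) by (apply pow_lt; lra).
  assert (Sn : (wn n + hn n = s * / 2 ^ n)%R) by (unfold wn, hn, s, Rdiv; ring).
  assert (Sd : (wn n + hn n < d)%R).
  { rewrite Sn. apply Rle_lt_trans with ((s + 1) * / 2 ^ n)%R.
    - apply Rmult_le_compat_r; [|lra]. left. now apply Rinv_0_lt_compat.
    - replace d with ((s + 1) * (d / (s + 1)))%R by (field; lra).
      apply Rmult_lt_compat_l; lra. }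
  destruct (corner_inn n) as [I1 [I2 [I3 I4]]].
  set (p := corner n) in *.
  assert (Wn := W n). assert (Hn' := H n).
  assert (Rf : rect_continuous f (fst p) (fst p + wn n) (snd p) (snd p + hn n)).
  { intros x' y' Hx' Hy'. apply rect_continuous_f; lra. }
  set (A := fun z => f (x, y) + l * (z - (x, y))).
  assert (CA : forall z, cderive A z l).
  { intros z. eapply cderive_eq; [apply cderive_plus; [apply cderive_const|apply cderive_scal, cderive_minus; [apply cderive_id|apply cderive_const]]|ring]. }
  assert (RA : rect_continuous A (fst p) (fst p + wn n) (snd p) (snd p + hn n)).
  { intros x' y' _ _. eapply ccontinuous_cderive, CA. }
  assert (JA : rect_int A (fst p) (fst p + wn n) (snd p) (snd p + hn n) = 0).
  { apply rect_int_primitive with (fun z => f (x, y) * z + l / 2 * ((z - (x, y)) * (z - (x, y)))); try lra; [exact RA|].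
    intros x' y' _ _.
    eapply cderive_eq; [apply cderive_plus; [apply cderive_scal, cderive_id|apply cderive_scal, cderive_mult;
      (apply cderive_minus; [apply cderive_id|apply cderive_const])]|].
    unfold A. cbv beta. field. }
  assert (JE : Jn n p = rect_int (fun z => f z - A z) (fst p) (fst p + wn n) (snd p) (snd p + hn n)).
  { rewrite rect_int_minus by (auto; lra). rewrite JA. unfold Jn. ring. }
  assert (BE : (Cmod (Jn n p) <= 2 * ((fst p + wn n - fst p) + (snd p + hn n - snd p)) *
      (eps / (2 * (s * s) + 1) * (wn n + hn n)))%R).
  { rewrite JE. apply rect_int_bound; try lra.
    - intros x' y' Hx' Hy' e Pe.
      destruct (Rf x' y' Hx' Hy' (e/2)%R ltac:(lra)) as [d1 [Pd1 K1]].
      destruct (RA x' y' Hx' Hy' (e/2)%R ltac:(lra)) as [d2 [Pd2 K2]].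
      exists (Rmin d1 d2). split; [now apply Rmin_glb_lt|]. intros z Hz.
      replace (f z - A z - (f (x', y') - A (x', y'))) with ((f z - f (x', y')) + - (A z - A (x', y'))) by ring.
      eapply Rle_lt_trans; [apply Cmod_triangle|]. rewrite Cmod_opp.
      specialize (K1 z (Rlt_le_trans _ _ _ Hz (Rmin_l _ _))).
      specialize (K2 z (Rlt_le_trans _ _ _ Hz (Rmin_r _ _))). lra.
    - intros x' y' Hx' Hy'. destruct (Hxy n) as [X Y]. fold p in X, Y.
      assert (B : (Cmod ((x', y') - (x, y)) <= wn n + hn n)%R).
      { eapply Rle_trans; [apply Cmod_le_Rabs|]. rewrite pt_minus. unfold Re, Im; simpl.
        apply Rplus_le_compat; apply Rabs_le; lra. }
      replace (f (x', y') - A (x', y')) with (f (x', y') - f (x, y) - l * ((x', y') - (x, y)))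
        by (unfold A; ring).
      eapply Rle_trans; [apply H'; lra|]. apply Rmult_le_compat_l; lra. }
  eapply Rle_trans; [apply (J_pow n)|]. fold p.
  eapply Rle_trans; [apply Rmult_le_compat_l; [apply pow_le; lra|exact BE]|].
  replace (4 ^ n)%R with (2 ^ n * 2 ^ n)%R by (rewrite <- Rpow_mult_distr; f_equal; ring).
  replace (fst p + wn n - fst p + (snd p + hn n - snd p))%R with (wn n + hn n)%R by ring.
  rewrite Sn. assert (Q : (0 < 2 * (s * s) + 1)%R) by nra.
  replace (2 ^ n * 2 ^ n * (2 * (s * / 2 ^ n) * (eps / (2 * (s * s) + 1) * (s * / 2 ^ n))))%R
    with (eps * ((2 * (s * s)) / (2 * (s * s) + 1)))%R by (field; split; apply Rgt_not_eq; assumption).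
  rewrite <- (Rmult_1_r eps) at 2. apply Rmult_le_compat_l; [lra|].
  apply Rmult_le_reg_r with (2 * (s * s) + 1)%R; [nra|].
  unfold Rdiv. rewrite Rmult_assoc, Rinv_l; nra.
Qed.
End Goursat.

Lemma rect_int_0 f a b c d : (a <= b)%R -> (c <= d)%R ->
  (forall x y, (a <= x <= b)%R -> (c <= y <= d)%R -> exists l, cderive f (x, y) l) ->
  rect_int f a b c d = 0.
Proof.
  intros Hab Hcd H. replace b with (a + (b - a))%R by ring. replace d with (c + (d - c))%R by ring.
  apply Goursat; try lra. intros x y Hx Hy. apply H; lra.
Qed.

(** Cutting along a square of half-side e around the exceptional point leaves pieces on which
    Goursat applies. The square has perimeter 8 e and the integrand is bounded near the point, so
    its contribution tends to 0 with e. *)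
Lemma rect_int_0_except f a b c d x0 y0 : (a < x0 < b)%R -> (c < y0 < d)%R -> ccontinuous f (x0, y0) ->
  (forall x y, (a <= x <= b)%R -> (c <= y <= d)%R -> (x <> x0 \/ y <> y0) -> exists l, cderive f (x, y) l) ->
  rect_int f a b c d = 0.
Proof.
  intros Hx0 Hy0 Hc H.
  assert (RC : rect_continuous f a b c d).
  { intros x y Hx Hy. destruct (Req_dec x x0) as [->|N].
    - destruct (Req_dec y y0) as [->|N]; [exact Hc|].
      destruct (H x0 y Hx Hy (or_intror N)) as [l Hl]. apply (ccontinuous_cderive _ _ _ Hl).
    - destruct (H x y Hx Hy (or_introl N)) as [l Hl]. apply (ccontinuous_cderive _ _ _ Hl). }
  destruct (Hc 1%R Rlt_0_1) as [d0 [Hd0 H1]].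
  set (M := (Cmod (f (x0, y0)) + 1)%R).
  assert (HM : (1 <= M)%R) by (unfold M; pose proof (Cmod_ge_0 (f (x0, y0))); lra).
  apply Cmod_eq_0, Rle_antisym; [|apply Cmod_ge_0].
  apply le_epsilon. intros eps He. rewrite Rplus_0_l.
  assert (Q : (0 < eps / (8 * M))%R) by (apply Rdiv_lt_0_compat; lra).
  set (e := Rmin (Rmin (d0 / 3) (eps / (8 * M))) (Rmin (Rmin ((x0 - a)/2) ((b - x0)/2)) (Rmin ((y0 - c)/2) ((d - y0)/2)))).
  assert (e0 : (0 < e)%R) by (unfold e; repeat apply Rmin_glb_lt; lra).
  assert (B : (e <= d0 / 3 /\ e <= eps / (8 * M) /\ e <= (x0 - a)/2 /\ e <= (b - x0)/2 /\
     e <= (y0 - c)/2 /\ e <= (d - y0)/2)%R).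
  { unfold e. repeat split; repeat first [apply Rle_refl | eapply Rle_trans; [apply Rmin_l|]; apply Rle_refl
      | eapply Rle_trans; [apply Rmin_l|]; eapply Rle_trans; [apply Rmin_l|]; apply Rle_refl
      | eapply Rle_trans; [apply Rmin_l|]; eapply Rle_trans; [apply Rmin_r|]; apply Rle_refl
      | eapply Rle_trans; [apply Rmin_r|]; eapply Rle_trans; [apply Rmin_l|]; eapply Rle_trans; [apply Rmin_l|]; apply Rle_refl
      | eapply Rle_trans; [apply Rmin_r|]; eapply Rle_trans; [apply Rmin_l|]; eapply Rle_trans; [apply Rmin_r|]; apply Rle_refl
      | eapply Rle_trans; [apply Rmin_r|]; eapply Rle_trans; [apply Rmin_r|]; eapply Rle_trans; [apply Rmin_l|]; apply Rle_refl
      | eapply Rle_trans; [apply Rmin_r|]; eapply Rle_trans; [apply Rmin_r|]; eapply Rle_trans; [apply Rmin_r|]; apply Rle_refl ]. }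
  destruct B as [Bd1 [B2 [B3 [B4 [B5 B6]]]]].
  rewrite (rect_int_quarter f a b c d (x0 - e) (y0 - e)) by (auto; lra).
  rewrite (rect_int_quarter f (x0 - e) b (y0 - e) d (x0 + e) (y0 + e)); try lra.
  2:{ intros x y Hx Hy. apply RC; lra. }
  assert (Z : forall a' b' c' d', (a <= a' <= b')%R -> (b' <= b)%R -> (c <= c' <= d')%R -> (d' <= d)%R ->
    (b' < x0 \/ x0 < a' \/ d' < y0 \/ y0 < c')%R -> rect_int f a' b' c' d' = 0).
  { intros a' b' c' d' h1 h2 h3 h4 h5. apply rect_int_0; try lra. intros x y Hx Hy. apply H; try lra. }
  rewrite (Z a (x0 - e)%R c (y0 - e)%R), (Z (x0 - e)%R b c (y0 - e)%R), (Z a (x0 - e)%R (y0 - e)%R d),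
    (Z (x0 + e)%R b (y0 - e)%R (y0 + e)%R), (Z (x0 - e)%R (x0 + e)%R (y0 + e)%R d),
    (Z (x0 + e)%R b (y0 + e)%R d) by lra.
  rewrite !Cplus_0_l, !Cplus_0_r.
  eapply Rle_trans; [apply (rect_int_bound f _ _ _ _ M); try lra|].
  - intros x y Hx Hy. apply RC; lra.
  - intros x y Hx Hy.
    assert (D : (Cmod ((x, y) - (x0, y0)) < d0)%R).
    { eapply Rle_lt_trans; [apply Cmod_le_Rabs|]. rewrite pt_minus. unfold Re, Im; simpl.
      apply Rle_lt_trans with (e + e)%R; [apply Rplus_le_compat; apply Rabs_le; lra|lra]. }
    specialize (H1 _ D). pose proof (Cmod_tri3 (f (x, y)) (f (x0, y0))). unfold M. lra.
  - replace (2 * (x0 + e - (x0 - e) + (y0 + e - (y0 - e))) * M)%R with (8 * M * e)%R by ring.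
    apply Rle_trans with (8 * M * (eps / (8 * M)))%R; [apply Rmult_le_compat_l; lra|].
    right. field. lra.
Qed.

(** * Cauchy's formula on a period strip *)

Definition periodic_on (f : C -> C) (y : R) : Prop := forall x, f ((x + 1)%R, y) = f (x, y).

Lemma CInt_shift (f : R -> C) a : (forall t, rcontinuous f t) -> (forall t, f (t + 1)%R = f t) ->
  CInt f a (a + 1) = CInt f 0 1.
Proof.
  intros Hc Hp.
  assert (E : forall u v, is_CInt f u v (CInt f u v)).
  { intros u v. apply (RInt_correct (V := CR)), (ex_RInt_continuous (V := CR)). intros t _. apply Hc. }
  assert (S : CInt f 1 (a + 1) = CInt f 0 a).
  { pose proof (E 1%R (a + 1)%R) as H.
    replace 1%R with (1 * 0 + 1)%R in H at 1 by ring. replace (a + 1)%R with (1 * a + 1)%R in H at 1 by ring.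
    apply (is_RInt_comp_lin (V := C_R_NormedModule)) in H.
    symmetry. apply is_CInt_unique. eapply is_RInt_ext; [|exact H].
    intros t _. cbv beta. rewrite Rmult_1_l, Hp. apply (scal_one (V := C_R_ModuleSpace)). }
  pose proof (is_CInt_unique _ _ _ _ (is_CInt_Chasles _ _ _ _ _ _ (E 0%R a) (E a (a + 1)%R))) as H1.
  pose proof (is_CInt_unique _ _ _ _ (is_CInt_Chasles _ _ _ _ _ _ (E 0%R 1%R) (E 1%R (a + 1)%R))) as H2.
  rewrite H1, S in H2.
  replace (CInt f a (a + 1)) with (CInt f 0 a + CInt f a (a + 1) - CInt f 0 a) by ring.
  rewrite H2. ring.
Qed.

(** On a rectangle of width 1 the two vertical sides cancel, so a vanishing contour integral
    compares bottom and top. *)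
Lemma periodic_int_const f a c d : (c <= d)%R -> periodic_on f c -> periodic_on f d -> (forall y, (c <= y <= d)%R -> periodic_on f y) ->
  rect_int f a (a + 1) c d = 0 -> CInt (fun t => f (t, c)) a (a + 1) = CInt (fun t => f (t, d)) a (a + 1).
Proof.
  intros Hcd _ _ Hp H. unfold rect_int in H.
  replace (CInt (fun t => f ((a + 1)%R, t)) c d) with (CInt (fun t => f (a, t)) c d) in H.
  - replace (CInt (fun t => f (t, c)) a (a + 1)) with (CInt (fun t => f (t, c)) a (a + 1) - CInt (fun t => f (t, d)) a (a + 1)
      + Ci * (CInt (fun t => f (a, t)) c d - CInt (fun t => f (a, t)) c d) + CInt (fun t => f (t, d)) a (a + 1)) by ring.
    rewrite H. ring.
  - apply (RInt_ext (V := CR)). intros t. rewrite Rmin_left, Rmax_right by easy. intros Ht.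
    symmetry. apply Hp. lra.
Qed.

(** A periodic substitute for the Cauchy kernel. For Im u > 0 it is the geometric series of the e(n
    u), which will produce the expansion in q; for Im u < 0 it decays exponentially as Im u
    decreases. *)
Definition strip_kernel (u : C) : C := / (1 - ee u).

Lemma one_minus_neq0 (w : C) : w <> 1 -> 1 - w <> 0.
Proof. intros H E. apply H. apply Ceq_minus in E. now symmetry. Qed.

Lemma cderive_strip_kernel z s : ee (z - s) <> 1 -> exists l, cderive (fun s => strip_kernel (z - s)) s l.
Proof.
  intros H. eexists. unfold strip_kernel. apply cderive_inv; [|now apply one_minus_neq0].
  apply cderive_minus; [apply cderive_const|]. apply cderive_comp; [apply cderive_ee|].
  apply cderive_minus; [apply cderive_const|apply cderive_id].
Qed.

Lemma strip_kernel_lower (u : C) : (Im u < 0)%R ->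
  (Cmod (strip_kernel u) <= / (exp (- (2 * PI) * Im u) - 1))%R.
Proof.
  intros H. unfold strip_kernel. pose proof PI_RGT_0.
  assert (E : (1 < exp (- (2 * PI) * Im u))%R).
  { rewrite <- exp_0 at 1. apply exp_increasing. nra. }
  assert (D : (exp (- (2 * PI) * Im u) - 1 <= Cmod (1 - ee u))%R).
  { rewrite <- Cmod_ee, Cmod_minus_sym. pose proof (Cmod_tri3 (ee u) 1). rewrite Cmod_1 in H1. lra. }
  rewrite Cmod_inv.
  - apply Rinv_le_contravar; lra.
  - apply Cmod_gt_0. lra.
Qed.

Lemma strip_kernel_upper (u : C) : (0 < Im u)%R ->
  (Cmod (strip_kernel u) <= / (1 - exp (- (2 * PI) * Im u)))%R.
Proof.
  intros H. unfold strip_kernel. pose proof PI_RGT_0.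
  assert (E : (exp (- (2 * PI) * Im u) < 1)%R).
  { rewrite <- exp_0. apply exp_increasing. nra. }
  assert (D : (1 - exp (- (2 * PI) * Im u) <= Cmod (1 - ee u))%R).
  { rewrite <- Cmod_ee. pose proof (Cmod_tri3 1 (ee u)). rewrite Cmod_1 in H1. lra. }
  rewrite Cmod_inv.
  - apply Rinv_le_contravar; lra.
  - apply Cmod_gt_0. lra.
Qed.

Lemma ee_plus_1 u : ee (u + 1) = ee u.
Proof. rewrite ee_add, ee_1. ring. Qed.

Lemma ee_minus_1 u : ee (u - 1) = ee u.
Proof. rewrite <- (ee_plus_1 (u - 1)). f_equal. ring. Qed.

Lemma ee_ne1 u : Im u <> 0%R -> ee u <> 1.
Proof. intros H E. apply H. now apply ee_eq1. Qed.

Lemma pt_shift (x y : R) : ((x + 1)%R, y) = (x, y) + 1.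
Proof. unfold Cplus, RtoC; simpl. f_equal. ring. Qed.

(* The kernel [1/(1 - e(z-s))] is 1-periodic with a simple pole at [s = z], so the vertical sides of
   the strip cancel. Dividing [g(s) - g(z)] by [1 - e(z-s)] removes the pole. *)
Section StripCauchy.
Variables (g : C -> C) (x y c Y : R).
Hypothesis Hc0 : (0 < c)%R.
Hypothesis Hcy : (c < y)%R.
Hypothesis HyY : (y < Y)%R.
Hypothesis Hg : holo g.
Hypothesis Hp : forall z, UH z -> g (z + 1) = g z.
Let z : C := (x, y).
(** Near s = z one has 1 - e(z - s) = tau (s - z) + ..., so g'(z) / tau is the value that makes the
    quotient continuous; periodicity gives the same value at all z + n. *)
Let phi (s : C) : C := if excluded_middle_informative (ee (z - s) = 1) then Cderiv g z / tau
   else (g s - g z) * strip_kernel (z - s).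

Local Lemma phi_near : ccontinuous phi z.
Proof.
  assert (Hz : UH z) by (unfold UH, z, Im; simpl; lra).
  pose proof (Cderiv_cderive g z Hg Hz) as D. set (l := Cderiv g z) in *.
  assert (DE : cderive (fun s => 1 - ee (z - s)) z tau).
  { eapply cderive_eq; [apply cderive_minus; [apply cderive_const|apply cderive_comp; [apply cderive_ee|apply cderive_minus; [apply cderive_const|apply cderive_id]]]|].
    cbv beta. replace (z - z) with (RtoC 0) by ring. rewrite ee_0. ring. }
  assert (E0 : phi z = l / tau).
  { unfold phi. destruct (excluded_middle_informative _) as [_|N]; [reflexivity|].
    exfalso. apply N. replace (z - z) with (RtoC 0) by ring. apply ee_0. }
  intros eps He.
  pose proof tau_neq0 as T0. pose proof (proj1 (Cmod_gt_0 _) T0) as Tm.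
  set (e1 := (Cmod tau / 2)%R).
  pose proof (Cmod_ge_0 l) as Pl.
  set (L := (Cmod (l / tau) + 1)%R).
  assert (HL : (1 <= L)%R) by (unfold L; pose proof (Cmod_ge_0 (l / tau)); lra).
  set (e2 := Rmin e1 (eps * Cmod tau / (8 * L))).
  assert (H1 : (0 < e1)%R) by (unfold e1; lra).
  assert (H2 : (0 < e2)%R) by (apply Rmin_glb_lt; [easy|apply Rdiv_lt_0_compat; nra]).
  assert (H2' : (e2 <= e1 /\ e2 <= eps * Cmod tau / (8 * L))%R) by (split; [apply Rmin_l|apply Rmin_r]).
  destruct (proj1 (cderive_eps _ _ _) D e2 H2) as [d1 [Hd1 K1]].
  destruct (proj1 (cderive_eps _ _ _) DE e2 H2) as [d2 [Hd2 K2]].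
  exists (Rmin d1 d2). split; [now apply Rmin_glb_lt|]. intros s Hs.
  specialize (K1 s (Rlt_le_trans _ _ _ Hs (Rmin_l _ _))).
  specialize (K2 s (Rlt_le_trans _ _ _ Hs (Rmin_r _ _))).
  rewrite E0. unfold phi. destruct (excluded_middle_informative _) as [_|N].
  { replace (l / tau - l / tau) with (RtoC 0) by ring. now rewrite Cmod_0. }
  replace (1 - ee (z - z)) with (RtoC 0) in K2 by (replace (z - z) with (RtoC 0) by ring; rewrite ee_0; ring).
  set (h := s - z) in *. set (u := 1 - ee (z - s)) in *.
  assert (U0 : u <> 0) by (apply one_minus_neq0, N).
  assert (Hh : (0 < Cmod h)%R).
  { apply Cmod_gt_0. intros E. apply N. replace (z - s) with (- h) by (unfold h; ring).
    rewrite E, Copp_0. apply ee_0. }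
  assert (Ub : (Cmod tau / 2 * Cmod h <= Cmod u)%R).
  { pose proof (Cmod_tri3 (tau * h) u) as T. rewrite Cmod_mult in T.
    replace (tau * h - u) with (- (u - 0 - tau * h)) in T by ring. rewrite Cmod_opp in T.
    assert (e2 * Cmod h <= e1 * Cmod h)%R by (apply Rmult_le_compat_r; lra).
    unfold e1 in *. lra. }
  unfold strip_kernel. fold u.
  replace ((g s - g z) * / u - l / tau) with (((g s - g z - l * h) - l / tau * (u - 0 - tau * h)) * / u)
    by (field; auto).
  rewrite Cmod_mult, Cmod_inv by exact U0.
  assert (Num : (Cmod (g s - g z - l * h - l / tau * (u - 0 - tau * h)) <= L * e2 * Cmod h)%R).
  { unfold Cminus at 1. eapply Rle_trans; [apply Cmod_triangle|]. rewrite Cmod_opp, Cmod_mult.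
    assert (Cmod (l / tau) * Cmod (u - 0 - tau * h) <= Cmod (l / tau) * (e2 * Cmod h))%R
      by (apply Rmult_le_compat_l; [apply Cmod_ge_0|exact K2]).
    unfold L. lra. }
  assert (Pu : (0 < Cmod u)%R) by now apply Cmod_gt_0.
  apply Rmult_lt_reg_r with (Cmod u); [exact Pu|].
  rewrite Rmult_assoc, Rinv_l, Rmult_1_r by lra.
  eapply Rle_lt_trans; [exact Num|].
  apply Rlt_le_trans with (eps * (Cmod tau / 2 * Cmod h))%R; [|apply Rmult_le_compat_l; lra].
  replace (eps * (Cmod tau / 2 * Cmod h))%R with (eps * Cmod tau / 2 * Cmod h)%R by field.
  apply Rmult_lt_compat_r; [exact Hh|].
  apply Rle_lt_trans with (L * (eps * Cmod tau / (8 * L)))%R; [apply Rmult_le_compat_l; lra|].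
  replace (L * (eps * Cmod tau / (8 * L)))%R with (eps * Cmod tau / 8)%R by (field; lra).
  assert (0 < eps * Cmod tau)%R by (apply Rmult_lt_0_compat; lra). lra.
Qed.

Local Lemma phi_cderive s : UH s -> ee (z - s) <> 1 -> exists l, cderive phi s l.
Proof.
  intros Hs N.
  destruct (cderive_strip_kernel z s N) as [l2 D2].
  pose proof (Cderiv_cderive g s Hg Hs) as D1.
  eexists. eapply cderive_ext_loc; [|apply (cderive_mult (fun s => g s - g z) (fun s => strip_kernel (z - s)));
    [apply cderive_minus; [exact D1|apply cderive_const]|exact D2]].
  assert (DE : cderive (fun s => ee (z - s)) s (-1 * (tau * ee (z - s)))).
  { apply (cderive_comp ee); [apply cderive_ee|].
    eapply cderive_eq; [apply cderive_minus; [apply cderive_const|apply cderive_id]|ring]. }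
  assert (P : (0 < Cmod (ee (z - s) - 1))%R).
  { apply Cmod_gt_0. intros E. apply N. apply Ceq_minus, E. }
  destruct (cderive_cont _ _ _ DE _ P) as [d [Hd K]]. exists d. split; [exact Hd|].
  intros w Hw. specialize (K w Hw). unfold phi.
  destruct (excluded_middle_informative _) as [E|_]; [|reflexivity].
  rewrite E, Cmod_minus_sym in K. lra.
Qed.

(** Centering the strip of width 1 at [x] puts z in the interior, while the other points z + n have
    distance at least 1 from the center line and stay outside. *)
Local Lemma rect_int_phi : rect_int phi (x - 1/2) (x - 1/2 + 1) c Y = 0.
Proof.
  apply rect_int_0_except with x y; try lra; [exact phi_near|].
  intros x' y' Hx' Hy' N. apply phi_cderive; [unfold UH, Im; simpl; lra|].
  intros E. destruct (ee_eq1 _ E) as [E1 [n E2]]. unfold z in *. rewrite pt_minus in *.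
  unfold Im, Re in *; simpl in *.
  assert (-1 < IZR n < 1)%R by lra.
  assert (n = 0)%Z by (destruct H as [H1 H2]; apply lt_IZR in H1, H2; lia). subst n.
  destruct N; lra.
Qed.

Local Lemma phi_periodic y' : (0 < y')%R -> periodic_on phi y'.
Proof.
  intros H t. rewrite pt_shift. unfold phi.
  replace (ee (z - ((t, y') + 1))) with (ee (z - (t, y'))).
  2:{ rewrite <- (ee_minus_1 (z - (t, y'))). f_equal. ring. }
  unfold strip_kernel. replace (ee (z - ((t, y') + 1))) with (ee (z - (t, y'))).
  2:{ rewrite <- (ee_minus_1 (z - (t, y'))). f_equal. ring. }
  rewrite Hp by exact H. reflexivity.
Qed.

Local Lemma gK_rcontinuous y' t : (0 < y')%R -> y' <> y ->
  rcontinuous (fun t => g (t, y') * strip_kernel (z - (t, y'))) t /\ rcontinuous (fun t => strip_kernel (z - (t, y'))) t.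
Proof.
  intros H N.
  destruct (cderive_strip_kernel z (t, y')) as [l2 D2].
  { apply ee_ne1. unfold z. rewrite pt_minus. unfold Im; simpl. lra. }
  pose proof (Cderiv_cderive g (t, y') Hg H) as D1.
  split.
  - apply (rcontinuous_h (fun s => g s * strip_kernel (z - s))). eapply ccontinuous_cderive. apply cderive_mult; eassumption.
  - apply (rcontinuous_h (fun s => strip_kernel (z - s))). eapply ccontinuous_cderive. eassumption.
Qed.

Local Lemma gK_periodic y' : (0 < y')%R -> periodic_on (fun s => g s * strip_kernel (z - s)) y' /\ periodic_on (fun s => strip_kernel (z - s)) y'.
Proof.
  intros H.
  assert (E : periodic_on (fun s => strip_kernel (z - s)) y').
  { intros t. rewrite pt_shift. unfold strip_kernel.
    replace (ee (z - ((t, y') + 1))) with (ee (z - (t, y'))); [reflexivity|].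
    rewrite <- (ee_minus_1 (z - (t, y'))). f_equal. ring. }
  split; [|exact E]. intros t. rewrite (E t). f_equal. rewrite pt_shift. now apply Hp.
Qed.

Local Lemma I_phi y' : (0 < y')%R -> y' <> y ->
  CInt (fun t => phi (t, y')) (x - 1/2) (x - 1/2 + 1) =
   CInt (fun t => g (t, y') * strip_kernel (z - (t, y'))) 0 1 - g z * CInt (fun t => strip_kernel (z - (t, y'))) 0 1.
Proof.
  intros H N.
  assert (A : (x - 1/2 <= x - 1/2 + 1)%R) by lra.
  rewrite <- (CInt_shift (fun t => g (t, y') * strip_kernel (z - (t, y'))) (x - 1/2)).
  - rewrite <- (CInt_shift (fun t => strip_kernel (z - (t, y'))) (x - 1/2)).
    + apply is_CInt_unique.
      pose proof (is_CInt_cont (fun t => g (t, y') * strip_kernel (z - (t, y'))) _ _ A (fun t _ => proj1 (gK_rcontinuous y' t H N))) as I1.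
      pose proof (is_CInt_cont (fun t => strip_kernel (z - (t, y'))) _ _ A (fun t _ => proj2 (gK_rcontinuous y' t H N))) as I2.
      pose proof (is_CInt_minus _ _ _ _ _ _ I1 (is_CInt_scal (g z) _ _ _ _ I2)) as I3.
      refine (is_CInt_ext _ _ _ _ _ A _ I3).
      intros t _. simpl. unfold phi. destruct (excluded_middle_informative _) as [E|_]; [|ring].
      exfalso. revert E. apply ee_ne1. unfold z. rewrite pt_minus. unfold Im; simpl. lra.
    + intros t. exact (proj2 (gK_rcontinuous y' t H N)).
    + intros t. apply (gK_periodic y' H).
  - intros t. exact (proj1 (gK_rcontinuous y' t H N)).
  - intros t. apply (gK_periodic y' H).
Qed.

(** Compares the level [c] below z with the level [Y] above it. As Y grows both integrals on the
    right tend to 0 for the functions considered later, and g(z) is isolated on the left. *)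
Lemma strip_cauchy_aux :
  CInt (fun t => g (t, c) * strip_kernel (z - (t, c))) 0 1 - g z * CInt (fun t => strip_kernel (z - (t, c))) 0 1
  = CInt (fun t => g (t, Y) * strip_kernel (z - (t, Y))) 0 1 - g z * CInt (fun t => strip_kernel (z - (t, Y))) 0 1.
Proof.
  rewrite <- !I_phi by lra.
  apply (periodic_int_const phi (x - 1/2) c Y); try lra; try (apply phi_periodic; lra).
  - intros y' Hy'. apply phi_periodic. lra.
  - exact rect_int_phi.
Qed.
End StripCauchy.

(** * Power series in the unit disc *)

Definition is_cseries (u : nat -> C) (l : C) : Prop := forall eps : R, (0 < eps)%R ->
  exists N, forall n, (N <= n)%nat -> (Cmod (csum n u - l) < eps)%R.

Lemma csum_ext n u v : (forall i, (i < n)%nat -> u i = v i) -> csum n u = csum n v.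
Proof. intros H. induction n as [|n IH]; simpl; [easy|]. rewrite IH, H; auto. Qed.

Lemma csum_plus n u v : csum n (fun i => u i + v i) = csum n u + csum n v.
Proof. induction n as [|n IH]; simpl; [ring|]. rewrite IH. ring. Qed.

Lemma csum_scal n c u : csum n (fun i => c * u i) = c * csum n u.
Proof. induction n as [|n IH]; simpl; [ring|]. rewrite IH. ring. Qed.

Lemma csum_minus n u v : csum n (fun i => u i - v i) = csum n u - csum n v.
Proof. induction n as [|n IH]; simpl; [ring|]. rewrite IH. ring. Qed.

Lemma csum_0 n (u : nat -> C) : (forall i, (i < n)%nat -> u i = 0) -> csum n u = 0.
Proof. intros H. induction n as [|n IH]; simpl; [easy|]. rewrite IH, H by auto. ring. Qed.

Lemma csum_split n m u : csum (n + m) u = csum n u + csum m (fun i => u (n + i)%nat).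
Proof.
  induction m as [|m IH]; [rewrite Nat.add_0_r; simpl; ring|].
  rewrite Nat.add_succ_r. simpl. rewrite IH. ring.
Qed.

Lemma csum_swap n m (u : nat -> nat -> C) :
  csum n (fun i => csum m (fun j => u i j)) = csum m (fun j => csum n (fun i => u i j)).
Proof.
  induction n as [|n IH]; simpl.
  - symmetry. apply csum_0. auto.
  - rewrite IH, <- csum_plus. reflexivity.
Qed.

Lemma csum_single n k (u : nat -> C) : (k < n)%nat -> (forall i, (i < n)%nat -> i <> k -> u i = 0) -> csum n u = u k.
Proof.
  intros Hk H. induction n as [|n IH]; [lia|]. simpl.
  destruct (Nat.eq_dec n k) as [->|N].
  - rewrite csum_0; [ring|]. intros i Hi. apply H; lia.
  - rewrite IH, (H n); [ring|lia|lia|lia|]. intros; apply H; lia.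
Qed.

Lemma is_cseries_unique u l l' : is_cseries u l -> is_cseries u l' -> l = l'.
Proof.
  intros H H'. apply Ceq_minus, Cmod_eq_0, Rle_antisym; [|apply Cmod_ge_0].
  apply le_epsilon. intros eps He. rewrite Rplus_0_l.
  destruct (H (eps/2)%R ltac:(lra)) as [N HN]. destruct (H' (eps/2)%R ltac:(lra)) as [N' HN'].
  specialize (HN (N + N')%nat ltac:(lia)). specialize (HN' (N + N')%nat ltac:(lia)).
  set (s := csum (N + N') u) in *.
  replace (l - l') with (- (s - l) + (s - l')) by ring.
  eapply Rle_trans; [apply Cmod_triangle|]. rewrite Cmod_opp. lra.
Qed.

Lemma is_cseries_ext u v l : (forall n, u n = v n) -> is_cseries u l -> is_cseries v l.
Proof.
  intros E H eps He. destruct (H eps He) as [N HN]. exists N. intros n Hn.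
  rewrite <- (csum_ext n u v); auto.
Qed.

Lemma is_cseries_plus u v l k : is_cseries u l -> is_cseries v k -> is_cseries (fun n => u n + v n) (l + k).
Proof.
  intros H H' eps He.
  destruct (H (eps/2)%R ltac:(lra)) as [N HN]. destruct (H' (eps/2)%R ltac:(lra)) as [N' HN'].
  exists (N + N')%nat. intros n Hn. rewrite csum_plus.
  specialize (HN n ltac:(lia)). specialize (HN' n ltac:(lia)).
  replace (csum n u + csum n v - (l + k)) with ((csum n u - l) + (csum n v - k)) by ring.
  eapply Rle_lt_trans; [apply Cmod_triangle|]. lra.
Qed.

Lemma is_cseries_scal c u l : is_cseries u l -> is_cseries (fun n => c * u n) (c * l).
Proof.
  intros H eps He. pose proof (Cmod_ge_0 c).
  destruct (H (eps / (Cmod c + 1))%R) as [N HN]; [apply Rdiv_lt_0_compat; lra|].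
  exists N. intros n Hn. rewrite csum_scal. specialize (HN n Hn).
  replace (c * csum n u - c * l) with (c * (csum n u - l)) by ring. rewrite Cmod_mult.
  apply Rle_lt_trans with (Cmod c * (eps / (Cmod c + 1)))%R; [apply Rmult_le_compat_l; lra|].
  replace eps with ((Cmod c + 1) * (eps / (Cmod c + 1)))%R at 2 by (field; lra).
  apply Rmult_lt_compat_r; [apply Rdiv_lt_0_compat; lra|lra].
Qed.

Lemma is_cseries_bound u l M : is_cseries u l -> (forall n, (Cmod (csum n u) <= M)%R) -> (Cmod l <= M)%R.
Proof.
  intros H HM. apply le_epsilon. intros eps He. destruct (H eps He) as [N HN].
  specialize (HN N (le_n _)). pose proof (Cmod_tri3 l (csum N u)).
  rewrite Cmod_minus_sym in HN. specialize (HM N). lra.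
Qed.

Lemma sum_n_csum (u : nat -> C) n : sum_n (G := C_R_CompleteNormedModule) u n = csum (S n) u.
Proof.
  induction n as [|n IH].
  - rewrite sum_O. simpl. ring.
  - rewrite sum_Sn, IH. reflexivity.
Qed.

Lemma geo_sum_le (r : R) n : (0 <= r < 1)%R -> (sum_n (fun k => r ^ k) n <= / (1 - r))%R.
Proof.
  intros Hr.
  assert (E : (sum_n (fun k => r ^ k) n * (1 - r) = 1 - r ^ (S n))%R).
  { induction n as [|n IH].
    - rewrite sum_O. simpl. ring.
    - rewrite sum_Sn. unfold plus; simpl. rewrite Rmult_plus_distr_r, IH. simpl. ring. }
  apply Rmult_le_reg_r with (1 - r)%R; [lra|]. rewrite E, Rinv_l by lra.
  pose proof (pow_le r (S n) ltac:(lra)). lra.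
Qed.

Lemma csum_geo_bound u B r n : (0 <= r < 1)%R -> (forall k, (Cmod (u k) <= B * r ^ k)%R) ->
  (Cmod (csum n u) <= B * / (1 - r))%R.
Proof.
  intros Hr H.
  assert (HB : (0 <= B)%R).
  { specialize (H 0%nat). simpl in H. pose proof (Cmod_ge_0 (u 0%nat)). lra. }
  destruct n as [|n].
  - simpl. rewrite Cmod_0. apply Rmult_le_pos; [easy|]. left. apply Rinv_0_lt_compat. lra.
  - apply Rle_trans with (B * sum_n (fun k => r ^ k) n)%R.
    + induction n as [|n IH].
      * rewrite sum_O. simpl. rewrite Cplus_0_l. specialize (H 0%nat). simpl in H. exact H.
      * change (csum (S (S n)) u) with (csum (S n) u + u (S n)).
        rewrite sum_Sn. unfold plus; simpl plus. rewrite Rmult_plus_distr_l.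
        eapply Rle_trans; [apply Cmod_triangle|]. apply Rplus_le_compat; [exact IH|apply H].
    + apply Rmult_le_compat_l; [easy|]. now apply geo_sum_le.
Qed.

Lemma is_cseries_geo_ex u B r : (0 <= r < 1)%R -> (forall k, (Cmod (u k) <= B * r ^ k)%R) -> exists l, is_cseries u l.
Proof.
  intros Hr H.
  destruct (ex_series_le (K := R_AbsRing) (V := C_R_CompleteNormedModule) u (fun k => B * r ^ k)%R) as [l Hl].
  - intros n. rewrite <- Cmod_norm. apply H.
  - exists (scal B (/ (1 - r))%R). apply (is_series_scal (K := R_AbsRing) (V := R_NormedModule) B (fun k => r ^ k)%R).
    apply is_series_geom. rewrite Rabs_pos_eq; lra.
  - exists l. intros eps He.
    assert (He2 : (0 < eps / sqrt 2)%R) by (apply Rdiv_lt_0_compat; [easy|apply sqrt_lt_R0; lra]).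
    destruct (proj1 (filterlim_locally _ _) Hl (mkposreal _ He2)) as [N HN].
    exists (S N). intros n Hn. destruct n as [|n]; [lia|].
    specialize (HN n ltac:(lia)). rewrite sum_n_csum in HN.
    pose proof (C_NormedModule_mixin_compat2 _ _ _ HN) as Q. simpl pos in Q.
    replace eps with (sqrt 2 * (eps / sqrt 2))%R; [exact Q|].
    field. apply Rgt_not_eq, sqrt_lt_R0; lra.
Qed.

(** Radius of convergence at least 1, in the form of bounds on the coefficients. *)
Definition disc_coefs (a : nat -> C) : Prop := forall r, (0 < r < 1)%R ->
  exists B, forall n, (Cmod (a n) * r ^ n <= B)%R.

Definition pser (a : nat -> C) (w : C) : C :=
  epsilon (inhabits (RtoC 0)) (fun l => is_cseries (fun n => a n * w ^ n) l).

Lemma pow_mono_le r s n : (0 <= r <= s)%R -> (r ^ n <= s ^ n)%R.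
Proof. intros H. apply pow_incr. exact H. Qed.

(** Boundedness at the larger radius s = (1 + r)/2 gives geometric decay at r with ratio r/s. *)
Lemma disc_coefs_geo a r : disc_coefs a -> (0 <= r < 1)%R -> exists B q, (0 <= q < 1)%R /\ (0 <= B)%R /\
  forall n, (Cmod (a n) * r ^ n <= B * q ^ n)%R.
Proof.
  intros Ha Hr. set (s := ((1 + r) / 2)%R).
  destruct (Ha s) as [B HB]; [unfold s; lra|].
  exists B, (r / s)%R.
  assert (Hs : (0 < s)%R) by (unfold s; lra).
  split; [|split].
  - split; [apply Rdiv_le_0_compat; lra|]. apply Rmult_lt_reg_r with s; [easy|].
    unfold Rdiv. rewrite Rmult_assoc, Rinv_l by lra. unfold s. lra.
  - specialize (HB 0%nat). simpl in HB. pose proof (Cmod_ge_0 (a 0%nat)). lra.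
  - intros n. replace (r ^ n)%R with (s ^ n * (r / s) ^ n)%R
      by (rewrite <- Rpow_mult_distr; f_equal; field; lra).
    rewrite <- Rmult_assoc. apply Rmult_le_compat_r; [|apply HB].
    apply pow_le, Rdiv_le_0_compat; lra.
Qed.

Lemma pser_is_cseries a w : disc_coefs a -> (Cmod w < 1)%R -> is_cseries (fun n => a n * w ^ n) (pser a w).
Proof.
  intros Ha Hw. unfold pser. apply epsilon_spec.
  destruct (disc_coefs_geo a (Cmod w) Ha (conj (Cmod_ge_0 w) Hw)) as [B [q [Hq [_ H]]]].
  apply (is_cseries_geo_ex _ B q Hq). intros k. rewrite Cmod_mult, Cmod_pow. apply H.
Qed.

Lemma pser_eq a w l : is_cseries (fun n => a n * w ^ n) l -> pser a w = l.
Proof.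
  intros H. apply (is_cseries_unique (fun n => a n * w ^ n)); [|exact H].
  unfold pser. apply epsilon_spec. now exists l.
Qed.

Lemma pser_bound a r : disc_coefs a -> (0 <= r < 1)%R -> exists B, forall w, (Cmod w <= r)%R -> (Cmod (pser a w) <= B)%R.
Proof.
  intros Ha Hr. destruct (disc_coefs_geo a r Ha Hr) as [B [q [Hq [PB H]]]].
  exists (B * / (1 - q))%R. intros w Hw.
  eapply is_cseries_bound; [apply pser_is_cseries; [exact Ha|lra]|].
  intros n. apply csum_geo_bound; [exact Hq|]. intros k. rewrite Cmod_mult, Cmod_pow.
  eapply Rle_trans; [|apply H]. apply Rmult_le_compat_l; [apply Cmod_ge_0|].
  apply pow_mono_le. split; [apply Cmod_ge_0|exact Hw].
Qed.

(** Bernoulli's inequality for (1 + x)^n with 1 + x = 1/q. *)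
Lemma n_pow_bound q : (0 < q < 1)%R -> exists B, (0 < B)%R /\ forall n, (INR n * q ^ n <= B)%R.
Proof.
  intros Hq. set (x := (/ q - 1)%R).
  assert (Hx : (0 < x)%R).
  { unfold x. rewrite <- Rinv_1 at 1. assert (/ 1 < / q)%R by (apply Rinv_lt_contravar; lra). lra. }
  exists (/ x)%R. split; [now apply Rinv_0_lt_compat|]. intros n.
  pose proof (poly n x Hx) as P.
  replace (1 + x)%R with (/ q)%R in P by (unfold x; ring).
  rewrite pow_inv in P.
  assert (Q : (0 < q ^ n)%R) by (apply pow_lt; lra).
  apply Rmult_le_reg_r with (x * / q ^ n)%R.
  - apply Rmult_lt_0_compat; [easy|now apply Rinv_0_lt_compat].
  - replace (INR n * q ^ n * (x * / q ^ n))%R with (INR n * x)%R by (field; lra).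
    replace (/ x * (x * / q ^ n))%R with (/ q ^ n)%R by (field; lra). lra.
Qed.

Lemma disc_coefs_mul_n a : disc_coefs a -> disc_coefs (fun n => RtoC (INR n) * a n).
Proof.
  intros Ha r Hr. set (s := ((1 + r) / 2)%R).
  assert (Hs : (0 < s < 1)%R) by (unfold s; lra).
  destruct (Ha s Hs) as [B HB].
  assert (Hq : (0 < r / s < 1)%R).
  { split; [apply Rdiv_lt_0_compat; lra|]. apply Rmult_lt_reg_r with s; [easy|].
    unfold Rdiv. rewrite Rmult_assoc, Rinv_l by lra. unfold s. lra. }
  destruct (n_pow_bound _ Hq) as [B' [PB' HB']].
  exists (B * B')%R. intros n. rewrite Cmod_mult, Cmod_R, Rabs_pos_eq by apply pos_INR.
  replace (r ^ n)%R with (s ^ n * (r / s) ^ n)%R by (rewrite <- Rpow_mult_distr; f_equal; field; lra).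
  replace (INR n * Cmod (a n) * (s ^ n * (r / s) ^ n))%R
    with ((Cmod (a n) * s ^ n) * (INR n * (r / s) ^ n))%R by ring.
  apply Rmult_le_compat; [| |apply HB|apply HB'].
  - apply Rmult_le_pos; [apply Cmod_ge_0|apply pow_le; lra].
  - apply Rmult_le_pos; [apply pos_INR|apply pow_le; lra].
Qed.

Lemma disc_coefs_scal c a : disc_coefs a -> disc_coefs (fun n => c * a n).
Proof.
  intros Ha r Hr. destruct (Ha r Hr) as [B HB]. exists (Cmod c * B)%R. intros n.
  rewrite Cmod_mult, Rmult_assoc. apply Rmult_le_compat_l; [apply Cmod_ge_0|apply HB].
Qed.

(** The second order Taylor bound for w^n, by induction on n. The factor r^2 on the left and the
    form n w^n / w of the derivative avoid the truncated exponents n - 1 and n - 2. *)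
Lemma pow_diff2 (w h : C) (r : R) n : (0 < r)%R -> w <> 0 -> (Cmod w <= r)%R -> (Cmod (w + h) <= r)%R ->
  (r * r * Cmod ((w + h) ^ n - w ^ n - h * / w * (RtoC (INR n) * w ^ n)) <= Cmod h * Cmod h * (INR n * INR n * r ^ n))%R.
Proof.
  intros Hr Hw H1 H2.
  pose proof (Cmod_ge_0 h) as Ph.
  induction n as [|n IH].
  - simpl. replace (1 - 1 - h * / w * (0 * 1)) with (RtoC 0) by ring. rewrite Cmod_0. lra.
  - set (E := (w + h) ^ n - w ^ n - h * / w * (RtoC (INR n) * w ^ n)) in *.
    assert (Q : (w + h) ^ S n - w ^ S n - h * / w * (RtoC (INR (S n)) * w ^ S n)
      = (w + h) * E + h * h * (RtoC (INR n) * (w ^ n * / w))).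
    { unfold E. rewrite S_INR, RtoC_plus, !Cpow_S. field. exact Hw. }
    rewrite Q.
    assert (W : (r * r * Cmod (RtoC (INR n) * (w ^ n * / w)) <= INR n * r ^ S n)%R).
    { destruct n as [|m].
      - simpl. rewrite Cmult_0_l, Cmod_0. lra.
      - replace (w ^ S m * / w) with (w ^ m) by (simpl; field; exact Hw).
        rewrite Cmod_mult, Cmod_R, Rabs_pos_eq, Cmod_pow by apply pos_INR.
        replace (r * r * (INR (S m) * Cmod w ^ m))%R with (INR (S m) * (r * r * Cmod w ^ m))%R by ring.
        apply Rmult_le_compat_l; [apply pos_INR|].
        replace (r ^ S (S m))%R with (r * r * r ^ m)%R by (simpl; ring).
        apply Rmult_le_compat_l; [nra|]. apply pow_mono_le. split; [apply Cmod_ge_0|easy]. }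
    apply Rle_trans with (r * r * (r * Cmod E + Cmod h * Cmod h * Cmod (RtoC (INR n) * (w ^ n * / w))))%R.
    { apply Rmult_le_compat_l; [nra|]. eapply Rle_trans; [apply Cmod_triangle|]. rewrite !Cmod_mult.
      apply Rplus_le_compat_r. apply Rmult_le_compat_r; [apply Cmod_ge_0|easy]. }
    replace (r * r * (r * Cmod E + Cmod h * Cmod h * Cmod (INR n * (w ^ n * / w))))%R with
      (r * (r * r * Cmod E) + Cmod h * Cmod h * (r * r * Cmod (INR n * (w ^ n * / w))))%R by ring.
    apply Rle_trans with (r * (Cmod h * Cmod h * (INR n * INR n * r ^ n)) + Cmod h * Cmod h * (INR n * r ^ S n))%R.
    { apply Rplus_le_compat; apply Rmult_le_compat_l; try easy; [lra|nra]. }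
    rewrite S_INR. replace (r ^ S n)%R with (r * r ^ n)%R by (simpl; ring).
    pose proof (pos_INR n) as Pn. pose proof (pow_le r n ltac:(lra)) as Pr.
    assert (0 <= Cmod h * Cmod h * (r * r ^ n))%R by (repeat apply Rmult_le_pos; lra).
    replace (r * (Cmod h * Cmod h * (INR n * INR n * r ^ n)) + Cmod h * Cmod h * (INR n * (r * r ^ n)))%R
      with ((INR n * INR n + INR n) * (Cmod h * Cmod h * (r * r ^ n)))%R by ring.
    replace (Cmod h * Cmod h * ((INR n + 1) * (INR n + 1) * (r * r ^ n)))%R
      with ((INR n + 1) * (INR n + 1) * (Cmod h * Cmod h * (r * r ^ n)))%R by ring.
    apply Rmult_le_compat_r; [easy|]. nra.
Qed.

(** Termwise use of [pow_diff2] leaves a remainder quadratic in h. The form with 1/w is convenient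
    because w will be e(z), which never vanishes, and the chain rule then cancels 1/w. *)
Lemma cderive_pser a (w : C) : disc_coefs a -> w <> 0 -> (Cmod w < 1)%R ->
  cderive (pser a) w (/ w * pser (fun n => RtoC (INR n) * a n) w).
Proof.
  intros Ha Hw0 Hw. set (r := ((1 + Cmod w) / 2)%R).
  pose proof (Cmod_ge_0 w) as Pw.
  assert (Hr : (0 < r < 1)%R) by (unfold r; lra).
  destruct (disc_coefs_geo _ r (disc_coefs_mul_n _ (disc_coefs_mul_n a Ha)) ltac:(lra)) as [B [q [Hq [PB HB]]]].
  set (S := (B * / (1 - q))%R).
  assert (HS : (0 <= S)%R).
  { apply Rmult_le_pos; [easy|]. left. apply Rinv_0_lt_compat. lra. }
  apply cderive_eps. intros eps He.
  assert (He' : (0 < eps * (r * r) / (S + 1))%R) by (apply Rdiv_lt_0_compat; [|lra]; repeat apply Rmult_lt_0_compat; lra).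
  exists (Rmin ((1 - Cmod w) / 2) (eps * (r * r) / (S + 1))). split; [apply Rmin_glb_lt; lra|].
  intros w' Hw'. set (h := w' - w) in *.
  assert (H1 : (Cmod h < (1 - Cmod w) / 2)%R) by (eapply Rlt_le_trans; [exact Hw'|apply Rmin_l]).
  assert (H2 : (Cmod h < eps * (r * r) / (S + 1))%R) by (eapply Rlt_le_trans; [exact Hw'|apply Rmin_r]).
  assert (Ew : w' = w + h) by (unfold h; ring).
  assert (Hwh : (Cmod (w + h) <= r)%R).
  { eapply Rle_trans; [apply Cmod_triangle|]. unfold r. lra. }
  rewrite Ew.
  pose proof (pser_is_cseries a (w + h) Ha ltac:(lra)) as C1.
  pose proof (pser_is_cseries a w Ha Hw) as C2.
  pose proof (pser_is_cseries _ w (disc_coefs_mul_n a Ha) Hw) as C3.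
  pose proof (is_cseries_plus _ _ _ _ C1 (is_cseries_plus _ _ _ _ (is_cseries_scal (-1) _ _ C2) (is_cseries_scal (- (h * / w)) _ _ C3))) as C4.
  cbv beta in C4.
  assert (Bd : (Cmod (pser a (w + h) - pser a w - / w * pser (fun n => RtoC (INR n) * a n)%C w * h) <=
     Cmod h * Cmod h / (r * r) * S)%R).
  { replace (pser a (w + h) - pser a w - / w * pser (fun n => RtoC (INR n) * a n) w * h)
      with (pser a (w + h) + (-1 * pser a w + - (h * / w) * pser (fun n : nat => INR n * a n) w)) by ring.
    eapply is_cseries_bound; [exact C4|]. intros n. unfold S. rewrite <- Rmult_assoc.
    apply csum_geo_bound; [exact Hq|]. intros k.
    replace (a k * (w + h) ^ k + (-1 * (a k * w ^ k) + - (h * / w) * (INR k * a k * w ^ k)))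
      with (a k * ((w + h) ^ k - w ^ k - h * / w * (RtoC (INR k) * w ^ k))) by ring.
    rewrite Cmod_mult.
    pose proof (pow_diff2 w h r k (proj1 Hr) Hw0 ltac:(unfold r; lra) Hwh) as D.
    specialize (HB k). rewrite !Cmod_mult, !Cmod_R, !Rabs_pos_eq in HB by apply pos_INR.
    set (E := Cmod ((w + h) ^ k - w ^ k - h * / w * (RtoC (INR k) * w ^ k))) in *.
    assert (Prr : (0 < r * r)%R) by nra.
    apply Rmult_le_reg_l with (r * r)%R; [exact Prr|].
    replace (r * r * (Cmod h * Cmod h / (r * r) * B * q ^ k))%R with (Cmod h * Cmod h * (B * q ^ k))%R by (field; lra).
    replace (r * r * (Cmod (a k) * E))%R with (Cmod (a k) * (r * r * E))%R by ring.
    eapply Rle_trans; [apply Rmult_le_compat_l; [apply Cmod_ge_0|exact D]|].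
    replace (Cmod (a k) * (Cmod h * Cmod h * (INR k * INR k * r ^ k)))%R
      with (Cmod h * Cmod h * (INR k * (INR k * Cmod (a k)) * r ^ k))%R by ring.
    apply Rmult_le_compat_l; [|exact HB]. pose proof (Cmod_ge_0 h). nra. }
  eapply Rle_trans; [exact Bd|].
  pose proof (Cmod_ge_0 h) as Ph.
  replace (Cmod h * Cmod h / (r * r) * S)%R with (Cmod h * S / (r * r) * Cmod h)%R by (field; lra).
  apply Rmult_le_compat_r; [easy|].
  apply Rmult_le_reg_r with (r * r)%R; [nra|].
  replace (Cmod h * S / (r * r) * (r * r))%R with (Cmod h * S)%R by (field; lra).
  apply Rle_trans with (Cmod h * (S + 1))%R; [apply Rmult_le_compat_l; lra|].
  apply Rle_trans with (eps * (r * r) / (S + 1) * (S + 1))%R; [apply Rmult_le_compat_r; lra|].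
  right. field. lra.
Qed.

Lemma ee_lt1 z : UH z -> (Cmod (ee z) < 1)%R.
Proof.
  intros H. rewrite Cmod_ee, <- exp_0. apply exp_increasing. unfold UH in H. pose proof PI_RGT_0. nra.
Qed.

Lemma cderive_pser_ee a z : disc_coefs a -> UH z ->
  cderive (fun z => pser a (ee z)) z (tau * pser (fun n => RtoC (INR n) * a n) (ee z)).
Proof.
  intros Ha Hz. pose proof (ee_neq0 z).
  eapply cderive_eq; [apply (cderive_comp (pser a)); [apply cderive_pser; [exact Ha|easy|now apply ee_lt1]|apply cderive_ee]|].
  field. easy.
Qed.

Lemma rcontinuous_bounded (f : R -> C) a b : (a <= b)%R -> (forall t, (a <= t <= b)%R -> rcontinuous f t) ->
  exists M, (0 <= M)%R /\ forall t, (a <= t <= b)%R -> (Cmod (f t) <= M)%R.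
Proof.
  intros Hab H.
  destruct (continuity_ab_maj (fun t => Cmod (f t)) a b Hab) as [m [Hm _]].
  - intros t Ht eps He. destruct (rcontinuous_eps_inv f t (H t Ht) eps He) as [d [Hd K]].
    exists d. split; [exact Hd|]. intros s [_ Hs]. simpl in *. unfold Rdist in *.
    eapply Rle_lt_trans; [|exact (K s Hs)].
    apply Rabs_le. pose proof (Cmod_tri3 (f s) (f t)). pose proof (Cmod_tri3 (f t) (f s)) as T.
    rewrite Cmod_minus_sym in T. lra.
  - exists (Cmod (f m)). split; [apply Cmod_ge_0|exact Hm].
Qed.

(** * Expansions at the cusp *)

Definition periodic (g : C -> C) : Prop := forall z, UH z -> g (z + 1) = g z.

(** In terms of q this is g = o(1/|q|), the growth that excludes a pole at q = 0. It is weak enough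
    to hold for moderate growth divided by e(l z) with l < 1. *)
Definition below_pole (g : C -> C) : Prop := forall eps : R, (0 < eps)%R -> exists Y0, forall z, UH z ->
  (Y0 < Im z)%R -> (Cmod (g z) <= eps * exp (2 * PI * Im z))%R.

Definition fourier_coef (g : C -> C) (c : R) (n : nat) : C :=
  CInt (fun t => g (t, c) * ee (- RtoC (INR n) * (t, c))) 0 1.

Lemma holo_cont_h g c t : holo g -> (0 < c)%R -> rcontinuous (fun t => g (t, c)) t.
Proof. intros Hg Hc. apply rcontinuous_h. eapply ccontinuous_cderive, Cderiv_cderive; [exact Hg|exact Hc]. Qed.

Lemma holo_mult f g : holo f -> holo g -> holo (fun z => f z * g z).
Proof. intros Hf Hg. apply holo_cderive. intros z Hz. eexists. apply cderive_mult; apply Cderiv_cderive; assumption. Qed.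

Lemma holo_ee_scal l : holo (fun z => ee (l * z)).
Proof. apply holo_cderive. intros z _. eexists. apply cderive_ee_scal. Qed.

Lemma holo_const (c : C) : holo (fun _ => c).
Proof. apply holo_cderive. intros z _. eexists. apply cderive_const. Qed.

Lemma ee_nat_periodic n z : ee (- RtoC (INR n) * (z + 1)) = ee (- RtoC (INR n) * z).
Proof.
  replace (- RtoC (INR n) * (z + 1)) with (- RtoC (INR n) * z + - RtoC (INR n)) by ring.
  rewrite ee_add, (ee_opp (RtoC (INR n))), ee_INR. field.
Qed.

Lemma fourier_coef_const_le g n c d : holo g -> periodic g -> (0 < c)%R -> (c <= d)%R -> fourier_coef g c n = fourier_coef g d n.
Proof.
  intros Hg Hp Hc Hd. unfold fourier_coef.
  set (f := fun s => g s * ee (- RtoC (INR n) * s)).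
  assert (P : forall y, (c <= y <= d)%R -> periodic_on f y).
  { intros y Hy x. unfold f. rewrite pt_shift, ee_nat_periodic. f_equal. apply Hp. unfold UH, Im; simpl. lra. }
  replace 1%R with (0 + 1)%R by ring.
  apply (periodic_int_const f 0 c d Hd).
  - apply P. lra.
  - apply P. lra.
  - exact P.
  - apply rect_int_0; try lra. intros x y _ Hy. eexists.
    apply Cderiv_cderive; [apply holo_mult; [exact Hg|apply holo_ee_scal]|unfold UH, Im; simpl; lra].
Qed.

Lemma fourier_coef_const g n c d : holo g -> periodic g -> (0 < c)%R -> (0 < d)%R -> fourier_coef g c n = fourier_coef g d n.
Proof.
  intros Hg Hp Hc Hd. destruct (Rle_dec c d) as [L|L].
  - now apply fourier_coef_const_le.
  - symmetry. apply fourier_coef_const_le; auto. lra.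
Qed.

Lemma exp_INR x n : exp (INR n * x) = (exp x ^ n)%R.
Proof.
  induction n as [|n IH]; [simpl; rewrite Rmult_0_l; apply exp_0|].
  rewrite S_INR, Rmult_plus_distr_r, exp_plus, IH, Rmult_1_l. simpl. ring.
Qed.

Lemma fourier_coef_bound g c n M : holo g -> (0 < c)%R -> (forall t, (0 <= t <= 1)%R -> (Cmod (g (t, c)) <= M)%R) ->
  (Cmod (fourier_coef g c n) <= M * exp (2 * PI * c) ^ n)%R.
Proof.
  intros Hg Hc HM.
  replace (M * exp (2 * PI * c) ^ n)%R with ((1 - 0) * (M * exp (2 * PI * c) ^ n))%R by ring.
  unfold fourier_coef. eapply is_CInt_bound; [lra|apply is_CInt_cont; [lra|]|].
  - intros t _. apply (holo_cont_h (fun s => g s * ee (- RtoC (INR n) * s))); [|exact Hc].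
    apply holo_mult; [exact Hg|apply holo_ee_scal].
  - intros t Ht. cbv beta. rewrite Cmod_mult, Cmod_ee.
    replace (- (2 * PI) * Im (- RtoC (INR n) * (t, c)))%R with (INR n * (2 * PI * c))%R
      by (unfold Im; simpl; ring).
    rewrite exp_INR. apply Rmult_le_compat_r; [apply pow_le; left; apply exp_pos|now apply HM].
Qed.

Section Geo.
Variables (g : C -> C) (c : R) (z : C).
Hypothesis Hg : holo g.
Hypothesis Hc : (0 < c)%R.
Hypothesis Hz : (c < Im z)%R.

(** The remainder of the geometric expansion of the kernel after N terms, integrated against g; it
    is O(rho^N) with rho = e^(-2 pi (Im z - c)) < 1. *)
Let IN (N : nat) : C := CInt (fun t => g (t, c) * (ee (RtoC (INR N) * (z - (t, c))) * strip_kernel (z - (t, c)))) 0 1.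

Local Lemma IN_rcontinuous N t : rcontinuous (fun t => g (t, c) * (ee (RtoC (INR N) * (z - (t, c))) * strip_kernel (z - (t, c)))) t.
Proof.
  apply (rcontinuous_h (fun s => g s * (ee (RtoC (INR N) * (z - s)) * strip_kernel (z - s)))).
  destruct (cderive_strip_kernel z (t, c)) as [l Hl].
  { apply ee_ne1. unfold Im in *; simpl. lra. }
  eapply ccontinuous_cderive. apply cderive_mult; [apply Cderiv_cderive; [exact Hg|exact Hc]|].
  apply (cderive_mult (fun s => ee (RtoC (INR N) * (z - s)))); [|exact Hl].
  apply (cderive_comp ee (fun s => RtoC (INR N) * (z - s))); [apply cderive_ee|].
  apply cderive_scal, cderive_minus; [apply cderive_const|apply cderive_id].
Qed.

Local Lemma IN_step N : IN N = fourier_coef g c N * ee z ^ N + IN (S N).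
Proof.
  assert (H01 : (0 <= 1)%R) by lra.
  unfold IN at 1. apply is_CInt_unique.
  assert (I1 : is_CInt (fun t => g (t, c) * ee (- RtoC (INR N) * (t, c))) 0 1 (fourier_coef g c N)).
  { apply is_CInt_cont; [exact H01|]. intros t _.
    apply (holo_cont_h (fun s => g s * ee (- RtoC (INR N) * s))); [|exact Hc].
    apply holo_mult; [exact Hg|apply holo_ee_scal]. }
  pose proof (is_CInt_cont _ _ _ H01 (fun t _ => IN_rcontinuous (S N) t)) as I2.
  pose proof (is_CInt_plus _ _ _ _ _ _ (is_CInt_scal (ee z ^ N) _ _ _ _ I1) I2) as I3.
  rewrite (Cmult_comm (fourier_coef g c N)).
  refine (is_CInt_ext _ _ _ _ _ H01 _ I3).
  intros t _. cbv beta.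
  rewrite <- ee_nat. rewrite S_INR, RtoC_plus.
  replace ((RtoC (INR N) + 1) * (z - (t, c))) with (RtoC (INR N) * (z - (t, c)) + (z - (t, c))) by ring.
  rewrite ee_add.
  replace (RtoC (INR N) * (z - (t, c))) with (RtoC (INR N) * z + - RtoC (INR N) * (t, c)) by ring.
  rewrite ee_add. unfold strip_kernel.
  assert (Nz : 1 - ee (z - (t, c)) <> 0).
  { apply one_minus_neq0, ee_ne1. unfold Im in *; simpl. lra. }
  field. exact Nz.
Qed.

Local Lemma IN_sum N : IN 0 = csum N (fun n => fourier_coef g c n * ee z ^ n) + IN N.
Proof.
  induction N as [|N IH]; [simpl; ring|]. rewrite IH, IN_step. simpl. ring.
Qed.

Lemma geo_expand : is_cseries (fun n => fourier_coef g c n * ee z ^ n) (CInt (fun t => g (t, c) * strip_kernel (z - (t, c))) 0 1).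
Proof.
  assert (E0 : CInt (fun t => g (t, c) * strip_kernel (z - (t, c))) 0 1 = IN 0).
  { unfold IN. apply (RInt_ext (V := CR)). intros t _. simpl INR. rewrite Cmult_0_l, ee_0, Cmult_1_l. reflexivity. }
  rewrite E0.
  set (rho := exp (- (2 * PI) * (Im z - c))).
  pose proof PI_RGT_0 as HPI.
  assert (Hr : (0 < rho < 1)%R).
  { split; [apply exp_pos|]. unfold rho. rewrite <- exp_0. apply exp_increasing. nra. }
  destruct (rcontinuous_bounded (fun t => g (t, c)) 0 1 ltac:(lra)) as [M [PM HM]].
  { intros t _. now apply holo_cont_h. }
  assert (B : forall N, (Cmod (IN N) <= M * / (1 - rho) * rho ^ N)%R).
  { intros N. replace (M * / (1 - rho) * rho ^ N)%R with ((1 - 0) * (M * (rho ^ N * / (1 - rho))))%R by ring.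
    assert (H01 : (0 <= 1)%R) by lra.
    apply (is_CInt_bound _ 0 1 _ _ H01 (is_CInt_cont _ 0 1 H01 (fun t _ => IN_rcontinuous N t))).

    intros t Ht. cbv beta. rewrite !Cmod_mult.
    apply Rmult_le_compat; [apply Cmod_ge_0|apply Rmult_le_pos; apply Cmod_ge_0|now apply HM|].
    assert (Ei : Im (z - (t, c)) = (Im z - c)%R) by reflexivity.
    apply Rmult_le_compat; [apply Cmod_ge_0|apply Cmod_ge_0| |].
    - rewrite ee_nat, Cmod_pow, Cmod_ee, Ei. apply Rle_refl.
    - unfold rho. rewrite <- Ei. apply strip_kernel_upper. rewrite Ei. lra. }
  intros eps He.
  set (A := (M * / (1 - rho))%R) in *.
  assert (PA : (0 <= A)%R) by (apply Rmult_le_pos; [easy|left; apply Rinv_0_lt_compat; lra]).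
  destruct (pow_lt_1_zero rho ltac:(rewrite Rabs_pos_eq; lra) (eps / (A + 1))%R) as [N HN].
  { apply Rdiv_lt_0_compat; lra. }
  exists N. intros n Hn. specialize (HN n Hn). rewrite Rabs_pos_eq in HN by (apply pow_le; lra).
  replace (csum n (fun n => fourier_coef g c n * ee z ^ n) - IN 0) with (- IN n) by (rewrite (IN_sum n); ring).
  rewrite Cmod_opp. eapply Rle_lt_trans; [apply B|].
  apply Rle_lt_trans with (A * (eps / (A + 1)))%R; [apply Rmult_le_compat_l; lra|].
  replace eps with ((A + 1) * (eps / (A + 1)))%R at 2 by (field; lra).
  apply Rmult_lt_compat_r; [apply Rdiv_lt_0_compat; lra|lra].
Qed.
End Geo.

(** At level Y above z the kernel is at most 2 e^(-2 pi (Y - Im z)), once Y exceeds Im z by 1, and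
    this compensates g = o(e^(2 pi Y)). *)
Lemma top_small g z : holo g -> below_pole g -> UH z -> forall eps : R, (0 < eps)%R -> exists Y0, forall Y, (Y0 < Y)%R ->
  (Cmod (CInt (fun t => g (t, Y) * strip_kernel (z - (t, Y)))%C 0 1) <= eps)%R.
Proof.
  intros Hg Hs Hz eps He. pose proof PI_RGT_0 as HPI. unfold UH in Hz.
  set (e := (eps / (2 * exp (2 * PI * Im z)))%R).
  assert (Ep : (0 < exp (2 * PI * Im z))%R) by apply exp_pos.
  assert (Pe : (0 < e)%R) by (apply Rdiv_lt_0_compat; lra).
  destruct (Hs e Pe) as [Y0 H0].
  exists (Rmax Y0 (Im z + 1)). intros Y HY.
  assert (HY0 : (Y0 < Y)%R) by (eapply Rle_lt_trans; [apply Rmax_l|exact HY]).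
  assert (HY1 : (Im z + 1 < Y)%R) by (eapply Rle_lt_trans; [apply Rmax_r|exact HY]).
  replace eps with ((1 - 0) * eps)%R by ring.
  eapply is_CInt_bound; [lra|apply is_CInt_cont; [lra|]|].
  - intros t _. apply (rcontinuous_h (fun s => g s * strip_kernel (z - s))).
    destruct (cderive_strip_kernel z (t, Y)) as [l Hl].
    { apply ee_ne1. unfold Im in *; simpl. lra. }
    eapply ccontinuous_cderive. apply cderive_mult; [apply Cderiv_cderive; [exact Hg|unfold UH, Im; simpl; lra]|exact Hl].
  - intros t Ht. cbv beta. rewrite Cmod_mult.
    assert (Ei : Im (z - (t, Y)) = (Im z - Y)%R) by reflexivity.
    assert (X : (2 <= exp (2 * PI * (Y - Im z)))%R).
    { assert (X1 : (1 + 1 <= exp 1)%R) by apply exp_ineq1_le.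
      assert (X2 : (exp 1 <= exp (2 * PI * (Y - Im z)))%R).
      { left. apply exp_increasing. pose proof PI2_1. unfold PI2 in *. nra. }
      lra. }
    apply Rle_trans with ((e * exp (2 * PI * Y)) * (2 * / exp (2 * PI * (Y - Im z))))%R.
    + apply Rmult_le_compat; try apply Cmod_ge_0.
      * apply (H0 (t, Y)); [unfold UH, Im; simpl; lra|exact HY0].
      * eapply Rle_trans; [apply strip_kernel_lower; rewrite Ei; lra|]. rewrite Ei.
        replace (- (2 * PI) * (Im z - Y))%R with (2 * PI * (Y - Im z))%R by ring.
        set (E := exp (2 * PI * (Y - Im z))) in *.
        apply Rmult_le_reg_r with (E * (E - 1))%R; [nra|].
        replace (/ (E - 1) * (E * (E - 1)))%R with E by (field; lra).
        replace (2 * / E * (E * (E - 1)))%R with (2 * (E - 1))%R by (field; lra). lra.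
    + right. unfold e.
      replace (exp (2 * PI * Y)) with (exp (2 * PI * Im z) * exp (2 * PI * (Y - Im z)))%R
        by (rewrite <- exp_plus; f_equal; ring).
      field. split; lra.
Qed.

Lemma below_pole_const (c : C) : below_pole (fun _ => c).
Proof.
  intros eps He. pose proof PI_RGT_0.
  exists (Cmod c / eps)%R. intros z Hz HY. unfold UH in Hz.
  assert (Cmod c <= eps * Im z)%R.
  { replace (Cmod c) with (eps * (Cmod c / eps))%R by (field; lra). apply Rmult_le_compat_l; lra. }
  eapply Rle_trans; [exact H0|]. apply Rmult_le_compat_l; [lra|].
  pose proof (exp_ineq1_le (2 * PI * Im z)). pose proof PI2_1. unfold PI2 in *. nra.
Qed.

Lemma fourier_coef_one c n : (0 < c)%R -> fourier_coef (fun _ => 1) c n = if Nat.eqb n 0 then 1 else 0.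
Proof.
  intros Hc. destruct n as [|n]; simpl Nat.eqb; cbv iota.
  - pose proof (is_CInt_const 1 0 1) as I.
    replace (RtoC (1 - 0) * 1) with (RtoC 1) in I by (rewrite Rminus_0_r; ring).
    assert (H01 : (0 <= 1)%R) by lra.
    apply (is_CInt_unique (fun t => 1 * ee (- RtoC (INR 0) * (t, c))) 0 1 1).
    refine (is_CInt_ext _ _ 0 1 _ H01 _ I).
    intros t _. simpl INR.
    replace (- RtoC 0 * (t, c)) with (RtoC 0) by ring. rewrite ee_0. ring.
  - unfold fourier_coef. apply is_CInt_unique. set (k := - RtoC (INR (S n))).
    assert (Hk : k <> 0).
    { unfold k. intros E. assert (E' : RtoC (INR (S n)) = 0) by (rewrite <- (Copp_0), <- E; ring).
      apply RtoC_inj in E'. revert E'. apply not_0_INR. lia. }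
    pose proof tau_neq0 as Ht.
    set (F := fun s : C => / (tau * k) * ee (k * s)).
    assert (DF : forall s, cderive F s (1 * ee (k * s))).
    { intros s. eapply cderive_eq; [apply cderive_scal, cderive_ee_scal|]. field. auto. }
    replace (RtoC 0) with (F (1%R, c) - F (0%R, c)).
    + apply (is_CInt_FTC (fun t => F (t, c))); [lra| |].
      * intros t _. apply rderive_h, DF.
      * intros t _. apply (holo_cont_h (fun s => 1 * ee (k * s))); [|exact Hc].
        apply holo_mult; [apply holo_const|apply holo_ee_scal].
    + unfold F, k. replace (1%R, c) with ((0%R, c) + 1); [rewrite ee_nat_periodic; ring|].
      unfold Cplus, RtoC; simpl. f_equal; ring.
Qed.

(** The coefficients are computed at level 1 but do not depend on the level. Levels near 0 give
    convergence in the whole unit disc, and the last clause keeps the Cauchy estimate at every level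
    for use in [cusp_holo_zero]. *)
Theorem qexp g : holo g -> periodic g -> below_pole g ->
  exists a, disc_coefs a /\ (forall z, UH z -> g z = pser a (ee z)) /\
    (forall c M, (0 < c)%R -> (forall t, (0 <= t <= 1)%R -> (Cmod (g (t, c)) <= M)%R) ->
       forall n, (Cmod (a n) <= M * exp (2 * PI * c) ^ n)%R).
Proof.
  intros Hg Hp Hs. exists (fourier_coef g 1).
  assert (Bd : forall c M, (0 < c)%R -> (forall t, (0 <= t <= 1)%R -> (Cmod (g (t, c)) <= M)%R) ->
       forall n, (Cmod (fourier_coef g 1 n) <= M * exp (2 * PI * c) ^ n)%R).
  { intros c M Hc HM n. rewrite (fourier_coef_const g n 1 c) by (auto; lra). now apply fourier_coef_bound. }
  pose proof PI_RGT_0 as HPI.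
  split; [|split; [|exact Bd]].
  (* The level on which |q| = r. *)
  - intros r Hr. set (c := (- ln r / (2 * PI))%R).
    assert (Hl : (ln r < 0)%R) by (rewrite <- ln_1; apply ln_increasing; lra).
    assert (Hc : (0 < c)%R) by (apply Rdiv_lt_0_compat; lra).
    destruct (rcontinuous_bounded (fun t => g (t, c)) 0 1 ltac:(lra)) as [M [PM HM]].
    { intros t _. now apply holo_cont_h. }
    exists M. intros n.
    replace M with (M * exp (2 * PI * c) ^ n * r ^ n)%R.
    + apply Rmult_le_compat_r; [apply pow_le; lra|]. now apply Bd.
    + unfold c. replace (2 * PI * (- ln r / (2 * PI)))%R with (- ln r)%R by (field; lra).
      rewrite exp_Ropp, exp_ln by lra. rewrite pow_inv. field. apply pow_nonzero. lra.
  - intros z Hz. symmetry. apply pser_eq.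
    set (c := (Im z / 2)%R).
    assert (Hc : (0 < c)%R) by (unfold c, UH in *; lra).
    assert (Hcz : (c < Im z)%R) by (unfold c, UH in *; lra).
    assert (E : CInt (fun t => g (t, c) * strip_kernel (z - (t, c))) 0 1 = g z).
    (* The integral of the kernel itself is the expansion of the constant function 1, whose only
       nonzero coefficient is the one of index 0. *)
    { assert (K1 : CInt (fun t => strip_kernel (z - (t, c))) 0 1 = 1).
      { apply (is_cseries_unique (fun n => fourier_coef (fun _ => 1) c n * ee z ^ n)).
        - replace (CInt (fun t => strip_kernel (z - (t, c))) 0 1) with (CInt (fun t => 1 * strip_kernel (z - (t, c))) 0 1).
          + apply (geo_expand (fun _ => 1)); auto. apply holo_const.
          + apply (RInt_ext (V := CR)). intros t _. apply Cmult_1_l.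
        - intros eps He. exists 1%nat. intros n Hn. rewrite (csum_single n 0); [|lia|].
          + rewrite fourier_coef_one by exact Hc. simpl. replace (1 * 1 - 1) with (RtoC 0) by ring. now rewrite Cmod_0.
          + intros i Hi Hi0. rewrite fourier_coef_one by exact Hc. destruct i; [lia|]. simpl. ring. }
      apply Ceq_minus, Cmod_eq_0, Rle_antisym; [|apply Cmod_ge_0].
      apply le_epsilon. intros eps He. rewrite Rplus_0_l.
      pose proof (Cmod_ge_0 (g z)) as Pg.
      destruct (top_small g z Hg Hs Hz (eps/2)%R ltac:(lra)) as [Y1 H1].
      destruct (top_small (fun _ => 1) z (holo_const 1) (below_pole_const 1) Hz (eps / (2 * (Cmod (g z) + 1)))%R) as [Y2 H2].
      { apply Rdiv_lt_0_compat; lra. }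
      set (Y := (Rmax (Im z) (Rmax Y1 Y2) + 1)%R).
      assert (Q1 : (Im z < Y /\ Y1 < Y /\ Y2 < Y)%R).
      { unfold Y. pose proof (Rmax_l (Im z) (Rmax Y1 Y2)). pose proof (Rmax_r (Im z) (Rmax Y1 Y2)).
        pose proof (Rmax_l Y1 Y2). pose proof (Rmax_r Y1 Y2). lra. }
      destruct Q1 as [Q1 [Q2 Q3]].
      pose proof (strip_cauchy_aux g (Re z) (Im z) c Y Hc Hcz Q1 Hg Hp) as SC.
      replace (Re z, Im z) with z in SC by (destruct z; reflexivity).
      rewrite K1 in SC. rewrite Cmult_1_r in SC. rewrite SC.
      specialize (H1 Y Q2). specialize (H2 Y Q3).
      replace (CInt (fun t => 1 * strip_kernel (z - (t, Y))) 0 1) with (CInt (fun t => strip_kernel (z - (t, Y))) 0 1) in H2.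
      2:{ apply (RInt_ext (V := CR)). intros t _. symmetry. apply Cmult_1_l. }
      unfold Cminus at 1. eapply Rle_trans; [apply Cmod_triangle|]. rewrite Cmod_opp, Cmod_mult.
      assert (Cmod (g z) * Cmod (CInt (fun t => strip_kernel (z - (t, Y)))%C 0 1) <= (Cmod (g z) + 1) * (eps / (2 * (Cmod (g z) + 1))))%R.
      { apply Rmult_le_compat; try apply Cmod_ge_0; [lra|exact H2]. }
      replace ((Cmod (g z) + 1) * (eps / (2 * (Cmod (g z) + 1))))%R with (eps / 2)%R in H by (field; lra).
      lra. }
    rewrite <- E. eapply is_cseries_ext; [|apply (geo_expand g c z Hg Hc Hcz)].
    intros n. cbv beta. f_equal. apply fourier_coef_const; auto. lra.
Qed.

Lemma holo_ext f g : (forall z, UH z -> f z = g z) -> holo f -> holo g.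
Proof.
  intros E H. apply holo_cderive. intros z Hz. exists (Cderiv f z).
  apply (cderive_ext_UH f); auto. now apply Cderiv_cderive.
Qed.

Lemma holo_plus f g : holo f -> holo g -> holo (fun z => f z + g z).
Proof. intros Hf Hg. apply holo_cderive. intros z Hz. eexists. apply cderive_plus; apply Cderiv_cderive; assumption. Qed.

Lemma holo_inv f : holo f -> (forall z, UH z -> f z <> 0) -> holo (fun z => / f z).
Proof. intros Hf N. apply holo_cderive. intros z Hz. eexists. apply cderive_inv; [apply Cderiv_cderive; assumption|auto]. Qed.

Lemma Cderiv_ext f g z : (forall w, UH w -> f w = g w) -> holo f -> UH z -> Cderiv f z = Cderiv g z.
Proof.
  intros E H Hz. symmetry. apply Cderiv_unique. apply (cderive_ext_UH f); auto. now apply Cderiv_cderive.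
Qed.

(** A single power series in q encodes holomorphy on the half-plane, period 1 and holomorphy at the
    cusp together. *)
Definition cusp_holo (f : C -> C) : Prop := exists a, disc_coefs a /\ forall z, UH z -> f z = pser a (ee z).

Definition cusp_bounded (f : C -> C) : Prop := exists B Y0 : R, forall z, UH z -> (Y0 < Im z)%R -> (Cmod (f z) <= B)%R.

Lemma UH_1 z : UH z -> UH (z + 1).
Proof. unfold UH, Im; simpl. lra. Qed.

Lemma cusp_holo_ext f g : (forall z, UH z -> f z = g z) -> cusp_holo f -> cusp_holo g.
Proof. intros E [a [Ha H]]. exists a. split; [exact Ha|]. intros z Hz. rewrite <- E; auto. Qed.

Lemma cusp_holo_holo f : cusp_holo f -> holo f.
Proof.
  intros [a [Ha H]]. apply holo_cderive. intros z Hz. eexists. eapply cderive_ext_UH; [exact Hz| |apply cderive_pser_ee; eassumption].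
  intros w Hw. simpl. now rewrite H.
Qed.

Lemma cusp_holo_periodic f : cusp_holo f -> periodic f.
Proof. intros [a [Ha H]] z Hz. rewrite !H by auto using UH_1. now rewrite ee_plus_1. Qed.

Lemma cusp_holo_deriv_pser f a : disc_coefs a -> (forall z, UH z -> f z = pser a (ee z)) ->
  disc_coefs (fun n => tau * (RtoC (INR n) * a n)) /\
  forall z, UH z -> Cderiv f z = pser (fun n => tau * (RtoC (INR n) * a n)) (ee z).
Proof.
  intros Ha H. split; [apply disc_coefs_scal, disc_coefs_mul_n, Ha|].
  intros z Hz. transitivity (tau * pser (fun n => RtoC (INR n) * a n) (ee z)).
  - apply Cderiv_unique. eapply cderive_ext_UH; [exact Hz| |apply cderive_pser_ee; eassumption].
    intros w Hw. simpl. now rewrite H.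
  - symmetry. apply pser_eq.
    eapply is_cseries_ext; [|apply is_cseries_scal, pser_is_cseries; [apply disc_coefs_mul_n, Ha|now apply ee_lt1]].
    intros n. simpl. ring.
Qed.

Lemma cusp_holo_deriv f : cusp_holo f -> cusp_holo (Cderiv f).
Proof.
  intros [a [Ha H]]. destruct (cusp_holo_deriv_pser f a Ha H) as [H1 H2]. eexists. split; [exact H1|exact H2].
Qed.

Lemma Cmod_ee_le c z : (c <= Im z)%R -> (Cmod (ee z) <= exp (- (2 * PI) * c))%R.
Proof.
  intros H. rewrite Cmod_ee. pose proof PI_RGT_0.
  destruct (Rle_lt_or_eq_dec _ _ H) as [L| ->]; [|apply Rle_refl].
  left. apply exp_increasing. nra.
Qed.

Lemma exp_neg_lt1 c : (0 < c)%R -> (exp (- (2 * PI) * c) < 1)%R.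
Proof. intros H. rewrite <- exp_0. apply exp_increasing. pose proof PI_RGT_0. nra. Qed.

Lemma cusp_holo_bdd f c : cusp_holo f -> (0 < c)%R -> exists B, forall z, (c <= Im z)%R -> (Cmod (f z) <= B)%R.
Proof.
  intros [a [Ha H]] Hc.
  destruct (pser_bound a (exp (- (2 * PI) * c)) Ha) as [B HB].
  { split; [left; apply exp_pos|now apply exp_neg_lt1]. }
  exists B. intros z Hz. rewrite H by (unfold UH; lra). apply HB. now apply Cmod_ee_le.
Qed.

Lemma pser_lim a : disc_coefs a -> exists B, (0 <= B)%R /\ forall z, (1 <= Im z)%R ->
  (Cmod (pser a (ee z) - a 0%nat) <= B * Cmod (ee z))%R.
Proof.
  intros Ha.
  set (r := exp (- (2 * PI) * 1)).
  assert (Hr : (0 < r < 1)%R) by (split; [apply exp_pos|apply exp_neg_lt1; lra]).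
  destruct (disc_coefs_geo a r Ha ltac:(lra)) as [B [q [Hq [PB HB]]]].
  exists (B / r * / (1 - q))%R. split.
  { repeat apply Rmult_le_pos; auto; left; apply Rinv_0_lt_compat; lra. }
  intros z Hz.
  set (w := ee z). assert (Hw : (Cmod w <= r)%R) by now apply Cmod_ee_le.
  assert (C1 := pser_is_cseries a w Ha ltac:(lra)).
  set (u := fun n => if Nat.eqb n 0 then RtoC 0 else a n * w ^ n).
  assert (C2 : is_cseries u (pser a w - a 0%nat)).
  { intros eps He. destruct (C1 eps He) as [N HN]. exists (S N). intros n Hn.
    specialize (HN n ltac:(lia)). destruct n as [|n]; [lia|].
    assert (E : csum (S n) u = csum (S n) (fun n => a n * w ^ n) - a 0%nat).
    { clear. induction n as [|n IH]; [unfold u; simpl; ring|].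
      change (csum (S n) u + u (S n) = csum (S n) (fun n => a n * w ^ n) + a (S n) * w ^ S n - a 0%nat).
      rewrite IH. unfold u. simpl. ring. }
    rewrite E. replace (csum (S n) (fun n => a n * w ^ n) - a 0%nat - (pser a w - a 0%nat))
      with (csum (S n) (fun n => a n * w ^ n) - pser a w) by ring. exact HN. }
  eapply is_cseries_bound; [exact C2|]. intros n.
  replace (B / r * / (1 - q) * Cmod w)%R with ((B / r * Cmod w) * / (1 - q))%R by ring.
  apply csum_geo_bound; [exact Hq|]. intros k. unfold u.
  pose proof (Cmod_ge_0 w) as Pw.
  destruct k as [|k]; simpl Nat.eqb; cbv iota.
  - rewrite Cmod_0. simpl. rewrite Rmult_1_r. repeat apply Rmult_le_pos; auto. left; apply Rinv_0_lt_compat; lra.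
  - rewrite Cmod_mult, Cmod_pow. specialize (HB (S k)).
    apply Rle_trans with (Cmod (a (S k)) * (r ^ k * Cmod w))%R.
    + apply Rmult_le_compat_l; [apply Cmod_ge_0|]. simpl. rewrite Rmult_comm.
      apply Rmult_le_compat_r; [easy|]. now apply pow_mono_le.
    + replace (Cmod (a (S k)) * (r ^ k * Cmod w))%R with ((Cmod (a (S k)) * r ^ S k) * (Cmod w / r))%R
        by (simpl; field; lra).
      replace (B / r * Cmod w * q ^ S k)%R with (B * q ^ S k * (Cmod w / r))%R by (field; lra).
      apply Rmult_le_compat_r; [|exact HB]. apply Rdiv_le_0_compat; lra.
Qed.

Lemma cusp_holo_lim f : cusp_holo f -> exists l B, (0 <= B)%R /\ forall z, (1 <= Im z)%R -> (Cmod (f z - l) <= B * Cmod (ee z))%R.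
Proof.
  intros [a [Ha H]]. exists (a 0%nat). destruct (pser_lim a Ha) as [B [PB HB]]. exists B. split; [exact PB|].
  intros z Hz. rewrite H by (unfold UH; lra). now apply HB.
Qed.

Lemma cusp_holo_deriv_lim f : cusp_holo f -> exists B, (0 <= B)%R /\ forall z, (1 <= Im z)%R -> (Cmod (Cderiv f z) <= B * Cmod (ee z))%R.
Proof.
  intros [a [Ha H]]. destruct (cusp_holo_deriv_pser f a Ha H) as [H1 H2].
  destruct (pser_lim _ H1) as [B [PB HB]]. exists B. split; [exact PB|]. intros z Hz.
  rewrite H2 by (unfold UH; lra). specialize (HB z Hz). simpl INR in HB.
  replace (tau * (0 * a 0%nat)) with (RtoC 0) in HB by ring.
  unfold Cminus in HB. rewrite Copp_0, Cplus_0_r in HB. exact HB.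
Qed.

Lemma cusp_bounded_below_pole f : cusp_bounded f -> below_pole f.
Proof.
  intros [B [Y0 H]] eps He.
  destruct (below_pole_const (RtoC B) eps He) as [Y1 H1].
  exists (Rmax Y0 Y1). intros z Hz HY.
  eapply Rle_trans; [apply H; [exact Hz|eapply Rle_lt_trans; [apply Rmax_l|exact HY]]|].
  eapply Rle_trans; [|apply (H1 z Hz); eapply Rle_lt_trans; [apply Rmax_r|exact HY]].
  rewrite Cmod_R. apply Rle_abs.
Qed.

Lemma cusp_holo_intro_below_pole f : holo f -> periodic f -> below_pole f -> cusp_holo f.
Proof.
  intros H1 H2 H3. destruct (qexp f H1 H2 H3) as [a [Ha [H _]]].
  exists a. auto.
Qed.

Lemma cusp_holo_intro f : holo f -> periodic f -> cusp_bounded f -> cusp_holo f.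
Proof. intros H1 H2 H3. apply cusp_holo_intro_below_pole; auto. now apply cusp_bounded_below_pole. Qed.

Lemma cusp_holo_cusp_bounded f : cusp_holo f -> cusp_bounded f.
Proof.
  intros H. destruct (cusp_holo_bdd f 1 H Rlt_0_1) as [B HB]. exists B, 1%R. intros z _ Hz. apply HB. lra.
Qed.

Lemma cusp_bounded_plus f g : cusp_bounded f -> cusp_bounded g -> cusp_bounded (fun z => f z + g z).
Proof.
  intros [B [Y H]] [B' [Y' H']]. exists (B + B')%R, (Rmax Y Y'). intros z Hz HY.
  eapply Rle_trans; [apply Cmod_triangle|].
  apply Rplus_le_compat; [apply H|apply H']; auto; (eapply Rle_lt_trans; [|exact HY]); [apply Rmax_l|apply Rmax_r].
Qed.

Lemma cusp_bounded_mult f g : cusp_bounded f -> cusp_bounded g -> cusp_bounded (fun z => f z * g z).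
Proof.
  intros [B [Y H]] [B' [Y' H']]. exists (B * B')%R, (Rmax Y Y'). intros z Hz HY.
  rewrite Cmod_mult.
  apply Rmult_le_compat; try apply Cmod_ge_0;
   [apply H|apply H']; auto; (eapply Rle_lt_trans; [|exact HY]); [apply Rmax_l|apply Rmax_r].
Qed.

Lemma cusp_holo_const (c : C) : cusp_holo (fun _ => c).
Proof.
  apply cusp_holo_intro; [apply holo_const|intros z _; reflexivity|].
  exists (Cmod c), 0%R. intros; apply Rle_refl.
Qed.

Lemma cusp_holo_plus f g : cusp_holo f -> cusp_holo g -> cusp_holo (fun z => f z + g z).
Proof.
  intros Hf Hg. apply cusp_holo_intro; [apply holo_plus; now apply cusp_holo_holo| |apply cusp_bounded_plus; now apply cusp_holo_cusp_bounded].
  intros z Hz. now rewrite !cusp_holo_periodic.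
Qed.

Lemma cusp_holo_mult f g : cusp_holo f -> cusp_holo g -> cusp_holo (fun z => f z * g z).
Proof.
  intros Hf Hg. apply cusp_holo_intro; [apply holo_mult; now apply cusp_holo_holo| |apply cusp_bounded_mult; now apply cusp_holo_cusp_bounded].
  intros z Hz. now rewrite !cusp_holo_periodic.
Qed.

Lemma cusp_holo_scal c f : cusp_holo f -> cusp_holo (fun z => c * f z).
Proof. intros H. apply cusp_holo_mult; [apply cusp_holo_const|exact H]. Qed.

Definition cusp_bounded_below (h : C -> C) : Prop := exists d Y0 : R, (0 < d)%R /\ forall z, UH z -> (Y0 < Im z)%R -> (d <= Cmod (h z))%R.

Lemma cusp_holo_inv h : cusp_holo h -> (forall z, UH z -> h z <> 0) -> cusp_bounded_below h -> cusp_holo (fun z => / h z).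
Proof.
  intros Hh N [d [Y0 [Hd H]]]. apply cusp_holo_intro.
  - apply holo_inv; [now apply cusp_holo_holo|exact N].
  - intros z Hz. now rewrite (cusp_holo_periodic h Hh z Hz).
  - exists (/ d)%R, Y0. intros z Hz HY. rewrite Cmod_inv by auto. apply Rinv_le_contravar; auto.
Qed.

Lemma cusp_holo_csum n (f : nat -> C -> C) : (forall i, (i < n)%nat -> cusp_holo (f i)) -> cusp_holo (fun z => csum n (fun i => f i z)).
Proof.
  induction n as [|n IH]; intros H; simpl; [apply cusp_holo_const|].
  apply cusp_holo_plus; auto.
Qed.

Lemma cusp_holo_div_q f : cusp_holo f -> (exists B : R, forall z, (1 <= Im z)%R -> (Cmod (f z) <= B * Cmod (ee z))%R) ->
  cusp_holo (fun z => f z * ee (- z)).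
Proof.
  intros Hf [B HB]. apply cusp_holo_intro.
  - apply holo_mult; [now apply cusp_holo_holo|]. apply (holo_ext (fun z => ee (-1 * z))); [|apply holo_ee_scal].
    intros z _. f_equal. ring.
  - intros z Hz. rewrite (cusp_holo_periodic f Hf z Hz). f_equal.
    replace (- (z + 1)) with (- z - 1) by ring. apply ee_minus_1.
  - exists B, 1%R. intros z Hz HY. rewrite Cmod_mult, ee_opp, Cmod_inv by apply ee_neq0.
    pose proof (proj1 (Cmod_gt_0 _) (ee_neq0 z)) as P.
    apply Rmult_le_reg_r with (Cmod (ee z)); [exact P|].
    rewrite Rmult_assoc, Rinv_l, Rmult_1_r by lra. apply HB. lra.
Qed.

(* The [n]-th coefficient is an integral along [Im z = y], hence [O(y^(p+1) e^(2 pi n y))]; let [y] tend to 0. *)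
Lemma cusp_holo_zero f C0 (p : nat) : cusp_holo f -> (forall z, UH z -> (Cmod (f z) <= C0 * Im z ^ S p)%R) ->
  forall z, UH z -> f z = 0.
Proof.
  intros Hf H z Hz.
  destruct (qexp f (cusp_holo_holo f Hf) (cusp_holo_periodic f Hf) (cusp_bounded_below_pole f (cusp_holo_cusp_bounded f Hf))) as [a [Ha [E Bd]]].
  assert (C00 : (0 <= C0)%R).
  { specialize (H (0, 1)%R). unfold UH, Im in H; simpl in H. rewrite pow1 in H.
    pose proof (Cmod_ge_0 (f (0, 1)%R)). specialize (H Rlt_0_1). lra. }
  assert (A : forall n, a n = 0).
  { intros n. apply Cmod_eq_0, Rle_antisym; [|apply Cmod_ge_0].
    apply le_epsilon. intros eps He. rewrite Rplus_0_l.
    set (K := (C0 * exp (2 * PI * 1) ^ n)%R).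
    assert (PK : (0 <= K)%R) by (apply Rmult_le_pos; [easy|apply pow_le; left; apply exp_pos]).
    set (c := Rmin 1 (eps / (K + 1))).
    assert (Hc : (0 < c)%R) by (apply Rmin_glb_lt; [lra|apply Rdiv_lt_0_compat; lra]).
    assert (Hc1 : (c <= 1)%R) by apply Rmin_l.
    eapply Rle_trans; [apply (Bd c (C0 * c ^ S p)%R Hc)|].
    - intros t _. apply (H (t, c)). exact Hc.
    - apply Rle_trans with (C0 * c * exp (2 * PI * 1) ^ n)%R.
      + apply Rmult_le_compat.
        * apply Rmult_le_pos; [easy|apply pow_le; lra].
        * apply pow_le; left; apply exp_pos.
        * apply Rmult_le_compat_l; [easy|]. simpl. rewrite <- (Rmult_1_r c) at 3.
          apply Rmult_le_compat_l; [lra|]. rewrite <- (pow1 p). apply pow_incr. lra.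
        * apply pow_incr. split; [left; apply exp_pos|].
          destruct (Rle_lt_or_eq_dec _ _ Hc1) as [L| ->]; [|apply Rle_refl].
          left. apply exp_increasing. pose proof PI_RGT_0. nra.
      + replace (C0 * c * exp (2 * PI * 1) ^ n)%R with (K * c)%R by (unfold K; ring).
        apply Rle_trans with (K * (eps / (K + 1)))%R; [apply Rmult_le_compat_l; [easy|apply Rmin_r]|].
        apply Rmult_le_reg_r with (K + 1)%R; [lra|].
        replace (K * (eps / (K + 1)) * (K + 1))%R with (K * eps)%R by (field; lra). nra. }
  rewrite E by exact Hz. apply pser_eq.
  intros eps He. exists 0%nat. intros n _. rewrite csum_0.
  - replace (0 - 0) with (RtoC 0) by ring. now rewrite Cmod_0.
  - intros i _. rewrite A. ring.
Qed.

(** * Smooth functions and the eta product *)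

(** [holo] provides one derivative, whereas iterating D requires all of them. They are obtained from
    q-series, exponentials e(l z) and composition with Moebius maps, for which differentiation stays
    inside the class. *)
Fixpoint smooth_n (n : nat) (f : C -> C) : Prop :=
  match n with O => holo f | S n => holo f /\ smooth_n n (Cderiv f) end.
Definition smooth f := forall n, smooth_n n f.

Lemma smooth_n_ext n : forall f g, (forall z, UH z -> f z = g z) -> smooth_n n f -> smooth_n n g.
Proof.
  induction n as [|n IH]; intros f g E H; simpl in *.
  - now apply (holo_ext f).
  - destruct H as [H1 H2]. split; [now apply (holo_ext f)|].
    apply (IH (Cderiv f)); [|exact H2]. intros z Hz. now apply Cderiv_ext.
Qed.

Lemma smooth_n_pred n : forall f, smooth_n (S n) f -> smooth_n n f.
Proof.
  induction n as [|n IH]; intros f [H1 H2]; [exact H1|]. split; [exact H1|]. apply IH, H2.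
Qed.

Lemma smooth_n_plus n : forall f g, smooth_n n f -> smooth_n n g -> smooth_n n (fun z => f z + g z).
Proof.
  induction n as [|n IH]; intros f g Hf Hg; [now apply holo_plus|].
  destruct Hf as [F1 F2]. destruct Hg as [G1 G2]. split; [now apply holo_plus|].
  eapply smooth_n_ext; [|apply (IH _ _ F2 G2)]. intros z Hz. symmetry. apply Cderiv_unique.
  apply cderive_plus; now apply Cderiv_cderive.
Qed.

Lemma smooth_n_mult n : forall f g, smooth_n n f -> smooth_n n g -> smooth_n n (fun z => f z * g z).
Proof.
  induction n as [|n IH]; intros f g Hf Hg; [now apply holo_mult|].
  pose proof (smooth_n_pred _ _ Hf) as F0. pose proof (smooth_n_pred _ _ Hg) as G0.
  destruct Hf as [F1 F2]. destruct Hg as [G1 G2]. split; [now apply holo_mult|].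
  eapply smooth_n_ext; [|apply smooth_n_plus; [apply (IH _ _ F2 G0)|apply (IH _ _ F0 G2)]].
  intros z Hz. symmetry. apply Cderiv_unique. apply cderive_mult; now apply Cderiv_cderive.
Qed.

Lemma smooth_n_const n : forall c : C, smooth_n n (fun _ => c).
Proof.
  induction n as [|n IH]; intros c; [apply holo_const|]. split; [apply holo_const|].
  eapply smooth_n_ext; [|apply (IH 0)]. intros z Hz. symmetry. apply Cderiv_unique, cderive_const.
Qed.

Lemma smooth_ext f g : (forall z, UH z -> f z = g z) -> smooth f -> smooth g.
Proof. intros E H n. now apply (smooth_n_ext n f). Qed.
Lemma smooth_holo f : smooth f -> holo f.
Proof. intros H. exact (H 0%nat). Qed.
Lemma smooth_deriv f : smooth f -> smooth (Cderiv f).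
Proof. intros H n. exact (proj2 (H (S n))). Qed.
Lemma smooth_plus f g : smooth f -> smooth g -> smooth (fun z => f z + g z).
Proof. intros Hf Hg n. now apply smooth_n_plus. Qed.
Lemma smooth_mult f g : smooth f -> smooth g -> smooth (fun z => f z * g z).
Proof. intros Hf Hg n. now apply smooth_n_mult. Qed.
Lemma smooth_const (c : C) : smooth (fun _ => c).
Proof. intros n. apply smooth_n_const. Qed.
Lemma smooth_scal c f : smooth f -> smooth (fun z => c * f z).
Proof. intros H. apply smooth_mult; [apply smooth_const|exact H]. Qed.
Lemma smooth_csum n (f : nat -> C -> C) : (forall i, (i < n)%nat -> smooth (f i)) -> smooth (fun z => csum n (fun i => f i z)).
Proof. induction n as [|n IH]; intros H; simpl; [apply smooth_const|]. apply smooth_plus; auto. Qed.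

Lemma smooth_ee_scal l : smooth (fun z => ee (l * z)).
Proof.
  intros n. induction n as [|n IH]; [apply holo_ee_scal|]. split; [apply holo_ee_scal|].
  eapply smooth_n_ext; [|apply smooth_n_mult; [apply smooth_n_const with (c := tau * l)|exact IH]].
  intros z Hz. symmetry. apply Cderiv_unique, cderive_ee_scal.
Qed.

Lemma smooth_cusp_holo f : cusp_holo f -> smooth f.
Proof.
  intros H n. revert f H. induction n as [|n IH]; intros f H; [now apply cusp_holo_holo|].
  split; [now apply cusp_holo_holo|]. apply IH. now apply cusp_holo_deriv.
Qed.

(* The coefficient of [w^m] in [(1 - w) (1 - w^2) ... (1 - w^N)]. *)
Fixpoint euler_coef (N : nat) (m : nat) : C :=
  match N with
  | O => if Nat.eqb m 0 then 1 else 0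
  | S N => euler_coef N m - (if Nat.ltb m (S N) then RtoC 0 else euler_coef N (m - S N))
  end.

(** The value at r of (1 + w)(1 + w^2) ... (1 + w^N), whose coefficients majorize those of the
    partial Euler product. *)
Fixpoint euler_bound (N : nat) (r : R) : R :=
  match N with O => 1%R | S N => (euler_bound N r * (1 + r ^ S N))%R end.

Definition euler_prod (N : nat) (w : C) : C := cprod N (fun n => 1 - w ^ S n).

Lemma euler_bound_pos N r : (0 <= r)%R -> (0 <= euler_bound N r)%R.
Proof.
  intros Hr. induction N as [|N IH]; [simpl; lra|]. change (euler_bound (S N) r) with (euler_bound N r * (1 + r ^ S N))%R. apply Rmult_le_pos; [exact IH|].
  pose proof (pow_le r (S N) Hr). lra.
Qed.

Lemma euler_coef_bound N r : (0 < r < 1)%R -> forall m, (Cmod (euler_coef N m) * r ^ m <= euler_bound N r)%R.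
Proof.
  intros Hr. induction N as [|N IH]; intros m.
  - simpl. destruct m as [|m]; simpl.
    + rewrite Cmod_1. lra.
    + rewrite Cmod_0. lra.
  - change (euler_coef (S N) m) with (euler_coef N m - (if Nat.ltb m (S N) then RtoC 0 else euler_coef N (m - S N))).
    change (euler_bound (S N) r) with (euler_bound N r * (1 + r ^ S N))%R.
    assert (Pm : (0 <= r ^ m)%R) by (apply pow_le; lra).
    destruct (Nat.ltb_spec m (S N)) as [L|L].
    + replace (euler_coef N m - 0) with (euler_coef N m) by ring. eapply Rle_trans; [apply IH|].
      rewrite <- (Rmult_1_r (euler_bound N r)) at 1. apply Rmult_le_compat_l; [apply euler_bound_pos; lra|].
      pose proof (pow_le r (S N) ltac:(lra)). lra.
    + unfold Cminus. eapply Rle_trans; [apply Rmult_le_compat_r; [exact Pm|apply Cmod_triangle]|].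
      rewrite Cmod_opp, Rmult_plus_distr_r, Rmult_plus_distr_l, Rmult_1_r.
      apply Rplus_le_compat; [apply IH|].
      replace (r ^ m)%R with (r ^ (m - S N) * r ^ S N)%R by (rewrite <- pow_add; f_equal; lia).
      rewrite <- Rmult_assoc. apply Rmult_le_compat_r; [apply pow_le; lra|apply IH].
Qed.

Lemma euler_coef_stable N m : (m <= N)%nat -> euler_coef N m = euler_coef m m.
Proof.
  intros H. induction H as [|N H IH]; [reflexivity|].
  change (euler_coef (S N) m) with (euler_coef N m - (if Nat.ltb m (S N) then RtoC 0 else euler_coef N (m - S N))).
  destruct (Nat.ltb_spec m (S N)) as [L|L]; [|lia]. rewrite IH. ring.
Qed.

Lemma pow_sum_le r N : (0 <= r < 1)%R -> (sum_n (fun k => r ^ S k)%R N <= / (1 - r))%R.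
Proof.
  intros Hr. eapply Rle_trans; [|apply (geo_sum_le r N Hr)].
  induction N as [|N IH].
  - rewrite !sum_O. simpl. lra.
  - rewrite !sum_Sn. unfold plus; simpl plus. apply Rplus_le_compat; [exact IH|].
    change (r ^ S (S N))%R with (r * r ^ S N)%R. pose proof (pow_le r (S N) ltac:(lra)). nra.
Qed.

Lemma euler_bound_exp r : (0 <= r < 1)%R -> forall N, (euler_bound N r <= exp (/ (1 - r)))%R.
Proof.
  intros Hr N.
  assert (P : (0 < / (1 - r))%R) by (apply Rinv_0_lt_compat; lra).
  destruct N as [|N].
  - simpl. pose proof (exp_ineq1_le (/ (1 - r))). lra.
  - apply Rle_trans with (exp (sum_n (fun k => r ^ S k)%R N)).
    + induction N as [|N IH].
      * rewrite sum_O. simpl. pose proof (exp_ineq1_le (r * 1)). lra.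
      * rewrite sum_Sn. unfold plus; simpl plus. rewrite exp_plus.
        change (euler_bound (S (S N)) r) with (euler_bound (S N) r * (1 + r ^ S (S N)))%R.
        pose proof (pow_le r (S (S N)) ltac:(lra)).
        apply Rmult_le_compat; [apply euler_bound_pos; lra|lra|exact IH|apply exp_ineq1_le].
    + destruct (Rle_lt_or_eq_dec _ _ (pow_sum_le r N Hr)) as [L| ->]; [|apply Rle_refl].
      left. now apply exp_increasing.
Qed.

(** The coefficient of w^m no longer changes once N >= m, so the diagonal gives the coefficients of
    the infinite product. *)
Definition euler_lim (m : nat) : C := euler_coef m m.

Lemma disc_coefs_euler_lim : disc_coefs euler_lim.
Proof.
  intros r Hr. exists (exp (/ (1 - r))). intros n. eapply Rle_trans; [apply (euler_coef_bound n r Hr)|].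
  apply euler_bound_exp. lra.
Qed.

Lemma is_cseries_shift u l k : is_cseries u l -> is_cseries (fun m => if Nat.ltb m k then RtoC 0 else u (m - k)%nat) l.
Proof.
  intros H eps He. destruct (H eps He) as [N HN]. exists (k + N)%nat. intros n Hn.
  replace n with (k + (n - k))%nat by lia. rewrite csum_split, csum_0.
  - rewrite Cplus_0_l. erewrite csum_ext; [apply (HN (n - k)%nat); lia|].
    intros i _. destruct (Nat.ltb_spec (k + i) k); [lia|]. f_equal. lia.
  - intros i Hi. destruct (Nat.ltb_spec i k); [reflexivity|lia].
Qed.

Lemma euler_prod_is_cseries N w : (Cmod w < 1)%R -> is_cseries (fun m => euler_coef N m * w ^ m) (euler_prod N w).
Proof.
  intros Hw. induction N as [|N IH].
  - intros eps He. exists 1%nat. intros n Hn. rewrite (csum_single n 0); [|lia|].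
    + simpl. unfold euler_prod. simpl. replace (1 * 1 - 1) with (RtoC 0) by ring. now rewrite Cmod_0.
    + intros i _ Hi. destruct i; [lia|]. simpl. ring.
  - pose proof (is_cseries_shift _ _ (S N) (is_cseries_scal (w ^ S N) _ _ IH)) as H1.
    pose proof (is_cseries_plus _ _ _ _ IH (is_cseries_scal (-1) _ _ H1)) as H2.
    replace (euler_prod (S N) w) with (euler_prod N w + -1 * (w ^ S N * euler_prod N w)).
    2:{ unfold euler_prod. simpl. ring. }
    eapply is_cseries_ext; [|exact H2]. intros m. cbv beta.
    change (euler_coef (S N) m) with (euler_coef N m - (if Nat.ltb m (S N) then RtoC 0 else euler_coef N (m - S N))).
    destruct (Nat.ltb_spec m (S N)) as [L|L]; [ring|].
    replace (w ^ m) with (w ^ S N * w ^ (m - S N)) by (rewrite <- Cpow_add_r; f_equal; lia). ring.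
Qed.

Definition Clims (u : nat -> C) (l : C) : Prop := forall eps : R, (0 < eps)%R ->
  exists N, forall n, (N <= n)%nat -> (Cmod (u n - l) < eps)%R.

Lemma pow_small q eps : (0 <= q < 1)%R -> (0 < eps)%R -> exists N, forall n, (N <= n)%nat -> (q ^ n < eps)%R.
Proof.
  intros Hq He. destruct (pow_lt_1_zero q ltac:(rewrite Rabs_pos_eq; lra) eps He) as [N HN].
  exists N. intros n Hn. specialize (HN n Hn). rewrite Rabs_pos_eq in HN by (apply pow_le; lra). exact HN.
Qed.

(** The terms of index below N agree with those of the limit. The tails are dominated by a geometric
    series with ratio q = |w|/r, where r lies halfway between |w| and 1, hence are O(q^N). *)
Lemma euler_prod_lim w : (Cmod w < 1)%R -> Clims (fun N => euler_prod N w) (pser euler_lim w).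
Proof.
  intros Hw. pose proof (Cmod_ge_0 w) as Pw.
  set (r := ((1 + Cmod w) / 2)%R). assert (Hr : (0 < r < 1)%R) by (unfold r; lra).
  set (q := (Cmod w / r)%R).
  assert (Hq : (0 <= q < 1)%R).
  { split; [apply Rdiv_le_0_compat; lra|]. apply Rmult_lt_reg_r with r; [lra|].
    unfold q, Rdiv. rewrite Rmult_assoc, Rinv_l by lra. unfold r. lra. }
  set (E := exp (/ (1 - r))). assert (PE : (0 < E)%R) by apply exp_pos.
  assert (Bd : forall N, (Cmod (euler_prod N w - pser euler_lim w) <= (2 * E * q ^ N) * / (1 - q))%R).
  { intros N.
    pose proof (is_cseries_plus _ _ _ _ (euler_prod_is_cseries N w Hw) (is_cseries_scal (-1) _ _ (pser_is_cseries euler_lim w disc_coefs_euler_lim Hw))) as H.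
    replace (euler_prod N w - pser euler_lim w) with (euler_prod N w + -1 * pser euler_lim w) by ring.
    eapply is_cseries_bound; [exact H|]. intros n.
    destruct (Nat.le_gt_cases n N) as [L|L].
    - rewrite csum_0.
      + rewrite Cmod_0. repeat apply Rmult_le_pos; try lra; [apply pow_le; lra|left; apply Rinv_0_lt_compat; lra].
      + intros i Hi. rewrite (euler_coef_stable N i) by lia. unfold euler_lim. ring.
    - replace n with (N + (n - N))%nat by lia. rewrite csum_split, csum_0, Cplus_0_l.
      + apply csum_geo_bound; [exact Hq|]. intros k. cbv beta.
        replace (euler_coef N (N + k) * w ^ (N + k) + -1 * (euler_lim (N + k) * w ^ (N + k)))
          with ((euler_coef N (N + k) - euler_lim (N + k)) * w ^ (N + k)) by ring.
        rewrite Cmod_mult, Cmod_pow.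
        replace (Cmod w) with (r * q)%R at 1 by (unfold q; field; lra).
        rewrite Rpow_mult_distr, <- Rmult_assoc, Rmult_assoc with (r1 := (2 * E)%R), <- pow_add.
        apply Rmult_le_compat_r; [apply pow_le; lra|].
        apply Rle_trans with ((Cmod (euler_coef N (N + k)) + Cmod (euler_lim (N + k))) * r ^ (N + k))%R.
        * apply Rmult_le_compat_r; [apply pow_le; lra|]. unfold Cminus.
          eapply Rle_trans; [apply Cmod_triangle|]. rewrite Cmod_opp. lra.
        * pose proof (euler_coef_bound N r Hr (N + k)). pose proof (euler_coef_bound (N + k) r Hr (N + k)).
          pose proof (euler_bound_exp r ltac:(lra) N). pose proof (euler_bound_exp r ltac:(lra) (N + k)).
          unfold euler_lim, E. lra.
      + intros i Hi. rewrite (euler_coef_stable N i) by lia. unfold euler_lim. ring. }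
  intros eps He.
  assert (Pi : (0 < / (1 - q))%R) by (apply Rinv_0_lt_compat; lra).
  destruct (pow_small q (eps / (2 * E * / (1 - q)))%R Hq) as [N HN].
  { apply Rdiv_lt_0_compat; [lra|]. repeat apply Rmult_lt_0_compat; lra. }
  exists N. intros n Hn. eapply Rle_lt_trans; [apply Bd|].
  replace (2 * E * q ^ n * / (1 - q))%R with (2 * E * / (1 - q) * q ^ n)%R by ring.
  replace eps with (2 * E * / (1 - q) * (eps / (2 * E * / (1 - q))))%R by (field; lra).
  apply Rmult_lt_compat_l; [repeat apply Rmult_lt_0_compat; lra|]. now apply HN.
Qed.

Lemma one_minus_exp x : (0 <= x < 1)%R -> (exp (- (x / (1 - x))) <= 1 - x)%R.
Proof.
  intros Hx. rewrite exp_Ropp.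
  pose proof (exp_ineq1_le (x / (1 - x))) as H.
  apply Rmult_le_reg_l with (exp (x / (1 - x))); [apply exp_pos|].
  rewrite Rinv_r by (apply Rgt_not_eq, exp_pos).
  replace 1%R with ((1 + x / (1 - x)) * (1 - x))%R at 1 by (field; lra).
  apply Rmult_le_compat_r; lra.
Qed.

(** Since the bound is independent of N it survives the limit: the infinite product has no zero in
    the disc and stays away from 0 near the cusp. Each factor is bounded by 1 - x >= exp(-x/(1 - x))
    at x = r^n, and the exponents sum up geometrically. *)
Lemma euler_prod_lower r N w : (0 <= r < 1)%R -> (Cmod w <= r)%R ->
  (exp (- (/ (1 - r) * / (1 - r))) <= Cmod (euler_prod N w))%R.
Proof.
  intros Hr Hw.
  assert (Pi : (0 < / (1 - r))%R) by (apply Rinv_0_lt_compat; lra).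
  assert (St : forall n, (exp (- (/ (1 - r) * r ^ S n)) <= Cmod (1 - w ^ S n))%R).
  { intros n.
    assert (X : (0 <= r ^ S n <= r)%R).
    { split; [apply pow_le; lra|]. simpl. rewrite <- (Rmult_1_r r) at 3. apply Rmult_le_compat_l; [lra|].
      rewrite <- (pow1 n). apply pow_incr. lra. }
    apply Rle_trans with (1 - r ^ S n)%R.
    - eapply Rle_trans; [|apply one_minus_exp; lra].
      assert (L : (- (/ (1 - r) * r ^ S n) <= - (r ^ S n / (1 - r ^ S n)))%R).
      { apply Ropp_le_contravar. unfold Rdiv. rewrite Rmult_comm. apply Rmult_le_compat_r; [lra|].
        apply Rinv_le_contravar; lra. }
      destruct (Rle_lt_or_eq_dec _ _ L) as [L'| ->]; [|apply Rle_refl]. left. now apply exp_increasing.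
    - pose proof (Cmod_tri3 1 (w ^ S n)) as T. rewrite Cmod_1, Cmod_pow in T.
      pose proof (pow_mono_le (Cmod w) r (S n) (conj (Cmod_ge_0 w) Hw)). lra. }
  destruct N as [|N].
  - unfold euler_prod. simpl. rewrite Cmod_1. apply Rle_trans with (exp 0); [|rewrite exp_0; lra].
    left. apply exp_increasing. nra.
  - apply Rle_trans with (exp (- (/ (1 - r) * sum_n (fun k => r ^ S k)%R N))).
    + pose proof (pow_sum_le r N Hr) as Q.
      assert (L : (- (/ (1 - r) * / (1 - r)) <= - (/ (1 - r) * sum_n (fun k => r ^ S k)%R N))%R).
      { apply Ropp_le_contravar. apply Rmult_le_compat_l; lra. }
      destruct (Rle_lt_or_eq_dec _ _ L) as [L'| ->]; [|apply Rle_refl]. left. now apply exp_increasing.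
    + induction N as [|N IH].
      * rewrite sum_O. unfold euler_prod. simpl cprod. rewrite Cmult_1_l. apply (St 0%nat).
      * rewrite sum_Sn. unfold plus; simpl plus. rewrite Rmult_plus_distr_l, Ropp_plus_distr, exp_plus.
        change (euler_prod (S (S N)) w) with (euler_prod (S N) w * (1 - w ^ S (S N))). rewrite Cmod_mult.
        apply Rmult_le_compat; try (left; apply exp_pos); [exact IH|apply St].
Qed.

Lemma Clims_lower u l d : Clims u l -> (forall n, (d <= Cmod (u n))%R) -> (d <= Cmod l)%R.
Proof.
  intros H Hd. apply le_epsilon. intros eps He. destruct (H eps He) as [N HN].
  specialize (HN N (le_n _)). pose proof (Cmod_tri3 (u N) l). specialize (Hd N). lra.
Qed.

Lemma pser_euler_lim_lower r w : (0 <= r < 1)%R -> (Cmod w <= r)%R ->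
  (exp (- (/ (1 - r) * / (1 - r))) <= Cmod (pser euler_lim w))%R.
Proof.
  intros Hr Hw. apply (Clims_lower (fun N => euler_prod N w)); [apply euler_prod_lim; lra|].
  intros n. now apply euler_prod_lower.
Qed.

Definition euler_fun (z : C) : C := pser euler_lim (ee z).

Lemma cusp_holo_euler_fun : cusp_holo euler_fun.
Proof. exists euler_lim. split; [apply disc_coefs_euler_lim|reflexivity]. Qed.

Lemma euler_fun_neq0 z : UH z -> euler_fun z <> 0.
Proof.
  intros Hz. apply Cmod_gt_0. eapply Rlt_le_trans; [apply exp_pos|].
  apply (pser_euler_lim_lower (Cmod (ee z))); [|apply Rle_refl].
  split; [apply Cmod_ge_0|now apply ee_lt1].
Qed.

Lemma euler_fun_low : cusp_bounded_below euler_fun.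
Proof.
  set (r := exp (- (2 * PI) * 1)).
  exists (exp (- (/ (1 - r) * / (1 - r)))), 1%R. split; [apply exp_pos|].
  intros z _ Hz. apply pser_euler_lim_lower.
  - split; [left; apply exp_pos|apply exp_neg_lt1; lra].
  - apply Cmod_ee_le. lra.
Qed.

Lemma Clim_eq u l : Clims u l -> Clim u = l.
Proof.
  intros H.
  assert (F : filterlim u eventually (locally (T := C_UniformSpace) l)).
  { apply filterlim_locally. intros eps. destruct (H eps (cond_pos eps)) as [N HN].
    exists N. intros n Hn. apply C_NormedModule_mixin_compat1. now apply HN. }
  apply (filterlim_locally_unique (K := R_AbsRing) (V := C_R_NormedModule) (F := eventually) u); [|exact F].
  unfold Clim. apply epsilon_spec. now exists l.
Qed.

Lemma eta_phi z : UH z -> eta z = ee (/ 24 * z) * euler_fun z.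
Proof.
  intros Hz. unfold eta. apply Clim_eq.
  replace (z / 24) with (/ 24 * z) by (unfold Cdiv; ring).
  assert (E : forall N, cprod N (fun n => 1 - ee (INR (S n) * z)) = euler_prod N (ee z)).
  { intros N. unfold euler_prod. induction N as [|N IH]; [reflexivity|]. cbn [cprod]. rewrite IH, ee_nat. reflexivity. }
  intros eps He.
  pose proof (proj1 (Cmod_gt_0 _) (ee_neq0 (/ 24 * z))) as P.
  destruct (euler_prod_lim (ee z) (ee_lt1 z Hz) (eps / Cmod (ee (/ 24 * z)))%R) as [N HN].
  { apply Rdiv_lt_0_compat; lra. }
  exists N. intros n Hn. cbv beta. rewrite E. unfold euler_fun.
  replace (ee (/ 24 * z) * euler_prod n (ee z) - ee (/ 24 * z) * pser euler_lim (ee z))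
    with (ee (/ 24 * z) * (euler_prod n (ee z) - pser euler_lim (ee z))) by ring.
  rewrite Cmod_mult. specialize (HN n Hn). cbv beta in HN.
  replace eps with (Cmod (ee (/ 24 * z)) * (eps / Cmod (ee (/ 24 * z))))%R by (field; lra).
  apply Rmult_lt_compat_l; lra.
Qed.

Lemma cderive_eta z : UH z -> cderive eta z (eta z * (tau * / 24 + Cderiv euler_fun z / euler_fun z)).
Proof.
  intros Hz. eapply cderive_eq.
  - eapply cderive_ext_UH; [exact Hz|intros w Hw; symmetry; apply eta_phi; exact Hw|].
    apply (cderive_mult (fun w => ee (/ 24 * w)) euler_fun); [apply cderive_ee_scal|apply Cderiv_cderive; [apply cusp_holo_holo, cusp_holo_euler_fun|exact Hz]].
  - rewrite eta_phi by exact Hz. field. now apply euler_fun_neq0.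
Qed.

Lemma eta_neq0 z : UH z -> eta z <> 0.
Proof. intros Hz. rewrite eta_phi by exact Hz. apply Cmult_neq_0; [apply ee_neq0|now apply euler_fun_neq0]. Qed.

(** Logarithmic derivative of eta = q^(1/24) times the Euler product: the power of q contributes
    (i/pi)(2 pi i/24) = -1/12. *)
Lemma Pfun_phi z : UH z -> Pfun z = - / 12 + Ci / PI * (Cderiv euler_fun z * / euler_fun z).
Proof.
  intros Hz. unfold Pfun. rewrite (Cderiv_unique _ _ _ (cderive_eta z Hz)).
  assert (HP : RtoC PI <> 0) by (intros E; apply RtoC_inj in E; pose proof PI_RGT_0; lra).
  unfold tau. rewrite RtoC_mult.
  replace (Ci / PI * (eta z * (2 * PI * Ci * / 24 + Cderiv euler_fun z / euler_fun z) / eta z))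
   with ((Ci * Ci) * / 12 + Ci / PI * (Cderiv euler_fun z * / euler_fun z)).
  - replace (Ci * Ci) with (RtoC (-1)); [|unfold Cmult, Ci, RtoC; simpl; f_equal; ring].
    f_equal. ring.
  - field. repeat split; auto using eta_neq0, euler_fun_neq0.
Qed.

Lemma cusp_holo_Pfun : cusp_holo Pfun.
Proof.
  eapply cusp_holo_ext; [intros z Hz; symmetry; apply Pfun_phi, Hz|].
  apply cusp_holo_plus; [apply cusp_holo_const|]. apply cusp_holo_scal, cusp_holo_mult; [apply cusp_holo_deriv, cusp_holo_euler_fun|].
  apply cusp_holo_inv; [apply cusp_holo_euler_fun|apply euler_fun_neq0|apply euler_fun_low].
Qed.

Lemma Pfun_lim : exists B Y0, (0 <= B)%R /\ (1 <= Y0)%R /\ forall z, (Y0 < Im z)%R -> (Cmod (Pfun z + / 12) <= B * Cmod (ee z))%R.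
Proof.
  destruct (cusp_holo_deriv_lim euler_fun cusp_holo_euler_fun) as [B [PB HB]].
  destruct euler_fun_low as [d [Y0 [Hd HY]]].
  pose proof (Cmod_ge_0 (Ci / PI)) as Pc.
  exists (Cmod (Ci / PI) * (B * / d))%R, (Rmax 1 Y0). split; [|split; [apply Rmax_l|]].
  - repeat apply Rmult_le_pos; auto. left. now apply Rinv_0_lt_compat.
  - intros z Hz.
    assert (H1 : (1 < Im z)%R) by (eapply Rle_lt_trans; [apply Rmax_l|exact Hz]).
    assert (H2 : (Y0 < Im z)%R) by (eapply Rle_lt_trans; [apply Rmax_r|exact Hz]).
    assert (Uz : UH z) by (unfold UH; lra).
    rewrite Pfun_phi by exact Uz.
    replace (- / 12 + Ci / PI * (Cderiv euler_fun z * / euler_fun z) + / 12) with (Ci / PI * (Cderiv euler_fun z * / euler_fun z)) by ring.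
    rewrite !Cmod_mult, Cmod_inv by now apply euler_fun_neq0.
    rewrite Rmult_assoc. apply Rmult_le_compat_l; [exact Pc|].
    replace (B * / d * Cmod (ee z))%R with (B * Cmod (ee z) * / d)%R by ring.
    apply Rmult_le_compat; [apply Cmod_ge_0| |apply HB; lra|].
    + left. apply Rinv_0_lt_compat, Cmod_gt_0, euler_fun_neq0, Uz.
    + apply Rinv_le_contravar; [exact Hd|now apply HY].
Qed.

(** * The principal logarithm and complex powers *)

Lemma Cmod_sqr w : (Cmod w * Cmod w = Re w * Re w + Im w * Im w)%R.
Proof. pose proof (Cmod2_alt w). simpl in H. lra. Qed.

(** The sine of acos(Re w/|w|) is |Im w|/|w|; the case distinction in [Carg] restores the sign of Im
    w. *)
Lemma Cexp_Clog (w : C) : w <> 0 -> Cexp (Clog w) = w.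
Proof.
  intros Hw. pose proof (proj1 (Cmod_gt_0 _) Hw) as P.
  pose proof (Cmod_sqr w) as Sq. set (m := Cmod w) in *.
  unfold Cexp, Clog. fold m. unfold Re at 1, Im at 1 2; simpl fst; simpl snd.
  rewrite exp_ln by exact P.
  assert (T : (-1 <= Re w / m <= 1)%R).
  { pose proof (Re_le_Cmod w) as H. fold m in H. apply Rabs_le_between in H.
    split; apply Rmult_le_reg_r with m; try easy; unfold Rdiv; rewrite Rmult_assoc, Rinv_l; lra. }
  assert (S : sqrt (1 - (Re w / m)²) = (Rabs (Im w) / m)%R).
  { replace (1 - (Re w / m)²)%R with ((Im w / m)²)%R.
    - rewrite sqrt_Rsqr_abs. unfold Rdiv. rewrite Rabs_mult. f_equal. apply Rabs_pos_eq. left. now apply Rinv_0_lt_compat.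
    - unfold Rsqr. apply Rmult_eq_reg_r with (m * m)%R; [|nra].
      replace (Im w / m * (Im w / m) * (m * m))%R with (Im w * Im w)%R by (field; lra).
      replace ((1 - Re w / m * (Re w / m)) * (m * m))%R with (m * m - Re w * Re w)%R by (field; lra). lra. }
  unfold Carg. fold m. destruct (Rle_dec 0 (Im w)) as [L|L].
  - rewrite cos_acos, sin_acos, S, Rabs_pos_eq by lra. destruct w as [x y].
    unfold Cmult, RtoC, Re, Im in *; simpl in *. f_equal; field; lra.
  - rewrite cos_neg, sin_neg, cos_acos, sin_acos, S, Rabs_left by lra. destruct w as [x y].
    unfold Cmult, RtoC, Re, Im in *; simpl in *. f_equal; field; lra.
Qed.

Lemma Cmod_cont_le a b : (Rabs (Cmod a - Cmod b) <= Cmod (a - b))%R.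
Proof.
  apply Rabs_le. pose proof (Cmod_tri3 a b). pose proof (Cmod_tri3 b a) as T.
  rewrite Cmod_minus_sym in T. lra.
Qed.

Lemma ccontinuous_Carg w : Im w <> 0%R -> forall eps : R, (0 < eps)%R -> exists d, (0 < d)%R /\
  forall v, (Cmod (v - w) < d)%R -> (Rabs (Carg v - Carg w) < eps)%R.
Proof.
  intros Hi eps He.
  assert (Pi : (0 < Rabs (Im w))%R) by now apply Rabs_pos_lt.
  pose proof (Im_le_Cmod w) as Hm. set (m := Cmod w) in *.
  assert (Pm : (0 < m)%R) by lra.
  set (t0 := (Re w / m)%R).
  assert (T : (-1 < t0 < 1)%R).
  { pose proof (Cmod_sqr w) as Sq. fold m in Sq.
    assert (0 < Im w * Im w)%R by nra.
    assert (Re w < m)%R by nra. assert (- m < Re w)%R by nra. unfold t0.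
    split; apply Rmult_lt_reg_r with m; try easy; unfold Rdiv; rewrite Rmult_assoc, Rinv_l; lra. }
  assert (CA : continuity_pt acos t0) by now apply derivable_continuous_pt, derivable_pt_acos.
  destruct (CA eps He) as [d1 [Hd1 K1]]. simpl in K1. unfold Rdist in K1.
  assert (K : forall t, (Rabs (t - t0) < d1)%R -> (Rabs (acos t - acos t0) < eps)%R).
  { intros t Ht. destruct (Req_dec t t0) as [->|N].
    - rewrite Rminus_diag, Rabs_R0. exact He.
    - apply K1. split; [|exact Ht]. split; [exact I|auto]. }
  exists (Rmin (Rabs (Im w)) (Rmin (m / 2) (d1 * m / 4))). split.
  { repeat apply Rmin_glb_lt; try lra. apply Rdiv_lt_0_compat; nra. }
  intros v Hv.
  assert (V1 : (Cmod (v - w) < Rabs (Im w))%R) by (eapply Rlt_le_trans; [exact Hv|apply Rmin_l]).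
  assert (V2 : (Cmod (v - w) < m / 2)%R)
    by (eapply Rlt_le_trans; [exact Hv|eapply Rle_trans; [apply Rmin_r|apply Rmin_l]]).
  assert (V3 : (Cmod (v - w) < d1 * m / 4)%R)
    by (eapply Rlt_le_trans; [exact Hv|eapply Rle_trans; [apply Rmin_r|apply Rmin_r]]).
  pose proof (Im_le_Cmod (v - w)) as J1. pose proof (Re_le_Cmod (v - w)) as J2.
  replace (Im (v - w)) with (Im v - Im w)%R in J1 by (unfold Im; simpl; ring).
  replace (Re (v - w)) with (Re v - Re w)%R in J2 by (unfold Re; simpl; ring).
  pose proof (Cmod_cont_le v w) as J3. fold m in J3.
  pose proof (Re_le_Cmod v) as J4.
  assert (Tt : (Rabs (Re v / Cmod v - t0) < d1)%R).
  { set (n := Cmod v) in *.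
    assert (Pn : (m / 2 < n)%R) by (apply Rabs_le_between in J3; lra).
    unfold t0. replace (Re v / n - Re w / m)%R with (((Re v - Re w) + Re v / n * (m - n)) / m)%R by (field; lra).
    unfold Rdiv at 1. rewrite Rabs_mult, (Rabs_pos_eq (/ m)) by (left; now apply Rinv_0_lt_compat).
    apply Rmult_lt_reg_r with m; [easy|]. rewrite Rmult_assoc, Rinv_l, Rmult_1_r by lra.
    eapply Rle_lt_trans; [apply Rabs_triang|]. rewrite Rabs_mult.
    assert (Rabs (Re v / n) <= 1)%R.
    { unfold Rdiv. rewrite Rabs_mult, (Rabs_pos_eq (/ n)) by (left; apply Rinv_0_lt_compat; lra).
      apply Rmult_le_reg_r with n; [lra|]. rewrite Rmult_assoc, Rinv_l; lra. }
    assert (Rabs (Re v / n) * Rabs (m - n) <= 1 * Cmod (v - w))%R.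
    { apply Rmult_le_compat; try apply Rabs_pos; [easy|]. rewrite Rabs_minus_sym. exact J3. }
    nra. }
  specialize (K _ Tt). unfold t0 in K. unfold Carg. fold m.
  apply Rabs_le_between in J1.
  destruct (Rle_dec 0 (Im v)) as [A|A]; destruct (Rle_dec 0 (Im w)) as [B|B].
  - exact K.
  - exfalso. rewrite Rabs_left in V1 by lra. lra.
  - exfalso. rewrite Rabs_pos_eq in V1 by lra. lra.
  - replace (- acos (Re v / Cmod v) - - acos (Re w / m))%R with (- (acos (Re v / Cmod v) - acos (Re w / m)))%R by ring.
    rewrite Rabs_Ropp. exact K.
Qed.

Lemma ccontinuous_Clog w : Im w <> 0%R -> ccontinuous Clog w.
Proof.
  intros Hi eps He.
  pose proof (Im_le_Cmod w) as Hm. assert (Pi : (0 < Rabs (Im w))%R) by now apply Rabs_pos_lt.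
  assert (Pm : (0 < Cmod w)%R) by lra.
  destruct (ccontinuous_Carg w Hi (eps/2)%R ltac:(lra)) as [d1 [Hd1 K1]].
  assert (CL : continuity_pt ln (Cmod w)) by (apply derivable_continuous_pt; exists (/ Cmod w)%R; now apply derivable_pt_lim_ln).
  destruct (CL (eps/2)%R ltac:(lra)) as [d2 [Hd2 K2]]. simpl in K2. unfold Rdist in K2.
  exists (Rmin d1 d2). split; [now apply Rmin_glb_lt|]. intros v Hv.
  specialize (K1 v (Rlt_le_trans _ _ _ Hv (Rmin_l _ _))).
  assert (Hv2 := Rlt_le_trans _ _ _ Hv (Rmin_r _ _)).
  eapply Rle_lt_trans; [apply Cmod_le_Rabs|].
  change (Rabs (ln (Cmod v) - ln (Cmod w)) + Rabs (Carg v - Carg w) < eps)%R.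
  assert (Rabs (ln (Cmod v) - ln (Cmod w)) < eps / 2)%R; [|lra].
  destruct (Req_dec (Cmod v) (Cmod w)) as [->|N].
  - rewrite Rminus_diag, Rabs_R0. lra.
  - apply K2. split; [split; [exact I|auto]|]. pose proof (Cmod_cont_le v w). lra.
Qed.

(** Inverse function argument: the difference D of two logarithms is small by continuity and
    satisfies e^D = v/w. Nonreal w suffice, because cz + d is nonreal for c <> 0 and constant for c
    = 0. *)
Lemma cderive_Clog w : Im w <> 0%R -> cderive Clog w (/ w).
Proof.
  intros Hi.
  assert (Hw : w <> 0) by (intros E; apply Hi; rewrite E; reflexivity).
  pose proof (proj1 (Cmod_gt_0 _) Hw) as Pm.
  apply cderive_eps. intros eps He.
  set (e := Rmin (1/2) (eps * Cmod w / 2)).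
  assert (Pe : (0 < e)%R) by (apply Rmin_glb_lt; [lra|apply Rdiv_lt_0_compat; nra]).
  assert (e1 : (e <= 1/2)%R) by apply Rmin_l. assert (e2 : (e <= eps * Cmod w / 2)%R) by apply Rmin_r.
  pose proof (cderive_Cexp 0) as D0. rewrite Cexp_0 in D0.
  destruct (proj1 (cderive_eps _ _ _) D0 e Pe) as [d1 [Hd1 K1]].
  destruct (ccontinuous_Clog w Hi d1 Hd1) as [d2 [Hd2 K2]].
  exists (Rmin d2 (Cmod w)). split; [now apply Rmin_glb_lt|]. intros v Hv.
  specialize (K2 v (Rlt_le_trans _ _ _ Hv (Rmin_l _ _))).
  assert (Hv2 := Rlt_le_trans _ _ _ Hv (Rmin_r _ _)).
  assert (Hv0 : v <> 0).
  { apply Cmod_gt_0. pose proof (Cmod_tri3 w v) as T. rewrite Cmod_minus_sym in T. lra. }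
  set (D := Clog v - Clog w) in *.
  assert (ED : Cexp D = v * / w).
  { assert (Q : Cexp (Clog w) * Cexp D = v).
    { rewrite <- Cexp_add. unfold D. replace (Clog w + (Clog v - Clog w)) with (Clog v) by ring. now apply Cexp_Clog. }
    rewrite Cexp_Clog in Q by exact Hw. rewrite <- Q. field. exact Hw. }
  specialize (K1 D). replace (D - 0) with D in K1 by ring. specialize (K1 K2).
  rewrite ED, Cexp_0 in K1.
  replace (v * / w - 1 - 1 * D) with (- (D - / w * (v - w))) in K1 by (field; exact Hw).
  rewrite Cmod_opp in K1.
  pose proof (Cmod_tri3 D (/ w * (v - w))) as T.
  rewrite Cmod_mult, Cmod_inv in T by exact Hw.
  set (h := Cmod (v - w)) in *. set (m := Cmod w) in *.
  assert (PD : (0 <= Cmod D)%R) by apply Cmod_ge_0.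
  assert (HD : (Cmod D <= 2 * (/ m * h))%R).
  { assert (e * Cmod D <= 1/2 * Cmod D)%R by (apply Rmult_le_compat_r; lra). lra. }
  eapply Rle_trans; [exact K1|].
  apply Rle_trans with (eps * m / 2 * (2 * (/ m * h)))%R.
  - apply Rmult_le_compat; lra.
  - right. field. lra.
Qed.

Lemma Cpow_add w a b : Cpow w (a + b) = Cpow w a * Cpow w b.
Proof. unfold Cpow. rewrite RtoC_plus, <- Cexp_add. f_equal. ring. Qed.

Lemma Cpow_0 w : Cpow w 0 = 1.
Proof. unfold Cpow. rewrite Cmult_0_l. apply Cexp_0. Qed.

Lemma Cpow_neq0 w k : Cpow w k <> 0.
Proof. apply Cexp_neq0. Qed.

Lemma Cpow_opp w k : Cpow w (- k) = / Cpow w k.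
Proof.
  assert (H : Cpow w k * Cpow w (- k) = 1).
  { rewrite <- Cpow_add. replace (k + - k)%R with 0%R by ring. apply Cpow_0. }
  pose proof (Cpow_neq0 w k).
  replace (Cpow w (- k)) with (/ Cpow w k * (Cpow w k * Cpow w (- k))) by (field; auto).
  rewrite H. ring.
Qed.

Lemma Cpow_1 (w : C) : w <> 0 -> Cpow w 1 = w.
Proof. intros H. unfold Cpow. rewrite Cmult_1_l. now apply Cexp_Clog. Qed.

Lemma Cpow_INR (w : C) n : w <> 0 -> Cpow w (INR n) = (w ^ n).
Proof.
  intros H. induction n as [|n IH]; [simpl; apply Cpow_0|].
  rewrite S_INR, Cpow_add, IH, Cpow_1 by exact H. simpl. ring.
Qed.

(** * Moebius transformations *)

Lemma Im_jfac g z : Im (jfac g z) = (IZR (sc g) * Im z)%R.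
Proof. unfold jfac, Im; simpl. ring. Qed.

Lemma sl2_cd g : (sc g = 0)%Z -> (sd g <> 0)%Z.
Proof. intros H E. pose proof (sdet g) as D. rewrite H, E in D. lia. Qed.

Lemma jfac_neq0 g z : UH z -> jfac g z <> 0.
Proof.
  intros Hz E. unfold UH in Hz.
  assert (I : Im (jfac g z) = 0%R) by (rewrite E; reflexivity). rewrite Im_jfac in I.
  assert (C0 : IZR (sc g) = 0%R) by nra. apply eq_IZR in C0.
  unfold jfac in E. rewrite C0, Cmult_0_l, Cplus_0_l in E. apply RtoC_inj, eq_IZR in E.
  now apply (sl2_cd g).
Qed.

Lemma cderive_jfac g z : cderive (jfac g) z (RtoC (IZR (sc g))).
Proof.
  unfold jfac. eapply cderive_eq; [apply cderive_plus; [apply cderive_scal, cderive_id|apply cderive_const]|ring].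
Qed.

Lemma det_C g : RtoC (IZR (sa g)) * RtoC (IZR (sd g)) - RtoC (IZR (sb g)) * RtoC (IZR (sc g)) = 1.
Proof.
  rewrite <- !RtoC_mult, <- RtoC_minus, <- !mult_IZR, <- minus_IZR, sdet. reflexivity.
Qed.

Lemma Im_mob g z : UH z -> Im (mob g z) = (Im z / (Cmod (jfac g z) * Cmod (jfac g z)))%R.
Proof.
  intros Hz. pose proof (jfac_neq0 g z Hz) as N. pose proof (proj1 (Cmod_gt_0 _) N) as P.
  pose proof (Cmod_sqr (jfac g z)) as Sq.
  assert (Dt : (IZR (sa g) * IZR (sd g) - IZR (sb g) * IZR (sc g) = 1)%R).
  { rewrite <- !mult_IZR, <- minus_IZR, sdet. reflexivity. }
  set (m := Cmod (jfac g z)) in *.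
  assert (G : forall u v : C, (Cmod v * Cmod v = Re v * Re v + Im v * Im v)%R -> (0 < Cmod v)%R ->
     Im (u / v) = ((Im u * Re v - Re u * Im v) / (Cmod v * Cmod v))%R).
  { intros [u1 u2] [p q] Hv Pv. rewrite Hv.
    assert (0 < Re (p, q) * Re (p, q) + Im (p, q) * Im (p, q))%R by nra.
    unfold Cdiv, Cmult, Cinv, Re, Im in *; simpl in *. field. nra. }
  unfold mob. rewrite G; [|exact Sq|exact P]. fold m. f_equal.
  unfold jfac, Re, Im. destruct z as [x y]. simpl.
  transitivity (y * (IZR (sa g) * IZR (sd g) - IZR (sb g) * IZR (sc g)))%R; [ring|rewrite Dt; ring].
Qed.

Lemma UH_mob g z : UH z -> UH (mob g z).
Proof.
  intros Hz. unfold UH. rewrite Im_mob by exact Hz. pose proof (proj1 (Cmod_gt_0 _) (jfac_neq0 g z Hz)).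
  apply Rdiv_lt_0_compat; [exact Hz|nra].
Qed.

Lemma cderive_mob g z : UH z -> cderive (mob g) z (/ (jfac g z * jfac g z)).
Proof.
  intros Hz. pose proof (jfac_neq0 g z Hz) as N. unfold mob, Cdiv.
  eapply cderive_eq; [apply (cderive_mult (fun z => RtoC (IZR (sa g)) * z + RtoC (IZR (sb g))) (fun z => / jfac g z));
    [apply cderive_plus; [apply cderive_scal, cderive_id|apply cderive_const]|apply cderive_inv; [apply cderive_jfac|exact N]]|].
  transitivity ((RtoC (IZR (sa g)) * RtoC (IZR (sd g)) - RtoC (IZR (sb g)) * RtoC (IZR (sc g))) / (jfac g z * jfac g z)).
  - unfold jfac in *. field. exact N.
  - rewrite det_C. field. exact N.
Qed.

Lemma cderive_Cpow_jfac g k z : UH z ->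
  cderive (fun z => Cpow (jfac g z) k) z (RtoC k * RtoC (IZR (sc g)) / jfac g z * Cpow (jfac g z) k).
Proof.
  intros Hz. pose proof (jfac_neq0 g z Hz) as N.
  destruct (Z.eq_dec (sc g) 0) as [E|E].
  - assert (Q : forall w, jfac g w = RtoC (IZR (sd g))).
    { intros w. unfold jfac. rewrite E. ring. }
    eapply cderive_eq; [apply (cderive_ext (fun _ => Cpow (RtoC (IZR (sd g))) k)); [intros w; now rewrite Q|apply cderive_const]|].
    rewrite E. field. exact N.
  - unfold Cpow at 1.
    eapply cderive_eq; [apply (cderive_comp Cexp (fun z => RtoC k * Clog (jfac g z))); [apply cderive_Cexp|apply cderive_scal;
      apply (cderive_comp Clog (jfac g)); [apply cderive_Clog|apply cderive_jfac]]|].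
    + rewrite Im_jfac. apply Rmult_integral_contrapositive. split; [|unfold UH in Hz; lra].
      intros E'. apply E. now apply eq_IZR in E'.
    + unfold Cpow. field. exact N.
Qed.

Lemma holo_mob f g : holo f -> holo (fun z => f (mob g z)).
Proof.
  intros H. apply holo_cderive. intros z Hz. eexists.
  apply cderive_comp; [apply Cderiv_cderive; [exact H|now apply UH_mob]|now apply cderive_mob].
Qed.

(** The derivative of 1/j is -c (1/j)^2, again a polynomial in 1/j, so the induction closes. *)
Lemma smooth_jinv g : smooth (fun z => / jfac g z).
Proof.
  assert (Hh : holo (fun z => / jfac g z)).
  { apply holo_inv; [|apply jfac_neq0]. apply holo_cderive. intros z _. eexists. apply cderive_jfac. }
  intros n. induction n as [|n IH]; [exact Hh|]. split; [exact Hh|].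
  eapply smooth_n_ext; [|apply smooth_n_mult; [apply smooth_n_const with (c := - RtoC (IZR (sc g)))|apply smooth_n_mult; exact IH]].
  intros z Hz. symmetry. apply Cderiv_unique. pose proof (jfac_neq0 g z Hz) as N.
  eapply cderive_eq; [apply cderive_inv; [apply cderive_jfac|exact N]|]. field. exact N.
Qed.

Lemma smooth_mob f g : smooth f -> smooth (fun z => f (mob g z)).
Proof.
  intros H n. revert f H. induction n as [|n IH]; intros f H.
  - apply holo_mob. now apply smooth_holo.
  - split; [apply holo_mob; now apply smooth_holo|].
    eapply smooth_n_ext; [|apply smooth_n_mult; [apply (smooth_n_mult n _ _ (smooth_jinv g n) (smooth_jinv g n))|apply (IH _ (smooth_deriv f H))]].
    intros z Hz. symmetry. apply Cderiv_unique. pose proof (jfac_neq0 g z Hz) as N.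
    eapply cderive_eq; [apply (cderive_comp f); [apply Cderiv_cderive; [now apply smooth_holo|now apply UH_mob]|now apply cderive_mob]|].
    cbv beta. field. exact N.
Qed.

Lemma mob_T z : mob sT z = z + 1.
Proof. unfold mob, jfac, sT; simpl. field. Qed.

Lemma jfac_T z : jfac sT z = 1.
Proof. unfold jfac, sT; simpl. ring. Qed.

Lemma Cpow_base1 k : Cpow 1 k = 1.
Proof.
  unfold Cpow, Clog.
  assert (E : Carg 1 = 0%R).
  { unfold Carg. rewrite Cmod_1. unfold Re, Im; simpl. destruct (Rle_dec 0 0); [|lra].
    replace (1 / 1)%R with 1%R by field. apply acos_1. }
  rewrite E, Cmod_1, ln_1. replace (RtoC k * (0%R, 0%R)) with (RtoC 0); [apply Cexp_0|].
  unfold Cmult, RtoC; simpl. f_equal; ring.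
Qed.

(** * Uniqueness for linear systems *)

Lemma rderive_part (p : C -> R) f t l : (forall a b, p (a - b) = (p a - p b)%R) ->
  (forall (r : R) a, p (RtoC r * a) = (r * p a)%R) -> (forall a, (Rabs (p a) <= Cmod a)%R) ->
  rderive f t l -> is_derive (fun s => p (f s)) t (p l).
Proof.
  intros P1 P2 P3 H. apply is_derive_Reals. intros eps He.
  destruct (rderive_eps_inv f t l H (eps/2)%R ltac:(lra)) as [d [Hd K]].
  exists (mkposreal d Hd). intros h Hh0 Hh. simpl in Hh.
  specialize (K (t + h)%R). replace (t + h - t)%R with h in K by ring. specialize (K Hh).
  replace ((p (f (t + h)) - p (f t)) / h - p l)%R
    with (p (f (t + h)%R - f t - RtoC h * l)%C / h)%R by (rewrite !P1, P2; field; easy).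
  unfold Rdiv. rewrite Rabs_mult, Rabs_inv.
  pose proof (Rabs_pos_lt h Hh0) as Ph.
  apply Rmult_lt_reg_r with (Rabs h); [easy|]. rewrite Rmult_assoc, Rinv_l, Rmult_1_r by lra.
  pose proof (P3 (f (t + h)%R - f t - RtoC h * l)). nra.
Qed.

Definition nrm2 (z : C) : R := (Re z * Re z + Im z * Im z)%R.

Lemma nrm2_Cmod z : nrm2 z = (Cmod z * Cmod z)%R.
Proof. symmetry. apply Cmod_sqr. Qed.

Lemma rderive_nrm2 f t l : rderive f t l ->
  is_derive (fun s => nrm2 (f s)) t (2 * (Re (f t) * Re l + Im (f t) * Im l))%R.
Proof.
  intros H.
  assert (H1 : is_derive (fun s => Re (f s)) t (Re l)).
  { apply (rderive_part Re); [intros; reflexivity|intros r [x y]; unfold Re; simpl; ring|apply Re_le_Cmod|exact H]. }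
  assert (H2 : is_derive (fun s => Im (f s)) t (Im l)).
  { apply (rderive_part Im); [intros; reflexivity|intros r [x y]; unfold Im; simpl; ring|apply Im_le_Cmod|exact H]. }
  unfold nrm2.
  replace (2 * (Re (f t) * Re l + Im (f t) * Im l))%R with
    ((Re l * Re (f t) + Re (f t) * Re l) + (Im l * Im (f t) + Im (f t) * Im l))%R by ring.
  apply (is_derive_plus (K := R_AbsRing) (V := R_NormedModule) (fun s => (Re (f s) * Re (f s))%R) (fun s => (Im (f s) * Im (f s))%R)).
  - apply (is_derive_mult (K := R_AbsRing) (fun s => Re (f s)) (fun s => Re (f s))); auto. intros; apply Rmult_comm.
  - apply (is_derive_mult (K := R_AbsRing) (fun s => Im (f s)) (fun s => Im (f s))); auto. intros; apply Rmult_comm.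
Qed.

Lemma inner_bound a b : (Rabs (2 * (Re a * Re b + Im a * Im b)) <= 2 * (Cmod a * Cmod b))%R.
Proof.
  replace (2 * (Re a * Re b + Im a * Im b))%R with (2 * Re (a * Cconj b))%R
    by (unfold Cconj, Re, Im; simpl; ring).
  rewrite Rabs_mult, Rabs_pos_eq by lra. apply Rmult_le_compat_l; [lra|].
  eapply Rle_trans; [apply Re_le_Cmod|]. rewrite Cmod_mult, Cmod_conj. lra.
Qed.

Lemma deriv_nonneg (f df : R -> R) a b : (a <= b)%R ->
  (forall x, (a <= x <= b)%R -> is_derive f x (df x)) -> (forall x, (a <= x <= b)%R -> (0 <= df x)%R) -> (f a <= f b)%R.
Proof.
  intros Hab H P.
  destruct (MVT_gen f a b df) as [c [Hc E]].
  - intros x. rewrite Rmin_left, Rmax_right by easy. intros Hx. apply H. lra.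
  - intros x. rewrite Rmin_left, Rmax_right by easy. intros Hx.
    apply derivable_continuous_pt. exists (df x). apply is_derive_Reals, H, Hx.
  - rewrite Rmin_left, Rmax_right in Hc by easy. specialize (P c Hc). nra.
Qed.

Fixpoint rsum (n : nat) (f : nat -> R) : R := match n with O => 0%R | S n => (rsum n f + f n)%R end.

Lemma rsum_le n f c : (forall i, (i < n)%nat -> (f i <= c)%R) -> (rsum n f <= INR n * c)%R.
Proof.
  induction n as [|n IH]; intros H; [simpl; lra|]. rewrite S_INR. simpl.
  specialize (IH (fun i Hi => H i (Nat.lt_lt_succ_r _ _ Hi))). specialize (H n ltac:(lia)). lra.
Qed.

Lemma rsum_term n f i : (forall i, (0 <= f i)%R) -> (i < n)%nat -> (f i <= rsum n f)%R.
Proof.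
  intros P. induction n as [|n IH]; intros Hi; [lia|]. simpl.
  assert (0 <= rsum n f)%R by (clear -P; induction n; simpl; [lra|specialize (P n); lra]).
  destruct (Nat.eq_dec i n) as [->|N]; [lra|]. specialize (IH ltac:(lia)). specialize (P n). lra.
Qed.

Lemma rsum_is_derive n (f : nat -> R -> R) (l : nat -> R) t : (forall i, (i < n)%nat -> is_derive (f i) t (l i)) ->
  is_derive (fun s => rsum n (fun i => f i s)) t (rsum n l).
Proof.
  induction n as [|n IH]; intros H; simpl.
  - apply (is_derive_const (K := R_AbsRing) (V := R_NormedModule)).
  - apply (is_derive_plus (K := R_AbsRing) (V := R_NormedModule)); auto.
Qed.

Lemma Cmod_csum_le n u c : (forall i, (i < n)%nat -> (Cmod (u i) <= c)%R) -> (Cmod (csum n u) <= INR n * c)%R.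
Proof.
  induction n as [|n IH]; intros H; [simpl; rewrite Cmod_0; lra|]. rewrite S_INR. simpl.
  eapply Rle_trans; [apply Cmod_triangle|].
  specialize (IH (fun i Hi => H i (Nat.lt_lt_succ_r _ _ Hi))). specialize (H n ltac:(lia)). lra.
Qed.

(** The energy E, the sum of the |y_i|^2, satisfies E' <= L E, so E e^(-L t) does not increase and
    stays 0. The constant L = 2 n^2 K counts n components with n products |y_j| |A| |y_k| <= K E
    each. *)
Lemma gronwall n (y : nat -> R -> C) (A : nat -> nat -> R -> C) K :
  (forall i j t, (i < n)%nat -> (j < n)%nat -> (0 <= t <= 1)%R -> (Cmod (A i j t) <= K)%R) ->
  (forall i t, (i < n)%nat -> (0 <= t <= 1)%R -> rderive (y i) t (csum n (fun j => A i j t * y j t))) ->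
  (forall i, (i < n)%nat -> y i 0%R = 0) -> forall i, (i < n)%nat -> y i 1%R = 0.
Proof.
  intros HK Hd H0 i Hi.
  assert (K0 : (0 <= K)%R).
  { specialize (HK i i 0%R Hi Hi ltac:(lra)). pose proof (Cmod_ge_0 (A i i 0%R)). lra. }
  set (E := fun t => rsum n (fun i => nrm2 (y i t))).
  set (dE := fun t => rsum n (fun i => (2 * (Re (y i t) * Re (csum n (fun j => A i j t * y j t)%C) + Im (y i t) * Im (csum n (fun j => A i j t * y j t)%C)))%R)).
  assert (DE : forall t, (0 <= t <= 1)%R -> is_derive E t (dE t)).
  { intros t Ht. apply rsum_is_derive. intros j Hj. apply rderive_nrm2. now apply Hd. }
  set (L := (INR n * (2 * (INR n * K)))%R).
  assert (EP : forall t j, (j < n)%nat -> (nrm2 (y j t) <= E t)%R).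
  { intros t j Hj. apply (rsum_term n (fun i => nrm2 (y i t)) j); [|exact Hj].
    intros k. rewrite nrm2_Cmod. pose proof (Cmod_ge_0 (y k t)). nra. }
  assert (BE : forall t, (0 <= t <= 1)%R -> (dE t <= L * E t)%R).
  { intros t Ht. unfold L. rewrite Rmult_assoc. apply rsum_le. intros j Hj.
    eapply Rle_trans; [apply Rle_abs|]. eapply Rle_trans; [apply inner_bound|].
    replace (2 * (INR n * K) * E t)%R with (2 * (INR n * (K * E t)))%R by ring.
    apply Rmult_le_compat_l; [lra|]. rewrite <- Cmod_mult, <- csum_scal.
    apply Cmod_csum_le. intros k Hk. rewrite !Cmod_mult.
    pose proof (EP t j Hj) as E1. pose proof (EP t k Hk) as E2. rewrite nrm2_Cmod in E1, E2.
    pose proof (HK j k t Hj Hk Ht) as HA.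
    pose proof (Cmod_ge_0 (y j t)). pose proof (Cmod_ge_0 (y k t)). pose proof (Cmod_ge_0 (A j k t)).
    assert (Cmod (y j t) * Cmod (y k t) <= E t)%R by nra.
    replace (Cmod (y j t) * (Cmod (A j k t) * Cmod (y k t)))%R with (Cmod (A j k t) * (Cmod (y j t) * Cmod (y k t)))%R by ring.
    apply Rmult_le_compat; auto. nra. }
  assert (M : (- (E 0 * exp (- L * 0)) <= - (E 1 * exp (- L * 1)))%R).
  { apply (deriv_nonneg (fun t => - (E t * exp (- L * t)))%R
      (fun t => - (dE t * exp (- L * t) + E t * (- L * exp (- L * t))))%R); [lra| |].
    - intros t Ht. apply (is_derive_opp (K := R_AbsRing) (V := R_NormedModule) (fun t => (E t * exp (- L * t))%R)).
      apply (is_derive_mult (K := R_AbsRing) E (fun t => exp (- L * t))); [now apply DE| |intros; apply Rmult_comm].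
      auto_derive; [exact I|ring].
    - intros t Ht. pose proof (BE t Ht). pose proof (exp_pos (- L * t)).
      assert (0 <= (L * E t - dE t) * exp (- L * t))%R by (apply Rmult_le_pos; lra). nra. }
  assert (E0 : E 0%R = 0%R).
  { apply Rle_antisym.
    - replace 0%R with (INR n * 0)%R at 2 by ring. apply rsum_le. intros j Hj. rewrite H0 by exact Hj.
      unfold nrm2, Re, Im; simpl. lra.
    - pose proof (EP 0%R i Hi) as Q. rewrite nrm2_Cmod in Q. pose proof (Cmod_ge_0 (y i 0%R)). nra. }
  rewrite E0 in M. pose proof (exp_pos (- L * 1)).
  assert (E1 : (E 1 <= 0)%R) by nra.
  pose proof (EP 1%R i Hi) as Q. rewrite nrm2_Cmod in Q. pose proof (Cmod_ge_0 (y i 1%R)).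
  apply Cmod_eq_0. nra.
Qed.

Lemma line_UH z0 z1 t : UH z0 -> UH z1 -> (0 <= t <= 1)%R -> UH (z0 + RtoC t * (z1 - z0)).
Proof.
  unfold UH. intros H0 H1 Ht.
  replace (Im (z0 + RtoC t * (z1 - z0))) with ((1 - t) * Im z0 + t * Im z1)%R by (unfold Im; simpl; ring).
  destruct (Req_dec t 0) as [->|N]; [lra|].
  assert (0 < t * Im z1)%R by (apply Rmult_lt_0_compat; lra).
  assert (0 <= (1 - t) * Im z0)%R by (apply Rmult_le_pos; lra). lra.
Qed.

Lemma rmax_bound n (P : nat -> R -> Prop) : (forall i K K', P i K -> (K <= K')%R -> P i K') ->
  (forall i, (i < n)%nat -> exists K, P i K) -> exists K, forall i, (i < n)%nat -> P i K.
Proof.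
  intros Mo. induction n as [|n IH]; intros H; [exists 0%R; intros; lia|].
  destruct IH as [K HK]; [intros; apply H; lia|]. destruct (H n ltac:(lia)) as [K' HK'].
  exists (Rmax K K'). intros i Hi. destruct (Nat.eq_dec i n) as [->|N].
  - apply (Mo _ K'); [exact HK'|apply Rmax_r].
  - apply (Mo _ K); [apply HK; lia|apply Rmax_l].
Qed.

(** The half-plane is convex, so z0 is joined to z by a segment, on which the system becomes a real
    one with bounded coefficients. *)
Theorem ode_unique n (y : nat -> C -> C) (A : nat -> nat -> C -> C) z0 :
  (forall i j, (i < n)%nat -> (j < n)%nat -> holo (A i j)) ->
  (forall i z, (i < n)%nat -> UH z -> cderive (y i) z (csum n (fun j => A i j z * y j z))) ->
  UH z0 -> (forall i, (i < n)%nat -> y i z0 = 0) -> forall i z, (i < n)%nat -> UH z -> y i z = 0.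
Proof.
  intros HA Hy Hz0 H0 i z Hi Hz.
  set (p := fun t : R => z0 + RtoC t * (z - z0)).
  assert (BK : exists K, forall i, (i < n)%nat -> forall j, (j < n)%nat -> forall t, (0 <= t <= 1)%R -> (Cmod (A i j (p t) * (z - z0)) <= K)%R).
  { apply rmax_bound.
    - intros i' K K' HK L j Hj t Ht. eapply Rle_trans; [now apply HK|exact L].
    - intros i' Hi'. apply rmax_bound.
      + intros j K K' HK L t Ht. eapply Rle_trans; [now apply HK|exact L].
      + intros j Hj.
        destruct (rcontinuous_bounded (fun t => A i' j (p t) * (z - z0)) 0 1 ltac:(lra)) as [M [_ HM]]; [|now exists M].
        intros t Ht. assert (Up : UH (p t)) by now apply line_UH.
        pose proof (rderive_line (fun w => A i' j w * (z - z0)) z0 (z - z0) t _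
          (cderive_mult _ _ _ _ _ (Cderiv_cderive _ _ (HA i' j Hi' Hj) Up) (cderive_const (z - z0) (p t)))) as R.
        apply (rcontinuous_rderive _ _ _ R). }
  destruct BK as [K HK].
  assert (G := gronwall n (fun i t => y i (p t)) (fun i j t => A i j (p t) * (z - z0)) K).
  cbv beta in G.
  replace z with (p 1%R) by (unfold p; ring).
  apply G; auto.
  - intros i' t Hi' Ht. assert (Up : UH (p t)) by now apply line_UH.
    pose proof (rderive_line (y i') z0 (z - z0) t _ (Hy i' (p t) Hi' Up)) as R.
    replace (csum n (fun j => A i' j (p t) * (z - z0) * y j (p t)))
      with ((z - z0) * csum n (fun j => A i' j (p t) * y j (p t))); [exact R|].
    rewrite <- csum_scal. apply csum_ext. intros; ring.
  - intros i' Hi'. replace (p 0%R) with z0 by (unfold p; ring). now apply H0.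
Qed.

Corollary ode_unique1 (y a : C -> C) z0 : holo a -> (forall z, UH z -> cderive y z (a z * y z)) ->
  UH z0 -> y z0 = 0 -> forall z, UH z -> y z = 0.
Proof.
  intros Ha Hy Hz0 H0 z Hz.
  apply (ode_unique 1 (fun _ => y) (fun _ _ => a) z0) with (i := 0%nat); auto.
  intros i w Hi Hw. simpl. rewrite Cplus_0_l. now apply Hy.
Qed.

(** A coefficient of size O(|q|) is integrable up to the cusp, so a solution that is nonzero at one
    height cannot tend to 0 along the imaginary axis. Applied to e(-lambda0 z) W. *)
Lemma vertical_lower (y a : C -> C) Y0 C0 : (0 < Y0)%R -> (0 <= C0)%R ->
  (forall z, UH z -> cderive y z (a z * y z)) ->
  (forall z, (Y0 <= Im z)%R -> (Cmod (a z) <= C0 * Cmod (ee z))%R) ->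
  y (0%R, Y0) <> 0 -> exists d, (0 < d)%R /\ forall t, (Y0 <= t)%R -> (d <= Cmod (y (0%R, t)))%R.
Proof.
  intros HY0 HC0 Hy Ha N. pose proof PI_RGT_0 as HPI.
  set (E := fun t : R => nrm2 (y (0%R, t))).
  set (g := fun t => exp (- (C0 / PI * exp (- (2 * PI) * t)))).
  set (l := fun t : R => Ci * (a (0%R, t) * y (0%R, t))).
  assert (DE : forall t, (Y0 <= t)%R -> is_derive E t (2 * (Re (y (0%R, t)) * Re (l t) + Im (y (0%R, t)) * Im (l t)))%R).
  { intros t Ht. apply (rderive_nrm2 (fun t => y (0%R, t))). apply rderive_v, Hy. unfold UH, Im; simpl. lra. }
  assert (Dg : forall t, is_derive g t (2 * C0 * exp (- (2 * PI) * t) * g t)%R).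
  { intros t. unfold g. auto_derive; [exact I|]. field. lra. }
  (* Gronwall: the factor [g] compensates the integrable bound on [a]. *)
  assert (Mono : forall t, (Y0 <= t)%R -> (E Y0 * g Y0 <= E t * g t)%R).
  { intros t Ht.
    apply (deriv_nonneg (fun t => E t * g t)%R (fun t => (2 * (Re (y (0%R, t)) * Re (l t) + Im (y (0%R, t)) * Im (l t))) * g t
       + E t * (2 * C0 * exp (- (2 * PI) * t) * g t))%R); [exact Ht| |].
    - intros s Hs. apply (is_derive_mult (K := R_AbsRing) E g); [apply DE; lra|apply Dg|intros; apply Rmult_comm].
    - intros s Hs.
      pose proof (inner_bound (y (0%R, s)) (l s)) as IB. apply Rabs_le_between in IB.
      assert (Gp : (0 < g s)%R) by apply exp_pos.
      assert (Bl : (Cmod (y (0%R, s)) * Cmod (l s) <= C0 * exp (- (2 * PI) * s) * E s)%R).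
      { unfold l, E. rewrite !Cmod_mult, Cmod_Ci, nrm2_Cmod.
        specialize (Ha (0%R, s) ltac:(simpl; lra)). rewrite Cmod_ee in Ha. simpl Im in Ha. unfold Im in Ha; simpl in Ha.
        pose proof (Cmod_ge_0 (y (0%R, s))) as Py.
        replace (Cmod (y (0%R, s)) * (1 * (Cmod (a (0%R, s)) * Cmod (y (0%R, s)))))%R
          with (Cmod (a (0%R, s)) * (Cmod (y (0%R, s)) * Cmod (y (0%R, s))))%R by ring.
        apply Rmult_le_compat_r; [nra|exact Ha]. }
      assert (0 <= (2 * (Re (y (0%R, s)) * Re (l s) + Im (y (0%R, s)) * Im (l s)) + 2 * (C0 * exp (- (2 * PI) * s) * E s)) * g s)%R
        by (apply Rmult_le_pos; lra). lra. }
  assert (P0 : (0 < E Y0 * g Y0)%R).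
  { apply Rmult_lt_0_compat; [|apply exp_pos]. unfold E. rewrite nrm2_Cmod.
    pose proof (proj1 (Cmod_gt_0 _) N). nra. }
  exists (sqrt (E Y0 * g Y0)). split; [now apply sqrt_lt_R0|].
  intros t Ht. specialize (Mono t Ht).
  assert (G1 : (g t <= 1)%R).
  { apply Rle_trans with (exp 0); [|rewrite exp_0; lra]. unfold g.
    assert (Q : (- (C0 / PI * exp (- (2 * PI) * t)) <= 0)%R).
    { pose proof (exp_pos (- (2 * PI) * t)). assert (0 <= C0 / PI)%R by (apply Rdiv_le_0_compat; lra). nra. }
    destruct (Rle_lt_or_eq_dec _ _ Q) as [L| ->]; [|apply Rle_refl]. left. now apply exp_increasing. }
  assert (Et : (0 <= E t)%R) by (unfold E; rewrite nrm2_Cmod; pose proof (Cmod_ge_0 (y (0%R, t))); nra).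
  rewrite <- (sqrt_square (Cmod (y (0%R, t)))) by apply Cmod_ge_0.
  apply sqrt_le_1_alt. rewrite <- nrm2_Cmod. fold (E t).
  assert (Gp : (0 < g t)%R) by apply exp_pos. nra.
Qed.

(** * Determinants *)

Module LA.
Import all_boot all_algebra perm boolp.
Import GRing.Theory.

(** A synonym of [C] that carries the field structure of MathComp, so that its determinants and
    adjugates become available. *)
Definition CC : Type := C.
HB.instance Definition _ := gen_eqMixin CC.
HB.instance Definition _ := gen_choiceMixin CC.

Fact CC_addNr : left_inverse (RtoC 0) Copp Cplus.
Proof. by move=> x; rewrite Cplus_comm Cplus_opp_r. Qed.
HB.instance Definition _ := GRing.isZmodule.Build CC Cplus_assoc Cplus_comm Cplus_0_l CC_addNr.

Fact CC_neq0 : (RtoC 1 : CC) != (RtoC 0 : CC).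
Proof. by apply/eqP; exact: C1_nz. Qed.
Fact CC_mulDl : left_distributive (Cmult : CC -> CC -> CC) Cplus.
Proof. by move=> x y z; rewrite Cmult_plus_distr_r. Qed.
HB.instance Definition _ := GRing.Zmodule_isComNzRing.Build CC Cmult_assoc Cmult_comm Cmult_1_l CC_mulDl CC_neq0.

Local Open Scope ring_scope.

Fact CC_mulVf : forall x : CC, x != 0 -> (Cinv x : CC) * x = 1.
Proof. by move=> x /eqP Hx; rewrite /GRing.mul /=; exact: Cinv_l. Qed.
Fact CC_inv0 : Cinv (0 : CC) = (0 : CC).
Proof. by rewrite /Cinv /= /Rdiv !Rmult_0_l Ropp_0 Rmult_0_l. Qed.
HB.instance Definition _ := GRing.ComNzRing_isField.Build CC CC_mulVf CC_inv0.

Lemma CmultE (a b : CC) : Cmult a b = a * b. Proof. by []. Qed.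

Lemma csumE n (f : nat -> C) : csum n f = \sum_(i < n) (f i : CC).
Proof. by elim: n => [|n IH]; rewrite ?big_ord0 // big_ord_recr /= IH. Qed.

(** The Leibniz rule. The differentiated factor is recognized by its index, hence the hypothesis
    [uniq]. *)
Lemma cderive_prod (I : eqType) (r : seq I) (f : I -> C -> CC) (d : I -> CC) (z : C) : uniq r ->
  (forall i, i \in r -> cderive (f i) z (d i)) ->
  cderive (fun w => \prod_(k <- r) f k w) z (\sum_(i <- r) \prod_(k <- r) (if k == i then d k else f k z)).
Proof.
elim: r => [|x r IH] /=.
  move=> _ _. have -> : (fun w => \prod_(k <- [::]) f k w) = (fun _ => 1 : CC).
    by apply: functional_extensionality => w; rewrite big_nil.
  by rewrite big_nil; exact: cderive_const.
move=> /andP[Hx Hr] H.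
have -> : (fun w => \prod_(k <- x :: r) f k w) = (fun w => Cmult (f x w) (\prod_(k <- r) f k w)).
  by apply: functional_extensionality => w; rewrite big_cons.
have H1 : cderive (f x) z (d x) by apply: H; rewrite mem_head.
have H2 := IH Hr (fun i Hi => H i (mem_behead (s := x :: r) Hi)).
apply: cderive_eq (cderive_mult _ _ _ _ _ H1 H2) _.
rewrite big_cons big_cons eqxx; apply: (f_equal2 Cplus).
  apply: (f_equal2 Cmult) => //. apply: eq_big_seq => k Hk. case: eqP => // E. by rewrite -E Hk in Hx.
rewrite CmultE big_distrr /=. apply: eq_big_seq => i Hi. rewrite big_cons.
case: eqP => // E. by rewrite E Hi in Hx.
Qed.

Lemma cderive_sum (I : Type) (r : seq I) (f : I -> C -> CC) (d : I -> CC) (z : C) :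
  (forall i, cderive (f i) z (d i)) ->
  cderive (fun w => \sum_(k <- r) f k w) z (\sum_(i <- r) d i).
Proof.
move=> H. elim: r => [|x r IH].
  have -> : (fun w => \sum_(k <- [::]) f k w) = (fun _ => 0 : CC).
    by apply: functional_extensionality => w; rewrite big_nil.
  by rewrite big_nil; exact: cderive_const.
have -> : (fun w => \sum_(k <- x :: r) f k w) = (fun w => Cplus (f x w) (\sum_(k <- r) f k w)).
  by apply: functional_extensionality => w; rewrite big_cons.
rewrite big_cons. exact: cderive_plus (H x) IH.
Qed.

Definition repl {n} (X D : 'M[CC]_n) (i : 'I_n) : 'M[CC]_n :=
  \matrix_(k, j) if k == i then D k j else X k j.

Lemma cderive_det n (X : C -> 'M[CC]_n) (D : 'M[CC]_n) z :
  (forall i j, cderive (fun w => X w i j) z (D i j)) ->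
  cderive (fun w => \det (X w)) z (\sum_i \det (repl (X z) D i)).
Proof.
move=> H. rewrite /determinant exchange_big /=.
apply: (cderive_sum _ _ (fun (s : {perm 'I_n}) w => ((-1) ^+ s * \prod_i X w i (s i))) _ z) => s.
rewrite -big_distrr /=. rewrite -CmultE.
apply: cderive_scal.
apply: cderive_eq; first by apply: (cderive_prod _ _ (fun i w => X w i (s i)) (fun i => D i (s i))) => // ; exact: index_enum_uniq.
apply: eq_bigr => i _. apply: eq_bigr => k _. by rewrite !mxE.
Qed.

(** Expansion along row i: the cofactors of that row do not see the replaced entries. *)
Lemma det_repl n (X D : 'M[CC]_n) i : \det (repl X D i) = (D *m \adj X) i i.
Proof.
rewrite (expand_det_row _ i) mxE. apply: eq_bigr => j _.
rewrite !mxE eqxx; congr (_ * _). rewrite /cofactor; congr (_ * \det _).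
apply/matrixP => a b. rewrite !mxE. by rewrite [lift i a == i]eq_sym (negbTE (neq_lift i a)).
Qed.

(** Summing [det_repl] over the rows gives the trace of B X adj(X), and X adj(X) is the scalar
    matrix det X. *)
Lemma cderive_det_liouville n (X : C -> 'M[CC]_n) (B : 'M[CC]_n) z :
  (forall i j, cderive (fun w => X w i j) z ((B *m X z) i j)) ->
  cderive (fun w => \det (X w)) z (\tr B * \det (X z)).
Proof.
move=> H. apply: cderive_eq; first exact: cderive_det H.
transitivity (\tr (B *m X z *m \adj (X z))).
  by apply: eq_bigr => i _; rewrite det_repl.
by rewrite -mulmxA mul_mx_adj mul_mx_scalar linearZ /= mulrC.
Qed.

(** Determinants and cofactors are polynomials in the entries, so they stay in every class of
    functions that contains the constants and is closed under sums and products. The class used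
    later is [cusp_holo]. *)
Section Closed.
Variable Q : (C -> C) -> Prop.
Hypothesis Q0 : forall c : C, Q (fun _ => c).
Hypothesis QD : forall f g, Q f -> Q g -> Q (fun z => Cplus (f z) (g z)).
Hypothesis QM : forall f g, Q f -> Q g -> Q (fun z => Cmult (f z) (g z)).

Lemma Q_sum (I : Type) (r : seq I) (f : I -> C -> CC) :
  (forall i, Q (f i)) -> Q (fun w => \sum_(k <- r) f k w).
Proof.
move=> H. elim: r => [|x r IH].
  have -> : (fun w => \sum_(k <- [::]) f k w) = (fun _ => 0 : CC).
    by apply: functional_extensionality => w; rewrite big_nil.
  exact: Q0.
have -> : (fun w => \sum_(k <- x :: r) f k w) = (fun w => Cplus (f x w) (\sum_(k <- r) f k w)).
  by apply: functional_extensionality => w; rewrite big_cons.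
exact: QD.
Qed.

Lemma Q_prod (I : Type) (r : seq I) (f : I -> C -> CC) :
  (forall i, Q (f i)) -> Q (fun w => \prod_(k <- r) f k w).
Proof.
move=> H. elim: r => [|x r IH].
  have -> : (fun w => \prod_(k <- [::]) f k w) = (fun _ => 1 : CC).
    by apply: functional_extensionality => w; rewrite big_nil.
  exact: Q0.
have -> : (fun w => \prod_(k <- x :: r) f k w) = (fun w => Cmult (f x w) (\prod_(k <- r) f k w)).
  by apply: functional_extensionality => w; rewrite big_cons.
exact: QM.
Qed.

Lemma Q_det n (X : C -> 'M[CC]_n) : (forall i j, Q (fun w => X w i j)) -> Q (fun w => \det (X w)).
Proof.
move=> H. apply: (Q_sum _ _ (fun (s : {perm 'I_n}) w => ((-1) ^+ s * \prod_i X w i (s i)))) => s.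
apply: QM; first exact: Q0. exact: (Q_prod _ _ (fun i w => X w i (s i))).
Qed.

Lemma Q_adj n (X : C -> 'M[CC]_n) : (forall i j, Q (fun w => X w i j)) ->
  forall i j, Q (fun w => (\adj (X w)) i j).
Proof.
move=> H i j.
have -> : (fun w => (\adj (X w)) i j) = (fun w => Cmult ((-1 : CC) ^+ (j + i)) (\det (row' j (col' i (X w))))).
  by apply: functional_extensionality => w; rewrite mxE.
apply: QM; first exact: Q0. apply: Q_det => a b.
have -> : (fun w => row' j (col' i (X w)) a b) = (fun w => X w (lift j a) (lift i b)).
  by apply: functional_extensionality => w; rewrite !mxE.
exact: H.
Qed.
End Closed.

Definition mk n (A : mat) : 'M[CC]_n := \matrix_(i, j) A i j.
Definition cdet n (A : mat) : C := \det (mk n A).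
(** [inord] turns naturals into ordinals and needs a nonempty index type, whence the size [n.+1];
    indices out of range go to 0. *)
Definition cadj n (A : mat) : mat := fun i j => (\adj (mk n.+1 A)) (inord i) (inord j).

Lemma cadj_l n (A : mat) i j : lt i n.+1 -> lt j n.+1 ->
  csum n.+1 (fun l => Cmult (cadj n A i l) (A l j)) = if Nat.eqb i j then cdet n.+1 A else RtoC 0.
Proof.
move=> /ltP Hi /ltP Hj. rewrite csumE.
have /matrixP /(_ (inord i) (inord j)) := mul_adj_mx (mk n.+1 A).
rewrite !mxE => E.
transitivity (\sum_(l < n.+1) (\adj (mk n.+1 A)) (inord i) l * (mk n.+1 A) l (inord j)).
  by apply: eq_bigr => l _; rewrite /cadj inord_val !mxE inordK.
rewrite E. rewrite -val_eqE /= !inordK //.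
have -> : Nat.eqb i j = (i == j) by apply/idP/idP => [/PeanoNat.Nat.eqb_eq ->|/eqP ->] //; exact: PeanoNat.Nat.eqb_refl.
by case: eqP.
Qed.

Lemma cadj_r n (A : mat) i j : lt i n.+1 -> lt j n.+1 ->
  csum n.+1 (fun l => Cmult (A i l) (cadj n A l j)) = if Nat.eqb i j then cdet n.+1 A else RtoC 0.
Proof.
move=> /ltP Hi /ltP Hj. rewrite csumE.
have /matrixP /(_ (inord i) (inord j)) := mul_mx_adj (mk n.+1 A).
rewrite !mxE => E.
transitivity (\sum_(l < n.+1) (mk n.+1 A) (inord i) l * (\adj (mk n.+1 A)) l (inord j)).
  by apply: eq_bigr => l _; rewrite /cadj inord_val !mxE inordK.
rewrite E. rewrite -val_eqE /= !inordK //.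
have -> : Nat.eqb i j = (i == j) by apply/idP/idP => [/PeanoNat.Nat.eqb_eq ->|/eqP ->] //; exact: PeanoNat.Nat.eqb_refl.
by case: eqP.
Qed.

Lemma cdet_left_null n (A : mat) : cdet n.+1 A = RtoC 0 ->
  exists c : nat -> C, (exists i, lt i n.+1 /\ c i <> RtoC 0) /\
    forall j, lt j n.+1 -> csum n.+1 (fun i => Cmult (c i) (A i j)) = RtoC 0.
Proof.
move=> H. have /eqP/det0P [v v0 Hv] : \det (mk n.+1 A) = 0 by [].
exists (fun i => v 0 (inord i)). split.
  case/rV0Pn: v0 => i Hi. exists i. split; first exact/ltP/ltn_ord. rewrite inord_val. by move/eqP: Hi.
move=> j /ltP Hj. rewrite csumE. have /matrixP /(_ 0 (inord j)) := Hv. rewrite !mxE => E.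
rewrite -[RHS]E. apply: eq_bigr => i _. by rewrite inord_val !mxE inordK.
Qed.

Lemma cdet_tr n (A : mat) : cdet n (fun i j => A j i) = cdet n A.
Proof. rewrite /cdet -[RHS]det_tr; apply: (congr1 (fun M : 'M[CC]_n => \det M)); apply/matrixP => i j; by rewrite !mxE. Qed.

Lemma cdet_scale n (A : mat) (d : nat -> C) :
  cdet n (fun i j => Cmult (d i) (A i j)) = Cmult (cprod n d) (cdet n A).
Proof.
rewrite /cdet.
have -> : mk n (fun i j => Cmult (d i) (A i j)) = diag_mx (\row_i (d i : CC)) *m mk n A.
  by apply/matrixP => i j; rewrite mul_diag_mx !mxE.
rewrite det_mulmx det_diag. apply: (f_equal2 Cmult) => // {A}.
elim: n => [|m IH]; first by rewrite big_ord0.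
rewrite big_ord_recr /= -IH. by apply: (f_equal2 Cmult); rewrite ?mxE //; apply: eq_bigr => i _; rewrite !mxE.
Qed.

Lemma cdet_mul n (A B : mat) : cdet n (mmul n A B) = Cmult (cdet n A) (cdet n B).
Proof.
rewrite /cdet. have -> : mk n (mmul n A B) = mk n A *m mk n B.
  by apply/matrixP => i j; rewrite !mxE /mmul csumE; apply: eq_bigr => l _; rewrite !mxE.
by rewrite det_mulmx.
Qed.

Lemma cdet_ext n (A B : mat) : (forall i j, lt i n -> lt j n -> A i j = B i j) -> cdet n A = cdet n B.
Proof.
move=> H. rewrite /cdet. apply: (congr1 (fun M : 'M[CC]_n => \det M)). apply/matrixP => i j. rewrite !mxE. by apply: H; apply/ltP.
Qed.

Lemma cdet_closed (Q : (C -> C) -> Prop) n (A : C -> mat) :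
  (forall c : C, Q (fun _ => c)) -> (forall f g, Q f -> Q g -> Q (fun z => Cplus (f z) (g z))) ->
  (forall f g, Q f -> Q g -> Q (fun z => Cmult (f z) (g z))) ->
  (forall i j, lt i n -> lt j n -> Q (fun w => A w i j)) -> Q (fun w => cdet n (A w)).
Proof.
move=> Q0 QD QM H. apply: Q_det => // i j.
have -> : (fun w => (mk n (A w)) i j) = (fun w => A w i j).
  by apply: functional_extensionality => w; rewrite mxE.
by apply: H; apply/ltP.
Qed.

Lemma cadj_closed (Q : (C -> C) -> Prop) n (A : C -> mat) :
  (forall c : C, Q (fun _ => c)) -> (forall f g, Q f -> Q g -> Q (fun z => Cplus (f z) (g z))) ->
  (forall f g, Q f -> Q g -> Q (fun z => Cmult (f z) (g z))) ->
  (forall i j, lt i n.+1 -> lt j n.+1 -> Q (fun w => A w i j)) -> forall i j, Q (fun w => cadj n (A w) i j).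
Proof.
move=> Q0 QD QM H i' j'. apply: Q_adj => // i j.
have -> : (fun w => (mk n.+1 (A w)) i j) = (fun w => A w i j).
  by apply: functional_extensionality => w; rewrite mxE.
by apply: H; apply/ltP.
Qed.

Lemma cdet_liouville n (A : C -> mat) (B : mat) z :
  (forall i j, lt i n -> lt j n -> cderive (fun w => A w i j) z (csum n (fun l => Cmult (A z i l) (B l j)))) ->
  cderive (fun w => cdet n (A w)) z (Cmult (csum n (fun i => B i i)) (cdet n (A z))).
Proof.
move=> H.
(* The system has the form A' = A B, with one solution per row; transposing it gives the form X' = B
   X of the general formula. *)
have HX : forall i j, cderive (fun w => (mk n (A w))^T i j) z (((mk n B)^T *m (mk n (A z))^T) i j).
  move=> i j.
  have -> : (fun w => ((mk n (A w))^T) i j) = (fun w => A w j i).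
    by apply: functional_extensionality => w; rewrite !mxE.
  apply: cderive_eq; first by apply: H; apply/ltP.
  rewrite csumE mxE. apply: eq_bigr => l _. by rewrite !mxE mulrC.
have := @cderive_det_liouville n (fun w => (mk n (A w))^T) _ z HX.
rewrite det_tr.
have -> : (fun w => \det (mk n (A w))^T) = (fun w => cdet n (A w)).
  by apply: functional_extensionality => w; rewrite det_tr.
suff -> : \tr (mk n B)^T = csum n (fun i => B i i) by [].
rewrite csumE. by apply: eq_bigr => i _; rewrite !mxE.
Qed.
End LA.

(** * The operator D under twists and pull-backs *)

Lemma Dop_tau k f z : Dop k f z = / tau * Cderiv f z + RtoC k * Pfun z * f z.
Proof. reflexivity. Qed.

Lemma smooth_Pfun : smooth Pfun.
Proof. apply smooth_cusp_holo, cusp_holo_Pfun. Qed.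

Lemma smooth_Dop k f : smooth f -> smooth (Dop k f).
Proof.
  intros H. apply (smooth_ext (fun z => / tau * Cderiv f z + RtoC k * Pfun z * f z)); [reflexivity|].
  apply smooth_plus; [apply smooth_scal, smooth_deriv, H|]. apply smooth_mult; [apply smooth_scal, smooth_Pfun|exact H].
Qed.

Lemma smooth_Dpow j k f : smooth f -> smooth (Dpow j k f).
Proof. intros H. induction j as [|j IH]; [exact H|]. simpl. now apply smooth_Dop. Qed.

Lemma Dop_ext k f g z : (forall w, UH w -> f w = g w) -> holo f -> UH z -> Dop k f z = Dop k g z.
Proof. intros E H Hz. rewrite !Dop_tau, (Cderiv_ext f g), E; auto. Qed.

Lemma Dpow_ext j k f g z : (forall w, UH w -> f w = g w) -> smooth f -> UH z -> Dpow j k f z = Dpow j k g z.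
Proof.
  intros E H. revert z. induction j as [|j IH]; intros z Hz; [now apply E|]. simpl.
  apply Dop_ext; auto. apply smooth_holo, smooth_Dpow, H.
Qed.

Lemma csum_Sl n (u : nat -> C) : csum (S n) u = u 0%nat + csum n (fun i => u (S i)).
Proof. induction n as [|n IH]; [simpl; ring|]. simpl in *. rewrite IH. ring. Qed.

Lemma cderive_csum n (f : nat -> C -> C) (l : nat -> C) z : (forall i, (i < n)%nat -> cderive (f i) z (l i)) ->
  cderive (fun w => csum n (fun i => f i w)) z (csum n l).
Proof. induction n as [|n IH]; intros H; simpl; [apply cderive_const|]. apply cderive_plus; auto. Qed.

Lemma holo_csum n (f : nat -> C -> C) : (forall i, (i < n)%nat -> holo (f i)) -> holo (fun z => csum n (fun i => f i z)).
Proof. induction n as [|n IH]; intros H; simpl; [apply holo_const|]. apply holo_plus; auto. Qed.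

Lemma Dop_lin n k c (f : nat -> C -> C) z : (forall i, (i < n)%nat -> holo (f i)) -> UH z ->
  Dop k (fun w => csum n (fun i => c i * f i w)) z = csum n (fun i => c i * Dop k (f i) z).
Proof.
  intros H Hz. rewrite Dop_tau.
  rewrite (Cderiv_unique _ z (csum n (fun i => c i * Cderiv (f i) z))).
  - rewrite <- !csum_scal, <- csum_plus. apply csum_ext. intros i Hi. rewrite Dop_tau. ring.
  - apply (cderive_csum n (fun i w => c i * f i w)). intros i Hi. apply cderive_scal, Cderiv_cderive; auto.
Qed.

Lemma Dpow_lin j n k c (f : nat -> C -> C) : (forall i, (i < n)%nat -> smooth (f i)) -> forall z, UH z ->
  Dpow j k (fun w => csum n (fun i => c i * f i w)) z = csum n (fun i => c i * Dpow j k (f i) z).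
Proof.
  intros H. induction j as [|j IH]; intros z Hz; [reflexivity|]. simpl.
  rewrite (Dop_ext _ _ (fun w => csum n (fun i => c i * Dpow j k (f i) w))); auto.
  - apply (Dop_lin n _ c (fun i => Dpow j k (f i))); auto. intros i Hi. apply smooth_holo, smooth_Dpow, H, Hi.
  - apply smooth_holo, smooth_Dpow. apply (smooth_csum n (fun i w => c i * f i w)). intros i Hi. apply smooth_scal, H, Hi.
Qed.

Lemma Cderiv_Dpow j k f z : tau * (Dpow (S j) k f z - RtoC (k + 2 * INR j) * Pfun z * Dpow j k f z) = Cderiv (Dpow j k f) z.
Proof. simpl. rewrite Dop_tau. field. apply tau_neq0. Qed.

Lemma cderive_Dpow j k f z : smooth f -> UH z ->
  cderive (Dpow j k f) z (tau * (Dpow (S j) k f z - RtoC (k + 2 * INR j) * Pfun z * Dpow j k f z)).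
Proof. intros H Hz. rewrite Cderiv_Dpow. apply Cderiv_cderive; [apply smooth_holo, smooth_Dpow, H|exact Hz]. Qed.

(** The conjugate of D_k by multiplication with e(l z). It preserves q-series, which the untwisted
    components of F0 are not. *)
Definition twist_D (l k : R) (g : C -> C) : C -> C :=
  fun z => / tau * Cderiv g z + (RtoC l + RtoC k * Pfun z) * g z.
Fixpoint twist_Dpow (j : nat) (l k : R) (g : C -> C) : C -> C :=
  match j with O => g | S j' => twist_D l (k + 2 * INR j') (twist_Dpow j' l k g) end.

Lemma cusp_holo_twist_D l k g : cusp_holo g -> cusp_holo (twist_D l k g).
Proof.
  intros H. apply cusp_holo_plus; [apply cusp_holo_scal, cusp_holo_deriv, H|]. apply cusp_holo_mult; [|exact H].
  apply cusp_holo_plus; [apply cusp_holo_const|]. apply cusp_holo_scal, cusp_holo_Pfun.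
Qed.

Lemma cusp_holo_twist_Dpow j l k g : cusp_holo g -> cusp_holo (twist_Dpow j l k g).
Proof. intros H. induction j as [|j IH]; [exact H|]. simpl. now apply cusp_holo_twist_D. Qed.

Lemma Dop_twist l k g z : holo g -> UH z ->
  Dop k (fun w => ee (RtoC l * w) * g w) z = ee (RtoC l * z) * twist_D l k g z.
Proof.
  intros H Hz. rewrite Dop_tau. unfold twist_D.
  rewrite (Cderiv_unique _ z (tau * RtoC l * ee (RtoC l * z) * g z + ee (RtoC l * z) * Cderiv g z)).
  - field. apply tau_neq0.
  - apply (cderive_mult (fun w => ee (RtoC l * w))); [apply cderive_ee_scal|now apply Cderiv_cderive].
Qed.

Lemma Dpow_twist j l k g : cusp_holo g -> forall z, UH z ->
  Dpow j k (fun w => ee (RtoC l * w) * g w) z = ee (RtoC l * z) * twist_Dpow j l k g z.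
Proof.
  intros H. induction j as [|j IH]; intros z Hz; [reflexivity|]. simpl.
  rewrite (Dop_ext _ _ (fun w => ee (RtoC l * w) * twist_Dpow j l k g w)); auto.
  - apply Dop_twist; auto. apply cusp_holo_holo, cusp_holo_twist_Dpow, H.
  - apply smooth_holo, smooth_Dpow, smooth_mult; [apply smooth_ee_scal|now apply smooth_cusp_holo].
Qed.

(* Vanishes for all [g] exactly when [P] is quasi-modular of weight 2. *)
Definition P_defect (g : SL2Z) (z : C) : C :=
  Pfun (mob g z) * (/ jfac g z * / jfac g z) + (- 1 * Pfun z + RtoC (IZR (sc g)) * / tau * / jfac g z).

Lemma smooth_P_defect g : smooth (P_defect g).
Proof.
  apply smooth_plus; [apply smooth_mult; [apply smooth_mob, smooth_Pfun|apply smooth_mult; apply smooth_jinv]|].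
  apply smooth_plus; [apply smooth_scal, smooth_Pfun|]. apply smooth_mult; [apply smooth_const|apply smooth_jinv].
Qed.

Lemma Cpow_S2 (w : C) k : w <> 0 -> Cpow w (k + 2) = Cpow w k * (w * w).
Proof.
  intros H. rewrite Cpow_add. f_equal. replace 2%R with (1 + 1)%R by ring.
  now rewrite Cpow_add, Cpow_1.
Qed.

(** This is D_k with P replaced by P + [P_defect g], that is, the pull-back of D_k by g. *)
Definition defect_D (g : SL2Z) (k : R) (f : C -> C) : C -> C := fun z => Dop k f z + RtoC k * P_defect g z * f z.
Fixpoint defect_Dpow (g : SL2Z) (j : nat) (k : R) (f : C -> C) : C -> C :=
  match j with O => f | S j' => defect_D g (k + 2 * INR j') (defect_Dpow g j' k f) end.

Lemma smooth_defect_D g k f : smooth f -> smooth (defect_D g k f).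
Proof.
  intros H. apply smooth_plus; [now apply smooth_Dop|]. apply smooth_mult; [apply smooth_scal, smooth_P_defect|exact H].
Qed.

Lemma smooth_defect_Dpow g j k f : smooth f -> smooth (defect_Dpow g j k f).
Proof. intros H. induction j as [|j IH]; [exact H|]. simpl. now apply smooth_defect_D. Qed.

(** Differentiating the transformation law, the derivative of (cz + d)^k produces the term k c/(cz +
    d), which [P_defect] absorbs together with the change of P. *)
Lemma Dop_trans g k chi f ft : holo f -> holo ft ->
  (forall z, UH z -> f (mob g z) = chi * Cpow (jfac g z) k * ft z) ->
  forall z, UH z -> Dop k f (mob g z) = chi * Cpow (jfac g z) (k + 2) * defect_D g k ft z.
Proof.
  intros Hf Hft E z Hz. pose proof (jfac_neq0 g z Hz) as N.
  pose proof (cderive_comp f (mob g) z _ _ (Cderiv_cderive f _ Hf (UH_mob g z Hz)) (cderive_mob g z Hz)) as D1.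
  pose proof (cderive_mult _ _ _ _ _ (cderive_mult _ _ _ _ _ (cderive_const chi z) (cderive_Cpow_jfac g k z Hz)) (Cderiv_cderive ft z Hft Hz)) as D2.
  pose proof (cderive_unique _ _ _ _ (cderive_ext_UH _ _ _ _ Hz E D1) D2) as Q. cbv beta in Q.
  assert (Q' : Cderiv f (mob g z) = chi * Cpow (jfac g z) k * (jfac g z * jfac g z) *
     (RtoC k * RtoC (IZR (sc g)) / jfac g z * ft z + Cderiv ft z)).
  { replace (Cderiv f (mob g z)) with ((jfac g z * jfac g z) * (/ (jfac g z * jfac g z) * Cderiv f (mob g z))) by (field; exact N).
    rewrite Q. field. exact N. }
  unfold defect_D, P_defect. rewrite !Dop_tau, Q', E, Cpow_S2 by auto. field. split; [exact N|apply tau_neq0].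
Qed.

Lemma Dpow_trans g j k chi f ft : smooth f -> smooth ft ->
  (forall z, UH z -> f (mob g z) = chi * Cpow (jfac g z) k * ft z) ->
  forall z, UH z -> Dpow j k f (mob g z) = chi * Cpow (jfac g z) (k + 2 * INR j) * defect_Dpow g j k ft z.
Proof.
  intros Hf Hft E. induction j as [|j IH]; intros z Hz.
  - simpl. rewrite Rmult_0_r, Rplus_0_r. now apply E.
  - rewrite S_INR. replace (k + 2 * (INR j + 1))%R with (k + 2 * INR j + 2)%R by ring.
    simpl. apply Dop_trans; auto; apply smooth_holo; [now apply smooth_Dpow|now apply smooth_defect_Dpow].
Qed.

(** The two top coefficients are all that the comparison of operators requires. Each step
    contributes its weight times the defect to the coefficient of D^(n-1), and k + (k+2) + ... + (k
    + 2(n-1)) = n k + n(n-1). *)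
Lemma defect_D_expand g n k : exists e : nat -> C -> C,
  (forall i, smooth (e i)) /\ (forall z, UH z -> e n z = 1) /\ (forall i z, (n < i)%nat -> UH z -> e i z = 0) /\
  (forall m z, n = S m -> UH z -> e m z = RtoC (INR n * k + INR n * INR m) * P_defect g z) /\
  (forall f, smooth f -> forall z, UH z -> defect_Dpow g n k f z = csum (S n) (fun i => e i z * Dpow i k f z)).
Proof.
  induction n as [|n [e [Hs [H1 [H0 [HQ He]]]]]].
  - exists (fun i _ => if Nat.eqb i 0 then 1 else 0). repeat split.
    + intros i. apply smooth_const.
    + intros i z Hi _. destruct i; [lia|reflexivity].
    + intros m z E. lia.
    + intros f Hf z Hz. simpl. ring.
  (* From D_(k+2n)(e D^i f) = e D^(i+1) f + (e'/tau + 2(n - i) P e) D^i f: the weights k + 2n of the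
     operator and k + 2i of D^i f differ by 2(n - i). The last summand of [b] is the defect term. *)
  - set (b := fun i z => / tau * Cderiv (e i) z + (RtoC (2 * (INR n - INR i)) * Pfun z + RtoC (k + 2 * INR n) * P_defect g z) * e i z).
    set (e' := fun i z => match i with O => RtoC 0 | S i' => e i' z end + b i z).
    assert (Sb : forall i, smooth (b i)).
    { intros i. apply smooth_plus; [apply smooth_scal, smooth_deriv, Hs|]. apply smooth_mult; [|apply Hs].
      apply smooth_plus; apply smooth_scal; [apply smooth_Pfun|apply smooth_P_defect]. }
    assert (Db : forall i z, (n < i)%nat -> UH z -> b i z = 0).
    { intros i z Hi Hz. unfold b. rewrite H0 by auto.
      rewrite (Cderiv_unique _ z 0); [ring|]. apply (cderive_ext_UH (fun _ => 0)); auto; [|apply cderive_const].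
      intros w Hw. symmetry. now apply H0. }
    assert (Dn : forall z, UH z -> b n z = RtoC (k + 2 * INR n) * P_defect g z).
    { intros z Hz. unfold b. rewrite H1 by auto.
      rewrite (Cderiv_unique _ z 0).
      - replace (2 * (INR n - INR n))%R with 0%R by ring. ring.
      - apply (cderive_ext_UH (fun _ => 1)); auto; [|apply cderive_const]. intros w Hw. symmetry. now apply H1. }
    exists e'. split; [|split; [|split; [|split]]].
    + intros i. apply smooth_plus; [|apply Sb]. destruct i; [apply smooth_const|apply Hs].
    + intros z Hz. unfold e'. rewrite Db, H1 by (auto; lia). ring.
    + intros i z Hi Hz. unfold e'. rewrite Db by (auto; lia). destruct i; [lia|]. rewrite H0 by (auto; lia). ring.
    + intros m z E Hz. injection E as <-. unfold e'. rewrite Dn by auto.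
      destruct n as [|n].
      * simpl INR. rewrite Cplus_0_l. f_equal. f_equal. ring.
      * rewrite (HQ n z eq_refl Hz). rewrite !S_INR.
        replace ((INR n + 1 + 1) * k + (INR n + 1 + 1) * (INR n + 1))%R
          with (((INR n + 1) * k + (INR n + 1) * INR n) + (k + 2 * (INR n + 1)))%R by ring.
        rewrite (RtoC_plus ((INR n + 1) * k + (INR n + 1) * INR n)). ring.
    + intros f Hf z Hz. simpl defect_Dpow. unfold defect_D.
      assert (SD : forall i, smooth (Dpow i k f)) by (intros; now apply smooth_Dpow).
      rewrite (Dop_ext _ _ (fun w => csum (S n) (fun i => e i w * Dpow i k f w))); auto.
      2:{ apply smooth_holo. now apply smooth_defect_Dpow. }
      rewrite He by auto. rewrite Dop_tau.
      rewrite (Cderiv_unique _ z (csum (S n) (fun i => Cderiv (e i) z * Dpow i k f z + e i z * Cderiv (Dpow i k f) z))).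
      2:{ apply (cderive_csum (S n) (fun i w => e i w * Dpow i k f w)). intros i _.
          apply cderive_mult; apply Cderiv_cderive; auto; apply smooth_holo; auto. }
      rewrite <- !csum_scal, <- !csum_plus.
      rewrite (csum_ext _ _ (fun i => e i z * Dpow (S i) k f z + b i z * Dpow i k f z)).
      * unfold e'. rewrite csum_plus.
        rewrite (csum_ext (S (S n)) _ (fun i => match i with O => RtoC 0 | S i' => e i' z * Dpow (S i') k f z end + b i z * Dpow i k f z)).
        2:{ intros i _. destruct i; ring. }
        rewrite csum_plus.
        change (csum (S (S n)) (fun i => b i z * Dpow i k f z)) with (csum (S n) (fun i => b i z * Dpow i k f z) + b (S n) z * Dpow (S n) k f z).
        rewrite (Db (S n)) by (auto; lia).
        rewrite (csum_Sl (S n) (fun i => match i with O => RtoC 0 | S i' => e i' z * Dpow (S i') k f z end)).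
        ring.
      * intros i _. rewrite <- (Cderiv_Dpow i k f z). unfold b.
        rewrite !RtoC_mult, !RtoC_plus, !RtoC_mult, RtoC_minus. field. apply tau_neq0.
Qed.

(** * Diagonalization of rho(T) *)

Lemma mid_csum n i (u : nat -> C) : (i < n)%nat -> csum n (fun j => mid i j * u j) = u i.
Proof.
  intros Hi. rewrite (csum_single n i); [|exact Hi|].
  - unfold mid. rewrite Nat.eqb_refl. ring.
  - intros j Hj N. unfold mid. destruct (Nat.eqb_spec i j); [congruence|ring].
Qed.

Lemma csum_assoc n m (a : nat -> C) (B : mat) (c : nat -> C) :
  csum n (fun l => a l * csum m (fun j => B l j * c j)) = csum m (fun j => csum n (fun l => a l * B l j) * c j).
Proof.
  transitivity (csum n (fun l => csum m (fun j => a l * B l j * c j))).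
  - apply csum_ext. intros l _. rewrite <- csum_scal. apply csum_ext. intros; ring.
  - rewrite csum_swap. apply csum_ext. intros j _.
    rewrite (Cmult_comm _ (c j)), <- csum_scal. apply csum_ext. intros; ring.
Qed.

Lemma mmul_id_vec n (A B : mat) (v : vec) i : meq n (mmul n A B) mid -> (i < n)%nat ->
  csum n (fun l => A i l * csum n (fun j => B l j * v j)) = v i.
Proof.
  intros H Hi. rewrite csum_assoc, <- (mid_csum n i v Hi). apply csum_ext. intros j Hj.
  rewrite <- (H i j Hi Hj). reflexivity.
Qed.

Lemma cdet_inv n (A B : mat) : meq (S n) (mmul (S n) A B) mid -> LA.cdet (S n) A <> 0.
Proof.
  intros H E. destruct (LA.cdet_left_null n A E) as [c [[i [Hi Ci0]] Hc]]. apply Ci0.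
  rewrite <- (mid_csum (S n) i c Hi).
  transitivity (csum (S n) (fun j => c j * csum (S n) (fun l => A j l * B l i))).
  - apply csum_ext. intros j Hj. pose proof (H j i Hj Hi) as Q. unfold mmul in Q. rewrite Q.
    unfold mid. rewrite Nat.eqb_sym. ring.
  - rewrite csum_assoc. apply csum_0. intros j Hj. rewrite Hc by exact Hj. ring.
Qed.

Lemma cdet_nonzero_inv n (A : mat) : LA.cdet (S n) A <> 0 ->
  exists B, meq (S n) (mmul (S n) A B) mid /\ meq (S n) (mmul (S n) B A) mid.
Proof.
  intros N. exists (fun i j => / LA.cdet (S n) A * LA.cadj n A i j). split; intros i j Hi Hj; unfold mmul.
  - transitivity (/ LA.cdet (S n) A * csum (S n) (fun l => A i l * LA.cadj n A l j)).
    + rewrite <- csum_scal. apply csum_ext. intros; ring.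
    + rewrite LA.cadj_r by auto. unfold mid. destruct (Nat.eqb i j); field; exact N.
  - transitivity (/ LA.cdet (S n) A * csum (S n) (fun l => LA.cadj n A i l * A l j)).
    + rewrite <- csum_scal. apply csum_ext. intros; ring.
    + rewrite LA.cadj_l by auto. unfold mid. destruct (Nat.eqb i j); field; exact N.
Qed.

(** Applying A - mu_k to a relation removes the last vector and multiplies the other coefficients by
    the nonzero numbers mu_i - mu_k. *)
Lemma eigen_indep n (A : mat) (mu : nat -> C) (v : nat -> vec) k :
  (forall i j, (i < k)%nat -> (j < k)%nat -> mu i = mu j -> i = j) ->
  (forall j, (j < k)%nat -> ~ veq n (v j) vzero /\ veq n (mapp n A (v j)) (fun i => mu j * v j i)) ->
  forall c : nat -> C, (forall i, (i < n)%nat -> csum k (fun j => c j * v j i) = 0) -> forall j, (j < k)%nat -> c j = 0.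
Proof.
  induction k as [|k IH]; intros Hmu Hv c Hc j Hj; [lia|].
  assert (L : forall j, (j < k)%nat -> c j = 0).
  { intros i Hi.
    assert (E : (mu i - mu k) * c i = 0).
    { rewrite Cmult_comm. apply (IH (fun i j Hi Hj => Hmu i j (Nat.lt_lt_succ_r _ _ Hi) (Nat.lt_lt_succ_r _ _ Hj))
        (fun j Hj => Hv j (Nat.lt_lt_succ_r _ _ Hj)) (fun i => c i * (mu i - mu k))); [|exact Hi].
      intros l Hl.
      assert (A0 : csum n (fun p => A l p * csum (S k) (fun j => c j * v j p)) = 0).
      { apply csum_0. intros p Hp. rewrite Hc by exact Hp. ring. }
      assert (A1 : csum (S k) (fun j => c j * (mu j * v j l)) = 0).
      { rewrite <- A0.
        transitivity (csum (S k) (fun j => csum n (fun p => A l p * (c j * v j p)))).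
        - apply csum_ext. intros p Hp. rewrite <- (proj2 (Hv p Hp) l Hl). unfold mapp.
          rewrite <- csum_scal. apply csum_ext. intros; ring.
        - rewrite csum_swap. apply csum_ext. intros p _. apply csum_scal. }
      pose proof (Hc l Hl) as A2. simpl in A1, A2.
      transitivity (csum k (fun j => c j * (mu j * v j l)) - mu k * csum k (fun j => c j * v j l)).
      - rewrite <- csum_scal, <- csum_minus. apply csum_ext. intros; ring.
      - replace (csum k (fun j => c j * (mu j * v j l))) with (- (c k * (mu k * v k l)))
          by (rewrite <- (Cplus_0_r (- _)), <- A1; ring).
        replace (csum k (fun j => c j * v j l)) with (- (c k * v k l)) by (rewrite <- (Cplus_0_r (- _)), <- A2; ring).
        ring. }
    destruct (classic (c i = 0)) as [Z|Z]; [exact Z|exfalso].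
    apply (Cmult_neq_0 (mu i - mu k) (c i)); auto. apply Cminus_eq_contra. intros Q.
    specialize (Hmu i k ltac:(lia) ltac:(lia) Q). lia. }
  destruct (Nat.eq_dec j k) as [->|N]; [|apply L; lia].
  destruct (classic (c k = 0)) as [Z|Z]; [exact Z|exfalso].
  apply (proj1 (Hv k Hj)). intros i Hi. specialize (Hc i Hi). simpl in Hc.
  rewrite csum_0, Cplus_0_l in Hc.
  - unfold vzero. destruct (classic (v k i = 0)) as [Z'|Z']; [exact Z'|]. exfalso. now apply (Cmult_neq_0 (c k) (v k i)).
  - intros l Hl. rewrite L by exact Hl. ring.
Qed.

(** [U] is the inverse of the matrix of eigenvectors, so its rows are left eigenvectors of A; they
    combine the components of a vector-valued form into eigenfunctions of the translation. *)
Lemma eigen_diag n (A : mat) (mu : nat -> C) :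
  (forall i j, (i < S n)%nat -> (j < S n)%nat -> mu i = mu j -> i = j) ->
  (forall j, (j < S n)%nat -> eigenvalue (S n) A (mu j)) ->
  exists U V : mat, meq (S n) (mmul (S n) U V) mid /\ meq (S n) (mmul (S n) V U) mid /\
    forall i j, (i < S n)%nat -> (j < S n)%nat -> csum (S n) (fun l => U i l * A l j) = mu i * U i j.
Proof.
  intros Hmu He.
  set (v := fun j => epsilon (inhabits vzero) (fun v => ~ veq (S n) v vzero /\ veq (S n) (mapp (S n) A v) (fun i => mu j * v i))).
  assert (Hv : forall j, (j < S n)%nat -> ~ veq (S n) (v j) vzero /\ veq (S n) (mapp (S n) A (v j)) (fun i => mu j * v j i)).
  { intros j Hj. unfold v. apply epsilon_spec. apply (He j Hj). }
  assert (N : LA.cdet (S n) (fun i j => v j i) <> 0).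
  { intros E. rewrite (LA.cdet_tr (S n) (fun i j => v i j)) in E.
    destruct (LA.cdet_left_null n _ E) as [c [[i [Hi Ci0]] Hc]]. apply Ci0.
    apply (eigen_indep (S n) A mu v (S n)); auto. }
  destruct (cdet_nonzero_inv n _ N) as [U [H1 H2]].
  exists U, (fun i j => v j i). split; [exact H2|split; [exact H1|]].
  intros i j Hi Hj.
  (* The spectral decomposition: A is the sum over p of mu_p times the column v_p times the row p of
     U. *)
  assert (EA : forall l, (l < S n)%nat -> A l j = csum (S n) (fun p => mu p * v p l * U p j)).
  { intros l Hl.
    transitivity (csum (S n) (fun p => csum (S n) (fun q => A l q * v p q) * U p j)).
    - rewrite <- (csum_assoc (S n) (S n) (fun q => A l q) (fun q p => v p q) (fun p => U p j)).
      rewrite (csum_single (S n) j); [|exact Hj|].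
      + pose proof (H1 j j Hj Hj) as Q. unfold mmul in Q. rewrite Q. unfold mid. rewrite Nat.eqb_refl. ring.
      + intros q Hq Nq. pose proof (H1 q j Hq Hj) as Q. unfold mmul in Q. rewrite Q. unfold mid.
        destruct (Nat.eqb_spec q j); [congruence|ring].
    - apply csum_ext. intros p Hp. pose proof (proj2 (Hv p Hp) l Hl) as Q. unfold mapp in Q. rewrite Q. reflexivity. }
  rewrite (csum_ext _ _ (fun l => U i l * csum (S n) (fun p => v p l * (mu p * U p j)))).
  2:{ intros l Hl. rewrite EA by exact Hl. f_equal. apply csum_ext. intros; ring. }
  rewrite csum_assoc.
  rewrite (csum_ext _ _ (fun p => mid i p * (mu p * U p j))).
  - now rewrite mid_csum.
  - intros p Hp. pose proof (H2 i p Hi Hp) as Q. unfold mmul in Q. rewrite Q. reflexivity.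
Qed.

(** * Growth at the cusp, modular forms as q-series, and the exponents *)

Lemma poly_exp (N : nat) (A del eps : R) : (0 <= A)%R -> (0 < del)%R -> (0 < eps)%R ->
  exists Y0 : R, (0 <= Y0)%R /\ forall y, (Y0 < y)%R -> (A * y ^ N <= eps * exp (del * y))%R.
Proof.
  intros HA Hd He.
  assert (HN : (0 < INR (S N))%R) by (apply lt_0_INR; lia).
  (* With this b, raising 1 + b y <= e^(b y) to the power N + 1 bounds y^(N+1) by e^(del y); the
     extra power of y absorbs the constants A and eps. *)
  set (b := (del / INR (S N))%R). assert (Hb : (0 < b)%R) by (apply Rdiv_lt_0_compat; lra).
  set (kap := (b ^ S N)%R). assert (Hk : (0 < kap)%R) by now apply pow_lt.
  exists (A / (eps * kap))%R. split; [apply Rdiv_le_0_compat; [lra|nra]|].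
  intros y Hy.
  assert (Py : (0 < y)%R).
  { eapply Rle_lt_trans; [|exact Hy]. apply Rdiv_le_0_compat; [lra|nra]. }
  assert (E : (kap * y * y ^ N <= exp (del * y))%R).
  { replace (del * y)%R with (INR (S N) * (b * y))%R by (unfold b; field; lra).
    rewrite exp_INR. replace (kap * y * y ^ N)%R with ((b * y) ^ S N)%R by (unfold kap; rewrite Rpow_mult_distr; simpl; ring).
    apply pow_incr. split; [nra|]. pose proof (exp_ineq1_le (b * y)). lra. }
  apply Rle_trans with (eps * (kap * y * y ^ N))%R; [|apply Rmult_le_compat_l; lra].
  replace (eps * (kap * y * y ^ N))%R with (eps * kap * y * y ^ N)%R by ring.
  apply Rmult_le_compat_r; [apply pow_le; lra|].
  apply Rmult_lt_compat_l with (r := (eps * kap)%R) in Hy; [|nra].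
  replace (eps * kap * (A / (eps * kap)))%R with A in Hy by (field; nra). lra.
Qed.

(** Here l < 1 is essential: |e(-l z)| = e^(2 pi l Im z) leaves a factor e^(2 pi (1 - l) Im z)
    against which polynomial growth is negligible. *)
Lemma mod_growth_below_pole (h : C -> C) (l : R) : (l < 1)%R -> (exists (c : R) (N : nat) (A : R), (0 <= A)%R /\ forall z, UH z -> (c < Im z)%R -> (Cmod (h z) <= A * Im z ^ N)%R) ->
  below_pole (fun z => ee (- RtoC l * z) * h z).
Proof.
  intros Hl [c [N [A [HA H]]]] eps He. pose proof PI_RGT_0 as HPI.
  destruct (poly_exp N A (2 * PI * (1 - l)) eps HA ltac:(nra) He) as [Y0 [PY HY]].
  exists (Rmax Y0 c). intros z Hz Hm.
  assert (H1 : (Y0 < Im z)%R) by (eapply Rle_lt_trans; [apply Rmax_l|exact Hm]).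
  assert (H2 : (c < Im z)%R) by (eapply Rle_lt_trans; [apply Rmax_r|exact Hm]).
  rewrite Cmod_mult, Cmod_ee.
  replace (- (2 * PI) * Im (- RtoC l * z))%R with (2 * PI * l * Im z)%R by (unfold Im; simpl; ring).
  replace (2 * PI * Im z)%R with (2 * PI * l * Im z + 2 * PI * (1 - l) * Im z)%R by ring.
  rewrite exp_plus.
  replace (eps * (exp (2 * PI * l * Im z) * exp (2 * PI * (1 - l) * Im z)))%R
    with (exp (2 * PI * l * Im z) * (eps * exp (2 * PI * (1 - l) * Im z)))%R by ring.
  apply Rmult_le_compat_l; [left; apply exp_pos|].
  eapply Rle_trans; [apply H; auto|]. now apply HY.
Qed.

Lemma cusp_bounded_growth f : cusp_bounded f -> mod_growth f.
Proof.
  intros [B [Y0 H]]. exists (Rmax (Rmax Y0 B) 0), 1%nat. intros x y Hy Hc.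
  assert (H1 : (Rmax Y0 B < y)%R) by (eapply Rle_lt_trans; [apply Rmax_l|exact Hc]).
  pose proof (Rmax_l Y0 B). pose proof (Rmax_r Y0 B).
  eapply Rle_trans; [apply H; unfold UH, Im; simpl; lra|]. simpl. lra.
Qed.

Lemma growth_csum n (c : nat -> C) (f : nat -> C -> C) : (forall i, (i < n)%nat -> mod_growth (f i)) ->
  exists (c0 : R) (N : nat) (A : R), (0 <= A)%R /\ forall z, UH z -> (c0 < Im z)%R ->
    (Cmod (csum n (fun i => c i * f i z)%C) <= A * Im z ^ N)%R.
Proof.
  induction n as [|n IH]; intros H.
  - exists 0%R, 0%nat, 0%R. split; [lra|]. intros. simpl. rewrite Cmod_0. lra.
  - destruct IH as [c0 [N [A [HA H1]]]]; [auto|].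
    destruct (H n ltac:(lia)) as [c1 [N1 H2]].
    exists (Rmax (Rmax c0 c1) 1), (N + N1)%nat, (A + Cmod (c n))%R.
    pose proof (Cmod_ge_0 (c n)) as Pc. split; [lra|]. intros z Hz Hm.
    assert (M1 : (1 < Im z)%R) by (eapply Rle_lt_trans; [apply Rmax_r|exact Hm]).
    assert (M2 : (Rmax c0 c1 < Im z)%R) by (eapply Rle_lt_trans; [apply Rmax_l|exact Hm]).
    pose proof (Rmax_l c0 c1). pose proof (Rmax_r c0 c1).
    simpl. eapply Rle_trans; [apply Cmod_triangle|]. rewrite Cmod_mult, Rmult_plus_distr_r.
    specialize (H1 z Hz ltac:(lra)).
    assert (H3a : (Cmod (f n z) <= Im z ^ N1)%R).
    { destruct z as [x y]. apply H2; unfold UH, Im in *; simpl in *; lra. }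
    assert (Q1 : (Im z ^ N <= Im z ^ (N + N1))%R) by (apply Rle_pow; [lra|lia]).
    assert (Q2 : (Im z ^ N1 <= Im z ^ (N + N1))%R) by (apply Rle_pow; [lra|lia]).
    apply Rplus_le_compat.
    + eapply Rle_trans; [exact H1|]. now apply Rmult_le_compat_l.
    + apply Rmult_le_compat_l; lra.
Qed.

Lemma ModForm_trans k f g z : ModForm k f -> UH z -> f (mob g z) = Cpow (jfac g z) (IZR k) * f z.
Proof.
  intros [_ [_ H]] Hz. rewrite <- (H g z Hz), Cpow_opp. field. apply Cpow_neq0.
Qed.

Lemma ModForm_periodic k f : ModForm k f -> periodic f.
Proof.
  intros H z Hz. rewrite <- mob_T, (ModForm_trans k f sT z H Hz), jfac_T, Cpow_base1. ring.
Qed.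

Lemma mod_growth_cusp_holo f : holo f -> periodic f -> mod_growth f -> cusp_holo f.
Proof.
  intros H1 H2 [c [N H3]]. apply cusp_holo_intro_below_pole; auto.
  assert (S : below_pole (fun z => ee (- RtoC 0 * z) * f z)).
  { apply mod_growth_below_pole; [lra|]. exists c, N, 1%R. split; [lra|]. intros [x y] Hz Hc.
    rewrite Rmult_1_l. apply H3; [exact Hz|exact Hc]. }
  intros eps He. destruct (S eps He) as [Y0 HY]. exists Y0. intros z Hz Hm. specialize (HY z Hz Hm).
  replace (- RtoC 0 * z) with (RtoC 0) in HY by ring. rewrite ee_0, Cmult_1_l in HY. exact HY.
Qed.

Lemma ModForm_cusp_holo k f : ModForm k f -> cusp_holo f.
Proof. intros H. apply mod_growth_cusp_holo; [apply H|now apply (ModForm_periodic k)|apply H]. Qed.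

Lemma ModForm_intro k f : cusp_holo f -> (forall g z, UH z -> f (mob g z) = Cpow (jfac g z) (IZR k) * f z) -> ModForm k f.
Proof.
  intros H1 H2. split; [now apply cusp_holo_holo|split; [apply cusp_bounded_growth, cusp_holo_cusp_bounded, H1|]].
  intros g z Hz. rewrite H2, Cpow_opp by exact Hz. field. apply Cpow_neq0.
Qed.

Lemma lamt_bound r m j : (0 <= lamt r m j < 1)%R.
Proof.
  unfold lamt. pose proof (base_Int_part (r j + m / 12)). lra.
Qed.

Lemma ee_lamt r m j : ee (RtoC (lamt r m j)) = ee (RtoC (m / 12)) * ee (RtoC (r j)).
Proof.
  unfold lamt. rewrite RtoC_minus, RtoC_plus. unfold Cminus. rewrite !ee_add, ee_opp, ee_IZR. field.
Qed.

Lemma T_exp_mono rho r : T_exponents rho r -> forall i j, (i < j)%nat -> (j < 5)%nat -> (0 <= r i /\ r i < r j /\ r j < 1)%R.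
Proof.
  intros [H0 [H1 [H4 _]]] i j Hij Hj.
  pose proof (H1 0%nat ltac:(lia)). pose proof (H1 1%nat ltac:(lia)). pose proof (H1 2%nat ltac:(lia)). pose proof (H1 3%nat ltac:(lia)).
  destruct i as [|[|[|[|[|i]]]]]; destruct j as [|[|[|[|[|j]]]]]; try lia; lra.
Qed.

Lemma T_exp_inj rho r : T_exponents rho r -> forall i j, (i < 5)%nat -> (j < 5)%nat ->
  ee (RtoC (r i)) = ee (RtoC (r j)) -> i = j.
Proof.
  intros H.
  assert (W : forall i j, (i < j)%nat -> (j < 5)%nat -> ee (RtoC (r i)) <> ee (RtoC (r j))).
  { intros i j Hij Hj E. destruct (T_exp_mono rho r H i j Hij Hj) as [A [B D]].
    assert (E1 : ee (RtoC (r j - r i)) = 1).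
    { rewrite RtoC_minus. unfold Cminus. rewrite ee_add, ee_opp, E. field. apply ee_neq0. }
    destruct (ee_eq1 _ E1) as [_ [n Hn]]. rewrite re_RtoC in Hn.
    assert (0 < IZR n < 1)%R as [L1 L2] by lra. apply lt_IZR in L1, L2. lia. }
  intros i j Hi Hj E. destruct (Nat.lt_trichotomy i j) as [L|[L|L]]; [|exact L|]; exfalso.
  - apply (W i j L Hj E).
  - apply (W j i L Hi (eq_sym E)).
Qed.

(** If the first two exponents both vanished, two of the distinct eigenvalues of rho(T) would
    coincide. Positivity is what permits division by 12 lambda0 in [P_defect_zero]. *)
Lemma lambda0_pos rho r m : T_exponents rho r -> (0 < lambda0 r m)%R.
Proof.
  intros H. destruct (T_exp_mono rho r H 0%nat 1%nat ltac:(lia) ltac:(lia)) as [A [B D]].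
  unfold lambda0.
  pose proof (lamt_bound r m 0). pose proof (lamt_bound r m 1). pose proof (lamt_bound r m 2).
  pose proof (lamt_bound r m 3). pose proof (lamt_bound r m 4).
  destruct (Req_dec (lamt r m 0) 0) as [E0|N0]; [|lra].
  destruct (Req_dec (lamt r m 1) 0) as [E1|N1]; [exfalso|lra].
  assert (Hee : ee (RtoC (r 0%nat)) = ee (RtoC (r 1%nat))).
  { pose proof (ee_lamt r m 0) as Q0. pose proof (ee_lamt r m 1) as Q1. rewrite E0 in Q0. rewrite E1, Q0 in Q1.
    pose proof (ee_neq0 (RtoC (m / 12))) as N.
    replace (ee (RtoC (r 0%nat))) with (/ ee (RtoC (m / 12)) * (ee (RtoC (m / 12)) * ee (RtoC (r 0%nat)))) by (field; exact N).
    rewrite Q1. field. exact N. }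
  apply (T_exp_inj rho r H) in Hee; lia.
Qed.

Lemma fun_choice n (P : nat -> (C -> C) -> Prop) : (forall i, (i < n)%nat -> exists f, P i f) ->
  exists f : nat -> C -> C, forall i, (i < n)%nat -> P i (f i).
Proof.
  intros H. exists (fun i => epsilon (inhabits (fun _ => RtoC 0)) (P i)).
  intros i Hi. apply epsilon_spec. now apply H.
Qed.

(** * The Wronskian and Cramer's rule *)

Section Setting.
Variables (rho : SL2Z -> mat) (ups : SL2Z -> C) (m : R) (r : nat -> R) (F0 : C -> vec) (k0 : R) (U V : mat).
Hypothesis Hrep : is_rep 5 rho.
Hypothesis Hu : forall g, ups g <> 0.
Hypothesis Hcusp : cusp_parameter ups m.
Hypothesis Hr : T_exponents rho r.
Hypothesis Hk0 : (k0 = 12 / 5 * lambda0 r m - 4)%R.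
Hypothesis HF0 : Hsp 5 rho ups k0 F0.
Hypothesis HUV : meq 5 (mmul 5 U V) mid.
Hypothesis HVU : meq 5 (mmul 5 V U) mid.
Hypothesis HU : forall i j, (i < 5)%nat -> (j < 5)%nat -> csum 5 (fun l => U i l * rho sT l j) = ee (RtoC (r i)) * U i j.

Let lam := lamt r m.

Lemma Hsp_trans k F g z i : Hsp 5 rho ups k F -> UH z -> (i < 5)%nat ->
  F (mob g z) i = ups g * Cpow (jfac g z) k * csum 5 (fun l => rho g i l * F z l).
Proof.
  intros [_ H] Hz Hi. pose proof (H g z Hz i Hi) as E. cbv beta in E. unfold mapp in E. rewrite <- E, Cpow_opp.
  field. split; [apply Cpow_neq0|apply Hu].
Qed.

Lemma Hsp_intro k F : (forall i, (i < 5)%nat -> holo (fun z => F z i) /\ mod_growth (fun z => F z i)) ->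
  (forall g z i, UH z -> (i < 5)%nat -> F (mob g z) i = ups g * Cpow (jfac g z) k * csum 5 (fun l => rho g i l * F z l)) ->
  Hsp 5 rho ups k F.
Proof.
  intros H1 H2. split; [exact H1|]. intros g z Hz i Hi. unfold mapp. rewrite (H2 g z i Hz Hi), Cpow_opp.
  field. split; [apply Cpow_neq0|apply Hu].
Qed.

(** Under z -> z + 1 the row i of U F is multiplied by ups(T) e(r_i) = e(lam_i), so division by
    e(lam_i z) leaves a periodic function. *)
Lemma Hsp_twist k F : Hsp 5 rho ups k F -> exists g : nat -> C -> C, forall i, (i < 5)%nat ->
  cusp_holo (g i) /\ forall z, UH z -> csum 5 (fun l => U i l * F z l) = ee (RtoC (lam i) * z) * g i z.
Proof.
  intros HF. apply (fun_choice 5 (fun i g => cusp_holo g /\ forall z, UH z -> csum 5 (fun l => U i l * F z l) = ee (RtoC (lam i) * z) * g z)).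
  intros i Hi.
  set (h := fun z => csum 5 (fun l => U i l * F z l)).
  exists (fun z => ee (- RtoC (lam i) * z) * h z). split.
  - apply cusp_holo_intro_below_pole.
    + apply holo_mult; [apply holo_ee_scal|]. apply (holo_csum 5 (fun l z => U i l * F z l)).
      intros l Hl. apply holo_mult; [apply holo_const|]. apply HF, Hl.
    + intros z Hz.
      assert (E : h (z + 1) = ups sT * (ee (RtoC (r i)) * h z)).
      { unfold h. rewrite <- (mob_T z).
        rewrite (csum_ext _ _ (fun l => ups sT * (U i l * csum 5 (fun j => rho sT l j * F z j)))).
        - rewrite csum_scal, csum_assoc, <- (csum_scal 5 (ee _)). f_equal.
          apply csum_ext. intros j Hj. rewrite HU by auto. ring.
        - intros l Hl. rewrite (Hsp_trans k F sT z l HF Hz Hl), jfac_T, Cpow_base1. ring. }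
      rewrite E, (proj2 Hcusp).
      replace (- RtoC (lam i) * (z + 1)) with (- RtoC (lam i) * z + - RtoC (lam i)) by ring.
      rewrite ee_add, (ee_opp (RtoC (lam i))). unfold lam. rewrite ee_lamt. field.
      split; apply ee_neq0.
    + apply mod_growth_below_pole; [apply lamt_bound|].
      apply (growth_csum 5 (U i) (fun l z => F z l)). intros l Hl. apply HF, Hl.
  - intros z Hz. fold (h z). rewrite Cmult_assoc, <- ee_add.
    replace (RtoC (lam i) * z + - RtoC (lam i) * z) with (RtoC 0) by ring. rewrite ee_0. ring.
Qed.

Lemma V_U (v : vec) i : (i < 5)%nat -> csum 5 (fun l => V i l * csum 5 (fun j => U l j * v j)) = v i.
Proof. intros Hi. now apply mmul_id_vec. Qed.

Lemma detU : LA.cdet 5 U <> 0.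
Proof. now apply (cdet_inv 4 U V). Qed.

Variables (M4 M6 M8 M10 : C -> C).
Hypothesis HM4 : ModForm 4 M4.
Hypothesis HM6 : ModForm 6 M6.
Hypothesis HM8 : ModForm 8 M8.
Hypothesis HM10 : ModForm 10 M10.
Hypothesis Hode : forall i, (i < 5)%nat -> mlde5 k0 M4 M6 M8 M10 (fun z => F0 z i).
Hypothesis Hind : forall c : nat -> C,
        (forall z, UH z -> csum 5 (fun i => Cmult (c i) (F0 z i)) = RtoC 0) ->
        forall i, (i < 5)%nat -> c i = RtoC 0.
Variable g : nat -> C -> C.
Hypothesis Hg : forall i, (i < 5)%nat ->
  cusp_holo (g i) /\ forall z, UH z -> csum 5 (fun l => U i l * F0 z l) = ee (RtoC (lam i) * z) * g i z.

Let f (i : nat) : C -> C := fun z => F0 z i.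
Let Y (z : C) : mat := fun i j => Dpow j k0 (f i) z.
Let W (z : C) : C := LA.cdet 5 (Y z).
Let Gh (z : C) : mat := fun i j => twist_Dpow j (lam i) k0 (g i) z.

Lemma smooth_f i : (i < 5)%nat -> smooth (f i).
Proof.
  intros Hi.
  apply (smooth_ext (fun z => csum 5 (fun l => V i l * (ee (RtoC (lam l) * z) * g l z)))).
  - intros z Hz. rewrite (csum_ext _ _ (fun l => V i l * csum 5 (fun j => U l j * F0 z j))).
    + now apply V_U.
    + intros l Hl. now rewrite (proj2 (Hg l Hl)).
  - apply (smooth_csum 5 (fun l z => V i l * (ee (RtoC (lam l) * z) * g l z))). intros l Hl.
    apply smooth_scal, smooth_mult; [apply smooth_ee_scal|]. apply smooth_cusp_holo, Hg, Hl.
Qed.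

Let mcoef (l : nat) : C -> C := match l with O => M10 | 1%nat => M8 | 2%nat => M6 | 3%nat => M4 | _ => fun _ => RtoC 0 end.
(** The companion matrix of the MLDE, for the system Y' = Y B: the derivative of D^j f is tau
    (D^(j+1) f - (k0 + 2j) P D^j f), and in the last column D^5 f is eliminated by the equation. As
    D^4 does not occur in the MLDE, the diagonal contains only multiples of P. *)
Let B (l j : nat) (z : C) : C := tau * ((if Nat.eqb l (S j) then RtoC 1 else RtoC 0)
   - (if Nat.eqb l j then RtoC (k0 + 2 * INR j) * Pfun z else RtoC 0) - (if Nat.eqb j 4 then mcoef l z else RtoC 0)).

Lemma cusp_holo_mcoef l : cusp_holo (mcoef l).
Proof.
  unfold mcoef. destruct l as [|[|[|[|l]]]]; [apply (ModForm_cusp_holo 10)|apply (ModForm_cusp_holo 8)|apply (ModForm_cusp_holo 6)|apply (ModForm_cusp_holo 4)|apply cusp_holo_const]; assumption.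
Qed.

Lemma holo_B l j : holo (B l j).
Proof.
  unfold B.
  apply (holo_ext (fun z => (tau * (if Nat.eqb l (S j) then RtoC 1 else RtoC 0)) +
    (((tau * (if Nat.eqb l j then - RtoC (k0 + 2 * INR j) else RtoC 0)) * Pfun z) + ((if Nat.eqb j 4 then - tau else RtoC 0) * mcoef l z)))).
  - intros z _. destruct (Nat.eqb l j); destruct (Nat.eqb j 4); ring.
  - apply holo_plus; [apply holo_const|apply holo_plus].
    + apply holo_mult; [apply holo_const|apply cusp_holo_holo, cusp_holo_Pfun].
    + apply holo_mult; [apply holo_const|apply cusp_holo_holo, cusp_holo_mcoef].
Qed.

Lemma Dpow5 i z : (i < 5)%nat -> UH z -> Dpow 5 k0 (f i) z = - (M4 z * Dpow 3 k0 (f i) z + M6 z * Dpow 2 k0 (f i) z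
    + M8 z * Dpow 1 k0 (f i) z + M10 z * f i z).
Proof.
  intros Hi Hz. pose proof (Hode i Hi z Hz) as E. fold (f i) in E.
  change (M10 z * F0 z i) with (M10 z * f i z) in E.
  set (a := Dpow 5 k0 (f i) z) in *. set (b := Dpow 3 k0 (f i) z) in *. set (c := Dpow 2 k0 (f i) z) in *.
  set (d := Dpow 1 k0 (f i) z) in *.
  replace a with ((a + M4 z * b + M6 z * c + M8 z * d + M10 z * f i z) - (M4 z * b + M6 z * c + M8 z * d + M10 z * f i z)) by ring.
  rewrite E. ring.
Qed.

Lemma cderive_Y i j z : (i < 5)%nat -> (j < 5)%nat -> UH z ->
  cderive (fun w => Y w i j) z (csum 5 (fun l => Y z i l * B l j z)).
Proof.
  intros Hi Hj Hz. eapply cderive_eq; [apply cderive_Dpow; [now apply smooth_f|exact Hz]|].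
  unfold Y, B, mcoef. destruct j as [|[|[|[|[|j]]]]]; try lia; cbn [csum Nat.eqb]; try ring.
  rewrite (Dpow5 i z Hi Hz). change (f i z) with (Dpow 0 k0 (f i) z). ring.
Qed.

Lemma W_neq0 z : UH z -> W z <> 0.
Proof.
  intros Hz E. destruct (LA.cdet_left_null 4 (Y z) E) as [c [[i [Hi Ci]] Hc]]. apply Ci.
  apply Hind; [|exact Hi]. intros w Hw.
  (* A left null vector c of Y(z) makes the sum of the c_i f_i a solution whose five initial values
     at z vanish. *)
  set (y := fun (j : nat) (w : C) => csum 5 (fun i => c i * Y w i j)).
  change (y 0%nat w = 0).
  refine (ode_unique 5 y (fun j l => B l j) z (fun j l _ _ => holo_B l j) _ Hz Hc 0%nat w _ Hw); [|lia].
  intros j w' Hj Hw'. unfold y.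
  eapply cderive_eq; [apply (cderive_csum 5 (fun i w => c i * Y w i j)); intros p Hp; apply cderive_scal, (cderive_Y p j); auto|].
  rewrite (csum_assoc 5 5 c (fun l j' => Y w' l j') (fun j' => B j' j w')). apply csum_ext. intros; ring.
Qed.

(** The place where the value of k0 enters: the weights k0, k0 + 2, ..., k0 + 8 add up to 12
    lambda0. *)
Lemma trB z : csum 5 (fun i => B i i z) = - (RtoC (12 * lambda0 r m) * tau * Pfun z).
Proof.
  replace (12 * lambda0 r m)%R with (k0 + (k0 + 2) + (k0 + 4) + (k0 + 6) + (k0 + 8))%R by (rewrite Hk0; field).
  unfold B, mcoef. cbn [csum Nat.eqb].
  replace (INR 0) with 0%R by reflexivity. replace (INR 1) with 1%R by reflexivity.
  replace (INR 2) with 2%R by (simpl; ring). replace (INR 3) with 3%R by (simpl; ring). replace (INR 4) with 4%R by (simpl; ring).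
  rewrite !RtoC_plus, !RtoC_mult. ring.
Qed.

Lemma cderive_W z : UH z -> cderive W z (- (RtoC (12 * lambda0 r m) * tau * Pfun z) * W z).
Proof.
  intros Hz. rewrite <- trB. apply (LA.cdet_liouville 5 Y (fun l j => B l j z)).
  intros i j Hi Hj. now apply cderive_Y.
Qed.

Lemma UY z i j : UH z -> (i < 5)%nat -> csum 5 (fun l => U i l * Y z l j) = ee (RtoC (lam i) * z) * Gh z i j.
Proof.
  intros Hz Hi. unfold Gh. rewrite <- Dpow_twist; [|apply Hg, Hi|exact Hz].
  unfold Y. rewrite <- (Dpow_lin j 5 k0 (U i) f); [|intros; now apply smooth_f|exact Hz].
  apply Dpow_ext; [|apply (smooth_csum 5 (fun l z => U i l * f l z)); intros; apply smooth_scal, smooth_f; auto|exact Hz].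
  intros w Hw. apply Hg; auto.
Qed.

Lemma det_Gh z : UH z -> LA.cdet 5 (Gh z) = LA.cdet 5 U * (ee (- RtoC (lambda0 r m) * z) * W z).
Proof.
  intros Hz. unfold W.
  assert (E : LA.cdet 5 (mmul 5 U (Y z)) = cprod 5 (fun i => ee (RtoC (lam i) * z)) * LA.cdet 5 (Gh z)).
  { rewrite <- LA.cdet_scale. apply LA.cdet_ext. intros i j Hi Hj. unfold mmul. now apply UY. }
  rewrite LA.cdet_mul in E.
  assert (EP : cprod 5 (fun i => ee (RtoC (lam i) * z)) = ee (RtoC (lambda0 r m) * z)).
  { simpl. rewrite Cmult_1_l, <- !ee_add. f_equal. unfold lambda0, lam. rewrite !RtoC_plus. ring. }
  rewrite EP in E.
  replace (LA.cdet 5 U * (ee (- RtoC (lambda0 r m) * z) * LA.cdet 5 (Y z))) with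
    (ee (- RtoC (lambda0 r m) * z) * (LA.cdet 5 U * LA.cdet 5 (Y z))) by ring.
  rewrite E, Cmult_assoc, <- ee_add.
  replace (- RtoC (lambda0 r m) * z + RtoC (lambda0 r m) * z) with (RtoC 0) by ring.
  rewrite ee_0. ring.
Qed.

Lemma cusp_holo_Gh i j : (i < 5)%nat -> cusp_holo (fun z => Gh z i j).
Proof. intros Hi. unfold Gh. apply cusp_holo_twist_Dpow, Hg, Hi. Qed.

Lemma cusp_holo_det_Gh : cusp_holo (fun z => LA.cdet 5 (Gh z)).
Proof.
  apply (LA.cdet_closed cusp_holo 5 Gh); [apply cusp_holo_const|apply cusp_holo_plus|apply cusp_holo_mult|]. intros i j Hi _. now apply cusp_holo_Gh.
Qed.

Lemma det_Gh_neq0 z : UH z -> LA.cdet 5 (Gh z) <> 0.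
Proof.
  intros Hz. rewrite det_Gh by exact Hz. apply Cmult_neq_0; [apply detU|].
  apply Cmult_neq_0; [apply ee_neq0|now apply W_neq0].
Qed.

(** A q-series converges at the cusp uniformly in Re z, so a lower bound along the imaginary axis
    forces a nonzero limit and then holds, up to a factor, in a whole neighbourhood of the cusp. *)
Lemma Cmod_ge_lim (h : C -> C) : cusp_holo h -> (exists d Y1, (0 < d)%R /\ forall t : R, (Y1 <= t)%R -> (d <= Cmod (h (0%R, t)))%R) -> cusp_bounded_below h.
Proof.
  intros Hh [d [Y1 [Hd H]]]. destruct (cusp_holo_lim h Hh) as [l [B0 [PB HB]]].
  assert (Sm0 : forall eps : R, (0 < eps)%R -> exists Y2 : R, (1 <= Y2)%R /\ forall z, (Y2 < Im z)%R -> (Cmod (h z - l) <= eps)%R).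
  { intros eps He. destruct (below_pole_const (RtoC B0) eps He) as [Y2 H2].
    exists (Rmax 1 Y2). split; [apply Rmax_l|]. intros z Hz.
    assert (Z1 : (1 < Im z)%R) by (eapply Rle_lt_trans; [apply Rmax_l|exact Hz]).
    assert (Z2 : (Y2 < Im z)%R) by (eapply Rle_lt_trans; [apply Rmax_r|exact Hz]).
    eapply Rle_trans; [apply HB; lra|]. specialize (H2 z ltac:(unfold UH; lra) Z2).
    rewrite Cmod_R, Rabs_pos_eq in H2 by exact PB. rewrite Cmod_ee.
    apply Rle_trans with (eps * exp (2 * PI * Im z) * exp (- (2 * PI) * Im z))%R.
    - apply Rmult_le_compat_r; [left; apply exp_pos|exact H2].
    - rewrite Rmult_assoc, <- exp_plus. replace (2 * PI * Im z + - (2 * PI) * Im z)%R with 0%R by ring.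
      rewrite exp_0. lra. }
  destruct (Sm0 (d / 4)%R ltac:(lra)) as [Y2 [P2 H2]].
  assert (Hl : (3 * d / 4 <= Cmod l)%R).
  { set (t := (Rmax Y1 Y2 + 1)%R). pose proof (Rmax_l Y1 Y2). pose proof (Rmax_r Y1 Y2).
    specialize (H t ltac:(unfold t; lra)). specialize (H2 (0%R, t) ltac:(unfold Im, t; simpl; lra)).
    pose proof (Cmod_tri3 (h (0%R, t)) l). lra. }
  exists (d / 2)%R, Y2. split; [lra|]. intros z Hz HY. specialize (H2 z HY).
  pose proof (Cmod_tri3 l (h z)) as T. rewrite Cmod_minus_sym in T. lra.
Qed.

Lemma low_det_Gh : cusp_bounded_below (fun z => LA.cdet 5 (Gh z)).
Proof.
  apply Cmod_ge_lim; [apply cusp_holo_det_Gh|].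
  destruct Pfun_lim as [B0 [Y0 [PB [PY HP]]]].
  set (L := lambda0 r m). pose proof (lambda0_pos rho r m Hr) as HL. fold L in HL.
  (* The factor e(-lambda0 z) adds -lambda0 tau to the logarithmic derivative -12 lambda0 tau P of
     W, which turns P into P + 1/12 = O(q). *)
  set (a := fun z => - (RtoC (12 * L) * tau) * (Pfun z + / 12)).
  assert (HW : forall z, UH z -> cderive (fun z => ee (- RtoC L * z) * W z) z (a z * (ee (- RtoC L * z) * W z))).
  { intros z Hz. eapply cderive_eq; [apply (cderive_mult (fun z => ee (- RtoC L * z))); [apply cderive_ee_scal|apply cderive_W, Hz]|].
    unfold a. fold L. rewrite RtoC_mult. field. }
  destruct (vertical_lower (fun z => ee (- RtoC L * z) * W z) a (Y0 + 1) (Cmod (RtoC (12 * L) * tau) * B0)) as [d [Hd H]].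
  - lra.
  - apply Rmult_le_pos; [apply Cmod_ge_0|exact PB].
  - exact HW.
  - intros z Hz. unfold a. rewrite Cmod_mult, Cmod_opp, Rmult_assoc. apply Rmult_le_compat_l; [apply Cmod_ge_0|].
    apply HP. lra.
  - apply Cmult_neq_0; [apply ee_neq0|]. apply W_neq0. unfold UH, Im; simpl. lra.
  - exists (Cmod (LA.cdet 5 U) * d)%R, (Y0 + 1)%R.
    pose proof (proj1 (Cmod_gt_0 _) detU). split; [now apply Rmult_lt_0_compat|].
    intros t Ht. rewrite det_Gh by (unfold UH, Im; simpl; lra). rewrite Cmod_mult.
    apply Rmult_le_compat_l; [lra|]. now apply H.
Qed.

Lemma Y_unique z (a b : nat -> C) : UH z ->
  (forall i, (i < 5)%nat -> csum 5 (fun j => Y z i j * a j) = csum 5 (fun j => Y z i j * b j)) ->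
  forall j, (j < 5)%nat -> a j = b j.
Proof.
  intros Hz H j Hj. destruct (cdet_nonzero_inv 4 (Y z) (W_neq0 z Hz)) as [Bi [_ HB]].
  rewrite <- (mmul_id_vec 5 Bi (Y z) a j HB Hj), <- (mmul_id_vec 5 Bi (Y z) b j HB Hj).
  apply csum_ext. intros l Hl. now rewrite H.
Qed.

(** Row i of U F and row i of U Y carry the same factor e(lam_i z), whatever the weight, because the
    automorphy factor of T is 1. After cancelling it, Cramer's rule for [Gh] takes place entirely
    among q-series. *)
Lemma Y_solve k F : Hsp 5 rho ups k F -> exists M : nat -> C -> C, (forall j, (j < 5)%nat -> cusp_holo (M j)) /\
  forall z i, UH z -> (i < 5)%nat -> F z i = csum 5 (fun j => Y z i j * M j z).
Proof.
  intros HF. destruct (Hsp_twist k F HF) as [h Hh].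
  exists (fun j z => / LA.cdet 5 (Gh z) * csum 5 (fun l => LA.cadj 4 (Gh z) j l * h l z)). split.
  - intros j Hj. apply cusp_holo_mult; [apply cusp_holo_inv; [apply cusp_holo_det_Gh|apply det_Gh_neq0|apply low_det_Gh]|].
    apply (cusp_holo_csum 5 (fun l z => LA.cadj 4 (Gh z) j l * h l z)). intros l Hl. apply cusp_holo_mult; [|apply Hh, Hl].
    apply (LA.cadj_closed cusp_holo 4 Gh); [apply cusp_holo_const|apply cusp_holo_plus|apply cusp_holo_mult|]. intros i' j' Hi' _. now apply cusp_holo_Gh.
  - intros z i Hz Hi.
    set (Mz := fun j => / LA.cdet 5 (Gh z) * csum 5 (fun l => LA.cadj 4 (Gh z) j l * h l z)).
    assert (GM : forall i, (i < 5)%nat -> csum 5 (fun j => Gh z i j * Mz j) = h i z).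
    { intros p Hp. unfold Mz.
      rewrite (csum_ext _ _ (fun j => / LA.cdet 5 (Gh z) * (Gh z p j * csum 5 (fun l => LA.cadj 4 (Gh z) j l * h l z)))) by (intros; ring).
      rewrite csum_scal, csum_assoc.
      rewrite (csum_ext _ _ (fun l => LA.cdet 5 (Gh z) * (mid p l * h l z))).
      - rewrite csum_scal, mid_csum by exact Hp. field. now apply det_Gh_neq0.
      - intros l Hl. rewrite (LA.cadj_r 4) by auto. unfold mid. destruct (Nat.eqb p l); ring. }
    rewrite <- (V_U (fun l => F z l) i Hi). fold (Mz).
    change (csum 5 (fun l => V i l * csum 5 (fun j => U l j * F z j)) = csum 5 (fun j => Y z i j * Mz j)).
    rewrite <- (V_U (fun i => csum 5 (fun j => Y z i j * Mz j)) i Hi).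
    apply csum_ext. intros l Hl. f_equal. rewrite (proj2 (Hh l Hl) z Hz), csum_assoc.
    rewrite <- (GM l Hl), <- csum_scal. apply csum_ext. intros j Hj. rewrite (UY z l j Hz Hl). ring.
Qed.

Lemma rho_cancel ga (v : vec) : (forall i, (i < 5)%nat -> csum 5 (fun l => rho ga i l * v l) = 0) ->
  forall l, (l < 5)%nat -> v l = 0.
Proof.
  intros H l Hl. destruct (proj2 Hrep ga) as [Bi [_ HB]].
  rewrite <- (mmul_id_vec 5 Bi (rho ga) v l HB Hl). apply csum_0. intros i Hi. rewrite H by exact Hi. ring.
Qed.

Let ft (ga : SL2Z) (i : nat) : C -> C := fun z => csum 5 (fun l => rho ga i l * f l z).

Lemma smooth_ft ga i : smooth (ft ga i).
Proof. apply (smooth_csum 5 (fun l z => rho ga i l * f l z)). intros l Hl. now apply smooth_scal, smooth_f. Qed.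

Lemma Dpow_ft ga n i z : UH z -> Dpow n k0 (ft ga i) z = csum 5 (fun l => rho ga i l * Dpow n k0 (f l) z).
Proof. intros Hz. apply (Dpow_lin n 5 k0 (rho ga i) f); auto. intros l Hl. now apply smooth_f. Qed.

Lemma Dpow_mob ga n i z : UH z -> (i < 5)%nat ->
  Dpow n k0 (f i) (mob ga z) = ups ga * Cpow (jfac ga z) (k0 + 2 * INR n) * defect_Dpow ga n k0 (ft ga i) z.
Proof.
  intros Hz Hi. apply Dpow_trans; auto; [now apply smooth_f|apply smooth_ft|].
  intros w Hw. now apply (Hsp_trans k0 F0 ga w i).
Qed.

Lemma Dpow5_ft ga i z : UH z -> Dpow 5 k0 (ft ga i) z = - (M4 z * Dpow 3 k0 (ft ga i) z + M6 z * Dpow 2 k0 (ft ga i) z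
    + M8 z * Dpow 1 k0 (ft ga i) z + M10 z * Dpow 0 k0 (ft ga i) z).
Proof.
  intros Hz. rewrite !Dpow_ft by exact Hz.
  rewrite (csum_ext 5 (fun l => rho ga i l * Dpow 5 k0 (f l) z) (fun l => rho ga i l * - (M4 z * Dpow 3 k0 (f l) z + M6 z * Dpow 2 k0 (f l) z
    + M8 z * Dpow 1 k0 (f l) z + M10 z * Dpow 0 k0 (f l) z))).
  - rewrite <- !csum_scal, <- !csum_plus.
    replace (- csum 5 (fun i0 => M4 z * (rho ga i i0 * Dpow 3 k0 (f i0) z) + M6 z * (rho ga i i0 * Dpow 2 k0 (f i0) z)
       + M8 z * (rho ga i i0 * Dpow 1 k0 (f i0) z) + M10 z * (rho ga i i0 * Dpow 0 k0 (f i0) z)))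
     with (-1 * csum 5 (fun i0 => M4 z * (rho ga i i0 * Dpow 3 k0 (f i0) z) + M6 z * (rho ga i i0 * Dpow 2 k0 (f i0) z)
       + M8 z * (rho ga i i0 * Dpow 1 k0 (f i0) z) + M10 z * (rho ga i i0 * Dpow 0 k0 (f i0) z))) by ring.
    rewrite <- csum_scal. apply csum_ext. intros l _. ring.
  - intros l Hl. now rewrite Dpow5.
Qed.

(* The operator of the MLDE and its pull-back by [ga] have the same solutions, hence the same
   coefficient of [D^4]; for the pull-back it is [12 lambda0] times the defect of [P]. *)
Lemma P_defect_zero ga z : UH z -> P_defect ga z = 0.
Proof.
  intros Hz.
  destruct (defect_D_expand ga 5 k0) as [e5 [_ [E51 [_ [E5Q E5]]]]].
  destruct (defect_D_expand ga 3 k0) as [e3 [_ [E31 [_ [_ E3]]]]].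
  destruct (defect_D_expand ga 2 k0) as [e2 [_ [E21 [_ [_ E2]]]]].
  destruct (defect_D_expand ga 1 k0) as [e1 [_ [E11 [_ [_ E1]]]]].
  (* The coefficients of D^n in the pulled-back operator minus the MLDE. Both have top coefficient
     1, so order 5 drops out, and order 4 receives a contribution from D^5 only. *)
  set (E' := fun n : nat => match n with
    | O => e5 0%nat z + M4 z * e3 0%nat z + M6 z * e2 0%nat z + M8 z * e1 0%nat z + M10 z - M10 z
    | 1%nat => e5 1%nat z + M4 z * e3 1%nat z + M6 z * e2 1%nat z + M8 z * e1 1%nat z - M8 z
    | 2%nat => e5 2%nat z + M4 z * e3 2%nat z + M6 z * e2 2%nat z - M6 z
    | 3%nat => e5 3%nat z + M4 z * e3 3%nat z - M4 z
    | _ => e5 4%nat z end).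
  assert (Z : forall i, (i < 5)%nat -> csum 5 (fun n => Dpow n k0 (ft ga i) z * E' n) = 0).
  { intros i Hi.
    pose proof (Hode i Hi (mob ga z) (UH_mob ga z Hz)) as O.
    change (fun z => F0 z i) with (f i) in O. change (f i (mob ga z)) with (Dpow 0 k0 (f i) (mob ga z)) in O.
    rewrite !Dpow_mob in O by auto.
    rewrite (ModForm_trans 4 M4), (ModForm_trans 6 M6), (ModForm_trans 8 M8), (ModForm_trans 10 M10) in O by auto.
    set (J := Cpow (jfac ga z)) in *.
    assert (JJ : forall a b c : R, (a + b = c)%R -> J a * J b = J c).
    { intros a b c <-. unfold J. now rewrite Cpow_add. }
    set (c := (k0 + 2 * INR 5)%R) in *.
    assert (H4 : J 4%R * J (k0 + 2 * INR 3)%R = J c) by (apply JJ; unfold c; simpl; ring).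
    assert (H6 : J 6%R * J (k0 + 2 * INR 2)%R = J c) by (apply JJ; unfold c; simpl; ring).
    assert (H8 : J 8%R * J (k0 + 2 * INR 1)%R = J c) by (apply JJ; unfold c; simpl; ring).
    assert (H10 : J 10%R * J (k0 + 2 * INR 0)%R = J c) by (apply JJ; unfold c; simpl; ring).
    set (q5 := defect_Dpow ga 5 k0 (ft ga i) z) in *. set (q3 := defect_Dpow ga 3 k0 (ft ga i) z) in *.
    set (q2 := defect_Dpow ga 2 k0 (ft ga i) z) in *. set (q1 := defect_Dpow ga 1 k0 (ft ga i) z) in *.
    set (q0 := defect_Dpow ga 0 k0 (ft ga i) z) in *.
    (* Every summand of the MLDE has weight k0 + 10, so one nonzero automorphy factor splits off. *)
    assert (O' : (ups ga * J c) * (q5 + M4 z * q3 + M6 z * q2 + M8 z * q1 + M10 z * q0) = 0).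
    { rewrite <- O.
      transitivity (ups ga * J c * q5 + M4 z * (ups ga * (J 4%R * J (k0 + 2 * INR 3)%R) * q3)
       + M6 z * (ups ga * (J 6%R * J (k0 + 2 * INR 2)%R) * q2) + M8 z * (ups ga * (J 8%R * J (k0 + 2 * INR 1)%R) * q1)
       + M10 z * (ups ga * (J 10%R * J (k0 + 2 * INR 0)%R) * q0)).
      - rewrite H4, H6, H8, H10. ring.
      - ring. }
    assert (L : q5 + M4 z * q3 + M6 z * q2 + M8 z * q1 + M10 z * q0 = 0).
    { destruct (classic (q5 + M4 z * q3 + M6 z * q2 + M8 z * q1 + M10 z * q0 = 0)) as [X|X]; [exact X|exfalso].
      revert O'. apply Cmult_neq_0; [|exact X]. apply Cmult_neq_0; [apply Hu|apply Cpow_neq0]. }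
    rewrite <- L. unfold q5, q3, q2, q1, q0.
    rewrite E5, E3, E2, E1 by (auto; apply smooth_ft). cbn [csum].
    rewrite (Dpow5_ft ga i z Hz), E51 by exact Hz. change (defect_Dpow ga 0 k0 (ft ga i) z) with (Dpow 0 k0 (ft ga i) z).
    unfold E'. ring. }
  assert (Z2 : forall l, (l < 5)%nat -> csum 5 (fun n => Y z l n * E' n) = 0).
  { apply (rho_cancel ga (fun l => csum 5 (fun n => Y z l n * E' n))). intros i Hi. rewrite <- (Z i Hi), csum_assoc. apply csum_ext. intros n Hn.
    rewrite Dpow_ft by exact Hz. reflexivity. }
  assert (E4 : E' 4%nat = 0).
  { apply (Y_unique z E' (fun _ => 0) Hz); [|lia]. intros i Hi. rewrite Z2 by exact Hi.
    symmetry. apply csum_0. intros; ring. }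
  unfold E' in E4. rewrite (E5Q 4%nat z eq_refl Hz) in E4.
  destruct (classic (P_defect ga z = 0)) as [X|X]; [exact X|exfalso]. revert E4. apply Cmult_neq_0; [|exact X].
  intros E. apply RtoC_inj in E. pose proof (lambda0_pos rho r m Hr). simpl in E. lra.
Qed.

Lemma defect_Dpow_Dpow ga n k h z : smooth h -> UH z -> defect_Dpow ga n k h z = Dpow n k h z.
Proof.
  intros Hh. revert z. induction n as [|n IH]; intros z Hz; [reflexivity|]. simpl. unfold defect_D.
  rewrite P_defect_zero by exact Hz.
  rewrite (Dop_ext _ (defect_Dpow ga n k h) (Dpow n k h)); auto; [ring|]. apply smooth_holo. now apply smooth_defect_Dpow.
Qed.

Lemma Y_mob ga n i z : UH z -> (i < 5)%nat ->
  Y (mob ga z) i n = ups ga * Cpow (jfac ga z) (k0 + 2 * INR n) * csum 5 (fun l => rho ga i l * Y z l n).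
Proof.
  intros Hz Hi. unfold Y. rewrite Dpow_mob by auto. f_equal.
  rewrite defect_Dpow_Dpow; [|apply smooth_ft|exact Hz]. now apply Dpow_ft.
Qed.

Lemma cusp_bounded_ee_scal (l : R) : (0 <= l)%R -> cusp_bounded (fun z => ee (RtoC l * z)).
Proof.
  intros Hl. exists 1%R, 0%R. intros z Hz _. rewrite Cmod_ee, <- exp_0. pose proof PI_RGT_0. unfold UH in Hz.
  replace (Im (RtoC l * z)) with (l * Im z)%R by (unfold Im; simpl; ring).
  assert (Q : (- (2 * PI) * (l * Im z) <= 0)%R) by (assert (0 <= l * Im z)%R by (apply Rmult_le_pos; lra); nra).
  destruct (Rle_lt_or_eq_dec _ _ Q) as [L| ->]; [left; now apply exp_increasing|apply Rle_refl].
Qed.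

Lemma cusp_bounded_ext h1 h2 : (forall z, UH z -> h1 z = h2 z) -> cusp_bounded h1 -> cusp_bounded h2.
Proof. intros E [b [y H]]. exists b, y. intros z Hz Hy. rewrite <- E by exact Hz. now apply H. Qed.

Lemma cusp_bounded_csum n (h : nat -> C -> C) : (forall i, (i < n)%nat -> cusp_bounded (h i)) -> cusp_bounded (fun z => csum n (fun i => h i z)).
Proof.
  induction n as [|n IH]; intros H; simpl; [apply cusp_holo_cusp_bounded, cusp_holo_const|]. apply cusp_bounded_plus; auto.
Qed.

(** Uses lam_l >= 0: the factors e(lam_l z) are bounded, so undoing the diagonalization keeps D^n F0
    bounded at the cusp and gives moderate growth. *)
Lemma cusp_bounded_Y i n : (i < 5)%nat -> cusp_bounded (fun z => Y z i n).
Proof.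
  intros Hi. apply (cusp_bounded_ext (fun z => csum 5 (fun l => V i l * (ee (RtoC (lam l) * z) * Gh z l n)))).
  - intros z Hz. rewrite <- (V_U (fun p => Y z p n) i Hi). apply csum_ext. intros l Hl. now rewrite UY.
  - apply (cusp_bounded_csum 5 (fun l z => V i l * (ee (RtoC (lam l) * z) * Gh z l n))). intros l Hl.
    apply cusp_bounded_mult; [apply cusp_holo_cusp_bounded, cusp_holo_const|]. apply cusp_bounded_mult; [apply cusp_bounded_ee_scal, lamt_bound|].
    apply cusp_holo_cusp_bounded. now apply cusp_holo_Gh.
Qed.

(** The number J of terms is arbitrary, since an element of R F0 may involve derivatives of any
    order. *)
Lemma Hsp_comb J (M : nat -> C -> C) (n : Z) :
  (forall j, (j < J)%nat -> ModForm (n - 2 * Z.of_nat j) (M j)) ->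
  Hsp 5 rho ups (k0 + IZR n) (fun z i => csum J (fun j => M j z * DpowV j k0 F0 z i)).
Proof.
  intros HM. apply Hsp_intro.
  - intros i Hi. split.
    + apply (holo_csum J (fun j z => M j z * Y z i j)). intros j Hj. apply holo_mult; [apply HM, Hj|].
      apply smooth_holo. apply (smooth_Dpow j k0 (f i)). now apply smooth_f.
    + apply cusp_bounded_growth. apply (cusp_bounded_csum J (fun j z => M j z * Y z i j)). intros j Hj.
      apply cusp_bounded_mult; [apply cusp_holo_cusp_bounded, (ModForm_cusp_holo _ _ (HM j Hj))|now apply cusp_bounded_Y].
  - intros ga z i Hz Hi.
    transitivity (csum J (fun j => (ups ga * Cpow (jfac ga z) (k0 + IZR n)) * csum 5 (fun l => rho ga i l * (M j z * Y z l j)))).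
    + apply csum_ext. intros j Hj. change (DpowV j k0 F0 (mob ga z) i) with (Y (mob ga z) i j).
      rewrite Y_mob, (ModForm_trans _ _ ga z (HM j Hj)) by auto.
      replace (k0 + IZR n)%R with (IZR (n - 2 * Z.of_nat j) + (k0 + 2 * INR j))%R.
      * rewrite (Cpow_add _ (IZR (n - 2 * Z.of_nat j))).
        rewrite (csum_ext 5 (fun l => rho ga i l * (M j z * Y z l j)) (fun l => M j z * (rho ga i l * Y z l j))) by (intros; ring).
        rewrite csum_scal. ring.
      * rewrite minus_IZR, mult_IZR, INR_IZR_INZ. ring.
    + rewrite csum_scal. f_equal. rewrite csum_swap. apply csum_ext. intros l Hl. now rewrite csum_scal.
Qed.

Lemma Hsp_Dpow n : Hsp 5 rho ups (k0 + 2 * INR n) (DpowV n k0 F0).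
Proof.
  apply Hsp_intro.
  - intros i Hi. split.
    + apply smooth_holo. apply (smooth_Dpow n k0 (f i)). now apply smooth_f.
    + apply cusp_bounded_growth. apply (cusp_bounded_Y i n Hi).
  - intros ga z i Hz Hi. now apply Y_mob.
Qed.

Lemma Y_modular n F : Hsp 5 rho ups (k0 + IZR n) F -> exists M : nat -> C -> C,
  (forall j, (j < 5)%nat -> ModForm (n - 2 * Z.of_nat j) (M j)) /\
  forall z i, UH z -> (i < 5)%nat -> F z i = csum 5 (fun j => M j z * DpowV j k0 F0 z i).
Proof.
  intros HF. destruct (Y_solve _ F HF) as [M [QM HM]]. exists M. split.
  - assert (T : forall ga z j, UH z -> (j < 5)%nat -> Cpow (jfac ga z) (2 * INR j) * M j (mob ga z) = Cpow (jfac ga z) (IZR n) * M j z).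
    { intros ga z j Hz Hj.
      apply (Y_unique z (fun j => Cpow (jfac ga z) (2 * INR j) * M j (mob ga z)) (fun j => Cpow (jfac ga z) (IZR n) * M j z) Hz); [|exact Hj].
      intros i Hi. apply Ceq_minus. revert i Hi.
      apply (rho_cancel ga (fun i => csum 5 (fun j => Y z i j * (Cpow (jfac ga z) (2 * INR j) * M j (mob ga z))) -
          csum 5 (fun j => Y z i j * (Cpow (jfac ga z) (IZR n) * M j z)))).
      intros i Hi.
      pose proof (Hsp_trans _ F ga z i HF Hz Hi) as E1.
      rewrite (HM (mob ga z) i (UH_mob ga z Hz) Hi) in E1.
      (* Two ways to write F(ga z): expand at ga z and transform Y, or transform F and expand at
         z. *)
      assert (E2 : (ups ga * Cpow (jfac ga z) k0) * csum 5 (fun l => rho ga i l * csum 5 (fun j => Y z l j * (Cpow (jfac ga z) (2 * INR j) * M j (mob ga z)))) =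
        (ups ga * Cpow (jfac ga z) k0) * csum 5 (fun l => rho ga i l * csum 5 (fun j => Y z l j * (Cpow (jfac ga z) (IZR n) * M j z)))).
      { transitivity (csum 5 (fun j => Y (mob ga z) i j * M j (mob ga z))).
        - rewrite csum_assoc, <- csum_scal. apply csum_ext. intros p Hp. rewrite Y_mob, Cpow_add by auto. ring.
        - rewrite E1, Cpow_add.
          rewrite (csum_ext 5 (fun l => rho ga i l * F z l) (fun l => rho ga i l * csum 5 (fun j => Y z l j * M j z))).
          + rewrite (csum_ext 5 (fun l => rho ga i l * csum 5 (fun j => Y z l j * (Cpow (jfac ga z) (IZR n) * M j z)))
               (fun l => Cpow (jfac ga z) (IZR n) * (rho ga i l * csum 5 (fun j => Y z l j * M j z)))).
            * rewrite csum_scal. ring.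
            * intros l Hl. rewrite (csum_ext 5 _ (fun j => Cpow (jfac ga z) (IZR n) * (Y z l j * M j z))) by (intros; ring).
              rewrite csum_scal. ring.
          + intros l Hl. now rewrite HM. }
      assert (N : ups ga * Cpow (jfac ga z) k0 <> 0) by (apply Cmult_neq_0; [apply Hu|apply Cpow_neq0]).
      set (X1 := csum 5 (fun l => rho ga i l * csum 5 (fun j => Y z l j * (Cpow (jfac ga z) (2 * INR j) * M j (mob ga z))))) in *.
      set (X2 := csum 5 (fun l => rho ga i l * csum 5 (fun j => Y z l j * (Cpow (jfac ga z) (IZR n) * M j z)))) in *.
      transitivity (X1 - X2).
      - unfold X1, X2. rewrite <- csum_minus. apply csum_ext. intros l Hl. ring.
      - replace X1 with (/ (ups ga * Cpow (jfac ga z) k0) * (ups ga * Cpow (jfac ga z) k0 * X1)).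
        + rewrite E2. field. split; [apply Cpow_neq0|apply Hu].
        + field. split; [apply Cpow_neq0|apply Hu]. }
    intros j Hj. apply ModForm_intro; [now apply QM|]. intros ga z Hz.
    specialize (T ga z j Hz Hj).
    replace (IZR (n - 2 * Z.of_nat j)) with (IZR n + - (2 * INR j))%R by (rewrite minus_IZR, mult_IZR, INR_IZR_INZ; ring).
    rewrite Cpow_add, Cpow_opp.
    replace (M j (mob ga z)) with (/ Cpow (jfac ga z) (2 * INR j) * (Cpow (jfac ga z) (2 * INR j) * M j (mob ga z)))
      by (field; apply Cpow_neq0).
    rewrite T. field. apply Cpow_neq0.
  - intros z i Hz Hi. rewrite (HM z i Hz Hi). apply csum_ext. intros j Hj. unfold DpowV. fold (f i). unfold Y. ring.
Qed.

Lemma comb_unique z (a b : nat -> C) : UH z ->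
  (forall i, (i < 5)%nat -> csum 5 (fun j => a j * DpowV j k0 F0 z i) = csum 5 (fun j => b j * DpowV j k0 F0 z i)) ->
  forall j, (j < 5)%nat -> a j = b j.
Proof.
  intros Hz H. apply (Y_unique z a b Hz). intros i Hi.
  rewrite (csum_ext 5 (fun j => Y z i j * a j) (fun j => a j * DpowV j k0 F0 z i)) by (intros; unfold DpowV, Y, f; ring).
  rewrite (csum_ext 5 (fun j => Y z i j * b j) (fun j => b j * DpowV j k0 F0 z i)) by (intros; unfold DpowV, Y, f; ring).
  now apply H.
Qed.
End Setting.

(** * Forms for the modular group *)

(** The constant term of a q-series. The rate O(|q|) is part of the definition because value 0 must
    permit division by q. *)
Definition cusp_value (f : C -> C) (l : C) : Prop := exists B : R, (0 <= B)%R /\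
  forall z, (1 <= Im z)%R -> (Cmod (f z - l) <= B * Cmod (ee z))%R.

Lemma ee_le1 z : (1 <= Im z)%R -> (Cmod (ee z) <= 1)%R.
Proof. intros H. left. apply ee_lt1. unfold UH. lra. Qed.

Lemma cusp_value_cusp_holo f : cusp_holo f -> exists l, cusp_value f l.
Proof. intros H. destruct (cusp_holo_lim f H) as [l [B HB]]. exists l, B. exact HB. Qed.

Lemma ee_small (B eps Y0 : R) : (0 <= B)%R -> (0 < eps)%R -> exists z, UH z /\ (1 <= Im z)%R /\ (Y0 < Im z)%R /\ (B * Cmod (ee z) <= eps)%R.
Proof.
  intros PB He. destruct (below_pole_const (RtoC B) eps He) as [Y2 H2].
  set (y := (Rmax 1 (Rmax Y0 Y2) + 1)%R).
  pose proof (Rmax_l 1 (Rmax Y0 Y2)). pose proof (Rmax_r 1 (Rmax Y0 Y2)). pose proof (Rmax_l Y0 Y2). pose proof (Rmax_r Y0 Y2).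
  assert (A : (1 < y /\ Y0 < y /\ Y2 < y)%R) by (unfold y; lra). destruct A as [A1 [A2 A3]].
  exists (0%R, y).
  assert (U0 : UH (0%R, y)) by (unfold UH, Im; simpl; lra).
  repeat split; try exact U0; try (unfold Im; simpl; lra).
  specialize (H2 (0%R, y) U0 A3). rewrite Cmod_R, Rabs_pos_eq in H2 by exact PB. rewrite Cmod_ee.
  apply Rle_trans with (eps * exp (2 * PI * Im (0%R, y)) * exp (- (2 * PI) * Im (0%R, y)))%R.
  - apply Rmult_le_compat_r; [left; apply exp_pos|exact H2].
  - rewrite Rmult_assoc, <- exp_plus. replace (2 * PI * Im (0%R, y) + - (2 * PI) * Im (0%R, y))%R with 0%R by ring.
    rewrite exp_0. lra.
Qed.

Lemma cusp_value_near f l B Y0 l' : cusp_value f l -> (0 <= B)%R -> (forall z, (Y0 < Im z)%R -> (Cmod (f z - l') <= B * Cmod (ee z))%R) -> l = l'.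
Proof.
  intros [disc_coefs [P1 H1]] PB H2. apply Ceq_minus, Cmod_eq_0, Rle_antisym; [|apply Cmod_ge_0].
  apply le_epsilon. intros eps He. rewrite Rplus_0_l.
  destruct (ee_small (disc_coefs + B) eps Y0 ltac:(lra) He) as [z [Hz [I1 [I2 E]]]].
  specialize (H1 z I1). specialize (H2 z I2).
  replace (l - l') with (- (f z - l) + (f z - l')) by ring.
  eapply Rle_trans; [apply Cmod_triangle|]. rewrite Cmod_opp. lra.
Qed.

Lemma cusp_value_unique f l l' : cusp_value f l -> cusp_value f l' -> l = l'.
Proof.
  intros H [B [PB HB]]. apply (cusp_value_near f l B 1 l' H PB). intros z Hz. apply HB. lra.
Qed.

Lemma cusp_value_ext f g l : (forall z, UH z -> f z = g z) -> cusp_value f l -> cusp_value g l.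
Proof. intros E [B [PB H]]. exists B. split; [exact PB|]. intros z Hz. rewrite <- E by (unfold UH; lra). now apply H. Qed.

Lemma cusp_value_const c : cusp_value (fun _ => c) c.
Proof.
  exists 0%R. split; [lra|]. intros z _. replace (c - c) with (RtoC 0) by ring. rewrite Cmod_0. lra.
Qed.

Lemma cusp_value_plus f g l k : cusp_value f l -> cusp_value g k -> cusp_value (fun z => f z + g z) (l + k).
Proof.
  intros [B [PB H]] [B' [PB' H']]. exists (B + B')%R. split; [lra|]. intros z Hz.
  replace (f z + g z - (l + k)) with ((f z - l) + (g z - k)) by ring.
  eapply Rle_trans; [apply Cmod_triangle|]. specialize (H z Hz). specialize (H' z Hz). lra.
Qed.

Lemma cusp_value_mult f g l k : cusp_value f l -> cusp_value g k -> cusp_value (fun z => f z * g z) (l * k).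
Proof.
  intros [B [PB H]] [B' [PB' H']]. pose proof (Cmod_ge_0 l) as Pl. pose proof (Cmod_ge_0 k) as Pk.
  exists (B * (Cmod k + B') + Cmod l * B')%R. split.
  { apply Rplus_le_le_0_compat; apply Rmult_le_pos; lra. }
  intros z Hz. specialize (H z Hz). specialize (H' z Hz).
  pose proof (ee_le1 z Hz) as E1. pose proof (Cmod_ge_0 (ee z)) as E0.
  replace (f z * g z - l * k) with ((f z - l) * g z + l * (g z - k)) by ring.
  eapply Rle_trans; [apply Cmod_triangle|]. rewrite !Cmod_mult.
  assert (G : (Cmod (g z) <= Cmod k + B')%R).
  { pose proof (Cmod_tri3 (g z) k). assert (B' * Cmod (ee z) <= B' * 1)%R by (apply Rmult_le_compat_l; lra). lra. }
  assert (Cmod (f z - l) * Cmod (g z) <= (B * Cmod (ee z)) * (Cmod k + B'))%R by (apply Rmult_le_compat; auto using Cmod_ge_0).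
  assert (Cmod l * Cmod (g z - k) <= Cmod l * (B' * Cmod (ee z)))%R by (apply Rmult_le_compat_l; lra). lra.
Qed.

Lemma cusp_value_scal c f l : cusp_value f l -> cusp_value (fun z => c * f z) (c * l).
Proof. intros H. apply cusp_value_mult; [apply cusp_value_const|exact H]. Qed.

Lemma cusp_value_deriv f : cusp_holo f -> cusp_value (Cderiv f) 0.
Proof.
  intros H. destruct (cusp_holo_deriv_lim f H) as [B [PB HB]]. exists B. split; [exact PB|]. intros z Hz.
  replace (Cderiv f z - 0) with (Cderiv f z) by ring. now apply HB.
Qed.

Lemma cusp_value_Pfun : cusp_value Pfun (- / 12).
Proof.
  destruct (cusp_value_cusp_holo Pfun cusp_holo_Pfun) as [l H]. destruct Pfun_lim as [B [Y0 [PB [_ HB]]]].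
  replace (- / 12) with l; [exact H|].
  apply (cusp_value_near Pfun l B Y0 (- / 12) H PB). intros z Hz.
  replace (Pfun z - - / 12) with (Pfun z + / 12) by ring. now apply HB.
Qed.

Lemma cusp_holo_Dop k f : cusp_holo f -> cusp_holo (Dop k f).
Proof.
  intros H. apply (cusp_holo_ext (fun z => / tau * Cderiv f z + RtoC k * Pfun z * f z)); [reflexivity|].
  apply cusp_holo_plus; [apply cusp_holo_scal, cusp_holo_deriv, H|]. apply cusp_holo_mult; [apply cusp_holo_scal, cusp_holo_Pfun|exact H].
Qed.

Lemma cusp_value_Dop k f l : cusp_holo f -> cusp_value f l -> cusp_value (Dop k f) (- (RtoC k * / 12) * l).
Proof.
  intros Hf H. replace (- (RtoC k * / 12) * l) with (/ tau * 0 + RtoC k * - / 12 * l) by ring.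
  apply (cusp_value_ext (fun z => / tau * Cderiv f z + RtoC k * Pfun z * f z)); [reflexivity|].
  apply cusp_value_plus; [apply cusp_value_scal, cusp_value_deriv, Hf|]. apply cusp_value_mult; [apply cusp_value_scal, cusp_value_Pfun|exact H].
Qed.

Lemma ModForm_plus k f g : ModForm k f -> ModForm k g -> ModForm k (fun z => f z + g z).
Proof.
  intros Hf Hg. apply ModForm_intro; [apply cusp_holo_plus; now apply (ModForm_cusp_holo k)|].
  intros ga z Hz. rewrite (ModForm_trans k f), (ModForm_trans k g) by auto. ring.
Qed.

Lemma ModForm_scal k c f : ModForm k f -> ModForm k (fun z => c * f z).
Proof.
  intros Hf. apply ModForm_intro; [apply cusp_holo_scal; now apply (ModForm_cusp_holo k)|].
  intros ga z Hz. rewrite (ModForm_trans k f) by auto. ring.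
Qed.

Lemma ModForm_mult k l f g : ModForm k f -> ModForm l g -> ModForm (k + l) (fun z => f z * g z).
Proof.
  intros Hf Hg. apply ModForm_intro; [apply cusp_holo_mult; [now apply (ModForm_cusp_holo k)|now apply (ModForm_cusp_holo l)]|].
  intros ga z Hz. rewrite (ModForm_trans k f), (ModForm_trans l g), plus_IZR, Cpow_add by auto. ring.
Qed.

Lemma ModForm_0 k : ModForm k (fun _ => RtoC 0).
Proof. apply ModForm_intro; [apply cusp_holo_const|]. intros. ring. Qed.

Lemma ModForm_csum k n (c : nat -> C) (f : nat -> C -> C) : (forall i, (i < n)%nat -> ModForm k (f i)) ->
  ModForm k (fun z => csum n (fun i => c i * f i z)).
Proof.
  induction n as [|n IH]; intros H; simpl; [apply ModForm_0|].
  apply ModForm_plus; [apply IH; auto|apply ModForm_scal; auto].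
Qed.

Definition Delta (z : C) : C := ee z * euler_fun z ^ 24.

Lemma Delta_neq0 z : UH z -> Delta z <> 0.
Proof. intros Hz. apply Cmult_neq_0; [apply ee_neq0|]. now apply Cpow_nz, euler_fun_neq0. Qed.

Lemma cusp_holo_pow f n : cusp_holo f -> cusp_holo (fun z => f z ^ n).
Proof. intros H. induction n as [|n IH]; simpl; [apply cusp_holo_const|now apply cusp_holo_mult]. Qed.

Lemma cusp_holo_ee : cusp_holo ee.
Proof.
  apply cusp_holo_intro.
  - apply holo_cderive. intros z _. eexists. apply cderive_ee.
  - intros z _. apply ee_plus_1.
  - exists 1%R, 0%R. intros z Hz _. left. now apply ee_lt1.
Qed.

Lemma cusp_holo_Delta : cusp_holo Delta.
Proof. apply cusp_holo_mult; [apply cusp_holo_ee|apply cusp_holo_pow, cusp_holo_euler_fun]. Qed.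

Lemma cusp_value_Delta : cusp_value Delta 0.
Proof.
  destruct (cusp_value_cusp_holo _ (cusp_holo_pow euler_fun 24 cusp_holo_euler_fun)) as [l Hl].
  replace (RtoC 0) with (0 * l) by ring. apply (cusp_value_mult ee); [|exact Hl].
  exists 1%R. split; [lra|]. intros z _. replace (ee z - 0) with (ee z) by ring. lra.
Qed.

Lemma Delta_eta z : UH z -> Delta z = eta z ^ 24.
Proof.
  intros Hz. rewrite eta_phi, Cpow_mult_l by exact Hz. unfold Delta. f_equal.
  rewrite <- ee_nat. f_equal. replace (RtoC (INR 24)) with (RtoC 24) by (f_equal; simpl; ring). field.
Qed.

Lemma cderive_pow f z l n : cderive f z l -> cderive (fun w => f w ^ S n) z (RtoC (INR (S n)) * l * f z ^ n).
Proof.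
  intros H. induction n as [|n IH].
  - eapply cderive_eq; [eapply cderive_ext; [|exact H]; intros w; simpl; ring|]. simpl. ring.
  - eapply cderive_eq; [apply (cderive_mult f (fun w => f w ^ S n)); [exact H|exact IH]|].
    rewrite (S_INR (S n)), RtoC_plus. simpl (f z ^ S n). ring.
Qed.

(** From P = (i/pi) eta'/eta the logarithmic derivative 24 eta'/eta of eta^24 equals -24 pi i P =
    -12 tau P. *)
Lemma cderive_Delta z : UH z -> cderive Delta z (- (12 * tau * Pfun z) * Delta z).
Proof.
  intros Hz. pose proof (eta_neq0 z Hz) as N.
  assert (HP : RtoC PI <> 0) by (intros E; apply RtoC_inj in E; pose proof PI_RGT_0; lra).
  eapply cderive_eq.
  - apply (cderive_ext_UH (fun w => eta w ^ 24)); [exact Hz|intros w Hw; symmetry; now apply Delta_eta|].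
    apply cderive_pow, cderive_eta, Hz.
  - rewrite Delta_eta by exact Hz. unfold Pfun. rewrite (Cderiv_unique _ _ _ (cderive_eta z Hz)).
    set (X := tau * / 24 + Cderiv euler_fun z / euler_fun z). unfold tau. rewrite RtoC_mult.
    replace (RtoC (INR 24)) with (RtoC 24) by (f_equal; simpl; ring).
    change (eta z ^ 24) with (eta z * eta z ^ 23).
    replace (- (12 * (2 * RtoC PI * Ci) * (Ci / PI * (eta z * X / eta z))) * (eta z * eta z ^ 23))
      with (- (24 * (Ci * Ci) * (eta z * X)) * eta z ^ 23) by (field; auto).
    replace (Ci * Ci) with (- (1)); [ring|]. unfold Cmult, Ci, Copp, RtoC; simpl. f_equal; ring.
Qed.

Definition sS : SL2Z := mkSL2Z 0 (-1) 1 0 eq_refl.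

Lemma jfac_S z : jfac sS z = z.
Proof. unfold jfac, sS; simpl. ring. Qed.

Lemma UH_neq0 (z : C) : UH z -> z <> 0.
Proof. intros H E. rewrite E in H. unfold UH, Im in H; simpl in H. lra. Qed.

Lemma mob_S z : UH z -> mob sS z = - / z.
Proof. intros Hz. unfold mob. rewrite jfac_S. unfold sS; simpl. field. now apply UH_neq0. Qed.

Lemma Ci_UH : UH Ci.
Proof. unfold UH, Ci, Im; simpl. lra. Qed.

Lemma mob_S_i : mob sS Ci = Ci.
Proof. rewrite mob_S by apply Ci_UH. rewrite Ci_inv. ring. Qed.

Lemma cusp_holo_shift f (n : Z) z : cusp_holo f -> UH z -> f (z + RtoC (IZR n)) = f z.
Proof.
  intros [a [Ha E]] Hz. rewrite !E; auto.
  - rewrite ee_add, ee_IZR. f_equal. ring.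
  - unfold UH, Im in *; simpl. lra.
Qed.

(** The hypothesis is the conclusion of [P_defect_zero] and is discharged with it in the end, so
    these results on scalar forms are obtained in the presence of F0. *)
Section QuasiModular.
Hypothesis HQ : forall ga z, UH z -> P_defect ga z = 0.

Lemma Pfun_mob ga z : UH z -> Pfun (mob ga z) = jfac ga z * jfac ga z * Pfun z - RtoC (IZR (sc ga)) * / tau * jfac ga z.
Proof.
  intros Hz. pose proof (jfac_neq0 ga z Hz) as N. pose proof (HQ ga z Hz) as E. unfold P_defect in E.
  replace (Pfun (mob ga z)) with (jfac ga z * jfac ga z * (Pfun (mob ga z) * (/ jfac ga z * / jfac ga z) +
    (-1 * Pfun z + RtoC (IZR (sc ga)) * / tau * / jfac ga z)) + (jfac ga z * jfac ga z * Pfun z - RtoC (IZR (sc ga)) * / tau * jfac ga z)).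
  - rewrite E. ring.
  - field. split; [apply tau_neq0|exact N].
Qed.

Lemma ModForm_D k f : ModForm k f -> ModForm (k + 2) (Dop (IZR k) f).
Proof.
  intros H. pose proof (ModForm_cusp_holo k f H) as Q. apply ModForm_intro; [now apply cusp_holo_Dop|].
  intros ga z Hz.
  rewrite (Dop_trans ga (IZR k) 1 f f); auto; [|now apply cusp_holo_holo|now apply cusp_holo_holo|].
  - unfold defect_D. rewrite HQ, plus_IZR by exact Hz. ring.
  - intros w Hw. rewrite (ModForm_trans k f) by auto. ring.
Qed.

(** As P = -E_2/12, Ramanujan's formula for the derivative of E_2 identifies this with E_4/144. *)
Definition Eis4 (z : C) : C := Pfun z * Pfun z + / tau * Cderiv Pfun z.

Lemma cusp_holo_Eis4 : cusp_holo Eis4.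
Proof. apply cusp_holo_plus; [apply cusp_holo_mult; apply cusp_holo_Pfun|apply cusp_holo_scal, cusp_holo_deriv, cusp_holo_Pfun]. Qed.

Lemma ModForm_Eis4 : ModForm 4 Eis4.
Proof.
  apply ModForm_intro; [apply cusp_holo_Eis4|]. intros ga z Hz.
  pose proof (jfac_neq0 ga z Hz) as N. pose proof (cusp_holo_holo _ cusp_holo_Pfun) as HP.
  set (c := RtoC (IZR (sc ga))).
  pose proof (cderive_comp Pfun (mob ga) z _ _ (Cderiv_cderive Pfun _ HP (UH_mob ga z Hz)) (cderive_mob ga z Hz)) as D1.
  assert (D2 : cderive (fun z => jfac ga z * jfac ga z * Pfun z - c * / tau * jfac ga z) z
     (2 * c * jfac ga z * Pfun z + jfac ga z * jfac ga z * Cderiv Pfun z - c * / tau * c)).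
  { eapply cderive_eq; [apply cderive_minus; [apply (cderive_mult (fun z => jfac ga z * jfac ga z)); [apply cderive_mult; apply cderive_jfac|now apply Cderiv_cderive]|
      apply cderive_scal, cderive_jfac]|]. cbv beta. unfold c. ring. }
  pose proof (cderive_unique _ _ _ _ (cderive_ext_UH _ _ _ _ Hz (fun w Hw => Pfun_mob ga w Hw) D1) D2) as E.
  assert (E' : Cderiv Pfun (mob ga z) = jfac ga z * jfac ga z * (2 * c * jfac ga z * Pfun z + jfac ga z * jfac ga z * Cderiv Pfun z - c * / tau * c)).
  { rewrite <- E. field. exact N. }
  unfold Eis4. rewrite E', Pfun_mob by exact Hz. fold c.
  replace (Cpow (jfac ga z) 4) with (jfac ga z ^ 4) by (rewrite <- Cpow_INR by exact N; f_equal; simpl; ring).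
  simpl. field. apply tau_neq0.
Qed.

Lemma cusp_value_Eis4 : cusp_value Eis4 (/ 144).
Proof.
  replace (/ 144) with (- / 12 * - / 12 + / tau * 0).
  - apply cusp_value_plus; [apply cusp_value_mult; apply cusp_value_Pfun|apply cusp_value_scal, cusp_value_deriv, cusp_holo_Pfun].
  - field. apply tau_neq0.
Qed.

Lemma RtoC_neq0 (x : R) : (x <> 0)%R -> RtoC x <> 0.
Proof. intros H E. apply RtoC_inj in E. contradiction. Qed.

Lemma Cinv_neq0 (x : C) : x <> 0 -> / x <> 0.
Proof.
  intros H E. apply C1_nz. rewrite <- (Cinv_r x H), E. ring.
Qed.

(** Weight 4 has [Eis4], weight 6 its derivative under D, a multiple of E_6. Multiplication by
    [Eis4] raises a by 2, so the induction carries two consecutive weights. *)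
Lemma noncusp_form a : a <> 1%nat -> exists G l, ModForm (2 * Z.of_nat a) G /\ cusp_value G l /\ l <> 0.
Proof.
  revert a. assert (H : forall a, (exists G l, ModForm (2 * Z.of_nat (a + 2)) G /\ cusp_value G l /\ l <> 0) /\
     (exists G l, ModForm (2 * Z.of_nat (a + 3)) G /\ cusp_value G l /\ l <> 0)).
  { intros a. induction a as [|a [IH1 IH2]].
    - split.
      + exists Eis4, (/ 144). repeat split; [apply ModForm_Eis4..|apply cusp_value_Eis4|]. apply Cinv_neq0, RtoC_neq0. lra.
      + exists (Dop 4 Eis4), (- (4 * / 12) * / 144). split; [|split].
        * apply (ModForm_D 4 Eis4 ModForm_Eis4).
        * apply cusp_value_Dop; [apply cusp_holo_Eis4|apply cusp_value_Eis4].
        * apply Cmult_neq_0; [|apply Cinv_neq0, RtoC_neq0; lra].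
          replace (- (4 * / 12)) with (RtoC (- / 3)).
          -- apply RtoC_neq0. lra.
          -- replace (RtoC 12) with (RtoC 4 * RtoC 3) by (rewrite <- RtoC_mult; f_equal; ring).
             rewrite RtoC_opp, RtoC_inv by lra. field.
    - split; [replace (S a + 2)%nat with (a + 3)%nat by lia; exact IH2|].
      destruct IH1 as [G [l [HG [Hl Nl]]]].
      exists (fun z => G z * Eis4 z), (l * / 144). split; [|split].
      + replace (2 * Z.of_nat (S a + 3))%Z with (2 * Z.of_nat (a + 2) + 4)%Z by lia.
        apply ModForm_mult; [exact HG|apply ModForm_Eis4].
      + apply cusp_value_mult; [exact Hl|apply cusp_value_Eis4].
      + apply Cmult_neq_0; [exact Nl|]. apply Cinv_neq0, RtoC_neq0. lra. }
  intros a Ha. destruct a as [|[|a]]; [|congruence|].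
  - exists (fun _ => 1), 1. split; [|split; [apply cusp_value_const|apply C1_nz]].
    apply ModForm_intro; [apply cusp_holo_const|]. intros ga z Hz. simpl. rewrite Cpow_0. ring.
  - replace (S (S a)) with (a + 2)%nat by lia. exact (proj1 (H a)).
Qed.

(** The difference u of Delta(-1/w) w^(-12) and Delta(w) satisfies the first order equation of
    Delta, by quasi-modularity of P. It vanishes at the fixed point i because i^12 = 1, hence
    everywhere. *)
Lemma Delta_S z : UH z -> Delta (- / z) = z ^ 12 * Delta z.
Proof.
  intros Hz. pose proof (cusp_holo_holo _ cusp_holo_Delta) as HD.
  set (u := fun w => Delta (mob sS w) * (/ w) ^ 12 - Delta w).
  assert (Hu : forall w, UH w -> cderive u w (- (12 * tau * Pfun w) * u w)).
  { intros w Hw. pose proof (UH_neq0 w Hw) as N. unfold u.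
    pose proof (cderive_comp Delta (mob sS) w _ _ (cderive_Delta _ (UH_mob sS w Hw)) (cderive_mob sS w Hw)) as D1.
    pose proof (cderive_pow Cinv w _ 11 (cderive_Cinv w N)) as D2.
    pose proof (cderive_minus _ _ _ _ _ (cderive_mult _ _ _ _ _ D1 D2) (cderive_Delta w Hw)) as D3.
    refine (cderive_eq _ _ _ _ D3 _). cbv beta.
    rewrite Pfun_mob, jfac_S by exact Hw. replace (RtoC (INR 12)) with (RtoC 12) by (f_equal; simpl; ring).
    change (RtoC (IZR (sc sS))) with (RtoC 1).
    change ((/ w) ^ 12) with (/ w * (/ w) ^ 11). set (X := (/ w) ^ 11). field. split; [exact N|apply tau_neq0]. }
  assert (U0 : u Ci = 0).
  { unfold u. rewrite mob_S_i, Ci_inv.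
    assert (E2 : Ci * Ci = - (1)) by (unfold Cmult, Ci, Copp, RtoC; simpl; f_equal; ring).
    assert (E12 : (- Ci) ^ 12 = 1).
    { transitivity ((Ci * Ci) * (Ci * Ci) * ((Ci * Ci) * (Ci * Ci)) * ((Ci * Ci) * (Ci * Ci))); [simpl; ring|]. rewrite E2. ring. }
    rewrite E12. ring. }
  assert (HA : holo (fun w => - (12 * tau * Pfun w))).
  { apply (holo_ext (fun w => - (12 * tau) * Pfun w)); [intros; ring|]. apply holo_mult; [apply holo_const|apply cusp_holo_holo, cusp_holo_Pfun]. }
  pose proof (ode_unique1 u _ Ci HA Hu Ci_UH U0 z Hz) as E. unfold u in E.
  rewrite mob_S in E by exact Hz. pose proof (UH_neq0 z Hz) as N.
  replace (Delta (- / z)) with (z ^ 12 * (Delta (- / z) * (/ z) ^ 12 - Delta z) + z ^ 12 * Delta z).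
  - rewrite E. ring.
  - rewrite Cpow_inv by exact N. field. exact N.
Qed.

(* Euclid's algorithm on the first column reduces to translations and inversion. *)
Lemma Delta_mob : forall n ga z, (Z.abs_nat (sc ga) < n)%nat -> UH z -> Delta (mob ga z) = jfac ga z ^ 12 * Delta z.
Proof.
  induction n as [|n IH]; intros ga z Hn Hz; [lia|].
  destruct (Z.eq_dec (sc ga) 0) as [E0|N0].
  - pose proof (sdet ga) as D. rewrite E0, Z.mul_0_r, Z.sub_0_r in D.
    assert (S : (sa ga = 1 /\ sd ga = 1 \/ sa ga = -1 /\ sd ga = -1)%Z).
    { destruct (Z.eq_mul_1 _ _ D) as [H|H]; rewrite H in D; lia. }
    assert (J : jfac ga z = RtoC (IZR (sd ga))) by (unfold jfac; rewrite E0; ring).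
    unfold mob. rewrite J. destruct S as [[-> ->]|[-> ->]].
    + replace ((1 * z + RtoC (IZR (sb ga))) / 1) with (z + RtoC (IZR (sb ga))) by field.
      rewrite (cusp_holo_shift Delta) by (auto; apply cusp_holo_Delta). simpl. ring.
    + replace (((-1) * z + RtoC (IZR (sb ga))) / (-1)) with (z + RtoC (IZR (- sb ga))).
      * rewrite (cusp_holo_shift Delta) by (auto; apply cusp_holo_Delta). replace (RtoC (-1)) with (- (1)) by (rewrite <- RtoC_opp; reflexivity). simpl. ring.
      * rewrite opp_IZR, RtoC_opp. replace (RtoC (-1)) with (- (1)) by (rewrite <- RtoC_opp; reflexivity). field.
  - set (q := (sa ga / sc ga)%Z). set (rr := (sa ga mod sc ga)%Z).
    assert (Eq : (sa ga = sc ga * q + rr)%Z) by (apply Z_div_mod_eq_full).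
    assert (Hrr : (Z.abs_nat (- rr) < n)%nat) by (unfold rr; pose proof (Z.mod_bound_or (sa ga) (sc ga) N0); lia).
    assert (Dt : (sc ga * - (sb ga - q * sd ga) - sd ga * - rr = 1)%Z) by (pose proof (sdet ga); nia).
    (* This is S^(-1) T^(-q) ga; its lower left entry is minus the remainder of a modulo c, so the
       induction applies. *)
    set (g2 := mkSL2Z (sc ga) (sd ga) (- rr) (- (sb ga - q * sd ga)) Dt).
    pose proof (UH_mob g2 z Hz) as U2. pose proof (jfac_neq0 g2 z Hz) as N2. pose proof (jfac_neq0 ga z Hz) as N.
    assert (Ej : mob g2 z * jfac g2 z = jfac ga z).
    { unfold mob. replace (RtoC (IZR (sa g2)) * z + RtoC (IZR (sb g2))) with (jfac ga z) by reflexivity. field. exact N2. }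
    assert (Em : mob ga z = - / mob g2 z + RtoC (IZR q)).
    { assert (E2 : mob g2 z = jfac ga z / jfac g2 z) by reflexivity. rewrite E2.
      unfold mob at 1.
      replace (- / (jfac ga z / jfac g2 z) + RtoC (IZR q)) with ((RtoC (IZR q) * jfac ga z - jfac g2 z) / jfac ga z) by (field; auto).
      f_equal. unfold jfac, g2; simpl sc; simpl sd. rewrite Eq at 1.
      rewrite !opp_IZR, minus_IZR, plus_IZR, !mult_IZR, !RtoC_opp, RtoC_minus, RtoC_plus, !RtoC_mult. ring. }
    rewrite Em, (cusp_holo_shift Delta), Delta_S; auto.
    + rewrite (IH g2 z Hrr Hz), <- Ej, Cpow_mult_l. ring.
    + apply cusp_holo_Delta.
    + rewrite <- (mob_S _ U2). apply UH_mob, U2.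
Qed.

Lemma ModForm_Delta : ModForm 12 Delta.
Proof.
  apply ModForm_intro; [apply cusp_holo_Delta|]. intros ga z Hz.
  rewrite (Delta_mob (S (Z.abs_nat (sc ga))) ga z (Nat.lt_succ_diag_r _) Hz). f_equal.
  rewrite <- Cpow_INR by now apply jfac_neq0. f_equal. simpl. ring.
Qed.

(** Delta is q times a q-series that is invertible also at the cusp, so a zero constant term is
    exactly what the division costs. *)
Lemma cusp_div k f : ModForm k f -> cusp_value f 0 -> exists h, ModForm (k - 12) h /\ forall z, UH z -> f z = Delta z * h z.
Proof.
  intros Hf [B [PB HB]]. pose proof (ModForm_cusp_holo k f Hf) as Qf.
  assert (Qh : cusp_holo (fun z => f z * / Delta z)).
  { apply (cusp_holo_ext (fun z => (f z * ee (- z)) * (/ euler_fun z) ^ 24)).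
    - intros z Hz. unfold Delta. rewrite ee_opp, Cpow_inv by now apply euler_fun_neq0. field.
      split; [apply euler_fun_neq0, Hz|apply ee_neq0].
    - apply cusp_holo_mult.
      + apply cusp_holo_div_q; [exact Qf|]. exists B. intros z Hz. specialize (HB z Hz).
        replace (f z - 0) with (f z) in HB by ring. exact HB.
      + apply (cusp_holo_pow (fun z => / euler_fun z)). apply cusp_holo_inv; [apply cusp_holo_euler_fun|apply euler_fun_neq0|apply euler_fun_low]. }
  exists (fun z => f z * / Delta z). split.
  - apply ModForm_intro; [exact Qh|]. intros ga z Hz.
    rewrite (ModForm_trans k f), (ModForm_trans 12 Delta) by (auto using ModForm_Delta).
    rewrite minus_IZR. unfold Rminus. rewrite Cpow_add, Cpow_opp. field.
    split; [now apply Delta_neq0|apply Cpow_neq0].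
  - intros z Hz. field. now apply Delta_neq0.
Qed.

(* [|f| y^(-(s+1))] is invariant, and a shift followed by an inversion at least doubles [Im z] as long as
   [Im z < 1/2], so the bound for large [Im z] propagates to all of the half-plane. *)
Lemma neg_weight s f : ModForm (- (2 * Z.of_nat (S s))) f -> forall z, UH z -> f z = 0.
Proof.
  intros Hf. pose proof (ModForm_cusp_holo _ f Hf) as Qf.
  destruct (cusp_holo_bdd f (1/2) Qf ltac:(lra)) as [B HB].
  assert (PB : (0 <= B)%R).
  { specialize (HB (0%R, 1%R) ltac:(unfold Im; simpl; lra)). pose proof (Cmod_ge_0 (f (0%R, 1%R))). lra. }
  (* For Im z >= 1/2 one has (2 Im z)^(s+1) >= 1, so the bound B there already has the required
     form. *)
  set (K := (B * 2 ^ S s)%R). assert (PK : (0 <= K)%R) by (apply Rmult_le_pos; [easy|apply pow_le; lra]).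
  apply (cusp_holo_zero f K s Qf).
  assert (St : forall n z, UH z -> ((1/2) ^ S n <= Im z)%R -> (Cmod (f z) <= K * Im z ^ S s)%R).
  { induction n as [|n IH]; intros z Hz Hn.
    - eapply Rle_trans; [apply HB; simpl in Hn; lra|]. unfold K. rewrite Rmult_assoc, <- Rpow_mult_distr.
      rewrite <- (Rmult_1_r B) at 1. apply Rmult_le_compat_l; [easy|]. rewrite <- (pow1 (S s)). apply pow_incr.
      simpl in Hn. lra.
    - destruct (Rle_dec (1/2) (Im z)) as [L|L]; [apply (IH z Hz); eapply Rle_trans; [|exact L]|].
      { simpl. apply Rle_trans with (1 / 2 * 1)%R; [|lra]. apply Rmult_le_compat_l; [lra|].
        pose proof (pow_incr (1 / 2) 1 n ltac:(lra)) as Q. rewrite pow1 in Q. exact Q. }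
      set (p := Int_part (Re z + 1/2)). pose proof (base_Int_part (Re z + 1/2)) as [I1 I2]. fold p in I1, I2.
      set (z0 := z + RtoC (IZR (- p))).
      assert (Iz : Im z0 = Im z) by (unfold z0, Im; simpl; ring).
      assert (Rz : (Rabs (Re z0) <= 1/2)%R).
      { unfold z0. rewrite opp_IZR. replace (Re (z + RtoC (- IZR p))) with (Re z - IZR p)%R by (unfold Re; simpl; ring).
        apply Rabs_le. lra. }
      assert (U0 : UH z0) by (unfold UH; rewrite Iz; exact Hz).
      assert (Fz : f z = f z0) by (symmetry; now apply cusp_holo_shift).
      pose proof (UH_neq0 z0 U0) as N0. pose proof (proj1 (Cmod_gt_0 _) N0) as P0.
      pose proof (Cmod_sqr z0) as Sq. set (t := (Cmod z0 * Cmod z0)%R) in *.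
      assert (Pt : (0 < t)%R) by (unfold t; nra).
      unfold UH in Hz.
      assert (Ht : (t <= 1/2)%R).
      { rewrite Sq, Iz. apply Rabs_le_between in Rz. nra. }
      pose proof (Im_mob sS z0 U0) as Is. rewrite jfac_S in Is. fold t in Is. rewrite Iz in Is.
      assert (Up : ((1/2) ^ S n <= Im (mob sS z0))%R).
      { rewrite Is. apply Rmult_le_reg_r with t; [easy|]. unfold Rdiv at 2. rewrite Rmult_assoc, Rinv_l, Rmult_1_r by lra.
        eapply Rle_trans; [|exact Hn]. change ((1/2) ^ S (S n))%R with (1/2 * (1/2) ^ S n)%R. rewrite Rmult_comm.
        apply Rmult_le_compat_r; [apply pow_le; lra|exact Ht]. }
      specialize (IH (mob sS z0) (UH_mob sS z0 U0) Up). rewrite Is in IH.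
      rewrite (ModForm_trans _ f sS z0 Hf U0), jfac_S in IH.
      assert (Ec : Cpow z0 (IZR (- (2 * Z.of_nat (S s)))) = / (z0 ^ (2 * S s))).
      { rewrite opp_IZR, Cpow_opp. f_equal. rewrite <- Cpow_INR by exact N0. f_equal.
        rewrite INR_IZR_INZ. f_equal. lia. }
      rewrite Ec, Cmod_mult, Cmod_inv in IH by (now apply Cpow_nz).
      rewrite Cmod_pow, pow_mult in IH. replace (Cmod z0 ^ 2)%R with t in IH by (unfold t; ring).
      rewrite Fz.
      assert (Pts : (0 < t ^ S s)%R) by now apply pow_lt.
      apply Rmult_le_reg_l with (/ t ^ S s)%R; [now apply Rinv_0_lt_compat|].
      eapply Rle_trans; [exact IH|]. right. unfold Rdiv. rewrite Rpow_mult_distr, pow_inv. ring. }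
  intros z Hz.
  destruct (pow_small (1/2) (Im z) ltac:(lra) Hz) as [N HN]. apply (St N z Hz). left. apply HN. lia.
Qed.

(** Division by Delta yields a form of weight 2k - 12 < 0. *)
Lemma cusp_zero k f : (0 <= k < 6)%nat -> ModForm (2 * Z.of_nat k) f -> cusp_value f 0 -> forall z, UH z -> f z = 0.
Proof.
  intros Hk Hf L z Hz. destruct (cusp_div _ f Hf L) as [h [Hh E]].
  rewrite E by exact Hz.
  rewrite (neg_weight (5 - k) h); [ring| |exact Hz].
  replace (- (2 * Z.of_nat (S (5 - k))))%Z with (2 * Z.of_nat k - 12)%Z by lia. exact Hh.
Qed.

Lemma ModForm_weight2 f : ModForm 2 f -> forall z, UH z -> f z = 0.
Proof.
  (* If [f] has value [l <> 0] at the cusp, a cusp form [D f - c f^2] of weight 4 vanishes, hence [f] solves a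
     linear equation of order 1; and [f(i) = 0] because inversion fixes [i]. *)
  intros Hf. pose proof (ModForm_cusp_holo 2 f Hf) as Qf. destruct (cusp_value_cusp_holo f Qf) as [l Hl].
  destruct (classic (l = 0)) as [->|N]; [apply (cusp_zero 1 f); [lia|exact Hf|exact Hl]|].
  (* The constant term of D f is -(2/12) l and that of c f^2 is c l^2; this c makes them equal. *)
  set (c := - (2 * / 12) * / l).
  assert (L0 : cusp_value (fun z => Dop 2 f z + - c * (f z * f z)) 0).
  { replace (RtoC 0) with (- (2 * / 12) * l + - c * (l * l)).
    - apply cusp_value_plus; [now apply cusp_value_Dop|]. apply cusp_value_scal, cusp_value_mult; exact Hl.
    - unfold c. field. exact N. }
  assert (E : forall z, UH z -> Dop 2 f z + - c * (f z * f z) = 0).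
  { apply (cusp_zero 2 _); [lia| |exact L0]. apply ModForm_plus; [apply (ModForm_D 2 f Hf)|].
    apply ModForm_scal, (ModForm_mult 2 2); exact Hf. }
  apply (ode_unique1 f (fun z => tau * (c * f z + - (2) * Pfun z)) Ci).
  - apply holo_mult; [apply holo_const|]. apply cusp_holo_holo, cusp_holo_plus; apply cusp_holo_scal; [exact Qf|apply cusp_holo_Pfun].
  - intros z Hz. eapply cderive_eq; [apply Cderiv_cderive; [now apply cusp_holo_holo|exact Hz]|].
    specialize (E z Hz). rewrite Dop_tau in E.
    replace (Cderiv f z) with (tau * ((/ tau * Cderiv f z + 2 * Pfun z * f z + - c * (f z * f z)) + (c * f z + - (2) * Pfun z) * f z)).
    + rewrite E. ring.
    + field. apply tau_neq0.
  - apply Ci_UH.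
  - pose proof (ModForm_trans 2 f sS Ci Hf Ci_UH) as T. rewrite mob_S_i, jfac_S in T.
    replace (Cpow Ci 2) with (- (1)) in T.
    + assert (E2 : 2 * f Ci = 0) by (replace (2 * f Ci) with (f Ci - - (1) * f Ci) by ring; rewrite <- T; ring).
      destruct (classic (f Ci = 0)) as [X|X]; [exact X|exfalso]. revert E2. apply Cmult_neq_0; [|exact X]. apply RtoC_neq0. lra.
    + replace 2%R with (INR 2) by (simpl; ring). rewrite Cpow_INR by apply Ci_nz.
      unfold Cmult, Ci, Copp, RtoC; simpl. unfold Cmult; simpl. f_equal; ring.
Qed.

(** * Dimensions of the spaces of scalar forms *)

Definition fun_dim (P : (C -> C) -> Prop) (d : nat) : Prop :=
  exists b : nat -> C -> C, (forall i, (i < d)%nat -> P (b i)) /\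
    (forall c : nat -> C, (forall z, UH z -> csum d (fun i => c i * b i z) = 0) -> forall i, (i < d)%nat -> c i = 0) /\
    (forall f, P f -> exists c : nat -> C, forall z, UH z -> f z = csum d (fun i => c i * b i z)).

Lemma fun_dim_zero (P : (C -> C) -> Prop) : (forall f, P f -> forall z, UH z -> f z = 0) -> fun_dim P 0.
Proof.
  intros H. exists (fun _ _ => RtoC 0). split; [intros; lia|split; [intros; lia|]].
  intros f Hf. exists (fun _ => RtoC 0). intros z Hz. now apply H.
Qed.

(** M_k is the sum of Delta M_(k-12) and the line of G: subtracting the right multiple of G makes a
    form vanish at the cusp, and the value at the cusp also separates G from the multiples of
    Delta. *)
Lemma fun_dim_step k G l d : ModForm k G -> cusp_value G l -> l <> 0 -> fun_dim (ModForm (k - 12)) d -> fun_dim (ModForm k) (S d).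
Proof.
  intros HG Hl Nl [b [Hb [Ib Sb]]].
  exists (fun i z => if Nat.ltb i d then Delta z * b i z else G z).
  assert (Es : forall (c : nat -> C) z, csum (S d) (fun i => c i * (if Nat.ltb i d then Delta z * b i z else G z)) =
     Delta z * csum d (fun i => c i * b i z) + c d * G z).
  { intros c z. simpl. rewrite Nat.ltb_irrefl. f_equal. rewrite <- csum_scal. apply csum_ext. intros i Hi.
    destruct (Nat.ltb_spec i d); [ring|lia]. }
  assert (MD : forall h, ModForm (k - 12) h -> ModForm k (fun z => Delta z * h z)).
  { intros h Hh. replace k with (12 + (k - 12))%Z by lia. apply ModForm_mult; [apply ModForm_Delta|exact Hh]. }
  split; [|split].
  - intros i Hi. destruct (Nat.ltb_spec i d) as [L|L]; [|exact HG]. now apply MD, Hb.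
  - intros c H.
    assert (Cd0 : c d = 0).
    { assert (Q : cusp_holo (fun z => csum d (fun i => c i * b i z))) by (apply (ModForm_cusp_holo (k - 12)), ModForm_csum; auto).
      destruct (cusp_value_cusp_holo _ Q) as [l' Hl'].
      pose proof (cusp_value_plus _ _ _ _ (cusp_value_mult _ _ _ _ cusp_value_Delta Hl') (cusp_value_scal (c d) _ _ Hl)) as L1.
      assert (L2 : cusp_value (fun z => Delta z * csum d (fun i => c i * b i z) + c d * G z) 0).
      { apply (cusp_value_ext (fun _ => 0)); [|apply cusp_value_const]. intros z Hz. rewrite <- Es. symmetry. now apply H. }
      pose proof (cusp_value_unique _ _ _ L1 L2) as E. rewrite Cmult_0_l, Cplus_0_l in E.
      destruct (classic (c d = 0)) as [X|X]; [exact X|exfalso]. revert E. now apply Cmult_neq_0. }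
    intros i Hi. destruct (Nat.eq_dec i d) as [->|N]; [exact Cd0|].
    apply Ib; [|lia]. intros z Hz. specialize (H z Hz). rewrite Es, Cd0, Cmult_0_l, Cplus_0_r in H.
    destruct (classic (csum d (fun i => c i * b i z) = 0)) as [X|X]; [exact X|exfalso]. revert H.
    apply Cmult_neq_0; [now apply Delta_neq0|exact X].
  - intros f Hf. destruct (cusp_value_cusp_holo f (ModForm_cusp_holo k f Hf)) as [l' Hl'].
    destruct (cusp_div k (fun z => f z + (- (l' / l)) * G z)) as [h [Hh E]].
    + apply ModForm_plus; [exact Hf|now apply ModForm_scal].
    + replace (RtoC 0) with (l' + (- (l' / l)) * l) by (field; exact Nl). apply cusp_value_plus; [exact Hl'|now apply cusp_value_scal].
    + destruct (Sb h Hh) as [c Hc]. exists (fun i => if Nat.ltb i d then c i else l' / l).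
      intros z Hz. rewrite Es, Nat.ltb_irrefl.
      rewrite (csum_ext d (fun i => (if Nat.ltb i d then c i else l' / l) * b i z) (fun i => c i * b i z)).
      * rewrite <- Hc by exact Hz. rewrite <- E by exact Hz. ring.
      * intros i Hi. destruct (Nat.ltb_spec i d); [reflexivity|lia].
Qed.

(** The dimension of M_(2a); the exceptional class 2a = 2 modulo 12 is a = 1 modulo 6. *)
Definition dim_even (a : nat) : nat := if Nat.eqb (a mod 6) 1 then (a / 6)%nat else (a / 6 + 1)%nat.

Lemma dim_even_6 b : dim_even (b + 1 * 6) = S (dim_even b).
Proof.
  unfold dim_even. rewrite Nat.div_add, Nat.Div0.mod_add by lia. destruct (Nat.eqb _ 1); lia.
Qed.

Lemma dim_ModForm a : fun_dim (ModForm (2 * Z.of_nat a)) (dim_even a).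
Proof.
  induction a as [a IH] using lt_wf_ind.
  destruct (Nat.eq_dec a 1) as [->|N1]; [apply fun_dim_zero; exact ModForm_weight2|].
  destruct (noncusp_form a N1) as [G [l [HG [Hl Nl]]]].
  destruct (Nat.lt_ge_cases a 6) as [L|L].
  - replace (dim_even a) with 1%nat by (destruct a as [|[|[|[|[|[|a]]]]]]; try reflexivity; lia).
    apply (fun_dim_step _ G l 0 HG Hl Nl). apply fun_dim_zero. intros f Hf. apply (neg_weight (5 - a)).
    replace (- (2 * Z.of_nat (S (5 - a))))%Z with (2 * Z.of_nat a - 12)%Z by lia. exact Hf.
  - replace (dim_even a) with (S (dim_even (a - 6))).
    + apply (fun_dim_step _ G l _ HG Hl Nl). replace (2 * Z.of_nat a - 12)%Z with (2 * Z.of_nat (a - 6))%Z by lia.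
      apply IH. lia.
    + rewrite <- dim_even_6. f_equal. lia.
Qed.

Lemma dim_ModForm_neg s : fun_dim (ModForm (- (2 * Z.of_nat (S s)))) 0.
Proof. apply fun_dim_zero. apply neg_weight. Qed.
End QuasiModular.

(** * The dimension formula *)

Fixpoint nsum (J : nat) (d : nat -> nat) : nat := match J with O => O | S J => (nsum J d + d J)%nat end.

Section Dimension.
Variables (k0 : R) (F0 : C -> vec) (k : Z) (d : nat -> nat).
Hypothesis Huniq : forall z (a b : nat -> C), UH z ->
  (forall i, (i < 5)%nat -> csum 5 (fun j => a j * DpowV j k0 F0 z i) = csum 5 (fun j => b j * DpowV j k0 F0 z i)) ->
  forall j, (j < 5)%nat -> a j = b j.
Hypothesis Hd : forall j, (j < 5)%nat -> fun_dim (ModForm (k - 2 * Z.of_nat j)) (d j).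

Definition comb_space (J : nat) (F : C -> vec) : Prop := exists M : nat -> C -> C,
  (forall j, (j < J)%nat -> ModForm (k - 2 * Z.of_nat j) (M j)) /\
  forall z, UH z -> veq 5 (F z) (fun i => csum J (fun j => M j z * DpowV j k0 F0 z i)).

Lemma comb_space_lin J s (c : nat -> C) (b : nat -> C -> vec) : (forall i, (i < s)%nat -> comb_space J (b i)) ->
  comb_space J (fun z l => csum s (fun i => c i * b i z l)).
Proof.
  intros H.
  set (M := fun i => epsilon (inhabits (fun _ _ => RtoC 0)) (fun M : nat -> C -> C =>
    (forall j, (j < J)%nat -> ModForm (k - 2 * Z.of_nat j) (M j)) /\
    forall z, UH z -> veq 5 (b i z) (fun l => csum J (fun j => M j z * DpowV j k0 F0 z l)))).
  assert (HM : forall i, (i < s)%nat -> (forall j, (j < J)%nat -> ModForm (k - 2 * Z.of_nat j) (M i j)) /\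
    forall z, UH z -> veq 5 (b i z) (fun l => csum J (fun j => M i j z * DpowV j k0 F0 z l))).
  { intros i Hi. unfold M. apply epsilon_spec, H, Hi. }
  exists (fun j z => csum s (fun i => c i * M i j z)). split.
  - intros j Hj. apply (ModForm_csum _ s c (fun i => M i j)). intros i Hi. now apply HM.
  - intros z Hz l Hl.
    rewrite (csum_ext s _ (fun i => c i * csum J (fun j => M i j z * DpowV j k0 F0 z l))).
    + rewrite csum_assoc. reflexivity.
    + intros i Hi. now rewrite (proj2 (HM i Hi) z Hz l Hl).
Qed.

(** Padded with zeros, the coefficients form a vector of length 5, to which uniqueness of the
    coefficients applies pointwise. *)
Lemma comb_space_indep J F (X : C -> C) : (J < 5)%nat -> comb_space J F ->
  (forall z, UH z -> veq 5 (fun l => F z l + X z * DpowV J k0 F0 z l) vzero) -> forall z, UH z -> X z = 0.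
Proof.
  intros HJ5 [M [_ HM]] H z Hz.
  set (a := fun j => if Nat.ltb j J then M j z else if Nat.eqb j J then X z else RtoC 0).
  assert (E : a J = 0).
  { apply (Huniq z a (fun _ => 0) Hz); [|exact HJ5]. intros l Hl.
    rewrite (csum_0 5 (fun j => 0 * DpowV j k0 F0 z l)) by (intros; ring).
    specialize (H z Hz l Hl). unfold vzero in H. rewrite (HM z Hz l Hl) in H. rewrite <- H.
    replace 5%nat with (J + S (5 - S J))%nat by lia. rewrite csum_split, csum_Sl.
    rewrite (csum_ext J _ (fun j => M j z * DpowV j k0 F0 z l)).
    - rewrite (csum_0 (5 - S J)).
      + unfold a. rewrite Nat.add_0_r, Nat.ltb_irrefl, Nat.eqb_refl. ring.
      + intros i Hi. unfold a. destruct (Nat.ltb_spec (J + S i) J); [lia|]. destruct (Nat.eqb_spec (J + S i) J); [lia|]. ring.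
    - intros i Hi. unfold a. destruct (Nat.ltb_spec i J); [reflexivity|lia]. }
  unfold a in E. now rewrite Nat.ltb_irrefl, Nat.eqb_refl in E.
Qed.

(** Induction on the number of terms: the basis for J terms is followed by the products of a basis
    of forms of weight k - 2J with D^J F0. *)
Lemma has_dim_comb_space J : (J <= 5)%nat -> has_dim (comb_space J) (nsum J d).
Proof.
  induction J as [|J IH]; intros HJ5.
  - exists (fun _ _ _ => RtoC 0). split; [simpl; intros; lia|split; [simpl; intros; lia|]].
    intros F [M [_ HM]]. exists (fun _ => RtoC 0). intros z Hz i Hi. rewrite (HM z Hz i Hi). reflexivity.
  - destruct IH as [b [Hb [Ib Sb]]]; [lia|]. destruct (Hd J ltac:(lia)) as [e [He [Ie Se]]].
    set (s := nsum J d) in *.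
    set (bb := fun i z l => if Nat.ltb i s then b i z l else e (i - s)%nat z * DpowV J k0 F0 z l).
    assert (Es : forall (c : nat -> C) z l, csum (s + d J) (fun i => c i * bb i z l) =
      csum s (fun i => c i * b i z l) + csum (d J) (fun i => c (s + i)%nat * e i z) * DpowV J k0 F0 z l).
    { intros c z l. rewrite csum_split. f_equal.
      - apply csum_ext. intros i Hi. unfold bb. destruct (Nat.ltb_spec i s); [reflexivity|lia].
      - rewrite (Cmult_comm (csum (d J) _)), <- csum_scal. apply csum_ext. intros i Hi. unfold bb.
        destruct (Nat.ltb_spec (s + i) s); [lia|]. replace (s + i - s)%nat with i by lia. ring. }
    change (nsum (S J) d) with (s + d J)%nat. exists bb. split; [|split].
    + intros i Hi. unfold bb. destruct (Nat.ltb_spec i s) as [L|L].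
      * destruct (Hb i L) as [M [HM EM]]. exists (fun j z => if Nat.ltb j J then M j z else RtoC 0). split.
        -- intros j Hj. destruct (Nat.ltb_spec j J); [now apply HM|apply ModForm_0].
        -- intros z Hz l Hl. cbn [csum]. rewrite Nat.ltb_irrefl, Cmult_0_l, Cplus_0_r, (EM z Hz l Hl).
           apply csum_ext. intros j Hj. destruct (Nat.ltb_spec j J); [reflexivity|lia].
      * exists (fun j z => if Nat.eqb j J then e (i - s)%nat z else RtoC 0). split.
        -- intros j Hj. destruct (Nat.eqb_spec j J) as [->|N]; [apply He; lia|apply ModForm_0].
        -- intros z Hz l Hl. cbn [csum]. rewrite Nat.eqb_refl, csum_0; [ring|].
           intros j Hj. destruct (Nat.eqb_spec j J); [lia|ring].
    + intros c H.
      assert (X0 : forall z, UH z -> csum (d J) (fun i => c (s + i)%nat * e i z) = 0).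
      { apply (comb_space_indep J (fun z l => csum s (fun i => c i * b i z l))); [lia|now apply comb_space_lin|].
        intros z Hz l Hl. rewrite <- Es. now apply H. }
      pose proof (Ie (fun i => c (s + i)%nat) X0) as C2.
      assert (C1 : forall i, (i < s)%nat -> c i = 0).
      { apply Ib. intros z Hz l Hl. specialize (H z Hz l Hl). cbv beta in H. rewrite Es, X0 in H by exact Hz.
        rewrite <- H. ring. }
      intros i Hi. destruct (Nat.lt_ge_cases i s) as [L|L]; [now apply C1|].
      specialize (C2 (i - s)%nat ltac:(lia)). cbv beta in C2. replace (s + (i - s))%nat with i in C2 by lia. exact C2.
    + intros F [M [HM EM]].
      destruct (Sb (fun z l => csum J (fun j => M j z * DpowV j k0 F0 z l))) as [c1 H1].
      { exists M. split; [intros; apply HM; lia|]. intros z Hz l Hl. reflexivity. }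
      destruct (Se (M J) (HM J (Nat.lt_succ_diag_r J))) as [c2 H2].
      exists (fun i => if Nat.ltb i s then c1 i else c2 (i - s)%nat). intros z Hz l Hl.
      rewrite (EM z Hz l Hl), Es. cbn [csum]. rewrite (H1 z Hz l Hl), H2 by exact Hz.
      f_equal; [|f_equal].
      * apply csum_ext. intros i Hi. destruct (Nat.ltb_spec i s); [reflexivity|lia].
      * apply csum_ext. intros i Hi. destruct (Nat.ltb_spec (s + i) s); [lia|]. do 2 f_equal. lia.
Qed.
End Dimension.

Lemma has_dim_iff (P Q : (C -> vec) -> Prop) n : (forall F, P F <-> Q F) -> has_dim P n -> has_dim Q n.
Proof.
  intros E [b [H1 [H2 H3]]]. exists b. split; [intros; now apply E, H1|split; [exact H2|]].
  intros F HF. now apply H3, E.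
Qed.

Lemma Hsp_ext rho ups k F G : (forall z, UH z -> veq 5 (F z) (G z)) -> Hsp 5 rho ups k F -> Hsp 5 rho ups k G.
Proof.
  intros E [H1 H2]. split.
  - intros i Hi. destruct (H1 i Hi) as [Hh [c [N Hm]]]. split.
    + apply (holo_ext (fun z => F z i)); [|exact Hh]. intros z Hz. now apply E.
    + exists c, N. intros x y Hy Hc. rewrite <- (E (x, y)) by auto. now apply Hm.
  - intros g z Hz i Hi. rewrite <- (E (mob g z) (UH_mob g z Hz) i Hi). rewrite (H2 g z Hz i Hi).
    unfold mapp. apply csum_ext. intros l Hl. now rewrite (E z Hz l Hl).
Qed.

(** For j > k the coefficient has negative weight 2(k - j) and must vanish; truncated subtraction
    alone would give the dimension of weight 0. *)
Definition dim_shift (k j : nat) : nat := if Nat.leb j k then dim_even (k - j) else 0%nat.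

Lemma dim_shift_6 k j : (j < 5)%nat -> dim_shift (k + 1 * 6) j = S (dim_shift k j) \/ (k < j)%nat.
Proof.
  intros Hj. unfold dim_shift. destruct (Nat.leb_spec j k) as [L|L]; [left|right; exact L].
  destruct (Nat.leb_spec j (k + 1 * 6)); [|lia]. rewrite <- dim_even_6. f_equal. lia.
Qed.

(** Both sides grow by 5 when k grows by 6, provided that all five summands are already present,
    that is k - 6 >= 4. The cases k < 10 are computed. *)
Lemma dim_formula k : nsum 5 (dim_shift k) = if Nat.eqb (k mod 6) 5 then (5 * k / 6)%nat else (5 * k / 6 + 1)%nat.
Proof.
  induction k as [k IH] using lt_wf_ind.
  destruct (Nat.lt_ge_cases k 10) as [L|L].
  - do 10 (destruct k as [|k]; [reflexivity|]). lia.
  - assert (E : (k = (k - 6) + 1 * 6)%nat) by lia. set (p := (k - 6)%nat) in *.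
    specialize (IH p ltac:(lia)). rewrite E.
    rewrite Nat.Div0.mod_add.
    replace (5 * (p + 1 * 6))%nat with (5 * p + 5 * 6)%nat by lia. rewrite Nat.div_add by lia.
    cbn [nsum] in *.
    destruct (dim_shift_6 p 0 ltac:(lia)) as [->|]; [|lia]. destruct (dim_shift_6 p 1 ltac:(lia)) as [->|]; [|lia].
    destruct (dim_shift_6 p 2 ltac:(lia)) as [->|]; [|lia]. destruct (dim_shift_6 p 3 ltac:(lia)) as [->|]; [|lia].
    destruct (dim_shift_6 p 4 ltac:(lia)) as [->|]; [|lia].
    destruct (Nat.eqb (p mod 6) 5); lia.
Qed.

Lemma Mgr_bound J (M : nat -> Z -> C -> C) : (forall j, (j < J)%nat -> Mgr (M j)) ->
  exists N, forall j a, (j < J)%nat -> (N < Z.abs a)%Z -> forall z, UH z -> M j a z = 0.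
Proof.
  induction J as [|J IH]; intros H; [exists 0%Z; intros; lia|].
  destruct IH as [N HN]; [auto|]. destruct (H J (Nat.lt_succ_diag_r J)) as [_ [N' HN']].
  exists (Z.max N N'). intros j a Hj Ha z Hz. destruct (Nat.eq_dec j J) as [->|Nj].
  - apply HN'; [lia|exact Hz].
  - apply HN; [lia|lia|exact Hz].
Qed.

(** Here the diagonalizing matrices and the q-series of F0, fixed so far, are produced from the
    distinctness of the eigenvalues; they no longer occur in the conclusions. *)
Lemma F0_structure (rho : SL2Z -> mat) (ups : SL2Z -> C) (m : R) (r : nat -> R) (F0 : C -> vec) (k0 : R) :
  is_rep 5 rho -> (forall g, ups g <> 0) -> cusp_parameter ups m -> T_exponents rho r ->
  k0 = (12 / 5 * lambda0 r m - 4)%R -> Hsp 5 rho ups k0 F0 -> fundamental_system k0 F0 ->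
  (forall n, Hsp 5 rho ups (k0 + 2 * INR n) (DpowV n k0 F0)) /\
  (forall J (M : nat -> C -> C) (n : Z), (forall j, (j < J)%nat -> ModForm (n - 2 * Z.of_nat j) (M j)) ->
     Hsp 5 rho ups (k0 + IZR n) (fun z i => csum J (fun j => M j z * DpowV j k0 F0 z i))) /\
  (forall n F, Hsp 5 rho ups (k0 + IZR n) F -> exists M : nat -> C -> C,
     (forall j, (j < 5)%nat -> ModForm (n - 2 * Z.of_nat j) (M j)) /\
     forall z i, UH z -> (i < 5)%nat -> F z i = csum 5 (fun j => M j z * DpowV j k0 F0 z i)) /\
  (forall z (a b : nat -> C), UH z ->
     (forall i, (i < 5)%nat -> csum 5 (fun j => a j * DpowV j k0 F0 z i) = csum 5 (fun j => b j * DpowV j k0 F0 z i)) ->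
     forall j, (j < 5)%nat -> a j = b j) /\
  (forall ga z, UH z -> P_defect ga z = 0).
Proof.
  intros Hrep Hu Hcusp Hr Hk0 HF0 [M4 [M6 [M8 [M10 [H4 [H6 [H8 [H10 [Hode [Hind _]]]]]]]]]].
  destruct (eigen_diag 4 (rho sT) (fun j => ee (RtoC (r j)))) as [U [V [HUV [HVU HU]]]].
  { apply (T_exp_inj rho r Hr). }
  { intros j Hj. apply Hr. now exists j. }
  assert (Hode' : forall i, (i < 5)%nat -> mlde5 k0 M4 M6 M8 M10 (fun z => F0 z i)) by (intros; now apply Hode).
  destruct (Hsp_twist rho ups m r U Hu Hcusp HU k0 F0 HF0) as [g Hg].
  split; [|split; [|split; [|split]]].
  - intros n. eapply Hsp_Dpow; eassumption.
  - intros J M n HM. eapply Hsp_comb; eassumption.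
  - intros n F HF. eapply Y_modular with (U := U) (V := V); eassumption.
  - intros z a b Hz H. eapply comb_unique; eassumption.
  - intros ga z Hz. eapply P_defect_zero; eassumption.
Qed.

Lemma Mgr_choice (P : Z -> (nat -> C -> C) -> Prop) : (forall n, exists M, P n M) -> exists M : Z -> nat -> C -> C, forall n, P n (M n).
Proof.
  intros H. exists (fun n => epsilon (inhabits (fun _ _ => RtoC 0)) (P n)). intros n. apply epsilon_spec, H.
Qed.
Close Scope C_scope.

Theorem theorem4p22
  (rho : SL2Z -> mat) (ups : SL2Z -> C) (w m : R) (r : nat -> R) (F0 : C -> vec)
  (Hrep : is_rep 5 rho)
  (HTu : T_unitarizable 5 rho)
  (HTd : T_determined 5 rho)
  (Hmult : multiplier_system w ups)
  (Hcusp : cusp_parameter ups m)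
  (Hr : T_exponents rho r)
  (Hint : exists z : Z, 12 * lambda0 r m / 5 - m = IZR z)
  (HF0 : Hsp 5 rho ups (12 / 5 * lambda0 r m - 4) F0)
  (HF0nz : exists z, UH z /\ ~ veq 5 (F0 z) vzero)
  (HF0fs : fundamental_system (12 / 5 * lambda0 r m - 4) F0) :
  let k0 := 12 / 5 * lambda0 r m - 4 in
  (* (i) free M-module of rank 5 with basis F0, DF0, ..., D^4F0 *)
  ((forall j, (j < 5)%nat -> Hsp 5 rho ups (k0 + 2 * INR j) (DpowV j k0 F0)) /\
   (forall M, (forall j, (j < 5)%nat -> Mgr (M j)) -> Hgr rho ups k0 (comb 5 M k0 F0)) /\
   (forall G, Hgr rho ups k0 G ->
      exists M, (forall j, (j < 5)%nat -> Mgr (M j)) /\ geq G (comb 5 M k0 F0)) /\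
   (forall M M', (forall j, (j < 5)%nat -> Mgr (M j) /\ Mgr (M' j)) ->
      geq (comb 5 M k0 F0) (comb 5 M' k0 F0) ->
      forall j a z, (j < 5)%nat -> UH z -> M j a z = M' j a z)) /\
  (* (ii) dimension formula *)
  (forall k : nat,
     has_dim (Hsp 5 rho ups (k0 + 2 * INR k))
       (if Nat.eqb (k mod 6) 5 then (5 * k / 6)%nat else (5 * k / 6 + 1)%nat)) /\
  (* (iii) H(rho,ups) = R F0 *)
  (forall G, Hgr rho ups k0 G <->
     exists (J : nat) (M : nat -> Z -> C -> C),
       (forall j, (j < J)%nat -> Mgr (M j)) /\ geq G (comb J M k0 F0)).
Proof.
  intros k0.
  assert (Hu : forall g, ups g <> RtoC 0).
  { intros g E. pose proof (proj1 Hmult g) as Q. rewrite E, Cmod_0 in Q. lra. }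
  destruct (F0_structure rho ups m r F0 k0 Hrep Hu Hcusp Hr eq_refl HF0 HF0fs) as [S1 [S2 [S3 [S4 S5]]]].
  assert (B : forall J M, (forall j, (j < J)%nat -> Mgr (M j)) -> Hgr rho ups k0 (comb J M k0 F0)).
  { intros J M HM. split.
    - intros n. apply (S2 J (fun j => M j (n - 2 * Z.of_nat j)%Z) n). intros j Hj. now apply HM.
    (* The coefficient of D^j has weight n - 2j, so the common bound N is shifted by at most 2J. *)
    - destruct (Mgr_bound J M HM) as [N HN]. exists (N + 2 * Z.of_nat J)%Z. intros n Hn z Hz i Hi.
      unfold comb, vzero. apply csum_0. intros j Hj. rewrite (HN j) by (auto; lia). apply Cmult_0_l. }
  assert (A : forall G, Hgr rho ups k0 G -> exists M, (forall j, (j < 5)%nat -> Mgr (M j)) /\ geq G (comb 5 M k0 F0)).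
  { intros G [HG [N HN]].
    destruct (Mgr_choice _ (fun n => S3 n (G n) (HG n))) as [Mn HM].
    (* The part of weight a of the coefficient j comes from the component of G of index a + 2j. As
       2j <= 8, this component is zero when |a| > N + 10, so by uniqueness the cut-off changes
       nothing, and it makes the family finitely supported. *)
    exists (fun j a => if Z_lt_dec (N + 10) (Z.abs a) then fun _ => RtoC 0 else Mn (a + 2 * Z.of_nat j)%Z j).
    split.
    - intros j Hj. split.
      + intros a. destruct (Z_lt_dec (N + 10) (Z.abs a)); [apply ModForm_0|].
        pose proof (proj1 (HM (a + 2 * Z.of_nat j)%Z) j Hj) as Q.
        replace (a + 2 * Z.of_nat j - 2 * Z.of_nat j)%Z with a in Q by lia. exact Q.
      + exists (N + 10)%Z. intros a Ha z Hz. destruct (Z_lt_dec (N + 10) (Z.abs a)); [reflexivity|lia].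
    - intros n z Hz i Hi. rewrite (proj2 (HM n) z i Hz Hi). unfold comb. apply csum_ext. intros j Hj.
      destruct (Z_lt_dec (N + 10) (Z.abs (n - 2 * Z.of_nat j))) as [L|L].
      + rewrite (S4 z (fun j => Mn n j z) (fun _ => RtoC 0) Hz); [reflexivity| |exact Hj].
        intros l Hl. rewrite <- (proj2 (HM n) z l Hz Hl), (HN n ltac:(lia) z Hz l Hl).
        symmetry. apply csum_0. intros p _. apply Cmult_0_l.
      + replace (n - 2 * Z.of_nat j + 2 * Z.of_nat j)%Z with n by lia. reflexivity. }
  split; [|split].
  - split; [|split; [|split]].
    + intros j _. apply S1.
    + apply B.
    + exact A.
    + intros M M' _ E j a z Hj Hz.
      (* In the component of index a + 2j the coefficient of D^j F0 has weight a. *)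
      pose proof (S4 z (fun p => M p (a + 2 * Z.of_nat j - 2 * Z.of_nat p)%Z z)
        (fun p => M' p (a + 2 * Z.of_nat j - 2 * Z.of_nat p)%Z z) Hz
        (fun i Hi => E (a + 2 * Z.of_nat j)%Z z Hz i Hi) j Hj) as Q.
      cbv beta in Q. now replace (a + 2 * Z.of_nat j - 2 * Z.of_nat j)%Z with a in Q by lia.
  - intros k. rewrite <- dim_formula.
    apply (has_dim_iff (comb_space k0 F0 (2 * Z.of_nat k) 5)).
    + assert (Ek : k0 + 2 * INR k = k0 + IZR (2 * Z.of_nat k)) by (rewrite mult_IZR, INR_IZR_INZ; reflexivity).
      rewrite Ek. intros F. split.
      * intros [M [HM EM]]. apply (Hsp_ext rho ups _ (fun z i => csum 5 (fun j => Cmult (M j z) (DpowV j k0 F0 z i)))).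
        -- intros z Hz i Hi. symmetry. now apply EM.
        -- now apply S2.
      * intros HF. destruct (S3 _ F HF) as [M [HM EM]]. exists M. split; [exact HM|].
        intros z Hz i Hi. now apply EM.
    + apply has_dim_comb_space; [exact S4| |lia]. intros j Hj. unfold dim_shift. destruct (Nat.leb_spec j k) as [L|L].
      * replace (2 * Z.of_nat k - 2 * Z.of_nat j)%Z with (2 * Z.of_nat (k - j))%Z by lia. now apply dim_ModForm.
      * replace (2 * Z.of_nat k - 2 * Z.of_nat j)%Z with (- (2 * Z.of_nat (S (j - k - 1))))%Z by lia.
        now apply dim_ModForm_neg.
  - intros G. split.
    + intros HG. exists 5%nat. now apply A.
    + intros [J [M [HM E]]]. destruct (B J M HM) as [disc_coefs [N B2]]. split.
      * intros n. apply (Hsp_ext rho ups _ (comb J M k0 F0 n)); [|apply disc_coefs].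
        intros z Hz i Hi. symmetry. now apply E.
      * exists N. intros n Hn z Hz i Hi. rewrite (E n z Hz i Hi). now apply B2.
Qed.
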